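(* Let $\mathtt{d}\in\{2,3\}$, let $\Omega\subset\mathbb{R}^{\mathtt{d}}$ be a bounded open domain with Lipschitz boundary, let $T>0$, $I=(0,T]$, and let $b,\sigma,\varepsilon>0$ be constants. Let $\mathcal{F}(\varphi)=\frac14(1-\varphi^2)^2$, and let $\varphi_0\in H^1_{(0)}(\Omega)$ satisfy $E(\varphi_0)=\int_\Omega \frac{\sigma\varepsilon}{2}|\nabla\varphi_0|^2+\frac{\sigma}{\varepsilon}\mathcal{F}(\varphi_0)\,dx<\infty$. Let $m\in\mathbb{N}$, $U=L^2(0,T;\mathbb{R}^m)$, let $\chi_1,\dots,\chi_m\in L^2_\sigma(\Omega)^{\mathtt{d}}\cap H^1(\Omega)^{\mathtt{d}}$ be given, and define $\mathcal{B}:U\to L^2(0,T;H^1(\Omega)^{\mathtt{d}})$ by $(\mathcal{B}u)(t)=\sum_{i=1}^m u_i(t)\chi_i$. Let $u_a,u_b\in L^\infty(0,T;\mathbb{R}^m)$ with $u_a(t)\le u_b(t)$ (componentwise) for almost every $t\in[0,T]$, and set $$U_{\mathrm{ad}}=\{u\in U \;:\; u_a(t)\le u(t)\le u_b(t)\ \text{componentwise in } \mathbb{R}^m \text{ for a.e. } t\in[0,T]\}.$$ Let $\beta_1,\beta_2\ge 0$, $\gamma>0$, $\varphi_d\in L^2(0,T;L^2(\Omega))$, $\varphi_T\in L^2(\Omega)$, and $$J(\varphi,u)=\frac{\beta_1}{2}\|\varphi-\varphi_d\|^2_{L^2(0,T;L^2(\Omega))}+\frac{\beta_2}{2}\|\varphi(T,\cdot)-\varphi_T\|^2_{L^2(\Omega)}+\frac{\gamma}{2}\|u\|_U^2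 .$$ For $u\in U_{\mathrm{ad}}$ let $\varphi(u)$ denote the phase-field component of the unique solution $(\varphi,\mu)$ of the convective Cahn-Hilliard system $$\begin{cases}\varphi_t+(\mathcal{B}u)\cdot\nabla\varphi-b\,\Delta\mu=0 & \text{in } I\times\Omega,\\ -\sigma\varepsilon\,\Delta\varphi+\frac{\sigma}{\varepsilon}\mathcal{F}'(\varphi)=\mu & \text{in } I\times\Omega,\\ \partial_n\varphi=\partial_n\mu=0 & \text{on } I\times\partial\Omega,\\ \varphi(0,\cdot)=\varphi_0 & \text{in }\Omega,\end{cases}$$ and put $\hat J(u)=J(\varphi(u),u)$. Then the optimal control problem $$\min_{u\in U_{\mathrm{ad}}}\hat J(u)$$ admits a solution, i.e. there exists $\bar u\in U_{\mathrm{ad}}$ with $\hat J(\bar u)=\inf_{u\in U_{\mathrm{ad}}}\hat J(u)$.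
   Context: Notation. $H^1_{(0)}(\Omega)$ is the space of functions in $H^1(\Omega)$ with zero mean value, and $H^{-1}_{(0)}(\Omega)$ is its dual. $L^2_\sigma(\Omega)^{\mathtt{d}}=\{f\in L^2(\Omega)^{\mathtt{d}}:\operatorname{div} f=0,\ f\cdot n_\Omega|_{\partial\Omega}=0\}$ is the space of solenoidal vector fields (divergence and normal trace understood in the usual weak sense). The solution space for the phase field is $W(0,T)=\{f\in L^2(0,T;H^1_{(0)}(\Omega)): f_t\in L^2(0,T;H^{-1}_{(0)}(\Omega))\}$; its elements are continuous on $[0,T]$ with values in $L^2(\Omega)$, so $\varphi(0,\cdot)$ and $\varphi(T,\cdot)$ make sense. Solution concept. A solution of the Cahn-Hilliard system with velocity $\mathtt{v}$ (here $\mathtt{v}=\mathcal{B}u$) is a pair $(\varphi,\mu)$ with $\varphi\in W(0,T)\cap L^2(0,T;H^2(\Omega))$, $\mu\in L^2(0,T;H^1(\Omega))$, $\varphi(0,\cdot)=\varphi_0$, satisfying the equations with homogeneous Neumann conditions in the usual weak sense: for a.e. $t$, $\langle\varphi_t,v\rangle+(\mathtt{v}\cdot\nabla\varphi,v)_{L^2(\Omega)}+b(\nabla\mu,\nabla v)_{L^2(\Omega)}=0$ for all $v\in H^1_{(0)}(\Omega)$, and $\sigma\varepsilon(\nabla\varphi,\nabla v)_{L^2(\Omega)}+\frac{\sigma}{\varepsilon}(\mathcal{F}'(\varphi),v)_{L^2(\Omega)}=(\mu,v)_{L^2(\Omega)}$ for all $v\in H^1(\Omega)$. Standing fact (known well-posedness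 result, which makes $\varphi(u)$ well defined). For $\varphi_0$ as in the claim and every $\mathtt{v}\in L^\infty(0,T;L^2_\sigma(\Omega)^{\mathtt{d}})\cap L^2(0,T;H^1(\Omega)^{\mathtt{d}})$ the system has a unique solution $(\varphi,\mu)$ in this sense. Every $\mathtt{v}=\mathcal{B}u$ with $u\in U_{\mathrm{ad}}$ belongs to this class of velocities. *)

(* Defs.v *)
From HB Require Import structures.
From mathcomp Require Import all_boot all_order all_algebra.
From mathcomp Require Import all_classical all_reals all_analysis.

Set Implicit Arguments.
Unset Strict Implicit.
Unset Printing Implicit Defensive.

Import Order.TTheory GRing.Theory Num.Theory.
Import numFieldNormedType.Exports.

Local Open Scope classical_set_scope.
Local Open Scope ring_scope.

Section RowMeasurable.
Context (R : realType) (n : nat).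

Let coors : 'I_n -> 'rV[R]_n -> R := fun i x => x ord0 i.

Let rv_set0 : g_sigma_preimage coors set0.
Proof. exact: sigma_algebra0. Qed.

Let rv_setC A : g_sigma_preimage coors A -> g_sigma_preimage coors (~` A).
Proof. exact: sigma_algebraC. Qed.

Let rv_bigcup (F : (set 'rV[R]_n)^nat) :
  (forall i, g_sigma_preimage coors (F i)) ->
  g_sigma_preimage coors (\bigcup_i (F i)).
Proof. exact: sigma_algebra_bigcup. Qed.

(* The product (equivalently, Borel) sigma-algebra. *)
HB.instance Definition _ := @isMeasurable.Build default_measure_display
  'rV[R]_n (g_sigma_preimage coors) rv_set0 rv_setC rv_bigcup.

End RowMeasurable.

Section RowFun.
Context (R : realType).

Lemma measurable_fun_rowP d (T : measurableType d) n (f : T -> 'rV[R]_n) :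
  (forall i, measurable_fun [set: T] (fun t => f t ord0 i)) ->
  measurable_fun [set: T] f.
Proof.
move=> mf _ Y mY; rewrite setTI.
have : preimage_set_system [set: T] f
    (g_sigma_preimage (fun i (x : 'rV[R]_n) => x ord0 i)) (f @^-1` Y).
  by exists Y => //; rewrite setTI.
rewrite -g_sigma_preimage_comp; apply: smallest_sub.
  exact: sigma_algebra_measurable.
case: n f mf Y mY => [|n] f mf Y mY; first by rewrite big_ord0.
rewrite -bigcup_mkord_ord; apply: bigcup_sub => i _ A [B mB <-].
exact: mf.
Qed.

Lemma measurable_coord n (i : 'I_n) :
  measurable_fun [set: 'rV[R]_n] (fun x : 'rV[R]_n => x ord0 i).
Proof.
move=> _ Y mY; apply: sub_sigma_algebra.
case: n i => [[]//|n] i; rewrite -bigcup_mkord_ord.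
by exists i; [exact: ltn_ord|exists Y => //; rewrite inord_val].
Qed.

Definition row_cons n (p : R * 'rV[R]_n) : 'rV[R]_n.+1 :=
  row_mx (p.1)%:M p.2.

Definition row_uncons n (y : 'rV[R]_n.+1) : R * 'rV[R]_n :=
  (y ord0 ord0, \row_j y ord0 (lift ord0 j)).

Lemma row_consK n : cancel (@row_cons n) (@row_uncons n).
Proof.
case=> x y; rewrite /row_cons /row_uncons /=; congr pair.
  have xE : (x%:M : 'M[R]_1) ord0 ord0 = x by rewrite mxE eqxx.
  rewrite -[RHS]xE -(row_mxEl (x%:M : 'M[R]_1) y ord0 ord0).
  by congr (row_mx _ _ _ _); exact: val_inj.
apply/rowP => j; rewrite mxE -(row_mxEr (x%:M : 'M[R]_1) y ord0 j).
by congr (row_mx _ _ _ _); exact: val_inj.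
Qed.

Lemma measurable_row_cons n : measurable_fun setT (@row_cons n).
Proof.
apply: measurable_fun_rowP => i; case: (split_ordP (i : 'I_(1 + n))) => j ->.
- rewrite (_ : (fun _ => _) = fst); first exact: measurable_fst.
  by apply/funext => -[x y]; rewrite /row_cons (row_mxEl (x%:M : 'M[R]_1) y) mxE (ord1 j) eqxx.
- rewrite (_ : (fun _ => _) = (fun z : 'rV[R]_n => z ord0 j) \o snd).
    by apply: measurableT_comp; [exact: measurable_coord|exact: measurable_snd].
  by apply/funext => -[x y]; rewrite /row_cons (row_mxEr (x%:M : 'M[R]_1) y).
Qed.

Lemma measurable_row_uncons n : measurable_fun setT (@row_uncons n).
Proof.
apply/measurable_fun_pairP; split => /=; first exact: measurable_coord.
apply: measurable_fun_rowP => i.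
rewrite (_ : (fun _ => _) = fun z : 'rV[R]_n.+1 => z ord0 (lift ord0 i)).
  exact: measurable_coord.
by apply/funext => z; rewrite /= mxE.
Qed.

Lemma sigma_finite_row_cons n (mu : {sigma_finite_measure set 'rV[R]_n -> \bar R}) :
  sigma_finite setT
    (pushforward (@lebesgue_measure R \x mu)%E (@row_cons n)).
Proof.
have /sigma_finiteP[F [TF ndF Foo]] := sigma_finiteT (@lebesgue_measure R).
have /sigma_finiteP[G [TG ndG Goo]] := sigma_finiteT mu.
exists (fun k => @row_uncons n @^-1` (F k `*` G k)).
  rewrite -preimage_bigcup (_ : \bigcup_k _ = setT) ?preimage_setT//.
  apply/seteqP; split => // -[x y] _.
  have [i _ Fx] : (\bigcup_i F i) x by rewrite -TF.
  have [j _ Gy] : (\bigcup_j G j) y by rewrite -TG.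
  exists (maxn i j) => //; split => /=.
    by move: x Fx; exact/subsetPset/ndF/leq_maxl.
  by move: y Gy; exact/subsetPset/ndG/leq_maxr.
move=> k; have [mF Fk] := Foo k; have [mG Gk] := Goo k; split.
  rewrite -[X in measurable X]setTI; apply: measurable_row_uncons => //.
  exact: measurableX.
rewrite /pushforward -comp_preimage (_ : _ \o _ = id); last first.
  by apply/funext => p; exact: row_consK.
by rewrite preimage_id product_measure1E// lte_mul_pinfty// ge0_fin_numE.
Qed.

End RowFun.

Section LebesgueSucc.
Context (R : realType) (n : nat).
Variable mu : {sigma_finite_measure set 'rV[R]_n -> \bar R}.

Definition lebesgue_succ : set 'rV[R]_n.+1 -> \bar R :=
  pushforward (@lebesgue_measure R \x mu)%E (@row_cons R n).

Let mf := @measurable_row_cons R n.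

Let lebesgue_succ0 : lebesgue_succ set0 = 0%E.
Proof. by rewrite /lebesgue_succ /pushforward preimage_set0 measure0. Qed.

Let lebesgue_succ_ge0 A : (0 <= lebesgue_succ A)%E.
Proof. exact: measure_ge0. Qed.

Let lebesgue_succ_sigma_additive : semi_sigma_additive lebesgue_succ.
Proof. exact: measure_semi_sigma_additive. Qed.

HB.instance Definition _ := isMeasure.Build _ _ _ lebesgue_succ
  lebesgue_succ0 lebesgue_succ_ge0 lebesgue_succ_sigma_additive.

HB.instance Definition _ := Measure_isSigmaFinite.Build _ _ _ lebesgue_succ
  (sigma_finite_row_cons mu).

End LebesgueSucc.

(* Lebesgue measure on R^(k+1) is the image of the product of the Lebesgue
   measures on R and R^k under (x, y) |-> row_mx x y. *)
Fixpoint lebesgue_rV (R : realType) (n : nat) :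
    {sigma_finite_measure set 'rV[R]_n -> \bar R} :=
  match n with
  | 0 => dirac (0 : 'rV[R]_0)
  | k.+1 => lebesgue_succ (lebesgue_rV R k)
  end.

Section Bochner.
Context (R : realType) (V : lmodType R).
(* The target space is the set X of representatives, with norm N; N is only a
   seminorm, as representatives equal almost everywhere are not identified. *)
Variables (X : set V) (N : V -> R).

Definition simple_into (s : R -> V) :=
  exists (k : nat) (A : 'I_k -> set R) (x : 'I_k -> V),
    [/\ forall j, measurable (A j), forall j, X (x j)
      & s = fun t => \sum_(j < k) \1_(A j) t *: x j].

Definition strongly_measurable (T : R) (u : R -> V) :=
  exists s : (R -> V)^nat, (forall n, simple_into (s n)) /\
    {ae @lebesgue_measure R, forall t, t \in `]0, T[ ->
      X (u t) /\ N (u t - s n t) @[n --> \oo] --> (0 : R)}.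

Definition bochner_L2 (T : R) (u : R -> V) :=
  strongly_measurable T u /\
  (\int[@lebesgue_measure R]_(t in `]0%R, T[) (N (u t) ^+ 2)%:E < +oo)%E.

Definition bochner_Linfty (T : R) (u : R -> V) :=
  strongly_measurable T u /\
  exists M : R, {ae @lebesgue_measure R, forall t, t \in `]0, T[ -> N (u t) <= M}.

End Bochner.

Definition dotv (R : realType) (n : nat) (x y : 'rV[R]_n) : R :=
  \sum_(i < n) x ord0 i * y ord0 i.

Definition unitv (R : realType) (d : nat) (i : 'I_d) : 'rV[R]_d :=
  delta_mx ord0 i.

Definition component (R : realType) (T : Type) (d : nat) (F : T -> 'rV[R]_d)
    (i : 'I_d) : T -> R :=
  fun x => F x ord0 i.

Fixpoint Ck (R : realType) (d k : nat) (psi : 'rV[R]_d -> R) : Prop :=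
  match k with
  | 0 => continuous psi
  | j.+1 => continuous psi /\
      forall i : 'I_d, (forall x, derivable psi x (unitv R i)) /\
        Ck j (fun x => 'D_(unitv R i) psi x)
  end.

Section Domain.
Context (R : realType) (d : nat).

(* Near each boundary point, in suitable Cartesian coordinates x *m Q, the set
   is the strict epigraph of a Lipschitz function of the d - 1 coordinates
   other than the i-th. *)
Definition lipschitz_boundary (Om : set 'rV[R]_d) :=
  forall p, (closure Om `\` Om°) p ->
    exists (Q : 'M[R]_d) (i : 'I_d) (g : 'rV[R]_d.-1 -> R),
      [/\ Q *m Q^T = 1%:M, lipschitz g
        & \forall x \near p,
            Om x <-> g (col' i (x *m Q)) < (x *m Q) ord0 i].

Definition bounded_lipschitz_domain (Om : set 'rV[R]_d) :=
  [/\ Om !=set0, open Om, connected Om, bounded_set Om & lipschitz_boundary Om].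

End Domain.

Section Spaces.
Context (R : realType) (d : nat) (Om : set 'rV[R]_d).

Local Notation scal := ('rV[R]_d -> R).
Local Notation vect := ('rV[R]_d -> 'rV[R]_d).
Local Notation leb := (lebesgue_rV R d).

Definition test_function (psi : scal) :=
  [/\ forall k, Ck k psi, compact (closure [set x | psi x != 0])
    & closure [set x | psi x != 0] `<=` Om].

Definition inner (f g : scal) : R := \int[leb]_(x in Om) (f x * g x).

Definition innerv (F G : vect) : R := \int[leb]_(x in Om) dotv (F x) (G x).

Definition L2 : set scal := [set f : scal | measurable_fun Om (f : scal) /\
  (\int[leb]_(x in Om) (f x ^+ 2)%:E < +oo)%E].

Definition normL2 (f : scal) : R := Num.sqrt (inner f f).

Definition L2v : set vect := [set F : vect | forall i, L2 (component F i)].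

Definition normL2v (F : vect) : R := Num.sqrt (innerv F F).

Definition is_weak_grad (f : scal) (G : vect) :=
  forall (i : 'I_d) (psi : scal), test_function psi ->
    inner f (fun x => 'D_(unitv R i) psi x) = - inner (component G i) psi.

Definition H1 : set scal :=
  [set f : scal | L2 f /\ exists G, L2v G /\ is_weak_grad f G].

(* A representative of the weak gradient, meaningful for f in H1. *)
Definition wgrad (f : scal) : vect :=
  xget (fun=> 0) [set G : vect | L2v G /\ is_weak_grad f G].

Definition normH1 (f : scal) : R :=
  Num.sqrt (normL2 f ^+ 2 + normL2v (wgrad f) ^+ 2).

Definition H2 : set scal :=
  [set f : scal | H1 f /\ forall i, H1 (component (wgrad f) i)].

Definition normH2 (f : scal) : R :=
  Num.sqrt (normH1 f ^+ 2
            + \sum_(i < d) normL2v (wgrad (component (wgrad f) i)) ^+ 2).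

Definition H1v : set vect := [set F : vect | forall i, H1 (component F i)].

Definition normH1v (F : vect) : R :=
  Num.sqrt (\sum_(i < d) normH1 (component F i) ^+ 2).

Definition H10 : set scal := [set f : scal | H1 f /\ \int[leb]_(x in Om) f x = 0].

(* The dual of H10; only the values on H10 are relevant. *)
Definition Hm1 : set (scal -> R) :=
  [set l : scal -> R | (forall (a : R) f g, H10 f -> H10 g ->
              l (a *: f + g) = a * l f + l g) /\
           exists C : R, forall f, H10 f -> `|l f| <= C * normH1 f].

Definition normHm1 (l : scal -> R) : R :=
  sup [set `|l f| | f in [set f : scal | H10 f /\ normH1 f <= 1]].

Definition is_weak_div (F : vect) (g : scal) :=
  forall psi : scal, test_function psi ->
    innerv F (fun x => \row_i 'D_(unitv R i) psi x) = - inner g psi.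

(* The normal trace of a field F in L2v with weak divergence g in L2 is the
   functional w |-> (F, grad w) + (g, w) on H1, by Green's formula. *)
Definition zero_normal_trace (F : vect) (g : scal) :=
  forall w, H1 w -> innerv F (wgrad w) + inner g w = 0.

Definition L2sigma : set vect :=
  [set F : vect | [/\ L2v F, is_weak_div F (fun=> 0)
             & zero_normal_trace F (fun=> 0)]].

Definition ae_eq_on (f g : scal) := {ae leb, forall x, Om x -> f x = g x}.

End Spaces.

Definition time_test (R : realType) (T : R) (z : R -> R) :=
  [/\ forall (n : nat) (t : R), derivable (derive1n n z) t 1,
      compact (closure [set t | z t != 0])
    & closure [set t | z t != 0] `<=` `]0, T[].

Definition double_well (R : realType) (s : R) : R := 4^-1 * (1 - s ^+ 2) ^+ 2.

Section CahnHilliard.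
Context (R : realType) (d : nat) (Om : set 'rV[R]_d) (T : R).

Local Notation scal := ('rV[R]_d -> R).
Local Notation vect := ('rV[R]_d -> 'rV[R]_d).
Local Notation leb := (lebesgue_rV R d).
Local Notation time := (@lebesgue_measure R).

(* The distributional time derivative, for the embedding of H10 into its dual
   by the L2 inner product. *)
Definition is_time_deriv (phi : R -> scal) (l : R -> scal -> R) :=
  forall v, H10 Om v -> forall z, time_test T z ->
    \int[time]_(t in `]0, T[) (inner Om (phi t) v * derive1 z t) =
    - \int[time]_(t in `]0, T[) (l t v * z t).

Definition W0T : set (R -> scal) :=
  [set phi | bochner_L2 (H10 Om) (normH1 Om) T phi /\
     exists l, bochner_L2 (Hm1 Om) (normHm1 Om) T l /\ is_time_deriv phi l].

(* A representative of the time derivative, meaningful for phi in W0T. *)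
Definition time_deriv (phi : R -> scal) : R -> scal -> R :=
  xget (fun=> 0)
    [set l | bochner_L2 (Hm1 Om) (normHm1 Om) T l /\ is_time_deriv phi l].

Definition L2_continuous (phi : R -> scal) :=
  forall t, t \in `[0, T] -> L2 Om (phi t) /\
    normL2 Om (phi s - phi t) @[s --> within `[0, T] (nbhs t)] --> (0 : R).

Definition energy_density (sigma eps : R) (f : scal) : scal :=
  fun x => sigma * eps / 2 * dotv (wgrad Om f x) (wgrad Om f x)
           + sigma / eps * double_well (f x).

Definition finite_energy (sigma eps : R) (f : scal) :=
  (\int[leb]_(x in Om) (energy_density sigma eps f x)%:E < +oo)%E.

(* phi is required to be the representative in C([0, T]; L2) of its class, so
   that phi 0 and phi T are the traces at the initial and final times. *)
Definition CH_solution (b sigma eps : R) (phi0 : scal) (v : R -> vect)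
    (phi mu : R -> scal) :=
  [/\ [/\ W0T phi, bochner_L2 (H2 Om) (normH2 Om) T phi
        & bochner_L2 (H1 Om) (normH1 Om) T mu],
      L2_continuous phi,
      ae_eq_on Om (phi 0) phi0,
      {ae time, forall t, t \in `]0, T[ -> forall w, H10 Om w ->
        time_deriv phi t w
        + inner Om (fun x => dotv (v t x) (wgrad Om (phi t) x)) w
        + b * innerv Om (wgrad Om (mu t)) (wgrad Om w) = 0}
    & {ae time, forall t, t \in `]0, T[ -> forall w, H1 Om w ->
        sigma * eps * innerv Om (wgrad Om (phi t)) (wgrad Om w)
        + sigma / eps * inner Om (fun x => derive1 (@double_well R) (phi t x)) w
        = inner Om (mu t) w}].

Definition velocity_class (v : R -> vect) :=
  bochner_Linfty (L2sigma Om) (normL2v Om) T v /\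
  bochner_L2 (H1v Om) (normH1v Om) T v.

Definition CH_well_posed (b sigma eps : R) (phi0 : scal) :=
  forall v, velocity_class v ->
    (exists phi mu, CH_solution b sigma eps phi0 v phi mu) /\
    (forall phi mu phi' mu',
      CH_solution b sigma eps phi0 v phi mu ->
      CH_solution b sigma eps phi0 v phi' mu' ->
      {ae time, forall t, t \in `]0, T[ ->
        ae_eq_on Om (phi t) (phi' t) /\ ae_eq_on Om (mu t) (mu' t)}).

(* Determined up to null sets when the system is well posed, and the cost does
   not depend on the representative chosen. *)
Definition phase_field (b sigma eps : R) (phi0 : scal) (v : R -> vect) :
    R -> scal :=
  xget (fun=> 0)
    [set phi | exists mu, CH_solution b sigma eps phi0 v phi mu].

Section Control.
Context (m : nat).

Definition control_space : set (R -> 'rV[R]_m) :=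
  [set u : R -> 'rV[R]_m | measurable_fun `]0, T[ u /\
     (\int[time]_(t in `]0%R, T[) (dotv (u t) (u t))%:E < +oo)%E].

Definition control_Linfty : set (R -> 'rV[R]_m) :=
  [set u : R -> 'rV[R]_m | measurable_fun `]0, T[ u /\
     exists M : R, {ae time, forall t, t \in `]0, T[ -> `|u t| <= M}].

Definition row_le (x y : 'rV[R]_m) := forall i, x ord0 i <= y ord0 i.

Definition admissible (ua ub : R -> 'rV[R]_m) : set (R -> 'rV[R]_m) :=
  [set u : R -> 'rV[R]_m | control_space u /\
     {ae time, forall t, t \in `[0, T] ->
       row_le (ua t) (u t) /\ row_le (u t) (ub t)}].

Definition control_op (chi : 'I_m -> vect) (u : R -> 'rV[R]_m) : R -> vect :=
  fun t x => \sum_(i < m) u t ord0 i *: chi i x.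

Definition cost (beta1 beta2 gamma : R) (phid : R -> scal) (phiT : scal)
    (phi : R -> scal) (u : R -> 'rV[R]_m) : R :=
  beta1 / 2 * \int[time]_(t in `]0, T[) (normL2 Om (phi t - phid t) ^+ 2)
  + beta2 / 2 * normL2 Om (phi T - phiT) ^+ 2
  + gamma / 2 * \int[time]_(t in `]0, T[) dotv (u t) (u t).

Definition reduced_cost (b sigma eps : R) (phi0 : scal)
    (chi : 'I_m -> vect) (beta1 beta2 gamma : R)
    (phid : R -> scal) (phiT : scal) (u : R -> 'rV[R]_m) : R :=
  cost beta1 beta2 gamma phid phiT
    (phase_field b sigma eps phi0 (control_op chi u)) u.

End Control.

End CahnHilliard.

(* Main.v *)
Require Import Defs.
From HB Require Import structures.
From mathcomp Require Import all_boot all_order all_algebra.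
From mathcomp Require Import all_classical all_reals all_analysis.
From mathcomp Require Import measurable_realfun.
From mathcomp Require Import ring lra.

Set Implicit Arguments.
Unset Strict Implicit.
Unset Printing Implicit Defensive.
Import Order.TTheory GRing.Theory Num.Theory.
Import numFieldNormedType.Exports.

Local Open Scope classical_set_scope.
Local Open Scope ring_scope.

(* The proof is the direct method, with the compactness argument replaced by a
   stability estimate between solutions.  Let u_n be a minimizing sequence and
   ubar its weak limit along an ultrafilter; let e be the difference of the
   states of u_n and ubar, and let Ge be the Riesz representative, for the H1
   inner product on mean-zero functions, of (e, .)_{L2}.  Testing the difference
   of the two systems with Ge gives, for y = (e, Ge) = |Ge|_{H1}^2,
     y' + c |e|_{H1}^2 <= C (1 + |phibar|_{H1}^2) y + C y^2 - 2 F,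
     F = sum_i (u_n - ubar)_i (chi_i . grad phibar, Ge),
   where the cubic nonlinearity is controlled by the embedding of H1 into L4
   (valid for d <= 3, proved from the cone property of Lipschitz domains).  In
   F, the field phibar is replaced by a simple function of time and each
   functional (chi_i . grad x, .) by (q, .) with q smooth enough that (q, Ge) has
   a time derivative bounded in L1; integrating by parts in time, F is small as
   soon as the primitives of the (u_n - ubar)_i are.  Gronwall's lemma and a
   continuation argument keep y small on [0, T], so the states converge strongly
   in L2 in space-time and weakly in L2 at time T, and the cost is lower
   semicontinuous. *)

(** An Aubin-Lions argument would need bounds on the states uniform along the minimizing sequence
    and a Rellich theorem. The stability estimate uses only the common bound on the controls and the
    regularity of the single reference state phibar. Its weight is the full H1 inner product, so
    that the Riesz theorem applies without a Poincare inequality; the price is lower-order terms,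
    absorbed through (e, e) = (Ge, e)_{H1} <= |Ge| |e|. Testing with Ge also removes all derivatives
    of the potential: its difference is only paired with e and Ge, for which the second equation can
    be inserted. The obstacle is the forcing F, a product of a weakly small factor u_n - ubar and a
    factor Ge that varies with n. Instead of compactness of Ge in time, what is used is an L1 bound,
    uniform in n, on the rates of the scalars (q, Ge); it comes from the same dissipation
    inequality, but only while y <= 1. The term C y^2 is likewise linear only while y <= 1, and both
    facts force the continuation argument. The ultrafilter gives the limits of all scalar sequences
    (u_n, z) at once, in place of a diagonal extraction. *)

Local Notation ae_imply :=
  (@filterS _ _ (ae_filter_ringOfSetsType (@lebesgue_measure _)) _ _ _) (only parsing).
Local Notation ae_imply2 :=
  (@filterS2 _ _ (ae_filter_ringOfSetsType (@lebesgue_measure _)) _ _ _ _) (only parsing).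
Local Notation ae_imply3 :=
  (@filterS3 _ _ (ae_filter_ringOfSetsType (@lebesgue_measure _)) _ _ _ _ _) (only parsing).

Lemma ae_conj (R : realType) (D P Q : measurableTypeR R -> Prop) :
  {ae @lebesgue_measure R, forall t, D t -> P t} ->
  {ae @lebesgue_measure R, forall t, D t -> Q t} ->
  {ae @lebesgue_measure R, forall t, D t -> P t /\ Q t}.
Proof. by move=> hP hQ; apply: (ae_imply2 hP hQ) => t p q Dt; split; [exact: p|exact: q]. Qed.

(** * Integrable, square-integrable and fourth-power-integrable functions *)

Section Integrable.
Context d (X : measurableType d) (R : realType).
Variables (mu : {measure set X -> \bar R}) (D : set X).
Hypothesis mD : measurable D.
Implicit Types f g h : X -> R.

Definition L1fun f := mu.-integrable D (EFin \o f).

Lemma L1_meas f : L1fun f -> measurable_fun D f.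
Proof. by move=> /measurable_int /measurable_EFinP. Qed.

Lemma L1P f : L1fun f <->
  measurable_fun D f /\ (\int[mu]_(x in D) `|f x|%:E < +oo)%E.
Proof.
split=> [/integrableP[mf fi]|[mf fi]]; first by split => //; exact/measurable_EFinP.
by apply/integrableP; split => //; exact/measurable_EFinP.
Qed.

Lemma L1_ext f g : (forall x, D x -> f x = g x) -> L1fun f -> L1fun g.
Proof. by move=> fg; apply: eq_integrable => // x /set_mem Dx /=; rewrite fg. Qed.

Lemma L1D f g : L1fun f -> L1fun g -> L1fun (fun x => f x + g x).
Proof. by move=> fi gi; have := integrableD mD fi gi. Qed.

Lemma L1N f : L1fun f -> L1fun (fun x => - f x).
Proof. by move=> fi; have := integrableN fi. Qed.

Lemma L1B f g : L1fun f -> L1fun g -> L1fun (fun x => f x - g x).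
Proof. by move=> fi /L1N gi; exact: L1D. Qed.

Lemma L1Z k f : L1fun f -> L1fun (fun x => k * f x).
Proof. by move=> fi; have := integrableZl mD k fi. Qed.

Lemma L10 : L1fun (fun=> 0).
Proof. exact: integrable0. Qed.

Lemma L1_sum n (f : 'I_n -> X -> R) :
  (forall i, L1fun (f i)) -> L1fun (fun x => \sum_(i < n) f i x).
Proof.
elim: n f => [|n IHn] f fi.
  by apply: L1_ext L10 => x _; rewrite big_ord0.
apply: (@L1_ext (fun x => f ord0 x + \sum_(i < n) f (lift ord0 i) x)).
  by move=> x _; rewrite big_ord_recl.
by apply: L1D => //; exact: IHn.
Qed.

Lemma L1_le f g : measurable_fun D f -> (forall x, D x -> `|f x| <= g x) ->
  L1fun g -> L1fun f.
Proof.
move=> mf fg; apply: le_integrable => //; first exact/measurable_EFinP.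
by move=> x Dx /=; rewrite lee_fin (le_trans (fg _ Dx))// ler_norm.
Qed.

Lemma L1_ge0 f : measurable_fun D f -> (forall x, D x -> 0 <= f x) ->
  (\int[mu]_(x in D) (f x)%:E < +oo)%E -> L1fun f.
Proof.
move=> mf f0 foo; apply/L1P; split => //.
by under eq_integral => x /set_mem Dx do rewrite ger0_norm ?f0//.
Qed.

Lemma L1_normr f : L1fun f -> L1fun (fun x => `|f x|).
Proof. exact: integrable_norm. Qed.

Lemma L1_cst (k : R) : (mu D < +oo)%E -> L1fun (fun=> k).
Proof.
move=> Doo; apply/L1P; split => //.
by rewrite [X in (X < _)%E](@integral_cst _ _ _ mu D mD `|k|%:E) lte_mul_pinfty ?lee_fin.
Qed.

Lemma L1_bnd (M : R) f : (mu D < +oo)%E -> measurable_fun D f ->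
  (forall x, D x -> `|f x| <= M) -> L1fun f.
Proof. by move=> Doo mf fM; apply: (L1_le mf fM); exact: L1_cst. Qed.

Lemma L1_EFin f : L1fun f ->
  (\int[mu]_(x in D) (f x)%:E)%E = (\int[mu]_(x in D) f x)%:E.
Proof. by move=> fi; rewrite /Rintegral fineK//; exact: integrable_fin_num. Qed.

Lemma Rint_ext f g : (forall x, D x -> f x = g x) ->
  \int[mu]_(x in D) f x = \int[mu]_(x in D) g x.
Proof. by move=> fg; apply: eq_Rintegral => x /set_mem; exact: fg. Qed.

Lemma RintD f g : L1fun f -> L1fun g -> \int[mu]_(x in D) (f x + g x) =
  \int[mu]_(x in D) f x + \int[mu]_(x in D) g x.
Proof. exact: RintegralD. Qed.

Lemma RintB f g : L1fun f -> L1fun g -> \int[mu]_(x in D) (f x - g x) =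
  \int[mu]_(x in D) f x - \int[mu]_(x in D) g x.
Proof. exact: RintegralB. Qed.

Lemma RintZ k f : L1fun f ->
  \int[mu]_(x in D) (k * f x) = k * \int[mu]_(x in D) f x.
Proof. exact: RintegralZl. Qed.

Lemma Rint0 : \int[mu]_(x in D) 0 = 0 :> R.
Proof. by rewrite Rintegral_cst// mul0r. Qed.

Lemma RintN f : L1fun f -> \int[mu]_(x in D) (- f x) = - \int[mu]_(x in D) f x.
Proof.
move=> fi; rewrite -mulN1r -RintZ//; apply: Rint_ext => x _; by rewrite mulN1r.
Qed.

Lemma Rint_sum n (f : 'I_n -> X -> R) : (forall i, L1fun (f i)) ->
  \int[mu]_(x in D) (\sum_(i < n) f i x) = \sum_(i < n) \int[mu]_(x in D) f i x.
Proof.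
elim: n f => [|n IHn] f fi.
  by rewrite big_ord0 -[RHS]Rint0; apply: Rint_ext => x _; rewrite big_ord0.
rewrite big_ord_recl -IHn// -RintD//; last exact: L1_sum.
by apply: Rint_ext => x _; rewrite big_ord_recl.
Qed.

Lemma le_Rint f g : L1fun f -> L1fun g -> (forall x, D x -> f x <= g x) ->
  \int[mu]_(x in D) f x <= \int[mu]_(x in D) g x.
Proof. exact: le_Rintegral. Qed.

Lemma le_Rint_norm f : L1fun f ->
  `|\int[mu]_(x in D) f x| <= \int[mu]_(x in D) `|f x|.
Proof. exact: le_normr_Rintegral. Qed.

Lemma ae_L1 f g : measurable_fun D g -> L1fun f ->
  {ae mu, forall x, D x -> f x = g x} -> L1fun g.
Proof.
move=> mg /L1P[mf foo] fg; apply/L1P; split => //.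
rewrite -(@ae_eq_integral _ _ _ mu D _ (fun x => `|f x|%:E))//.
- by apply/measurable_EFinP; exact: measurableT_comp.
- by apply/measurable_EFinP; exact: measurableT_comp.
- by apply: filterS fg => x /= + Dx => /(_ Dx) ->.
Qed.

Lemma ae_Rint f g : measurable_fun D g -> measurable_fun D f ->
  {ae mu, forall x, D x -> f x = g x} ->
  \int[mu]_(x in D) f x = \int[mu]_(x in D) g x.
Proof.
move=> mg mf fg; congr fine; apply: ae_eq_integral => //.
- exact/measurable_EFinP.
- exact/measurable_EFinP.
- by apply: filterS fg => x /= + Dx => /(_ Dx) ->.
Qed.

(** Replacing [f] by the minimum of [f] and [g] changes it only on a null set and turns the almost
    everywhere inequality into a pointwise one. *)
Lemma ae_le_Rint f g : L1fun f -> L1fun g ->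
  {ae mu, forall x, D x -> f x <= g x} ->
  \int[mu]_(x in D) f x <= \int[mu]_(x in D) g x.
Proof.
move=> fi gi fg.
have mh : measurable_fun D (fun x => Num.min (f x) (g x)).
  by apply: measurable_minr; exact: L1_meas.
have hf : {ae mu, forall x, D x -> f x = Num.min (f x) (g x)}.
  by apply: filterS fg => x /= + Dx => /(_ Dx) fgx; rewrite min_l.
rewrite (ae_Rint mh (L1_meas fi) hf); apply: le_Rint => //.
  exact: ae_L1 hf.
by move=> x _; rewrite ge_min lexx orbT.
Qed.

Lemma ae_L1_le f g : measurable_fun D f -> L1fun g ->
  {ae mu, forall x, D x -> `|f x| <= g x} -> L1fun f.
Proof.
move=> mf gi fg.
have mh : measurable_fun D (fun x => Num.max (g x) `|f x|).
  by apply: measurable_maxr; [exact: L1_meas|exact: measurableT_comp].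
apply: (@L1_le _ (fun x => Num.max (g x) `|f x|)) => //.
  by move=> x _; rewrite le_max lexx orbT.
apply: ae_L1 gi _ => //.
by apply: filterS fg => x /= + Dx => /(_ Dx) fgx; rewrite max_l.
Qed.

Lemma Rint_eq0_ae f : L1fun f -> (forall x, D x -> 0 <= f x) ->
  \int[mu]_(x in D) f x = 0 -> {ae mu, forall x, D x -> f x = 0}.
Proof.
move=> fi f0 int0.
have mf := L1_meas fi.
have : ae_eq mu D (EFin \o f) (cst 0%E).
  apply/ae_eq_integral_abs => //; first exact/measurable_EFinP.
  rewrite -[RHS]/(0%R%:E) -int0 -L1_EFin//; apply: eq_integral => x /set_mem Dx /=.
  by rewrite ger0_norm// f0.
by apply: filterS => x /= + Dx => /(_ Dx) [].
Qed.

Definition L2fun f :=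
  measurable_fun D f /\ (\int[mu]_(x in D) (f x ^+ 2)%:E < +oo)%E.

Definition ip f g : R := \int[mu]_(x in D) (f x * g x).

Lemma L2P f : L2fun f <-> measurable_fun D f /\ L1fun (fun x => f x ^+ 2).
Proof.
split=> [[mf foo]|[mf /L1P[_ foo]]]; split => //.
- apply: L1_ge0 => //; last by move=> x _; rewrite sqr_ge0.
  exact: measurable_funX.
- by under eq_integral => x _ do rewrite -[_ ^+ 2]ger0_norm ?sqr_ge0//.
Qed.

Lemma L2_meas f : L2fun f -> measurable_fun D f.
Proof. by case. Qed.

Lemma L2_sqr f : L2fun f -> L1fun (fun x => f x ^+ 2).
Proof. by move=> /L2P[]. Qed.

Lemma L2_mul f g : L2fun f -> L2fun g -> L1fun (fun x => f x * g x).
Proof.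
move=> /L2P[mf fi] /L2P[mg gi].
apply: (@L1_le _ (fun x => f x ^+ 2 + g x ^+ 2)).
- exact: measurable_funM.
- by move=> x _; rewrite ler_norml; apply/andP; split; nra.
- exact: L1D.
Qed.

Lemma L2_le f g : measurable_fun D f -> (forall x, D x -> `|f x| <= `|g x|) ->
  L2fun g -> L2fun f.
Proof.
move=> mf fg /L2P[mg gi]; apply/L2P; split => //.
apply: L1_le gi; first exact: measurable_funX.
move=> x Dx; rewrite ger0_norm ?sqr_ge0// -(real_normK (num_real (f x))).
by rewrite -(real_normK (num_real (g x))) lerXn2r ?nnegrE// fg.
Qed.

Lemma L2D f g : L2fun f -> L2fun g -> L2fun (fun x => f x + g x).
Proof.
move=> /[dup] fL /L2P[mf fi] /[dup] gL /L2P[mg gi]; apply/L2P; split.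
  exact: measurable_funD.
apply: (@L1_ext (fun x => f x ^+ 2 + g x ^+ 2 + 2 * (f x * g x))).
  by move=> x _; ring.
by apply: L1D; [exact: L1D|apply: L1Z; exact: L2_mul].
Qed.

Lemma L2Z k f : L2fun f -> L2fun (fun x => k * f x).
Proof.
move=> /L2P[mf fi]; apply/L2P; split; first exact: measurable_funM.
by apply: L1_ext (L1Z (k ^+ 2) fi) => x _; ring.
Qed.

Lemma L2N f : L2fun f -> L2fun (fun x => - f x).
Proof. by move=> /(L2Z (-1)); congr L2fun; apply/funext => x; rewrite mulN1r. Qed.

Lemma L2B f g : L2fun f -> L2fun g -> L2fun (fun x => f x - g x).
Proof. by move=> fL /L2N; exact: L2D. Qed.

Lemma L20 : L2fun (fun=> 0).
Proof. by apply/L2P; split => //; apply: L1_ext L10 => x _; rewrite expr0n. Qed.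

Lemma L2_ext f g : (forall x, D x -> f x = g x) -> L2fun f -> L2fun g.
Proof.
move=> fg /L2P[mf fi]; apply/L2P; split.
  by apply: eq_measurable_fun mf => x /set_mem; exact: fg.
by apply: L1_ext fi => x /fg ->.
Qed.

Lemma L2_cst (k : R) : (mu D < +oo)%E -> L2fun (fun=> k).
Proof. by move=> Doo; apply/L2P; split => //; exact: L1_cst. Qed.

Lemma L2_L1 f : (mu D < +oo)%E -> L2fun f -> L1fun f.
Proof.
by move=> /(L2_cst 1) c1 /L2_mul/(_ c1); apply: L1_ext => x _; rewrite mulr1.
Qed.

Lemma L2_bnd (M : R) f : (mu D < +oo)%E -> measurable_fun D f ->
  (forall x, D x -> `|f x| <= M) -> L2fun f.
Proof.
move=> Doo mf fM; apply: L2_le (L2_cst M Doo) => // x Dx.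
by rewrite (le_trans (fM _ Dx))// ler_norm.
Qed.

Lemma ipC f g : ip f g = ip g f.
Proof. by apply: Rint_ext => x _; rewrite mulrC. Qed.

Lemma ipDl f g h : L2fun f -> L2fun g -> L2fun h ->
  ip (fun x => f x + g x) h = ip f h + ip g h.
Proof.
move=> fL gL hL; rewrite /ip -RintD; [|exact: L2_mul|exact: L2_mul].
by apply: Rint_ext => x _; rewrite mulrDl.
Qed.

Lemma ipZl k f g : L2fun f -> L2fun g -> ip (fun x => k * f x) g = k * ip f g.
Proof.
move=> fL gL; rewrite /ip -RintZ; last exact: L2_mul.
by apply: Rint_ext => x _; rewrite mulrA.
Qed.

Lemma ip_ge0 f : 0 <= ip f f.
Proof. by apply: Rintegral_ge0 => x _; rewrite -expr2 sqr_ge0. Qed.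

Lemma ip_ext f g f' g' : (forall x, D x -> f x = f' x) ->
  (forall x, D x -> g x = g' x) -> ip f g = ip f' g'.
Proof. by move=> ff gg; apply: Rint_ext => x Dx; rewrite ff// gg. Qed.

Lemma ae_ip f g f' g' : L2fun f -> L2fun g -> L2fun f' -> L2fun g' ->
  {ae mu, forall x, D x -> f x = f' x} ->
  {ae mu, forall x, D x -> g x = g' x} -> ip f g = ip f' g'.
Proof.
move=> fL gL fL' gL' ff' gg'; apply: ae_Rint.
- exact/L1_meas/L2_mul.
- exact/L1_meas/L2_mul.
by apply: filterS2 ff' gg' => x /= ff' gg' Dx; rewrite ff'// gg'.
Qed.

Definition L4fun f :=
  measurable_fun D f /\ (\int[mu]_(x in D) (f x ^+ 4)%:E < +oo)%E.

Lemma L4P f : L4fun f <-> measurable_fun D f /\ L2fun (fun x => f x ^+ 2).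
Proof.
split=> [[mf foo]|[mf [_ foo]]]; split => //.
- split; first exact: measurable_funX.
  by under eq_integral => x _ do rewrite -exprM.
- by under eq_integral => x _ do rewrite (exprM _ 2 2).
Qed.

Lemma L4_meas f : L4fun f -> measurable_fun D f.
Proof. by case. Qed.

Lemma L4_sqr f : L4fun f -> L2fun (fun x => f x ^+ 2).
Proof. by move=> /L4P[]. Qed.

Lemma L4_mul f g : L4fun f -> L4fun g -> L2fun (fun x => f x * g x).
Proof.
move=> /L4P[mf fi] /L4P[mg gi]; apply/L2P; split; first exact: measurable_funM.
by apply: L1_ext (L2_mul fi gi) => x _; rewrite exprMn.
Qed.

Lemma L4Z k f : L4fun f -> L4fun (fun x => k * f x).
Proof.
move=> /L4P[mf fi]; apply/L4P; split; first exact: measurable_funM.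
by apply: L2_ext (L2Z (k ^+ 2) fi) => x _; rewrite exprMn.
Qed.

Lemma L4D f g : L4fun f -> L4fun g -> L4fun (fun x => f x + g x).
Proof.
move=> /[dup] fL /L4P[mf fi] /[dup] gL /L4P[mg gi]; apply/L4P; split.
  exact: measurable_funD.
apply: (@L2_ext (fun x => f x ^+ 2 + g x ^+ 2 + 2 * (f x * g x))).
  by move=> x _; ring.
by apply: L2D; [exact: L2D|apply: L2Z; exact: L4_mul].
Qed.

Lemma L4B f g : L4fun f -> L4fun g -> L4fun (fun x => f x - g x).
Proof.
move=> fL /(L4Z (-1)) /(L4D fL).
by congr L4fun; apply/funext => x; rewrite mulN1r.
Qed.

End Integrable.

(** * Complete semi-inner-product spaces *)

Section PreHilbert.
Context (R : realType) (V : lmodType R).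
Variables (X : set V) (B : V -> V -> R).

(** Convergence in the seminorm attached to [B]. Limits are determined only up to vectors of zero
    length, since functions equal almost everywhere are not identified. *)
Definition quad_cvg (s : nat -> V) (x : V) := forall e : R, 0 < e ->
  exists N, forall n, (N <= n)%N -> B (s n - x) (s n - x) <= e.

Definition quad_cauchy (s : nat -> V) := forall e : R, 0 < e ->
  exists N, forall n k, (N <= n)%N -> (N <= k)%N ->
    B (s n - s k) (s n - s k) <= e.

Definition is_subspace (E : set V) :=
  E 0 /\ forall (a : R) x y, E x -> E y -> E (a *: x + y).

(** A Hilbert space before the quotient by null vectors, carried by a subset [X] of an ambient
    module of functions. The algebraic laws are required on [X] only, because the integrals that
    define [B] behave well only there. *)
Record semi_hilbert : Prop := SemiHilbert {
  sh_sub : is_subspace X ;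
  sh_sym : forall x y, X x -> X y -> B x y = B y x ;
  sh_lin : forall (a : R) x y z, X x -> X y -> X z ->
    B (a *: x + y) z = a * B x z + B y z ;
  sh_ge0 : forall x, X x -> 0 <= B x x ;
  sh_complete : forall s, (forall n, X (s n)) -> quad_cauchy s ->
    exists2 x, X x & quad_cvg s x }.

Hypothesis H : semi_hilbert.
Implicit Types (a : R) (x y z w : V).

Let X0 : X 0. Proof. exact: (sh_sub H).1. Qed.

Lemma subspaceD (E : set V) x y : is_subspace E -> E x -> E y -> E (x + y).
Proof. by move=> [_ h] Ex Ey; rewrite -[x]scale1r; exact: h. Qed.

Lemma subspaceZ (E : set V) a x : is_subspace E -> E x -> E (a *: x).
Proof. by move=> [h0 h] Ex; rewrite -[_ *: _]addr0; exact: h. Qed.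

Lemma subspaceB (E : set V) x y : is_subspace E -> E x -> E y -> E (x - y).
Proof.
by move=> hE Ex Ey; apply: subspaceD => //; rewrite -scaleN1r; exact: subspaceZ.
Qed.

Let XD x y : X x -> X y -> X (x + y).
Proof. by apply: subspaceD; exact: (sh_sub H). Qed.
Let XZ a x : X x -> X (a *: x).
Proof. by apply: subspaceZ; exact: (sh_sub H). Qed.
Let XB x y : X x -> X y -> X (x - y).
Proof. by apply: subspaceB; exact: (sh_sub H). Qed.

Lemma shDl x y z : X x -> X y -> X z -> B (x + y) z = B x z + B y z.
Proof. by move=> *; rewrite -{1}[x]scale1r (sh_lin H)// mul1r. Qed.

Lemma sh0l z : X z -> B 0 z = 0.
Proof.
by move=> Xz; have := shDl X0 X0 Xz; rewrite addr0 => /eqP; rewrite -subr_eq subrr eq_sym => /eqP.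
Qed.

Lemma shZl a x z : X x -> X z -> B (a *: x) z = a * B x z.
Proof. by move=> *; rewrite -[a *: x]addr0 (sh_lin H)// sh0l// addr0. Qed.

Lemma shBl x y z : X x -> X y -> X z -> B (x - y) z = B x z - B y z.
Proof. by move=> *; rewrite -scaleN1r addrC (sh_lin H)// mulN1r addrC. Qed.

Lemma shDr x y z : X x -> X y -> X z -> B z (x + y) = B z x + B z y.
Proof.
by move=> Xx Xy Xz; rewrite (sh_sym H)// ?shDl// 1?(sh_sym H Xx)// 1?(sh_sym H Xy)//; exact: XD.
Qed.

Lemma shZr a x z : X x -> X z -> B z (a *: x) = a * B z x.
Proof. by move=> Xx Xz; rewrite (sh_sym H)// ?shZl// 1?(sh_sym H Xx)//; exact: XZ. Qed.

Lemma shBr x y z : X x -> X y -> X z -> B z (x - y) = B z x - B z y.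
Proof.
by move=> Xx Xy Xz; rewrite (sh_sym H)// ?shBl// 1?(sh_sym H Xx)// 1?(sh_sym H Xy)//; exact: XB.
Qed.

Lemma sh_sqrD x y : X x -> X y -> B (x + y) (x + y) = B x x + 2 * B x y + B y y.
Proof.
move=> Xx Xy; rewrite shDl ?shDr//; [|exact: XD].
by rewrite (sh_sym H Xy Xx); ring.
Qed.

Lemma sh_sqrB x y : X x -> X y -> B (x - y) (x - y) = B x x - 2 * B x y + B y y.
Proof.
move=> Xx Xy; rewrite shBl ?shBr//; [|exact: XB].
by rewrite (sh_sym H Xy Xx); ring.
Qed.

Lemma sh_sqrZ a x : X x -> B (a *: x) (a *: x) = a ^+ 2 * B x x.
Proof. by move=> Xx; rewrite shZl ?shZr//; [ring|exact: XZ]. Qed.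

Lemma sh_CS2 x y : X x -> X y -> B x y ^+ 2 <= B x x * B y y.
Proof.
move=> Xx Xy.
have h a : 0 <= a ^+ 2 * B x x + 2 * a * B x y + B y y.
  have := sh_ge0 H (XD (XZ a Xx) Xy).
  by rewrite sh_sqrD ?sh_sqrZ ?shZl//; [|exact: XZ]; rewrite mulrA.
have := sh_ge0 H Xx; rewrite le_eqVlt => /predU1P[Bx0|Bx0].
  rewrite -Bx0 mul0r; have [->|t0] := eqVneq (B x y) 0; first by rewrite expr0n.
  (* If [x] has zero length the quadratic in [a] degenerates to an affine function; with nonzero
     slope it would take the value -1 at this point. *)
  have := h (- (B y y + 1) / (2 * B x y)); rewrite -Bx0 mulr0.
  have -> : 0 + 2 * (- (B y y + 1) / (2 * B x y)) * B x y + B y y = -1 by field.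
  by rewrite ler0N1.
have := h (- B x y / B x x).
have -> : (- B x y / B x x) ^+ 2 * B x x + 2 * (- B x y / B x x) * B x y + B y y
   = (B x x * B y y - B x y ^+ 2) / B x x by field; rewrite gt_eqF.
by rewrite ler_pdivlMr// mul0r subr_ge0.
Qed.

Definition sh_norm x : R := Num.sqrt (B x x).

Lemma sh_norm_ge0 x : 0 <= sh_norm x. Proof. exact: sqrtr_ge0. Qed.

Lemma sh_norm2 x : X x -> sh_norm x ^+ 2 = B x x.
Proof. by move=> Xx; rewrite sqr_sqrtr ?(sh_ge0 H). Qed.

Lemma sh_CS x y : X x -> X y -> `|B x y| <= sh_norm x * sh_norm y.
Proof.
move=> Xx Xy; rewrite -sqrtrM ?(sh_ge0 H)// -sqrtr_sqr ler_sqrt ?sh_CS2//.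
by rewrite mulr_ge0// (sh_ge0 H).
Qed.

Lemma sh_normD x y : X x -> X y -> sh_norm (x + y) <= sh_norm x + sh_norm y.
Proof.
move=> Xx Xy; rewrite -(@ler_pXn2r _ 2)// ?nnegrE ?addr_ge0 ?sh_norm_ge0//.
rewrite sh_norm2 ?sh_sqrD//; last exact: XD.
rewrite sqrrD !sh_norm2//; have := sh_CS Xx Xy; rewrite ler_norml => /andP[_ h].
by rewrite -mulr_natl; lra.
Qed.

Lemma sh_normZ a x : X x -> sh_norm (a *: x) = `|a| * sh_norm x.
Proof.
by move=> Xx; rewrite /sh_norm sh_sqrZ// sqrtrM ?sqr_ge0// sqrtr_sqr.
Qed.

Lemma sh_normC x y : X x -> X y -> sh_norm (x - y) = sh_norm (y - x).
Proof.
move=> Xx Xy; have -> : x - y = (-1) *: (y - x) by rewrite scaleN1r opprB.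
by rewrite sh_normZ ?normrN1 ?mul1r//; exact: XB.
Qed.

Lemma sh_normB x y : X x -> X y -> sh_norm (x - y) <= sh_norm x + sh_norm y.
Proof.
move=> Xx Xy; rewrite -[sh_norm y]mul1r -(normrN1 R) -sh_normZ// scaleN1r.
by apply: sh_normD => //; rewrite -scaleN1r; exact: XZ.
Qed.

Lemma sh_norm_dist x y : X x -> X y -> `|sh_norm x - sh_norm y| <= sh_norm (x - y).
Proof.
move=> Xx Xy; have h u v : X u -> X v -> sh_norm u <= sh_norm (u - v) + sh_norm v.
  by move=> Xu Xv; rewrite -{1}(subrK v u); apply: sh_normD => //; exact: XB.
have := h _ _ Xx Xy; have := h _ _ Xy Xx; rewrite (sh_normC Xy Xx).
by rewrite ler_norml; lra.
Qed.

Lemma sh_quad_cvg s x w : (forall n, X (s n)) -> X x -> X w -> quad_cvg s x ->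
  forall e : R, 0 < e -> exists N, forall n, (N <= n)%N -> `|B (s n) w - B x w| <= e.
Proof.
move=> Xs Xx Xw sx e e0.
have Bw0 : 0 < B w w + 1 by rewrite ltr_wpDl// (sh_ge0 H).
have [N hN] := sx (e ^+ 2 / (B w w + 1)) (divr_gt0 (exprn_gt0 2 e0) Bw0).
exists N => n /hN h; rewrite -shBl//.
rewrite -(@ler_pXn2r _ 2)// ?nnegrE ?(ltW e0)// real_normK ?num_real//.
apply: (le_trans (sh_CS2 (XB (Xs n) Xx) Xw)).
apply: (@le_trans _ _ (e ^+ 2 / (B w w + 1) * (B w w + 1))); last by rewrite divfK ?gt_eqF.
apply: ler_pM => //; [exact/(sh_ge0 H)/XB|exact: (sh_ge0 H)|by rewrite lerDl].
Qed.

(* The minimizing sequence of d |-> |d|^2 - 2 l(d) on E is Cauchy by the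
   parallelogram identity. *)
Lemma sh_minimizing (E : set V) (l : V -> R) (C : R) :
  is_subspace E -> E `<=` X ->
  (forall a x y, E x -> E y -> l (a *: x + y) = a * l x + l y) ->
  (forall x, E x -> `|l x| <= C * sh_norm x) ->
  exists s, [/\ forall n, E (s n), quad_cauchy s &
    forall w, E w -> forall e : R, 0 < e ->
      exists N, forall n, (N <= n)%N -> `|B (s n) w - l w| <= e].
Proof.
move=> hE EX llin lC.
have E0 := hE.1.
have lD x y : E x -> E y -> l (x + y) = l x + l y.
  by move=> Ex Ey; rewrite -{1}[x]scale1r llin// mul1r.
have l0 : l 0 = 0.
  by have := lD _ _ E0 E0; rewrite addr0 => /eqP; rewrite -subr_eq subrr eq_sym => /eqP.
have lZ a x : E x -> l (a *: x) = a * l x.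
  by move=> Ex; rewrite -[a *: x]addr0 llin// l0 addr0.
pose J x := B x x - 2 * l x.
have Jge x : E x -> - (C ^+ 2) <= J x.
  move=> Ex; have := lC _ Ex; rewrite /J -(sh_norm2 (EX _ Ex)).
  rewrite ler_norml => /andP[_ h]; have := sqr_ge0 (sh_norm x - C).
  by rewrite sqrrB -mulr_natl; move: (sh_norm x) h => n h h'; lra.
pose A := [set J x | x in E].
have hA : has_inf A.
  split; first by exists (J 0); exists 0.
  by exists (- C ^+ 2) => _ [x Ex <-]; exact: Jge.
have Jm x : E x -> inf A <= J x by move=> Ex; apply: (ge_inf hA.2); exists x.
have ex n : exists x, E x /\ J x < inf A + n.+1%:R^-1.
  have n0 : 0 < n.+1%:R^-1 :> R by rewrite invr_gt0.
  have [_ [x Ex <-] Jx] := inf_adherent n0 hA.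
  by exists x.
have [s hs] := choice ex.
have Es n := (hs n).1.
have small (e : R) : 0 < e -> exists N, forall n, (N <= n)%N -> n.+1%:R^-1 <= e.
  move=> e0; exists (Num.truncn e^-1) => n hn.
  rewrite -[leRHS]invrK lef_pV2 ?posrE ?invr_gt0//.
  apply: le_trans (ltW (truncnS_gt _)) _.
  by rewrite ler_nat ltnS.
exists s; split => //.
- move=> e e0; have [N hN] := small (e / 4) ltac:(by rewrite divr_gt0).
  exists N => n k /hN hn /hN hk.
  have Exy := subspaceD hE (Es n) (Es k).
  have hm := Jm _ (subspaceZ (2^-1) hE Exy).
  have Xn := EX _ (Es n); have Xk := EX _ (Es k).
  move: hm; rewrite /J lZ// lD// sh_sqrZ; last exact: XD.
  rewrite sh_sqrD// sh_sqrB//.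
  have := (hs n).2; have := (hs k).2; rewrite /J.
  move: (inf A) (B _ _) (B _ _) (B _ _) (l _) (l _) hn hk => m p q r u v.
  move: (n.+1%:R^-1) (k.+1%:R^-1) => a b; lra.
- move=> w Ew e e0.
  have Xw := EX _ Ew.
  have hw := sh_ge0 H Xw.
  (* Near-minimality in the directions [t] and [- t] bounds the defect |B (s n) w - l w| by half of
     t B w w + 1/((n+1) t). This [t] makes the first term at most [e], and [n] is then taken so
     large that the second one is too. *)
  pose t := e / (B w w + 1).
  have Bw0 : 0 < B w w + 1 by rewrite ltr_wpDl.
  have t0 : 0 < t by rewrite divr_gt0.
  have tw : t * B w w <= e.
    by rewrite /t mulrAC ler_pdivrMr//; nra.
  have [N hN] := small (e * t) ltac:(by rewrite mulr_gt0).
  exists N => n /hN hn.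
  have key a : 0 <= 2 * a * (B (s n) w - l w) + a ^+ 2 * B w w + n.+1%:R^-1.
    have := Jm _ (subspaceD hE (Es n) (subspaceZ a hE Ew)).
    rewrite /J lD ?lZ//; last exact: subspaceZ.
    rewrite sh_sqrD; [|exact: EX|exact: XZ].
    rewrite shZr//; last exact: EX.
    rewrite sh_sqrZ//; have := (hs n).2; rewrite /J; move: (n.+1%:R^-1) => q h1 h2; lra.
  have tw' : t ^+ 2 * B w w <= t * e by rewrite expr2 -mulrA ler_wpM2l// ltW.
  have := key t; have := key (- t); rewrite ler_norml sqrrN.
  move: (B (s n) w - l w) (t ^+ 2 * B w w) tw' (n.+1%:R^-1) hn => z u tw' q hn h1 h2.
  clearbody t; rewrite -(@ler_pM2l _ (2 * t)) ?mulr_gt0//.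
  rewrite -[X in _ && X](@ler_pM2l _ (2 * t)) ?mulr_gt0//.
  by apply/andP; split; lra.
Qed.

Lemma eq_of_dist_small (x y : R) : (forall e, 0 < e -> `|x - y| <= e) -> x = y.
Proof.
move=> h; apply/eqP; rewrite -subr_eq0 -normr_le0.
by apply/ler_addgt0Pl => e e0; rewrite addr0; exact: h.
Qed.

(** The minimizing sequence converges by completeness, and its approximate Euler equation B (s n) w
    = l w passes to the limit because [B] is continuous in its first argument. *)
Lemma riesz_representation (l : V -> R) (C : R) :
  (forall a x y, X x -> X y -> l (a *: x + y) = a * l x + l y) ->
  (forall x, X x -> `|l x| <= C * sh_norm x) ->
  exists2 g, X g & forall w, X w -> B g w = l w.
Proof.
move=> llin lC.
have [s [Xs cs hs]] := sh_minimizing (sh_sub H) (@subset_refl _ X) llin lC.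
have [g Xg sg] := sh_complete H Xs cs.
exists g => // w Xw; apply: eq_of_dist_small => e e0.
have e2 : 0 < e / 2 by rewrite divr_gt0.
have [N hN] := hs w Xw _ e2; have [M hM] := sh_quad_cvg Xs Xg Xw sg e2.
have h1 := hN _ (leq_maxl N M); have h2 := hM _ (leq_maxr N M).
by move: h1 h2; rewrite !ler_norml; lra.
Qed.

(** The subspace [E] need not be closed: a minimizing sequence in [E] for the functional B g
    converges in [X] to the projection x of [g] onto the closure, and g - x is orthogonal to [E],
    hence of zero length. *)
Lemma dense_of_orthogonal (E : set V) : is_subspace E -> E `<=` X ->
  (forall z, X z -> (forall w, E w -> B z w = 0) -> B z z = 0) ->
  forall g (e : R), X g -> 0 < e -> exists2 w, E w & B (g - w) (g - w) <= e.
Proof.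
move=> hE EX orth g e Xg e0.
have [||s [Es cs hs]] := @sh_minimizing E (fun w => B g w) (sh_norm g) hE EX.
- move=> a x y /EX Xx /EX Xy; rewrite shDr ?shZr//; exact: XZ.
- by move=> x /EX; exact: sh_CS.
have Xs n := EX _ (Es n).
have [x Xx sx] := sh_complete H Xs cs.
have z0 : B (g - x) (g - x) = 0.
  apply: orth; first exact: XB.
  move=> w Ew; have Xw := EX _ Ew; rewrite shBl//; apply/eqP; rewrite subr_eq0 eq_sym; apply/eqP.
  apply: eq_of_dist_small => r r0.
  have r2 : 0 < r / 2 by rewrite divr_gt0.
  have [N hN] := hs w Ew _ r2; have [M hM] := sh_quad_cvg Xs Xx Xw sx r2.
  have h1 := hN _ (leq_maxl N M); have h2 := hM _ (leq_maxr N M).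
  by move: h1 h2; rewrite !ler_norml; lra.
have [N hN] := sx _ e0; exists (s N) => //.
have -> : g - s N = (g - x) - (s N - x) by rewrite opprB addrA subrK.
have gx := XB Xg Xx; have sNx := XB (Xs N) Xx.
rewrite sh_sqrB// z0.
have : B (g - x) (s N - x) = 0.
  by apply/eqP; rewrite -sqrf_eq0 eq_le sqr_ge0 andbT (le_trans (sh_CS2 _ _))// z0 mul0r.
by move=> ->; rewrite mulr0 subr0 add0r hN.
Qed.

End PreHilbert.

(** * Completeness of L2 (Riesz-Fischer) *)

Section L2Complete.
Context d (X : measurableType d) (R : realType).
Variables (mu : {measure set X -> \bar R}) (D : set X).
Hypothesis mD : measurable D.

Local Notation ipD := (ip mu D).
Local Notation L2X := (L2fun mu D).

Lemma is_subspace_L2 : is_subspace (L2X : set (X -> R)).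
Proof.
split; first exact: L20.
move=> a x y Lx Ly.
rewrite (_ : a *: x + y = fun t => a * x t + y t)//.
by apply: L2D => //; exact: L2Z.
Qed.

(** The k-th increment is at most sqrt (g x) * 2^-k, so the increments are dominated by a geometric
    series. *)
Lemma ereal_sup_pseries_cvg (g : X -> R) (s : nat -> X -> R) x :
  (forall k, (s k.+1 x - s k x) ^+ 2 * 4 ^+ k <= g x) -> cvgn (fun k => s k x).
Proof.
move=> h.
have g0 : 0 <= g x by apply: le_trans (h 0%N); rewrite mulr_ge0 ?sqr_ge0.
have cs : cvgn (series (fun k => `|s k.+1 x - s k x|)).
  apply: (@series_le_cvg _ _ (geometric (Num.sqrt (g x)) 2^-1)) => //.
  - by move=> k; rewrite /= mulr_ge0 ?sqrtr_ge0// exprn_ge0.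
  - move=> k /=.
    rewrite -(@ler_pXn2r _ 2)// ?nnegrE// ?mulr_ge0 ?sqrtr_ge0 ?exprn_ge0//.
    rewrite exprMn sqr_sqrtr// real_normK ?num_real//.
    rewrite -exprM mulnC exprM -/(_^-1) exprVn.
    have -> : (2 ^+ 2 : R) = 4 by ring.
    by rewrite exprVn ler_pdivlMr ?exprn_gt0.
  - by apply: is_cvg_geometric_series; rewrite ger0_norm// invf_lt1// ltr1n.
have /cvg_ex[/= l hl] := normed_cvg cs.
apply/cvg_ex; exists (l + s 0%N x).
rewrite (_ : (fun k => s k x) = (fun k => series (fun k => s k.+1 x - s k x) k + s 0%N x)).
  by apply: cvgD => //; exact: cvg_cst.
apply/funext => k; rewrite /series/= (telescope_sumr (fun k => s k x))//.
by rewrite subrK.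
Qed.

(** The integrals of the weighted squared increments sum to a convergent geometric series. Their sum
    [G] is therefore integrable, hence finite almost everywhere, and where it is finite the
    pointwise criterion applies. *)
Lemma fast_cauchy_cvg (s : nat -> X -> R) : (forall n, L2X (s n)) ->
  (forall k, (\int[mu]_(x in D) ((s k.+1 x - s k x) ^+ 2 * 4 ^+ k)%:E <= (4^-1 ^+ k)%:E)%E) ->
  exists2 f : X -> R, measurable_fun D f &
    {ae mu, forall x, D x -> s k x @[k --> \oo] --> f x}.
Proof.
move=> Ls fast.
pose h k x := (s k.+1 x - s k x) ^+ 2 * 4 ^+ k.
have h0 k x : 0 <= h k x by rewrite mulr_ge0 ?sqr_ge0 ?exprn_ge0.
have mh k : measurable_fun D (h k).
  apply: measurable_funM => //; apply: measurable_funX.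
  by apply: measurable_funB; exact: L2_meas.
pose G x := (\sum_(0 <= k <oo) (h k x)%:E)%E.
have mG : measurable_fun D G.
  apply: ge0_emeasurable_sum => [k x _ _|k _]; first by rewrite lee_fin.
  exact/measurable_EFinP.
have iG : (\int[mu]_(x in D) G x < +oo)%E.
  rewrite integral_nneseries//; last 2 first.
  - by move=> k; exact/measurable_EFinP.
  - by move=> k x _; rewrite lee_fin.
  apply: (@le_lt_trans _ _ (\sum_(0 <= k <oo) (4^-1 ^+ k)%:E)%E).
    apply: lee_nneseries => [*|k *]; last exact: fast.
    by apply: integral_ge0 => x _; rewrite lee_fin.
  have lt1 : `|4^-1 : R| < 1 by rewrite ger0_norm// invf_lt1// ltr1n.
  have := cvg_geometric_series (a := 1) lt1.
  move=> c'; have c : (series (geometric 1 4^-1) n)%:E @[n --> \oo] --> (1 / (1 - 4^-1) : R)%:E.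
    by apply: cvg_EFin => //; exact: nearW.
  rewrite (_ : limn _ = (1 / (1 - 4^-1) : R)%:E) ?ltry//.
  apply: cvg_lim => //; apply: cvg_trans c.
  apply: near_eq_cvg; near=> n => /=.
  by rewrite -sumEFin; apply: eq_bigr => i _; rewrite /= mul1r.
have G0 x : D x -> (0 <= G x)%E.
  by move=> _; apply: nneseries_ge0 => k _ _; rewrite lee_fin.
have iG' : mu.-integrable D G.
  apply/integrableP; split => //.
  by under eq_integral => x /set_mem Dx do rewrite gee0_abs ?G0//.
have aeG := integrable_ae mD iG'.
pose E := D `&` [set x | G x \is a fin_num].
have mE : measurable E by exact: emeasurable_fin_num.
pose f x := limn (fun k => (s k \_ E) x).
have hE x : E x -> cvgn (fun k => s k x).
  move=> [Dx Gx]; apply: (@ereal_sup_pseries_cvg (fun x => fine (G x))) => k.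
  rewrite -lee_fin fineK//.
  apply: (@le_trans _ _ (\sum_(0 <= i < k.+1) (h i x)%:E)%E).
    rewrite big_nat_recr//= leeDr// sume_ge0// => i _; by rewrite lee_fin.
  by apply: nneseries_lim_ge => n _ _; rewrite lee_fin.
exists f.
  apply: (@measurable_fun_cvg _ _ _ _ (fun k => s k \_ E)).
    move=> k; apply: measurable_funTS; apply/(measurable_restrictT _ mE).
    by apply: measurable_funS (L2_meas (Ls k)) => // x [].
  move=> x Dx; have [Ex|nEx] := pselect (E x).
    have Ef : (fun k => (s k \_ E) x) = s^~ x.
      by apply/funext => k; rewrite patchT ?inE.
    by rewrite /f Ef; exact: hE.
  have Ef : (fun k => (s k \_ E) x) = fun=> 0.
    by apply/funext => k; rewrite patchN// notin_setE.
  by rewrite /f Ef; exact: is_cvg_cst.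
apply: filterS aeG => x /= aeG Dx.
have Ex : E x by split => //; exact: aeG.
have Ef : (fun k => (s k \_ E) x) = s^~ x.
  by apply/funext => k; rewrite patchT ?inE.
by rewrite /f Ef; exact: hE.
Unshelve. all: by end_near. Qed.

Lemma Rint_fatou (s : nat -> X -> R) (f : X -> R) (e : R) : 0 <= e ->
  (forall n, measurable_fun D (s n)) -> measurable_fun D f ->
  (forall n x, 0 <= s n x) -> (forall x, 0 <= f x) ->
  {ae mu, forall x, D x -> s n x @[n --> \oo] --> f x} ->
  (exists N, forall n, (N <= n)%N -> (\int[mu]_(x in D) (s n x)%:E <= e%:E)%E) ->
  (\int[mu]_(x in D) (f x)%:E <= e%:E)%E.
Proof.
move=> e0 ms mf s0 f0 sf [N hN].
have [Z [mZ Z0 sZ]] := sf.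
have mDZ : measurable (D `\` Z) by exact: measurableD.
have ms' n : measurable_fun (D `\` Z) (EFin \o s n).
  by apply/measurable_EFinP; apply: measurable_funS (ms n) => // x [].
have h := @fatou _ _ _ mu _ mDZ (fun n x => (s n x)%:E) ms' (fun n x _ => (s0 n x : (0 <= (s n x)%:E)%E)).
have intZ (g : X -> R) : measurable_fun D g -> (forall x, 0 <= g x) ->
    (\int[mu]_(x in D) (g x)%:E = \int[mu]_(x in D `\` Z) (g x)%:E)%E.
  move=> mg g0; apply: ge0_negligible_integral => //; first exact/measurable_EFinP.
  by move=> x _; rewrite lee_fin.
have hN' n : (N <= n)%N -> (\int[mu]_(x in D `\` Z) (s n x)%:E <= e%:E)%E.
  by move=> Nn; rewrite -intZ//; exact: hN.
rewrite intZ//.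
have -> : (\int[mu]_(x in D `\` Z) (f x)%:E = \int[mu]_(x in D `\` Z) limn_einf (fun n => (s n x)%:E))%E.
  apply: eq_integral => x /set_mem [Dx nZx].
  have : s n x @[n --> \oo] --> f x.
    by apply: contrapT => nc; apply: nZx; apply: sZ => /= /(_ Dx).
  move=> sfx'; have sfx : (s n x)%:E @[n --> \oo] --> (f x)%:E.
    by apply: cvg_EFin => //; exact: nearW.
  apply/esym; rewrite is_cvg_limn_einfE; first exact: cvg_lim sfx.
  exact: cvgP sfx.
apply: (le_trans h).
rewrite limn_einf_lim; apply: lime_le; first exact: is_cvg_einfs.
apply: nearW => n; apply: (le_trans _ (hN' (maxn n N) (leq_maxr _ _))).
by apply: ereal_inf_lbound; exists (maxn n N) => //=; exact: leq_maxl.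
Qed.

Lemma L2_complete (s : nat -> X -> R) : (forall n, L2X (s n)) ->
  quad_cauchy ipD s -> exists2 f, L2X f & quad_cvg ipD s f.
Proof.
move=> Ls cs.
(* Squared increments of integral at most 16^-k leave 4^-k after the weight 4^k of
   [fast_cauchy_cvg]. *)
have pos4 k : 0 < 16^-1 ^+ k :> R by rewrite exprn_gt0// invr_gt0.
have ex k : exists N, forall n m, (N <= n)%N -> (N <= m)%N ->
    ipD (s n - s m) (s n - s m) <= 16^-1 ^+ k := cs _ (pos4 k).
have [N hN] := choice ex.
pose M := fix M k := if k is j.+1 then maxn (M j).+1 (N j.+1) else N 0%N.
have NM k : (N k <= M k)%N by case: k => //= k; exact: leq_maxr.
have MM j k : (j <= k)%N -> (M j <= M k)%N.
  elim: k => [|k IH]; first by rewrite leqn0 => /eqP ->.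
  rewrite leq_eqVlt => /predU1P[->//|]; rewrite ltnS => /IH h.
  by apply: leq_trans h _; rewrite /= (leq_trans (leqnSn _))// leq_maxl.
have Mge k : (k <= M k)%N.
  by elim: k => //= k IH; rewrite (leq_trans _ (leq_maxl _ _)).
pose t k := s (M k).
have Lt k : L2X (t k) by exact: Ls.
have sq n m : L1fun mu D (fun x => (s n x - s m x) ^+ 2).
  by apply: L2_sqr; exact: L2B.
have fast k : (\int[mu]_(x in D) ((t k.+1 x - t k x) ^+ 2 * 4 ^+ k)%:E <= (4^-1 ^+ k)%:E)%E.
  have h1 : L1fun mu D (fun x => (t k.+1 x - t k x) ^+ 2 * 4 ^+ k).
    by apply: (L1_ext mD _ (L1Z mD (4 ^+ k) (sq (M k.+1) (M k)))) => x _; rewrite mulrC.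
  rewrite L1_EFin// lee_fin.
  rewrite (_ : \int[mu]_(x in D) _ = 4 ^+ k * ipD (t k.+1 - t k) (t k.+1 - t k)); last first.
    rewrite -RintZ//; last exact: (sq (M k.+1) (M k)).
    by apply: Rint_ext => x _; rewrite mulrC.
  have h := hN k (M k.+1) (M k) (leq_trans (NM k) (MM _ _ (leqnSn k))) (NM k).
  apply: (@le_trans _ _ (4 ^+ k * 16^-1 ^+ k)); first by rewrite ler_wpM2l ?exprn_ge0.
  rewrite -exprMn (_ : 4 * 16^-1 = 4^-1 :> R)//.
  by field.
have [f mf tf] := fast_cauchy_cvg Lt fast.
have key n e : 0 <= e -> (exists K, forall k, (K <= k)%N -> ipD (s n - t k) (s n - t k) <= e) ->
    (\int[mu]_(x in D) ((s n x - f x) ^+ 2)%:E <= e%:E)%E.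
  move=> e0 [K hK]; apply: (@Rint_fatou (fun k x => (s n x - t k x) ^+ 2)) => //.
  - move=> k; apply: measurable_funX; apply: measurable_funB; exact: L2_meas.
  - apply: measurable_funX; apply: measurable_funB => //; exact: L2_meas.
  - by move=> k x; rewrite sqr_ge0.
  - by move=> x; rewrite sqr_ge0.
  - apply: filterS tf => x /= + Dx => /(_ Dx) tfx.
    have c : s n x - t k x @[k --> \oo] --> s n x - f x.
      by apply: cvgB => //; exact: cvg_cst.
    by rewrite expr2; under eq_fun do rewrite expr2; exact: cvgM.
  - by exists K => k /hK h; rewrite (L1_EFin mD (sq n (M k))) lee_fin; exact: h.
have tail n e : 0 <= e -> (exists K, forall m, (K <= m)%N -> ipD (s n - s m) (s n - s m) <= e) ->
    (\int[mu]_(x in D) ((s n x - f x) ^+ 2)%:E <= e%:E)%E.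
  move=> e0 [K hK]; apply: key => //.
  by exists K => k Kk; apply: hK; exact: leq_trans Kk (Mge k).
have Lf : L2X f.
  have [K hK] := cs 1 ltr01.
  have h : L2X (fun x => s K x - f x).
    split; first by apply: measurable_funB => //; exact: L2_meas.
    apply: (@le_lt_trans _ _ 1%:E); last exact: ltry.
    by apply: tail => //; exists K => m Km; exact: hK.
  by apply: (L2_ext mD _ (L2B mD (Ls K) h)) => x _; rewrite opprB addrC subrK.
exists f => // e e0.
have [K hK] := cs e e0.
exists K => n Kn.
rewrite -lee_fin /ip -(@L1_EFin _ _ _ mu D)//; last by apply: L2_mul => //; exact: L2B.
by apply: tail; [exact: ltW|exists K => m Km; exact: hK].
Qed.

Lemma semi_hilbert_L2 : semi_hilbert L2X (ipD : (X -> R) -> (X -> R) -> R).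
Proof.
split.
- exact: is_subspace_L2.
- by move=> f g _ _; exact: ipC.
- move=> a f g h fL gL hL.
  rewrite (_ : a *: f + g = fun x => a * f x + g x)// ipDl ?ipZl//; exact: L2Z.
- by move=> f _; exact: ip_ge0.
- exact: L2_complete.
Qed.

End L2Complete.

(** * Smooth cutoff functions *)

Section Smooth.
Context (R : realType).
Implicit Types f g : R -> R.

Fixpoint Cdiff (k : nat) f : Prop :=
  match k with
  | 0 => True
  | j.+1 => (forall x, derivable f x 1) /\ Cdiff j (derive1 f)
  end.

Definition smooth f := forall k, Cdiff k f.

Lemma CdiffS k f : Cdiff k.+1 f -> Cdiff k f.
Proof. by elim: k f => [//|k IHk] f [df /IHk cf]; split. Qed.

Lemma smooth_derivable f x : smooth f -> derivable f x 1.
Proof. by move=> /(_ 1%N)[]. Qed.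

Lemma smooth_derive1 f : smooth f -> smooth (derive1 f).
Proof. by move=> sf k; have [] := sf k.+1. Qed.

Lemma derivable_continuous f : (forall x, derivable f x 1) -> continuous f.
Proof.
by move=> df x; apply: differentiable_continuous; exact/derivable1_diffP.
Qed.

Lemma smooth_continuous f : smooth f -> continuous f.
Proof. by move=> sf; apply: derivable_continuous => x; exact: smooth_derivable. Qed.

Lemma smooth_derive1n f : smooth f ->
  forall n t, derivable (derive1n n f) t 1.
Proof.
move=> sf n; suff h : smooth (derive1n n f) by move=> t; exact: smooth_derivable.
by elim: n => [//|n IHn]; rewrite derive1nS; exact: smooth_derive1.
Qed.

Lemma derive1_cst_fun (c : R) : derive1 (fun=> c : R) = (fun=> 0) :> (R -> R).
Proof. by apply/funext => x; rewrite derive1_cst. Qed.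

Lemma Cdiff_cst k (c : R) : Cdiff k (fun=> c).
Proof.
elim: k c => [//|k IHk] c; split; first by move=> x; exact: derivable_cst.
by rewrite derive1_cst_fun.
Qed.

Lemma derive1D f g : (forall x, derivable f x 1) -> (forall x, derivable g x 1) ->
  derive1 (fun x => f x + g x) = (fun x => (derive1 f) x + (derive1 g) x).
Proof. by move=> df dg; apply/funext => x; rewrite !derive1E deriveD. Qed.

Lemma derive1M f g : (forall x, derivable f x 1) -> (forall x, derivable g x 1) ->
  derive1 (fun x => f x * g x) = (fun x => (derive1 f) x * g x + f x * (derive1 g) x).
Proof.
move=> df dg; apply/funext => x; rewrite !derive1E deriveM// addrC.
by congr (_ + _); rewrite /GRing.scale/= mulrC.
Qed.

Lemma CdiffD k f g : Cdiff k f -> Cdiff k g -> Cdiff k (fun x => f x + g x).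
Proof.
elim: k f g => [//|k IHk] f g [df cf] [dg cg]; split.
  by move=> x; apply: derivableD.
by rewrite derive1D//; exact: IHk.
Qed.

Lemma CdiffM k f g : Cdiff k f -> Cdiff k g -> Cdiff k (fun x => f x * g x).
Proof.
elim: k f g => [//|k IHk] f g /[dup] /CdiffS cf' [df cf] /[dup] /CdiffS cg' [dg cg]; split.
  by move=> x; apply: derivableM.
by rewrite derive1M//; apply: CdiffD; exact: IHk.
Qed.

Lemma smoothM f g : smooth f -> smooth g -> smooth (fun x => f x * g x).
Proof. by move=> sf sg k; exact: CdiffM. Qed.

Lemma smoothD f g : smooth f -> smooth g -> smooth (fun x => f x + g x).
Proof. by move=> sf sg k; exact: CdiffD. Qed.

Lemma smooth_cst c : smooth (fun=> c).
Proof. by move=> k; exact: Cdiff_cst. Qed.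

Lemma derive1_eq f (x l : R) : is_derive x 1 f l -> (derive1 f) x = l.
Proof. by move=> h; rewrite derive1E; case: h. Qed.

Lemma is_derive_inv_fun g x : g x != 0 -> derivable g x 1 ->
  is_derive x 1 (fun y => (g y)^-1) (- (g x) ^- 2 * (derive1 g) x).
Proof.
move=> gx dg.
have -> : - (g x) ^- 2 * (derive1 g) x = - (g x) ^- 2 *: 'D_1 g x.
  by rewrite derive1E.
by apply: is_deriveV => //; exact: derivableP.
Qed.

Lemma CdiffV k g : (forall x, g x != 0) -> Cdiff k g -> Cdiff k (fun x => (g x)^-1).
Proof.
move=> g0; elim: k => [//|k IHk] /[dup] /CdiffS cg [dg cg'].
have dV x := is_derive_inv_fun (g0 x) (dg x).
split; first by move=> x; have [] := dV x.
rewrite (_ : derive1 (fun x => _) =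
    fun x => (-1) * (((g x)^-1 * (g x)^-1) * (derive1 g) x)); last first.
  apply/funext => x; rewrite (derive1_eq (dV x)) expr2 invfM; ring.
have cV := IHk cg.
by apply: CdiffM; [exact: Cdiff_cst|apply: CdiffM => //; exact: CdiffM].
Qed.

Lemma is_derive_affine f (a b x : R) : derivable f (a * x + b) 1 ->
  is_derive x 1 (fun y => f (a * y + b)) (a * (derive1 f) (a * x + b)).
Proof.
move=> df.
have da : is_derive x 1 (fun y : R => a * y + b) a.
  apply: is_derive_eq; by rewrite /GRing.scale/= ?mulr1 ?mulr0 ?addr0 ?add0r.
have df' : is_derive (a * x + b) 1 f ((derive1 f) (a * x + b)).
  by rewrite derive1E; exact: derivableP.
by have := @is_derive1_comp _ f (fun y : R => a * y + b) x _ _ df' da; rewrite /GRing.scale/= mulrC.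
Qed.

Lemma derive1_affine f (a b : R) : (forall x, derivable f x 1) ->
  derive1 (fun y => f (a * y + b)) = (fun x => a * (derive1 f) (a * x + b)).
Proof.
by move=> df; apply/funext => x; exact: (derive1_eq (is_derive_affine (df _))).
Qed.

Lemma Cdiff_affine k f (a b : R) : Cdiff k f -> Cdiff k (fun y => f (a * y + b)).
Proof.
elim: k f => [//|k IHk] f [df cf]; split.
  by move=> x; have [] := is_derive_affine (df (a * x + b)).
by rewrite derive1_affine//; apply: CdiffM; [exact: Cdiff_cst|exact: IHk].
Qed.

Lemma smooth_affine f (a b : R) : smooth f -> smooth (fun y => f (a * y + b)).
Proof. by move=> sf k; exact: Cdiff_affine. Qed.

(** The functions x^-n exp(-1/x), extended by zero. The derivative of each is a linear combination
    of two others ([is_derive_flat_exp]), so one induction proves the whole family smooth. *)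
Definition flat_exp (n : nat) (x : R) : R :=
  if 0 < x then x^-1 ^+ n * expR (- x^-1) else 0.

(** Raise y/(n+1) <= exp(y/(n+1)) to the power n+1. *)
Lemma pow_expN_le (n : nat) (y : R) : 0 <= y ->
  y ^+ n.+1 * expR (- y) <= n.+1%:R ^+ n.+1.
Proof.
move=> y0; rewrite expRN -/(_ / _) ler_pdivrMr ?expR_gt0//.
have n0 : 0 < n.+1%:R :> R by rewrite ltr0n.
have -> : expR y = expR (y / n.+1%:R) ^+ n.+1.
  by rewrite -expRM_natl mulrC divfK ?gt_eqF.
rewrite -exprMn lerXn2r// ?nnegrE ?mulr_ge0 ?expR_ge0//.
rewrite -ler_pdivrMl// mulrC (le_trans _ (expR_ge1Dx _))//.
by rewrite lerDr.
Qed.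

Lemma flat_exp_ge0 n x : 0 <= flat_exp n x.
Proof.
rewrite /flat_exp; case: ifP => // x0.
by rewrite mulr_ge0 ?expR_ge0// exprn_ge0// invr_ge0 ltW.
Qed.

Lemma flat_exp_le n x : flat_exp n x <= n.+1%:R ^+ n.+1 * `|x|.
Proof.
rewrite /flat_exp; case: ifP => x0; last by rewrite mulr_ge0// exprn_ge0.
rewrite gtr0_norm// -ler_pdivrMr// mulrAC -exprSr.
by apply: pow_expN_le; rewrite invr_ge0 ltW.
Qed.

Lemma is_derive_flat_exp (n : nat) (x : R) :
  is_derive x 1 (flat_exp n) (- n%:R * flat_exp n.+1 x + flat_exp n.+2 x).
Proof.
have [x0|x0|->] := ltgtP x 0.
- rewrite /flat_exp ltNge (ltW x0)/= mulr0 addr0.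
  apply: (@near_eq_is_derive _ _ _ (cst 0)).
  by near=> y; rewrite ltNge (ltW _)//; near: y; exact: lt_nbhsl.
- rewrite /flat_exp x0.
  apply: (@near_eq_is_derive _ _ _ (fun y : R => y^-1 ^+ n * expR (- y^-1))).
    by near=> y; rewrite ifT//; near: y; exact: lt_nbhsr.
  have x0' : x != 0 by rewrite gt_eqF.
  have dV : is_derive x 1 (fun y : R => y^-1) (- x ^- 2).
    by have := @is_deriveV R id x 1 1 x0' (is_derive_id _ _); rewrite /GRing.scale/= mulr1.
  have dN : is_derive x 1 (fun y : R => - y^-1) (x ^- 2).
    by rewrite -[x ^- 2]opprK; exact: is_deriveN.
  have dE := @is_derive1_comp _ expR (fun y : R => - y^-1) x _ _ (is_derive_expR (- x^-1)) dN.
  have dX := is_deriveX n dV.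
  have fE : (GRing.inv : R -> R) ^+ n = (fun y => y^-1 ^+ n).
    by apply/funext => y; rewrite exprfctE.
  rewrite fE in dX.
  have dM := @is_deriveM _ _ (fun y : R => y^-1 ^+ n) (fun y : R => expR (- y^-1)) _ _ _ _ dX dE.
  apply: (is_derive_eq dM) => {dM}.
  rewrite /GRing.scale/=; case: n {dX fE} => [|n]; rewrite /= ?mulr0n ?mul0r !exprS ?expr0.
    by field.
  by move: (n.+1%:R) => c; field.
(* At the origin the difference quotient of [flat_exp n] is [flat_exp n.+1 h], which is at most a
   multiple of |h|. *)
- suff : (h^-1 *: (flat_exp n (h + 0) - flat_exp n 0) @[h --> (0 : R)^'] --> (0 : R)).
    move=> h; have {}h : is_derive (0 : R) (1 : R) (flat_exp n) 0.
      have h' : (fun h => h^-1 *: ((flat_exp n \o shift 0) (h *: 1) - flat_exp n 0)) @ (0 : R)^' --> (0 : R).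
        by under eq_fun => y do rewrite /GRing.scale/= mulr1.
      apply: DeriveDef; first by apply/cvg_ex; exists 0.
      exact: cvg_lim h'.
    by rewrite /flat_exp ltxx mulr0 addr0.
  have h0 : flat_exp n 0 = 0 by rewrite /flat_exp ltxx.
  rewrite h0; apply/cvgrPdist_le => e e0; near=> h.
  rewrite addr0 subr0 sub0r normrN /GRing.scale/=.
  have -> : h^-1 * flat_exp n h = flat_exp n.+1 h.
    rewrite /flat_exp; case: ifP => _; last by rewrite mulr0.
    by rewrite exprS mulrA.
  rewrite ger0_norm ?flat_exp_ge0//; apply: le_trans (flat_exp_le _ _) _.
  rewrite -ler_pdivlMl ?exprn_gt0//.
  near: h; apply: nbhs_dnbhs.
  have c0 : 0 < n.+2%:R ^- n.+2 * e by rewrite mulr_gt0// invr_gt0 exprn_gt0.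
  apply/nbhs_ballP; exists (n.+2%:R ^- n.+2 * e) => //= y.
  by rewrite /ball/= sub0r normrN => /ltW.
Unshelve. all: by end_near. Qed.

Lemma smooth_flat_exp n : smooth (flat_exp n).
Proof.
move=> k; elim: k n => [//|k IHk] n; split.
  by move=> x; have [] := is_derive_flat_exp n x.
rewrite (_ : derive1 (flat_exp n) =
    fun x => (fun=> - n%:R) x * flat_exp n.+1 x + flat_exp n.+2 x); last first.
  by apply/funext => x; exact: (derive1_eq (is_derive_flat_exp n x)).
by apply: CdiffD => //; apply: CdiffM => //; exact: Cdiff_cst.
Qed.

Definition smooth_step (x : R) : R :=
  flat_exp 0 x * (flat_exp 0 x + flat_exp 0 ((-1) * x + 1))^-1.

Lemma flat_exp0_gt0 x : 0 < x -> 0 < flat_exp 0 x.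
Proof. by move=> x0; rewrite /flat_exp x0 mul1r expR_gt0. Qed.

Lemma flat_exp_le0 n x : x <= 0 -> flat_exp n x = 0.
Proof. by move=> x0; rewrite /flat_exp ltNge x0. Qed.

Lemma smooth_step_den x : 0 < flat_exp 0 x + flat_exp 0 ((-1) * x + 1).
Proof.
have [x0|x0] := ltP 0 x.
  by rewrite ltr_pwDl ?flat_exp0_gt0// flat_exp_ge0.
by rewrite ltr_wpDl ?flat_exp_ge0// flat_exp0_gt0//; lra.
Qed.

Lemma smooth_smooth_step : smooth smooth_step.
Proof.
move=> k; apply: CdiffM; first exact: smooth_flat_exp.
apply: CdiffV; first by move=> x; rewrite gt_eqF// smooth_step_den.
apply: CdiffD; first exact: smooth_flat_exp.
by apply: Cdiff_affine; exact: smooth_flat_exp.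
Qed.

Lemma smooth_step_ge0 x : 0 <= smooth_step x.
Proof. by rewrite mulr_ge0 ?flat_exp_ge0// invr_ge0 ltW// smooth_step_den. Qed.

Lemma smooth_step_le1 x : smooth_step x <= 1.
Proof.
by rewrite /smooth_step ler_pdivrMr ?smooth_step_den// mul1r lerDl flat_exp_ge0.
Qed.

Lemma smooth_step_le0 x : x <= 0 -> smooth_step x = 0.
Proof. by move=> x0; rewrite /smooth_step flat_exp_le0// mul0r. Qed.

Lemma smooth_step_ge1 x : 1 <= x -> smooth_step x = 1.
Proof.
move=> x1; rewrite /smooth_step (@flat_exp_le0 _ (-1 * x + 1)); last by lra.
by rewrite addr0 divff// gt_eqF// flat_exp0_gt0//; lra.
Qed.

Lemma derive1_ratio_ge0 (f g : R -> R) : (forall x, derivable f x 1) ->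
  (forall x, derivable g x 1) -> (forall x, 0 <= f x) -> (forall x, 0 <= g x) ->
  (forall x, 0 < f x + g x) ->
  (forall x, 0 <= derive1 f x) -> (forall x, derive1 g x <= 0) ->
  forall x, 0 <= derive1 (fun y => f y * (f y + g y)^-1) x.
Proof.
move=> df dg f0 g0 fg f'0 g'0 x.
pose h y := f y + g y.
have dh y : derivable h y 1 by exact: derivableD.
have hn y : h y != 0 by rewrite gt_eqF// /h.
have dV (y : R) := is_derive_inv_fun (hn y) (dh y).
have dV' y : derivable (fun z => (h z)^-1) y 1 by have [] := dV y.
have -> : (fun y => f y * (f y + g y)^-1) = (fun y => f y * (h y)^-1) by [].
rewrite (derive1M df dV') (derive1_eq (dV x)).
have -> : derive1 h x = derive1 f x + derive1 g x by rewrite (derive1D df dg).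
have := f'0 x; have := g'0 x; have := fg x; have := f0 x; have := g0 x; rewrite /h.
move: (f x) (g x) (derive1 f x) (derive1 g x) => a b a' b' b0 a0 ab b'0 a'0.
have -> : a' * (a + b)^-1 + a * (- (a + b) ^- 2 * (a' + b')) =
   (a' * b + a * - b') * ((a + b) ^- 2) by field; rewrite gt_eqF.
by rewrite mulr_ge0 ?invr_ge0 ?exprn_ge0 ?(ltW ab)// addr_ge0 ?mulr_ge0// oppr_ge0.
Qed.

(** Monotonicity makes the derivative of a rescaled step a nonnegative kernel of mass one, as
    averaging in [ramp_approx] requires. *)
Lemma derive_smooth_step_ge0 x : 0 <= derive1 smooth_step x.
Proof.
have d0 y : derivable (flat_exp 0) y 1 := smooth_derivable (smooth_flat_exp 0).
have e0 y : 0 <= derive1 (flat_exp 0) y.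
  by rewrite (derive1_eq (is_derive_flat_exp 0 y)) oppr0 mul0r add0r flat_exp_ge0.
have da y := is_derive_affine (d0 ((-1) * y + 1)).
have dg (y : R) : derivable (fun y : R => flat_exp 0 ((-1) * y + 1)) y 1 by have [] := da y.
have g'0 y : derive1 (fun y : R => flat_exp 0 ((-1) * y + 1)) y <= 0.
  by rewrite (derive1_eq (da y)) mulN1r oppr_le0.
have h := derive1_ratio_ge0 d0 dg (@flat_exp_ge0 0) (fun y => flat_exp_ge0 0 _) smooth_step_den e0 g'0.
exact: h.
Qed.

End Smooth.

(** * Lebesgue measure on row vectors *)

Section ImageMeasure.
Context d1 d2 (X : measurableType d1) (Y : measurableType d2) (R : realType).
Variables (mu : {measure set X -> \bar R}) (phi : X -> Y).
Hypothesis mphi : measurable_fun setT phi.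

Lemma image_measure_exists : exists nu : {measure set Y -> \bar R},
  forall A, nu A = mu (phi @^-1` A).
Proof.
unshelve (refine (ex_intro _ (pushforward mu phi : {measure set Y -> \bar R}) _)).
- exact: mphi.
- by [].
Qed.

Lemma ge0_integral_image (nu : {measure set Y -> \bar R}) (f : Y -> \bar R) :
  (forall A, measurable A -> nu A = mu (phi @^-1` A)) ->
  measurable_fun setT f -> (forall y, 0 <= f y)%E ->
  (\int[nu]_y f y = \int[mu]_x f (phi x))%E.
Proof.
move=> nuE mf f0.
have := @ge0_integral_pushforward _ _ _ _ R phi mphi mu setT f measurableT mf (fun y _ => f0 y).
rewrite preimage_setT => <-; apply: eq_measure_integral => A mA _; exact: nuE.
Qed.

Lemma integral_image (nu : {measure set Y -> \bar R}) (f : Y -> \bar R) :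
  (forall A, measurable A -> nu A = mu (phi @^-1` A)) ->
  measurable_fun setT f -> mu.-integrable setT (f \o phi) ->
  (\int[nu]_y f y = \int[mu]_x f (phi x))%E.
Proof.
move=> nuE mf fi.
have := @integral_pushforward _ _ _ _ _ _ mphi mu setT f mf fi measurableT.
rewrite preimage_setT => <-; apply: eq_measure_integral => A mA _; exact: nuE.
Qed.

End ImageMeasure.

Section Affine1.
Context (R : realType).
Local Notation RT := (measurableTypeR R).

Definition affine1 (s c x : R) : R := s * x + c.

Lemma measurable_affine1 (s c : R) : measurable_fun [set: RT] (affine1 s c : RT -> RT).
Proof.
have h : measurable_fun [set: R] (affine1 s c).
  by apply: measurable_funD => //; apply: measurable_funM.
exact: h.
Qed.

(** The image of Lebesgue measure under the affine map, multiplied by [s], has the right value on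
    every interval []a, b]]; uniqueness of Lebesgue measure then identifies the two. *)
Lemma ge0_integral_affine1 (s c : R) (f : RT -> \bar R) : 0 < s ->
  measurable_fun [set: RT] f -> (forall x, 0 <= f x)%E ->
  (\int[@lebesgue_measure R]_x f (s * x + c)%R =
   (s^-1)%:E * \int[@lebesgue_measure R]_x f x)%E.
Proof.
move=> s0 mf f0.
pose k : {nonneg R} := NngNum (ltW s0).
have mphi := measurable_affine1 s c.
have [nu nuE] := @image_measure_exists _ _ RT RT R (@lebesgue_measure R) _ mphi.
pose m := mscale k nu.
have mE : forall A, measurable A -> lebesgue_measure A = m A.
  apply: lebesgue_measure_unique => _ [[a b]] /= _ <-.
  rewrite /m /mscale /= nuE.
  have -> : affine1 s c @^-1` `]a, b] = `](a - c) / s, (b - c) / s]%classic.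
    apply/seteqP; split => x /=; rewrite !in_itv/= /affine1 ltr_pdivrMr// ler_pdivlMr//;
      by rewrite ltrBlDr lerBrDr mulrC.
  have hlt : ((a - c) / s < (b - c) / s) = (a < b).
    by rewrite ltr_pM2r ?invr_gt0// ltrD2r.
  rewrite [LHS]lebesgue_measure_itv [X in (_ * X)%E]lebesgue_measure_itv /= !lte_fin hlt.
  case: ifP => _; last by rewrite mule0.
  rewrite -!EFinB -EFinM; congr EFin; field; by rewrite gt_eqF.
have -> : (\int[@lebesgue_measure R]_x f x = \int[m]_x f x)%E.
  by apply: eq_measure_integral => A mA _; exact: mE.
have h' := @ge0_integral_image _ _ RT RT R (@lebesgue_measure R) _ mphi nu f (fun A _ => nuE A) mf f0.
rewrite /m ge0_integral_mscale// h'.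
by rewrite muleA -EFinM mulVf ?gt_eqF// mul1e.
Qed.

End Affine1.

Section LebesgueRow.
Context (R : realType).
Implicit Types n : nat.
Local Notation leb n := (lebesgue_rV R n).
Local Notation RT := (measurableTypeR R).

Lemma measurable_row_consT n :
  measurable_fun [set: RT * 'rV[R]_n] (@row_cons R n).
Proof. exact: measurable_row_cons. Qed.

Lemma integral_lebesgue_succ n (f : 'rV[R]_n.+1 -> \bar R) :
  measurable_fun setT f -> (forall x, 0 <= f x)%E ->
  (\int[leb n.+1]_x f x =
   \int[@lebesgue_measure R]_t \int[leb n]_y f (row_cons (t, y)))%E.
Proof.
move=> mf f0.
rewrite (ge0_integral_image (@measurable_row_consT n) (mu := (@lebesgue_measure R \x leb n)%E))//.
have mc : measurable_fun [set: RT * 'rV[R]_n] (f \o @row_cons R n).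
  exact: (measurableT_comp mf (@measurable_row_consT n)).
exact: (@fubini_tonelli1 _ _ RT _ R (@lebesgue_measure R) (leb n) (f \o @row_cons R n) mc (fun x => f0 _)).
Qed.

Lemma measurable_affine_rV n (s : R) (c : 'rV[R]_n) :
  measurable_fun setT (fun x : 'rV[R]_n => s *: x + c).
Proof.
apply: measurable_fun_rowP => i; under eq_fun do rewrite !mxE.
by apply: measurable_funD => //; apply: measurable_funM => //; exact: measurable_coord.
Qed.

Lemma row_consE0 n t (y : 'rV[R]_n) j : row_cons (t, y) ord0 (lshift n (j : 'I_1)) = t.
Proof.
by rewrite /row_cons (row_mxEl (t%:M : 'M[R]_1) y) mxE (ord1 j) eqxx mulr1n.
Qed.

Lemma row_consES n t (y : 'rV[R]_n) j : row_cons (t, y) ord0 (rshift 1 j) = y ord0 j.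
Proof. by rewrite /row_cons (row_mxEr (t%:M : 'M[R]_1) y). Qed.

Lemma row_unconsK n : cancel (@row_uncons R n) (@row_cons R n).
Proof.
move=> c; apply/rowP => i; case: (split_ordP (i : 'I_(1 + n))) => j ->.
  by rewrite /row_uncons row_consE0; congr (c _ _); apply: val_inj; rewrite /= (ord1 j).
by rewrite /row_uncons row_consES mxE; congr (c _ _); exact: val_inj.
Qed.

Lemma affine_row_cons n (s : R) (c : 'rV[R]_n.+1) t (y : 'rV[R]_n) :
  s *: row_cons (t, y) + c =
  row_cons (s * t + (row_uncons c).1, s *: y + (row_uncons c).2).
Proof.
rewrite -{1}(row_unconsK c); case: (row_uncons c) => c0 c' /=.
apply/rowP => i; rewrite mxE [X in X + _]mxE.
case: (split_ordP (i : 'I_(1 + n))) => j ->; first by rewrite !row_consE0.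
by rewrite !row_consES mxE [X in _ = X + _]mxE.
Qed.

(** Tonelli splits off the first coordinate, on which the map acts separately from the others
    ([affine_row_cons]); each coordinate contributes one factor s^-1. *)
Lemma ge0_integral_affine n (s : R) (c : 'rV[R]_n) (f : 'rV[R]_n -> \bar R) :
  0 < s -> measurable_fun setT f -> (forall x, 0 <= f x)%E ->
  (\int[leb n]_x f (s *: x + c)%R = (s^-1 ^+ n)%:E * \int[leb n]_x f x)%E.
Proof.
move=> s0; elim: n c f => [|n IHn] c f mf f0.
  rewrite expr0 mul1e; apply: eq_integral => x _; congr f.
  by apply/rowP => -[].
have mfr : measurable_fun [set: RT * 'rV[R]_n] (f \o @row_cons R n).
  exact: (measurableT_comp mf (@measurable_row_consT n)).
rewrite integral_lebesgue_succ//; last first.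
  by apply: measurableT_comp => //; exact: measurable_affine_rV.
rewrite integral_lebesgue_succ//.
pose G t := (\int[leb n]_y f (row_cons (t, y)))%E.
have mG : measurable_fun [set: RT] G.
  exact: (measurable_fun_fubini_tonelli_F (f \o @row_cons R n) mfr (fun=> f0 _)).
have G0 t : (0 <= G t)%E by apply: integral_ge0.
transitivity (\int[@lebesgue_measure R]_t ((s^-1 ^+ n)%:E * G (s * t + (row_uncons c).1)%R))%E.
  apply: eq_integral => t _; rewrite /G -(IHn (row_uncons c).2)//; last first.
    by apply: (measurable_fun_pair2 (s * t + (row_uncons c).1) mfr).
  by apply: eq_integral => y _; rewrite affine_row_cons.
have mGs : measurable_fun [set: RT] (fun t : RT => G (s * t + (row_uncons c).1)).
  by apply: (measurableT_comp mG); exact: measurable_affine1.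
have sn0 : 0 <= s^-1 ^+ n by rewrite exprn_ge0// invr_ge0 ltW.
rewrite (ge0_integralZl_EFin _ measurableT (fun t _ => G0 _) mGs sn0).
by rewrite (ge0_integral_affine1 _ s0 mG G0) muleA -EFinM exprSr.
Qed.

Lemma lebesgue_shift n (c : 'rV[R]_n) (A : set 'rV[R]_n) : measurable A ->
  leb n ((fun x => x + c) @^-1` A) = leb n A.
Proof.
move=> mA; have mi : measurable_fun setT (EFin \o \1_A : 'rV[R]_n -> \bar R).
  by apply/measurable_EFinP; exact: measurable_indic.
have mS : measurable ((fun x => x + c) @^-1` A).
  rewrite -[X in measurable X]setTI.
  by have := @measurable_affine_rV n 1 c measurableT _ mA; under eq_fun do rewrite scale1r.
have i0 (x : 'rV[R]_n) : (0 <= (\1_A x : R)%:E)%E by rewrite lee_fin.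
have := @ge0_integral_affine n 1 c _ ltr01 mi i0.
rewrite invr1 expr1n mul1e [RHS]integral_indic// setIT => <-.
rewrite -[in LHS](setIT (_ @^-1` _)) -integral_indic//.
by apply: eq_integral => x _; rewrite scale1r.
Qed.

Lemma integral_shift n (c : 'rV[R]_n) (f : 'rV[R]_n -> \bar R) :
  (leb n).-integrable setT f ->
  (leb n).-integrable setT (fun x => f (x + c)) /\
  (\int[leb n]_x f (x + c)%R = \int[leb n]_x f x)%E.
Proof.
move=> fi.
have mS : measurable_fun setT (fun x : 'rV[R]_n => x + c).
  by have := @measurable_affine_rV n 1 c; under eq_fun do rewrite scale1r.
have mf : measurable_fun setT f by exact: measurable_int fi.
have fic : (leb n).-integrable setT (fun x => f (x + c)).
  apply/integrableP; split; first exact: measurableT_comp.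
  have := @ge0_integral_affine n 1 c (fun x => `|f x|)%E ltr01.
  rewrite invr1 expr1n mul1e; under eq_integral do rewrite scale1r.
  move=> -> //; last exact: measurableT_comp.
  by have /integrableP[] := fi.
split => //.
by rewrite -(integral_image mS (fun A mA => esym (lebesgue_shift c mA))).
Qed.

(** Coordinate boxes play two roles: they form a generating family stable under intersection, and
    they are the supports of product cutoffs. *)
Definition obox n (a b : 'rV[R]_n) : set 'rV[R]_n :=
  [set x | forall i, a ord0 i < x ord0 i < b ord0 i].

Definition cbox n (a b : 'rV[R]_n) : set 'rV[R]_n :=
  [set x | forall i, a ord0 i <= x ord0 i <= b ord0 i].

Lemma obox_setI n (a b a' b' : 'rV[R]_n) : obox a b `&` obox a' b' =
  obox (\row_i Num.max (a ord0 i) (a' ord0 i)) (\row_i Num.min (b ord0 i) (b' ord0 i)).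
Proof.
apply/seteqP; split => x /=.
  by move=> [h h'] i; rewrite !mxE gt_max lt_min; have /andP[-> ->] := h i; have /andP[-> ->] := h' i.
move=> h; split => i; have := h i; rewrite !mxE gt_max lt_min;
  by move=> /andP[/andP[h1 h2] /andP[h3 h4]]; rewrite ?h1 ?h2 ?h3 ?h4.
Qed.

Lemma measurable_coord_set n (P : 'I_n -> set R) : (forall i, measurable (P i)) ->
  measurable [set x : 'rV[R]_n | forall i, P i (x ord0 i)].
Proof.
move=> mP.
have -> : [set x : 'rV[R]_n | forall i, P i (x ord0 i)] =
    \bigcap_(i in [set: 'I_n]) ((fun x : 'rV[R]_n => x ord0 i) @^-1` P i).
  by apply/seteqP; split => x /= h i; [move=> _; exact: h|exact: h].
apply: fin_bigcap_measurable; first exact: finite_finset.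
move=> i _; rewrite -[X in measurable X]setTI.
exact: measurable_coord.
Qed.

Lemma measurable_obox n (a b : 'rV[R]_n) : measurable (obox a b).
Proof.
have -> : obox a b = [set x : 'rV[R]_n | forall i, `]a ord0 i, b ord0 i[%classic (x ord0 i)].
  by apply/seteqP; split => x /= h i; have := h i; rewrite in_itv.
exact: (measurable_coord_set (fun i => measurable_itv `]a ord0 i, b ord0 i[)).
Qed.

Lemma ball_rVP n (x y : 'rV[R]_n) (e : R) : 0 < e ->
  ball x e y <-> forall i, `|x ord0 i - y ord0 i| < e.
Proof.
move=> e0; split=> [[_ h] i|h]; first exact: h.
by split => // i j; rewrite (ord1 i); exact: h.
Qed.

(** Boxes with rational centre and half-width 1/(j+1) are enumerated through [unpickle]; those whose
    closed box leaves [A] are replaced by the empty set. Every point of [A] lies in a retained box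
    by density of the rationals. *)
Lemma open_rV_boxes n (A : set 'rV[R]_n) : open A ->
  exists F : nat -> set 'rV[R]_n, A = \bigcup_k F k /\
    forall k, F k = set0 \/ exists a b, F k = obox a b /\ cbox a b `<=` A.
Proof.
move=> oA.
pose lo (p : 'rV[rat]_n * nat) : 'rV[R]_n := \row_i (ratr (p.1 ord0 i) - p.2.+1%:R^-1).
pose hi (p : 'rV[rat]_n * nat) : 'rV[R]_n := \row_i (ratr (p.1 ord0 i) + p.2.+1%:R^-1).
pose F k := if unpickle k is Some p then
  if asbool (cbox (lo p) (hi p) `<=` A) then obox (lo p) (hi p) else set0 else set0.
exists F; split; last first.
  move=> k; rewrite /F; case: unpickle => [p|]; last by left.
  case: asboolP => [h|_]; last by left.
  by right; exists (lo p), (hi p).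
apply/seteqP; split => x; last first.
  move=> [k _]; rewrite /F; case: unpickle => [p|//]; case: asboolP => // h hx.
  by apply: h => i; have /andP[h1 h2] := hx i; rewrite !ltW.
move=> Ax.
have /nbhs_ballP[e /= e0 eA] : nbhs x A by exact: open_nbhs_nbhs.
have [j hj] : exists j : nat, j.+1%:R^-1 <= e / 2.
  exists (Num.truncn (e / 2)^-1); rewrite -[leRHS]invrK lef_pV2 ?posrE ?invr_gt0 ?divr_gt0//.
  exact: ltW (truncnS_gt _).
have j0 : 0 < j.+1%:R^-1 :> R by rewrite invr_gt0.
have hq i : exists q : rat, `|x ord0 i - ratr q| < j.+1%:R^-1.
  have [|q] := @rat_in_itvoo R (x ord0 i - j.+1%:R^-1) (x ord0 i + j.+1%:R^-1).
    by move: (j.+1%:R^-1) j0 => r r0; lra.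
  rewrite in_itv/= => /andP[h1 h2]; exists q; rewrite ltr_norml.
  by move: (j.+1%:R^-1) h1 h2 => r h1 h2; lra.
have [q qx] := choice hq.
pose p : 'rV[rat]_n * nat := (\row_i q i, j).
exists (pickle p) => //; rewrite /F pickleK.
case: asboolP => [_ i|[]].
  rewrite !mxE/=; have := qx i; rewrite ?mxE ltr_norml.
  by move: (j.+1%:R^-1) => r /andP[h1 h2]; apply/andP; split; lra.
move=> y hy; apply: eA; apply/ball_rVP => // i.
have := hy i; rewrite !mxE/= ?mxE; have := qx i; rewrite ltr_norml => /andP[h1 h2] /andP[h3 h4].
move: (j.+1%:R^-1) hj h1 h2 h3 h4 => r hj h1 h2 h3 h4.
by rewrite ltr_norml; apply/andP; split; lra.
Qed.

Lemma open_measurable_rV n (A : set 'rV[R]_n) : open A -> measurable A.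
Proof.
move=> /open_rV_boxes[F [-> hF]]; apply: bigcupT_measurable => k.
by case: (hF k) => [->//|[a [b [-> _]]]]; exact: measurable_obox.
Qed.

Lemma lebesgue_cbox_finite n (M : R) :
  (leb n [set x : 'rV[R]_n | forall i, `|x ord0 i| <= M]%R < +oo)%E.
Proof.
have mI : measurable ([set t : R | `|t| <= M] : set RT).
  rewrite (_ : [set _ | _] = `[-M, M]%classic)//.
  by apply/seteqP; split => t /=; rewrite in_itv/= ler_norml.
elim: n => [|n IHn].
  by rewrite /= /dirac indicE; case: (_ \in _); rewrite ltry.
have mA k : measurable [set x : 'rV[R]_k | forall i, `|x ord0 i| <= M].
  exact: (@measurable_coord_set k (fun=> [set t | `|t| <= M])).
rewrite /= /lebesgue_succ /pushforward.
have -> : @row_cons R n @^-1` [set x | forall i, `|x ord0 i| <= M] =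
   [set t | `|t| <= M] `*` [set x : 'rV[R]_n | forall i, `|x ord0 i| <= M].
  apply/seteqP; split => -[t y] /=.
    move=> h; split.
      have := h (lshift n ord0 : 'I_(1 + n)).
      by rewrite /row_cons (row_mxEl (t%:M : 'M[R]_1) y) mxE eqxx mulr1n.
    move=> i; have := h (rshift 1 i : 'I_(1 + n)).
    by rewrite /row_cons (row_mxEr (t%:M : 'M[R]_1) y).
  move=> [ht hy] i; case: (split_ordP (i : 'I_(1 + n))) => j ->.
    by rewrite /row_cons (row_mxEl (t%:M : 'M[R]_1) y) mxE (ord1 j) eqxx mulr1n.
  by rewrite /row_cons (row_mxEr (t%:M : 'M[R]_1) y).
rewrite (product_measure1E _ _ mI (mA n)); apply: lte_mul_pinfty => //.
rewrite (_ : [set _ | _] = `[-M, M]%classic); last first.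
  by apply/seteqP; split => t /=; rewrite in_itv/= ler_norml.
have h : (@lebesgue_measure R) `[- M, M]%classic \is a fin_num.
  by rewrite lebesgue_measure_itv/=; case: ifP => // _; rewrite -EFinB.
exact: h.
Qed.

Lemma ler_coord_norm n (x : 'rV[R]_n) i : `|x ord0 i| <= `|x|.
Proof. by rewrite [leRHS]mx_normrE; exact: (le_bigmax _ _ (ord0, i)). Qed.

Lemma bounded_lebesgue_finite n (A : set 'rV[R]_n) : measurable A ->
  bounded_set A -> (leb n A < +oo)%E.
Proof.
move=> mA [M0 [_ hM]].
have h := hM (`|M0| + 1) ltac:(by rewrite (le_lt_trans (ler_norm _))// ltrDl).
apply: le_lt_trans (lebesgue_cbox_finite n (`|M0| + 1)).
apply: le_measure; rewrite ?inE//.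
  apply: (@measurable_coord_set n (fun=> [set t | `|t| <= `|M0| + 1])) => _.
  rewrite (_ : [set _ | _] = `[-(`|M0| + 1), (`|M0| + 1)]%classic)//.
  by apply/seteqP; split => t /=; rewrite in_itv/= ler_norml.
by move=> x Ax i; apply: le_trans (ler_coord_norm _ _) _; exact: h.
Qed.

End LebesgueRow.

(** * Weak derivatives in one variable *)

Section Convergence.
Context d (X : measurableType d) (R : realType).
Variables (mu : {measure set X -> \bar R}) (D : set X).
Hypothesis mD : measurable D.
Implicit Types f g h : X -> R.

Lemma Rint_indic (A : set X) f :
  \int[mu]_(x in D) (\1_A x * f x) = \int[mu]_(x in D `&` A) f x.
Proof.
rewrite Rintegral_mkcondr; apply: Rint_ext => x _.
rewrite /patch indicE; case: (x \in A); first by rewrite mul1r.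
by rewrite mul0r.
Qed.

Lemma L1_subset (A : set X) f : measurable A -> A `<=` D -> L1fun mu D f ->
  L1fun mu A f.
Proof. by move=> mA AD; apply: integrableS. Qed.

Lemma L1_indic (A : set X) f : measurable A -> L1fun mu D f ->
  L1fun mu D (fun x => \1_A x * f x).
Proof.
move=> mA fi; apply: (L1_le mD _ _ (L1_normr fi)).
  by apply: measurable_funM; [exact: measurable_indic|exact: L1_meas fi].
move=> x _; rewrite normrM indicE; case: (_ \in _); rewrite ?normr1 ?mul1r//.
by rewrite normr0 mul0r.
Qed.

Lemma Rint_dominated (f_ : nat -> X -> R) f g :
  (forall n, measurable_fun D (f_ n)) -> measurable_fun D f ->
  {ae mu, forall x, D x -> f_ n x @[n --> \oo] --> f x} ->
  L1fun mu D g -> (forall n x, D x -> `|f_ n x| <= g x) ->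
  \int[mu]_(x in D) f_ n x @[n --> \oo] --> \int[mu]_(x in D) f x.
Proof.
move=> mf_ mf fcv gi fg.
have [||||| fi _ h] := @dominated_convergence _ _ _ mu D mD
  (fun n x => (f_ n x)%:E) (fun x => (f x)%:E) (fun x => (g x)%:E).
- by move=> n; exact/measurable_EFinP.
- exact/measurable_EFinP.
- apply: filterS fcv => x /= + Dx => /(_ Dx) c.
  by apply: cvg_EFin => //; exact: nearW.
- exact: gi.
- by apply: nearW => x n Dx; rewrite lee_fin fg.
rewrite /Rintegral; apply: fine_cvg.
rewrite fineK; first exact: h.
exact: integrable_fin_num.
Qed.

End Convergence.

(** * Cutoffs of intervals and smoothed jumps *)

Section Bump.
Context (R : realType).
Local Notation RT := (measurableTypeR R).
Implicit Types (a b : R) (n : nat).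

(* Smooth cutoff supported in [a + 1/(n+1), b - 1/(n+1)]. *)
Definition bump a b n (x : R) : R :=
  smooth_step (n.+1%:R * x + (- n.+1%:R * a - 1)) *
  smooth_step (- n.+1%:R * x + (n.+1%:R * b - 1)).

Lemma smooth_bump a b n : smooth (bump a b n).
Proof. by apply: smoothM; apply: smooth_affine; exact: smooth_smooth_step. Qed.

Lemma bump_ge0 a b n x : 0 <= bump a b n x.
Proof. by rewrite mulr_ge0// smooth_step_ge0. Qed.

Lemma bump_le1 a b n x : bump a b n x <= 1.
Proof. by rewrite mulr_ile1// ?smooth_step_ge0// smooth_step_le1. Qed.

Lemma bump_neq0 a b n x : bump a b n x != 0 ->
  a + n.+1%:R^-1 <= x <= b - n.+1%:R^-1.
Proof.
have n0 : 0 < n.+1%:R :> R by rewrite ltr0n.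
have nn : n.+1%:R * n.+1%:R^-1 = 1 :> R by rewrite mulfV// gt_eqF.
apply: contraNT; rewrite negb_and -!ltNge => /orP[h|h]; rewrite /bump.
  rewrite (@smooth_step_le0 _ (_ + (- _ * a - 1))) ?mul0r//.
  move: h; rewrite -(ltr_pM2l n0) mulrDr nn => h; lra.
rewrite (@smooth_step_le0 _ (_ + (_ * b - 1))) ?mulr0//.
move: h; rewrite -(ltr_pM2l n0) mulrBr nn => h; lra.
Qed.

Lemma bump_eq0 a b n x : ~~ (a < x < b) -> bump a b n x = 0.
Proof.
move=> h; apply: contraNeq h => /bump_neq0 /andP[h1 h2].
have n0 : 0 < n.+1%:R^-1 :> R by rewrite invr_gt0.
by rewrite (lt_le_trans _ h1) ?ltrDl// (le_lt_trans h2)// ltrBlDr ltrDl.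
Qed.

Lemma near_natr_ge (c : R) : \forall n \near \oo, c <= n.+1%:R.
Proof.
exists (Num.truncn c) => // n /= hn.
by rewrite (le_trans (ltW (truncnS_gt _)))// ler_nat ltnS.
Qed.

Lemma bump_cvg a b x : bump a b n x @[n --> \oo] --> (\1_`]a, b[%classic x : R).
Proof.
have [/andP[ax xb]|h] := boolP (a < x < b).
  rewrite indicE mem_set; last by rewrite /= in_itv/= ax.
  apply: cvg_near_cst; near=> n.
  have h1 : 2 / (x - a) <= n.+1%:R by near: n; exact: near_natr_ge.
  have h2 : 2 / (b - x) <= n.+1%:R by near: n; exact: near_natr_ge.
  move: h1 h2; rewrite ler_pdivrMr ?subr_gt0// ler_pdivrMr ?subr_gt0// => h1 h2.
  rewrite /bump !smooth_step_ge1 ?mulr1//.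
    by move: h2; rewrite mulrBr => h2; lra.
  by move: h1; rewrite mulrBr => h1; lra.
rewrite indicE memNset; last by rewrite /= in_itv/=; exact/negP.
by apply: cvg_near_cst; apply: nearW => n; rewrite bump_eq0.
Unshelve. all: by end_near. Qed.

Lemma derive1_smooth_step_eq0 (x : R) : (x < 0) || (1 < x) ->
  derive1 (@smooth_step R) x = 0.
Proof.
move=> /orP[h|h]; rewrite derive1E.
  rewrite (@near_eq_derive _ _ _ _ (cst 0)) ?derive_cst//.
  by near=> y; rewrite smooth_step_le0// ltW//; near: y; exact: lt_nbhsl.
rewrite (@near_eq_derive _ _ _ _ (cst (1 : R))) ?derive_cst//.
by near=> y; rewrite smooth_step_ge1// ltW//; near: y; exact: lt_nbhsr.
Unshelve. all: by end_near. Qed.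

(** Rises from 0 to 1 between c + 1/(n+1) and c + 2/(n+1). The rise starts strictly to the right of
    [c], so that differences of ramps can have compact support in an open interval that starts at
    [c]. *)
Definition ramp (c : R) n (x : R) := smooth_step (n.+1%:R * x + (- n.+1%:R * c - 1)).

Lemma smooth_ramp c n : smooth (ramp c n).
Proof. by apply: smooth_affine; exact: smooth_smooth_step. Qed.

Lemma derive1_ramp c n x : derive1 (ramp c n) x =
  n.+1%:R * derive1 (@smooth_step R) (n.+1%:R * x + (- n.+1%:R * c - 1)).
Proof.
rewrite /ramp derive1_affine// => y.
by apply: smooth_derivable; exact: smooth_smooth_step.
Qed.

Lemma derive1_ramp_ge0 c n x : 0 <= derive1 (ramp c n) x.
Proof. by rewrite derive1_ramp mulr_ge0// derive_smooth_step_ge0. Qed.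

Lemma derive1_ramp_neq0 c n x : derive1 (ramp c n) x != 0 ->
  0 <= n.+1%:R * (x - c) - 1 <= 1.
Proof.
rewrite derive1_ramp => h; have {h}: ~~ ((n.+1%:R * x + (- n.+1%:R * c - 1) < 0) ||
    (1 < n.+1%:R * x + (- n.+1%:R * c - 1))).
  by apply: contra h => /derive1_smooth_step_eq0 ->; rewrite mulr0.
rewrite negb_or -!leNgt mulrBr => /andP[h1 h2]; apply/andP; split; lra.
Qed.

Lemma ramp_bnd c n x : 0 <= ramp c n x <= 1.
Proof. by rewrite smooth_step_ge0 smooth_step_le1. Qed.

Lemma ramp_eq0 c n x : n.+1%:R * (x - c) <= 1 -> ramp c n x = 0.
Proof. by rewrite mulrBr => h; apply: smooth_step_le0; lra. Qed.

Lemma ramp_eq1 c n x : 2 <= n.+1%:R * (x - c) -> ramp c n x = 1.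
Proof. by rewrite mulrBr => h; apply: smooth_step_ge1; lra. Qed.

End Bump.

Lemma dist_sub_le (R : realType) (A B a b e : R) : `|A - a| <= e / 2 -> `|B - b| <= e / 2 ->
  `|a - b - (A - B)| <= e.
Proof.
rewrite !ler_norml => /andP[u1 u2] /andP[v1 v2]; apply/andP; split; lra.
Qed.

Section WeakFTC.
Context (R : realType).
Local Notation RT := (measurableTypeR R).
Local Notation time := (@lebesgue_measure R).
Variable T : R.
Hypothesis T0 : 0 < T.

Definition cont_on (f : R -> R) := forall c, 0 <= c <= T -> forall e : R, 0 < e ->
  exists2 dl : R, 0 < dl & forall x, 0 <= x <= T -> `|x - c| < dl -> `|f x - f c| <= e.

Lemma cont_on_within f : cont_on f -> {within `[0, T], continuous f}.
Proof.
move=> cf; apply/subspace_continuousP => c /=; rewrite in_itv/= => c0T.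
apply/cvgrPdist_le => e e0; have [dl dl0 h] := cf c c0T e e0.
apply/nbhs_ballP; exists dl => //= x; rewrite /ball/= => xc.
by rewrite in_itv/= => x0T; rewrite distrC; apply: h => //; rewrite distrC.
Qed.

Lemma measurable_itvT (i : interval R) : measurable ([set` i] : set RT).
Proof. exact: measurable_itv. Qed.

Lemma cont_on_measurable f : cont_on f ->
  measurable_fun (`]0, T[%classic : set RT) (f : RT -> R).
Proof.
move=> /cont_on_within cf.
have h : measurable_fun (`]0, T[%classic : set R) f.
  apply: (@measurable_funS _ _ _ _ (`[0, T]%classic : set R)) => //.
    by move=> x /=; rewrite !in_itv/= => /andP[/ltW -> /ltW ->].
  exact: subspace_continuous_measurable_fun.
exact: h.
Qed.

Lemma cont_on_bounded f : cont_on f ->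
  exists2 M : R, 0 <= M & forall x, 0 <= x <= T -> `|f x| <= M.
Proof.
move=> cf.
have cn : cont_on (fun x => `|f x|).
  move=> c c0T e e0; have [dl dl0 h] := cf c c0T e e0; exists dl => // x x0T xc.
  by apply: le_trans (ler_dist_dist _ _) _; exact: h.
have [c c0T hc] := EVT_max (ltW T0) (cont_on_within cn).
exists `|f c| => // x x0T; apply: hc; by rewrite in_itv.
Qed.

Lemma time_finite : (time `]0%R, T[%classic < +oo)%E.
Proof.
rewrite lebesgue_measure_itv/=; case: ifP => _; last by rewrite ltry.
by rewrite -EFinB ltry.
Qed.

Lemma cont_on_L1 f : cont_on f -> L1fun time `]0, T[%classic f.
Proof.
move=> cf; have [M M0 hM] := cont_on_bounded cf.
apply: (@L1_bnd _ _ _ _ _ (measurable_itvT _) M); [exact: time_finite|exact: cont_on_measurable|].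
by move=> x /=; rewrite in_itv/= => /andP[/ltW h1 /ltW h2]; apply: hM; rewrite h1.
Qed.

Lemma continuous_cont_on f : continuous f -> cont_on f.
Proof.
move=> cf c _ e e0; have /cvgrPdist_le/(_ _ e0)/nbhs_ballP[dl /= dl0 h] := cf c.
by exists dl => // x _ xc; rewrite distrC; apply: h; rewrite /ball/= distrC.
Qed.

Lemma cont_onM f g : cont_on f -> cont_on g -> cont_on (fun x => f x * g x).
Proof.
move=> cf cg c c0T e e0.
have [M M0 hM] := cont_on_bounded cf; have [N N0 hN] := cont_on_bounded cg.
have MN0 : 0 < M + N + 1 by rewrite ltr_wpDl ?addr_ge0.
have e'0 : 0 < e / (M + N + 1) by rewrite divr_gt0.
have [d1 d10 h1] := cf c c0T _ e'0; have [d2 d20 h2] := cg c c0T _ e'0.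
exists (Num.min d1 d2); first by rewrite lt_min d10.
move=> x x0T; rewrite lt_min => /andP[x1 x2].
have -> : f x * g x - f c * g c = f x * (g x - g c) + (f x - f c) * g c by ring.
apply: le_trans (ler_normD _ _) _; rewrite !normrM.
apply: (@le_trans _ _ (M * (e / (M + N + 1)) + (e / (M + N + 1)) * N)).
  apply: lerD; apply: ler_pM => //; [exact: hM|exact: h2|exact: h1|exact: hN].
rewrite [X in _ + X]mulrC -mulrDl mulrA ler_pdivrMr// mulrC ler_wpM2l ?(ltW e0)//.
by rewrite lerDl.
Qed.

Lemma Rint_derive1 f : smooth f ->
  \int[time]_(x in `]0, T[) derive1 f x = f T - f 0.
Proof.
move=> sf; have cf' := smooth_continuous (smooth_derive1 sf).
have h : (\int[time]_(x in `[0%R, T]) (derive1 f x)%:E = (f T)%:E - (f 0)%:E)%E.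
  apply: (@continuous_FTC2 R (derive1 f) f 0 T T0) => //.
    by apply: continuous_subspaceT => x; exact: cf'.
  have cf := smooth_continuous sf.
  split; first by move=> x _; exact: smooth_derivable.
    by apply: cvg_at_right_filter; exact: cf.
  by apply: cvg_at_left_filter; exact: cf.
rewrite /Rintegral -[RHS]/(fine ((f T)%:E - (f 0)%:E)%E) -h; congr fine.
rewrite (@integral_itv_bndoo _ 0 T (fun x => (derive1 f x)%:E) true false)//.
apply/measurable_EFinP.
exact: (cont_on_measurable (continuous_cont_on cf')).
Qed.

(** The derivative of the ramp is a nonnegative kernel of mass one concentrated between c + 1/(n+1)
    and c + 2/(n+1), so the integral is an average of values of [f] within [e] of [L]. The two
    bounds on [c] place the whole rise inside [[0, T]]. *)
Lemma ramp_approx f c n (L e : R) : cont_on f -> 0 <= e ->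
  - 1 <= n.+1%:R * c -> 2 <= n.+1%:R * (T - c) ->
  (forall x, 0 < x < T -> 0 <= n.+1%:R * (x - c) - 1 <= 1 -> `|f x - L| <= e) ->
  `|\int[time]_(x in `]0, T[) (f x * derive1 (ramp c n) x) - L| <= e.
Proof.
move=> cf e0 hc hT hf; set r := derive1 (ramp c n).
have mI := measurable_itvT `]0, T[.
have cr : cont_on r.
  by apply: continuous_cont_on; apply: smooth_continuous; apply: smooth_derive1; exact: smooth_ramp.
have ir : \int[time]_(x in `]0, T[) r x = 1.
  rewrite Rint_derive1; last exact: smooth_ramp.
  rewrite ramp_eq1// ramp_eq0 ?subr0// sub0r mulrN; lra.
have Lr : L = \int[time]_(x in `]0, T[) (L * r x).
  by rewrite (RintZ mI L (cont_on_L1 cr)) ir mulr1.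
have fr := cont_on_L1 (cont_onM cf cr).
have Lri : L1fun time `]0, T[%classic (fun x => L * r x) := L1Z mI L (cont_on_L1 cr).
rewrite {1}Lr -(RintB mI fr Lri).
apply: le_trans (le_Rint_norm mI (L1B mI fr Lri)) _.
have -> : e = \int[time]_(x in `]0, T[) (e * r x).
  by rewrite (RintZ mI e (cont_on_L1 cr)) ir mulr1.
apply: (le_Rint mI (L1_normr (L1B mI fr Lri)) (L1Z mI e (cont_on_L1 cr))).
move=> x /=; rewrite in_itv/= => x0T.
rewrite -mulrBl normrM (ger0_norm (derive1_ramp_ge0 _ _ _)).
rewrite -/r; have [->|rx] := eqVneq (r x) 0; first by rewrite !mulr0.
by rewrite ler_wpM2r ?derive1_ramp_ge0// hf//; exact: derive1_ramp_neq0.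
Qed.

(** A trapezoid inside []a, b[]: the shift 3/(n+1) makes the second ramp rise from b - 2/(n+1) to b
    - 1/(n+1), so the descent ends strictly before [b]. *)
Lemma time_test_ramp (a b : R) n : 0 <= a -> b <= T -> 3 <= n.+1%:R * (b - a) ->
  time_test T (fun x => ramp a n x + (-1) * ramp (b - 3 / n.+1%:R) n x).
Proof.
move=> a0 bT hab.
have n0 : 0 < n.+1%:R :> R by rewrite ltr0n.
set z := fun x => _.
have sz : smooth z.
  apply: smoothD; first exact: smooth_ramp.
  by apply: smoothM; [exact: smooth_cst|exact: smooth_ramp].
have h3 x : n.+1%:R * (x - (b - 3 / n.+1%:R)) = n.+1%:R * (x - b) + 3 by field; rewrite gt_eqF.
have sub : [set t | z t != 0] `<=` `[a + n.+1%:R^-1, b - n.+1%:R^-1]%classic.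
  move=> x /=; rewrite in_itv/=; apply: contraNT; rewrite negb_and -!ltNge.
  have nn : n.+1%:R * n.+1%:R^-1 = 1 :> R by rewrite mulfV// gt_eqF.
  rewrite /z => /orP[]; rewrite -(ltr_pM2l n0) ?mulrDr ?mulrN nn => h.
    rewrite !ramp_eq0 ?mulr0 ?addr0 ?h3//; move: hab; rewrite !mulrBr => hab; lra.
  rewrite !ramp_eq1 ?h3; [by rewrite mulr1 subrr| |]; move: hab; rewrite !mulrBr => hab; lra.
have csub : closure [set t | z t != 0] `<=` `[a + n.+1%:R^-1, b - n.+1%:R^-1]%classic.
  rewrite [X in _ `<=` X](_ : _ = closure `[a + n.+1%:R^-1, b - n.+1%:R^-1]%classic); last first.
    by apply/closure_id; exact: itv_closed.
  exact: closure_subset.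
split; first by move=> k t; exact: smooth_derive1n.
  apply: (@subclosed_compact _ _ `[a + n.+1%:R^-1, b - n.+1%:R^-1]%classic) => //.
    exact: closed_closure.
  exact: segment_compact.
apply: subset_trans csub _ => x /=; rewrite !in_itv/= => /andP[h1 h2].
have n0' : 0 < n.+1%:R^-1 :> R by rewrite invr_gt0.
by move: (n.+1%:R^-1) n0' h1 h2 => r r0 h1 h2; apply/andP; split; lra.
Qed.

(** The trapezoids of [time_test_ramp] converge to the indicator of []a, b[], and their derivatives
    to the difference of the point masses at [a] and [b]. Continuity of [f] gives the second limit,
    domination by |k| the first. *)
Lemma weak_derivative_ftc f k : cont_on f -> L1fun time `]0, T[%classic k ->
  (forall z, time_test T z ->
    \int[time]_(t in `]0, T[) (f t * derive1 z t) =
    - \int[time]_(t in `]0, T[) (k t * z t)) ->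
  forall a b, 0 <= a -> a < b -> b <= T ->
    f b - f a = \int[time]_(t in `]a, b[) k t.
Proof.
move=> cf ki weak a b a0 ab bT.
have mI := measurable_itvT `]0, T[.
pose z n x := ramp a n x + (-1) * ramp (b - 3 / n.+1%:R) n x.
have a0T : 0 <= a <= T by rewrite a0 (le_trans (ltW ab)).
have b0T : 0 <= b <= T by rewrite bT (le_trans a0 (ltW ab)).
have zE n x : derive1 (z n) x = derive1 (ramp a n) x - derive1 (ramp (b - 3 / n.+1%:R) n) x.
  have dr (c y : R) : derivable (ramp c n) y 1 := smooth_derivable (smooth_ramp c n).
  have dc (y : R) : derivable (fun=> -1 : R) y 1 by exact: derivable_cst.
  have dm (y : R) : derivable (fun x => (-1) * ramp (b - 3 / n.+1%:R) n x) y 1.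
    by apply: smooth_derivable; apply: smoothM; [exact: smooth_cst|exact: smooth_ramp].
  rewrite /z (derive1D (dr a) dm) (derive1M dc (dr _)) derive1_cst_fun.
  by rewrite mul0r add0r mulN1r.
have h3 n x : n.+1%:R * (x - (b - 3 / n.+1%:R)) = n.+1%:R * (x - b) + 3 :> R.
  by field; rewrite gt_eqF// ltr0n.
have cv1 : \int[time]_(t in `]0, T[) (f t * derive1 (z n) t) @[n --> \oo] --> f a - f b.
  apply/cvgrPdist_le => e e0.
  have e2 : 0 < e / 2 by rewrite divr_gt0.
  have [d1 d10 hd1] := cf a a0T _ e2; have [d2 d20 hd2] := cf b b0T _ e2.
  near=> n.
  have n0 : 0 < n.+1%:R :> R by rewrite ltr0n.
  have N1 : 3 / d1 <= n.+1%:R by near: n; exact: near_natr_ge.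
  have N2 : 3 / d2 <= n.+1%:R by near: n; exact: near_natr_ge.
  have N3 : 3 / (b - a) <= n.+1%:R by near: n; exact: near_natr_ge.
  rewrite ler_pdivrMr// in N1; rewrite ler_pdivrMr// in N2; rewrite ler_pdivrMr ?subr_gt0// in N3.
  have n1 : 1 <= n.+1%:R :> R by rewrite ler1n.
  have na : 0 <= n.+1%:R * a by rewrite mulr_ge0// ltW.
  have nbT : n.+1%:R * b <= n.+1%:R * T by rewrite ler_pM2l.
  rewrite mulrBr in N3.
  have r1 := @ramp_approx f a n (f a) (e / 2) cf (ltW e2).
  have r2 := @ramp_approx f (b - 3 / n.+1%:R) n (f b) (e / 2) cf (ltW e2).
  have cr c : cont_on (derive1 (ramp c n)).
    by apply: continuous_cont_on; apply: smooth_continuous; apply: smooth_derive1; exact: smooth_ramp.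
  have -> : \int[time]_(t in `]0, T[) (f t * derive1 (z n) t) =
     \int[time]_(t in `]0, T[) (f t * derive1 (ramp a n) t) -
     \int[time]_(t in `]0, T[) (f t * derive1 (ramp (b - 3 / n.+1%:R) n) t).
    rewrite -(RintB mI (cont_on_L1 (cont_onM cf (cr _))) (cont_on_L1 (cont_onM cf (cr _)))).
    by apply: Rint_ext => x _; rewrite zE mulrBr.
  have {}r1 := r1 (le_trans (lerN10 R) na) ltac:(rewrite mulrBr; clear -N3 nbT; lra).
  have {}r2 := r2 ltac:(rewrite mulrBr mulrCA divff ?gt_eqF//; clear -N3 na; lra)
    ltac:(rewrite h3 mulrBr; clear -nbT; lra).
  have {}r1 : `|\int[time]_(t in `]0, T[) (f t * derive1 (ramp a n) t) - f a| <= e / 2.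
    apply: r1 => x /andP[x0 xT] /andP[u1 u2]; apply: hd1; first by rewrite !ltW.
    rewrite -(ltr_pM2l n0) -{1}(gtr0_norm n0) -normrM; clear -u1 u2 N1.
    by rewrite ger0_norm; lra.
  have {}r2 : `|\int[time]_(t in `]0, T[) (f t * derive1 (ramp (b - 3 / n.+1%:R) n) t) - f b| <= e / 2.
    apply: r2 => x /andP[x0 xT]; rewrite h3 => /andP[u1 u2]; apply: hd2; first by rewrite !ltW.
    rewrite -(ltr_pM2l n0) -{1}(gtr0_norm n0) -normrM; clear -u1 u2 N2.
    by rewrite ler0_norm; lra.
  exact: dist_sub_le r1 r2.
have cv2 : \int[time]_(t in `]0, T[) (k t * z n t) @[n --> \oo] -->
    \int[time]_(t in `]0, T[) (\1_`]a, b[%classic t * k t).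
  have mz n : measurable_fun (`]0, T[%classic : set RT) (z n : RT -> R).
    apply: cont_on_measurable; apply: continuous_cont_on; apply: smooth_continuous.
    apply: smoothD; first exact: smooth_ramp.
    by apply: smoothM; [exact: smooth_cst|exact: smooth_ramp].
  have mk := L1_meas ki.
  apply: (@Rint_dominated _ _ _ _ _ mI _ _ (fun x => `|k x|)).
  - by move=> n; exact: measurable_funM.
  - by apply: measurable_funM => //; apply: measurable_indic; exact: measurable_itvT.
  - apply: nearW => x _; rewrite [X in _ --> X]mulrC; apply: cvgMr.
    apply: cvg_near_cst; near=> n.
    have n0 : 0 < n.+1%:R :> R by rewrite ltr0n.
    have N3 : 3 / (b - a) <= n.+1%:R by near: n; exact: near_natr_ge.
    rewrite ler_pdivrMr ?subr_gt0// mulrBr in N3.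
    have [xa|ax] := leP x a.
      have nxa : n.+1%:R * x <= n.+1%:R * a by rewrite ler_pM2l.
      rewrite /z !ramp_eq0 ?h3 ?mulrBr; [|lra|lra].
      rewrite mulr0 addr0 indicE memNset//=; rewrite in_itv/= ltNge xa; by [].
    have [bx|xb] := leP b x.
      have nxb : n.+1%:R * b <= n.+1%:R * x by rewrite ler_pM2l.
      rewrite /z !ramp_eq1 ?h3 ?mulrBr; [|lra|lra].
      rewrite mulr1 subrr indicE memNset//=; rewrite in_itv/= [x < b]ltNge bx andbF; by [].
    have N4 : 2 / (x - a) <= n.+1%:R by near: n; exact: near_natr_ge.
    have N5 : 2 / (b - x) <= n.+1%:R by near: n; exact: near_natr_ge.
    rewrite ler_pdivrMr ?subr_gt0// mulrBr in N4; rewrite ler_pdivrMr ?subr_gt0// mulrBr in N5.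
    rewrite /z ramp_eq1 ?ramp_eq0 ?h3 ?mulrBr; [|lra|lra].
    by rewrite mulr0 addr0 indicE mem_set//= in_itv/= ax xb.
  - exact: L1_normr.
  - move=> n x _; rewrite normrM ler_piMr//.
    have /andP[u1 u2] := ramp_bnd a n x; have /andP[v1 v2] := ramp_bnd (b - 3 / n.+1%:R) n x.
    by rewrite /z ler_norml; apply/andP; split; lra.
have -> : \int[time]_(t in `]a, b[) k t = \int[time]_(t in `]0, T[) (\1_`]a, b[%classic t * k t).
  rewrite Rint_indic (_ : _ `&` _ = `]a, b[%classic)//.
  apply/seteqP; split => x /=; rewrite !in_itv/=; first by move=> [].
  move=> /andP[u v]; split; last by rewrite u.
  by rewrite (le_lt_trans a0 u) (lt_le_trans v bT).
have cv3 : (- (\int[time]_(t in `]0, T[) (k t * z n t)))%R @[n --> \oo] --> f a - f b.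
  apply: cvg_trans cv1; apply: near_eq_cvg; near=> n; apply: weak.
  apply: time_test_ramp => //; rewrite -ler_pdivrMr ?subr_gt0//.
  by near: n; exact: near_natr_ge.
have := cvg_unique _ cv3 (cvgN cv2) => /(_ (@Rhausdorff R)) h.
by rewrite -[RHS]opprK -h opprB.
Unshelve. all: by end_near. Qed.

End WeakFTC.

(** * Test functions and Sobolev functions *)

Section ProductTest.
Context (R : realType).
Local Notation leb n := (lebesgue_rV R n).

(** Tensor products are a class of functions of several variables closed under partial derivatives:
    a derivative only replaces one factor ([upd]). Smoothness in all variables thus reduces to one
    variable. *)
Definition prodf n (g : 'I_n -> R -> R) (x : 'rV[R]_n) : R :=
  \prod_(i < n) g i (x ord0 i).

Definition upd n (g : 'I_n -> R -> R) i h : 'I_n -> R -> R :=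
  fun j => if j == i then h else g j.

Lemma prodf_upd n (g : 'I_n -> R -> R) i h x :
  prodf (upd g i h) x = h (x ord0 i) * \prod_(j < n | j != i) g j (x ord0 j).
Proof.
rewrite /prodf (bigD1 i)//= /upd eqxx; congr (_ * _).
by apply: eq_bigr => j /negPf ->.
Qed.

Lemma prodf_split n (g : 'I_n -> R -> R) i x :
  prodf g x = g i (x ord0 i) * \prod_(j < n | j != i) g j (x ord0 j).
Proof. by rewrite /prodf (bigD1 i). Qed.

Lemma is_derive_prodf n (g : 'I_n -> R -> R) i (x : 'rV[R]_n) :
  derivable (g i) (x ord0 i) 1 ->
  is_derive x (unitv R i) (prodf g) (prodf (upd g i (derive1 (g i))) x).
Proof.
move=> dg; pose c := \prod_(j < n | j != i) g j (x ord0 j).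
have E : (fun h : R => h^-1 *: ((prodf g \o shift x) (h *: unitv R i) - prodf g x)) =
    (fun h : R => (h^-1 *: ((g i \o shift (x ord0 i)) (h *: 1) - g i (x ord0 i))) * c).
  apply/funext => h; rewrite /= !(prodf_split _ i) /GRing.scale/= mulr1 -mulrA mulrBl.
  congr (_ * (_ * _ - _)).
    by rewrite !mxE !eqxx /GRing.scale/= mulr1.
  apply: eq_bigr => j ji; congr (g j _).
  by rewrite !mxE eqxx /= (negPf ji) mulr0 add0r.
have cv : h^-1 *: ((prodf g \o shift x) (h *: unitv R i) - prodf g x) @[h --> 0^'] -->
    prodf (upd g i (derive1 (g i))) x.
  rewrite E prodf_upd; apply: cvgMr_tmp.
  by rewrite derive1E; exact: dg.
apply: DeriveDef; first by apply/cvg_ex; exists (prodf (upd g i (derive1 (g i))) x).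
exact: cvg_lim cv.
Qed.

Lemma continuous_prodf n (g : 'I_n -> R -> R) : (forall i, continuous (g i)) ->
  continuous (prodf g).
Proof.
move=> cg; rewrite (_ : prodf g = \prod_(i < n) (fun x : 'rV[R]_n => g i (x ord0 i))); last first.
  by apply/funext => x; rewrite /prodf fct_prodE.
apply: (@big_ind ('rV[R]_n -> R) (fun f => continuous f)) => [|f h cf ch|i _].
- by rewrite (_ : 1 = cst 1)//; exact: cst_continuous.
- by move=> x; exact: (cvgM (cf x) (ch x)).
- by move=> x; apply: continuous_comp; [exact: coord_continuous|exact: cg].
Qed.

Lemma Ck_prodf k n (g : 'I_n -> R -> R) : (forall i, smooth (g i)) -> Ck k (prodf g).
Proof.
elim: k g => [|k IHk] g sg /=.
  by apply: continuous_prodf => i; exact: smooth_continuous.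
split; first by apply: continuous_prodf => i; exact: smooth_continuous.
move=> i; have di x := @is_derive_prodf n g i x (smooth_derivable (sg i)).
split; first by move=> x; have [] := di x.
rewrite (_ : (fun x => 'D_(unitv R i) (prodf g) x) = prodf (upd g i (derive1 (g i)))).
  apply: IHk => j; rewrite /upd; case: eqP => _ //.
  exact: smooth_derive1.
by apply/funext => x; have [] := di x.
Qed.

Definition box_bump n (a b : 'rV[R]_n) k : 'rV[R]_n -> R :=
  prodf (fun i => bump (a ord0 i) (b ord0 i) k).

Lemma box_bump_ge0 n (a b : 'rV[R]_n) k x : 0 <= box_bump a b k x.
Proof. by apply: prodr_ge0 => i _; exact: bump_ge0. Qed.

Lemma box_bump_le1 n (a b : 'rV[R]_n) k x : box_bump a b k x <= 1.
Proof. by apply: prodr_ile1 => i _; rewrite bump_ge0 bump_le1. Qed.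

Lemma box_bump_support n (a b : 'rV[R]_n) k x : box_bump a b k x != 0 ->
  forall i, a ord0 i + k.+1%:R^-1 <= x ord0 i <= b ord0 i - k.+1%:R^-1.
Proof. by move=> /prodf_neq0 h i; apply: bump_neq0; exact: h. Qed.

Lemma closed_cbox n (a b : 'rV[R]_n) : closed (cbox a b).
Proof.
have -> : cbox a b = \bigcap_(i in [set: 'I_n])
    ((fun x : 'rV[R]_n => x ord0 i) @^-1` `[a ord0 i, b ord0 i]%classic).
  by apply/seteqP; split => x /= h i; [move=> _|]; have := h i; rewrite /= in_itv/=; [|apply].
apply: closed_bigI => i _; apply: closed_comp; last exact: itv_closed.
by move=> x _; exact: coord_continuous.
Qed.

Lemma normr_rV_le n (x : 'rV[R]_n) (M : R) : 0 <= M ->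
  (forall i, `|x ord0 i| <= M) -> `|x| <= M.
Proof.
move=> M0 h; rewrite [leLHS]mx_normrE; apply: bigmax_le => // -[i j] _ /=.
by rewrite (ord1 i).
Qed.

Lemma compact_cbox n (a b : 'rV[R]_n) : compact (cbox a b).
Proof.
apply: bounded_closed_compact; last exact: closed_cbox.
exists (`|a| + `|b|); split; first exact: num_real.
move=> M hM x hx; apply: le_trans (ltW hM).
apply: normr_rV_le => [|i]; first by rewrite addr_ge0.
have /andP[h1 h2] := hx i.
have := ler_coord_norm a i; have := ler_coord_norm b i.
rewrite !ler_norml => /andP[h3 h4] /andP[h5 h6]; apply/andP; split.
  by apply: le_trans h1; rewrite opprD; apply: le_trans h5; rewrite gerDl oppr_le0.
by apply: le_trans h2 (le_trans h4 _); rewrite lerDr.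
Qed.

Lemma test_function_prodf n (A : set 'rV[R]_n) (g : 'I_n -> R -> R) (a b : 'rV[R]_n) :
  (forall i, smooth (g i)) -> (forall x, prodf g x != 0 -> cbox a b x) ->
  cbox a b `<=` A -> test_function A (prodf g).
Proof.
move=> sg hg abA.
have csub : closure [set x | prodf g x != 0] `<=` cbox a b.
  rewrite [X in _ `<=` X](_ : _ = closure (cbox a b)); last first.
    by apply/closure_id; exact: closed_cbox.
  exact: closure_subset.
split; first by move=> k; exact: Ck_prodf.
  apply: (subclosed_compact _ (@compact_cbox _ a b)) => //; exact: closed_closure.
exact: subset_trans csub abA.
Qed.

Lemma box_bump_cbox n (a b : 'rV[R]_n) k :
  let a' := \row_i (a ord0 i + k.+1%:R^-1) in
  let b' := \row_i (b ord0 i - k.+1%:R^-1) in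
  (forall x, box_bump a b k x != 0 -> cbox a' b' x) /\ cbox a' b' `<=` obox a b.
Proof.
move=> a' b'; split=> [x /box_bump_support h i|x h i].
  by rewrite !mxE; exact: h.
have := h i; rewrite !mxE => /andP[h1 h2].
have k0 : 0 < k.+1%:R^-1 :> R by rewrite invr_gt0.
by rewrite (lt_le_trans _ h1) ?ltrDl// (le_lt_trans h2)// ltrBlDr ltrDl.
Qed.

Lemma box_bump_cvg n (a b : 'rV[R]_n) x :
  box_bump a b k x @[k --> \oo] --> (\1_(obox a b) x : R).
Proof.
have -> : (\1_(obox a b) x : R) = \prod_(i < n) \1_`]a ord0 i, b ord0 i[%classic (x ord0 i).
  rewrite indicE; have [h|h] := pselect (obox a b x); rewrite ?(mem_set h) ?(memNset h).
    rewrite big1// => i _; rewrite indicE mem_set//=.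
    by rewrite in_itv/=; exact: h.
  move: h => /existsNP[i hi]; by rewrite (bigD1 i)//= indicE memNset ?mul0r//=.
rewrite /box_bump /prodf.
elim: n a b x => [|n IHn] a b x.
  by under eq_fun do rewrite big_ord0; rewrite big_ord0; exact: cvg_cst.
under eq_fun do rewrite big_ord_recl; rewrite big_ord_recl.
apply: cvgM; first exact: bump_cvg.
have := IHn (\row_i a ord0 (lift ord0 i)) (\row_i b ord0 (lift ord0 i)) (\row_i x ord0 (lift ord0 i)).
under eq_fun do under eq_bigr do rewrite !mxE.
by under eq_bigr do rewrite !mxE.
Qed.

Lemma measurable_prodf n (g : 'I_n -> R -> R) : (forall i, continuous (g i)) ->
  measurable_fun setT (prodf g).
Proof.
move=> cg; apply: measurable_prod => i _.
apply: measurableT_comp; last exact: measurable_coord.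
exact: continuous_measurable_fun.
Qed.

Definition oboxes n : set (set 'rV[R]_n) := [set A | exists a b, A = obox a b].

(** A half-space y_i < x is a countable union of open boxes, so the boxes generate the coordinate
    sigma-algebra. Together with [obox_setI_closed] this makes them a pi-system for
    [dynkin_induction]. *)
Lemma measurable_rV_oboxes n : @measurable _ 'rV[R]_n = <<s @oboxes n >>.
Proof.
apply/seteqP; split; last first.
  apply: smallest_sub; first exact: sigma_algebra_measurable.
  by move=> _ [a [b ->]]; exact: measurable_obox.
apply: smallest_sub; first exact: smallest_sigma_algebra.
apply: (@big_ind (set (set 'rV[R]_n)) (fun S => S `<=` <<s @oboxes n >>)) => [|A B hA hB|i _].
- by move=> A [].
- by move=> C [/hA|/hB].
have mc : @measurable_fun _ _ (g_sigma_algebraType (@oboxes n)) (measurableTypeR R)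
    setT (fun x : 'rV[R]_n => x ord0 i).
  apply: (@measurability _ _ _ _ _ _ (@RGenCInfty.G R)).
    exact: RGenCInfty.measurableE.
  move=> _ [_ [x ->] <-]; rewrite setTI.
  pose a N : 'rV[R]_n := \row_j - N%:R.
  pose b N : 'rV[R]_n := \row_j (if j == i then Num.min x N%:R else N%:R).
  rewrite (_ : _ @^-1` _ = ~` \bigcup_N obox (a N) (b N)).
    apply: measurableC; apply: bigcupT_measurable => N.
    by apply: sub_sigma_algebra; exists (a N), (b N).
  apply/seteqP; split => y /=; rewrite in_itv/= andbT.
    move=> xy [N _ /(_ i)]; rewrite !mxE eqxx lt_min => /andP[_ /andP[]].
    by rewrite ltNge xy.
  move=> h; rewrite leNgt; apply/negP => yx; apply: h.
  exists (Num.truncn `|y|).+1 => // j; rewrite !mxE.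
  have hy : `|y ord0 j| < (Num.truncn `|y|).+1%:R.
    by apply: le_lt_trans (ler_coord_norm _ _) _; exact: truncnS_gt.
  move: hy; rewrite ltr_norml => /andP[-> hy]/=.
  by have [ji|//] := eqVneq j i; rewrite lt_min hy andbT ji.
move=> _ [B mB <-].
exact: (mc measurableT B mB).
Qed.

Lemma obox_setI_closed n : setI_closed (@oboxes n).
Proof. by move=> _ _ [a [b ->]] [a' [b' ->]]; rewrite obox_setI; eexists; eexists. Qed.

Lemma measurable_box_bump n (a b : 'rV[R]_n) k (D : set 'rV[R]_n) :
  measurable_fun D (box_bump a b k).
Proof.
apply: measurable_funTS; apply: measurable_prodf => i.
by apply: smooth_continuous; exact: smooth_bump.
Qed.

(** Box bumps tend to the indicator of the box, so [f] has zero integral over every box in [Om].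
    Dynkin's theorem extends this to all measurable subsets of a box, where [f] must then vanish,
    and countably many boxes cover [Om]. *)
Lemma du_bois_reymond n (Om : set 'rV[R]_n) (f : 'rV[R]_n -> R) :
  open Om -> L1fun (leb n) Om f ->
  (forall a b k, obox a b `<=` Om -> \int[leb n]_(x in Om) (f x * box_bump a b k x) = 0) ->
  {ae leb n, forall x, Om x -> f x = 0}.
Proof.
move=> oO fi hf.
have mO := open_measurable_rV oO.
have box0 a b : obox a b `<=` Om -> \int[leb n]_(x in obox a b) f x = 0.
  move=> abO.
  have cv : \int[leb n]_(x in Om) (f x * box_bump a b k x) @[k --> \oo] -->
      \int[leb n]_(x in Om) (\1_(obox a b) x * f x).
    have mf := L1_meas fi.
    apply: (@Rint_dominated _ _ _ _ _ mO _ _ (fun x => `|f x|)).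
    - by move=> k; apply: measurable_funM => //; exact: measurable_box_bump.
    - by apply: measurable_funM => //; apply: measurable_indic; exact: measurable_obox.
    - apply: nearW => x _; rewrite [X in _ --> X]mulrC; apply: cvgMr.
      exact: box_bump_cvg.
    - exact: L1_normr.
    - move=> k x _; rewrite normrM ler_piMr// ger0_norm ?box_bump_ge0//.
      exact: box_bump_le1.
  have c0 : \int[leb n]_(x in Om) (f x * box_bump a b k x) @[k --> \oo] --> (0 : R).
    by under eq_fun do rewrite hf//; exact: cvg_cst.
  have <- := cvg_unique (@Rhausdorff R) cv c0.
  by rewrite Rint_indic setIC (setIidl abO).
have boxae a b : cbox a b `<=` Om -> {ae leb n, forall x, obox a b x -> f x = 0}.
  move=> abO; set B := obox a b.
  have BO : B `<=` Om.
    by move=> x hx; apply: abO => i; have /andP[h1 h2] := hx i; rewrite !ltW.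
  have mB : measurable B by exact: measurable_obox.
  have fB : L1fun (leb n) B f by exact: L1_subset fi.
  have fS S : measurable S -> L1fun (leb n) (S `&` B) f.
    by move=> mS; apply: (L1_subset mB) fB => //; exact: measurableI.
  pose P (S : set 'rV[R]_n) := (\int[leb n]_(x in S `&` B) (f x)%:E)%E = 0%E.
  have hP S : measurable S -> P S.
    rewrite [in X in X -> _]measurable_rV_oboxes.
    apply: (dynkin_induction (@measurable_rV_oboxes n) (@obox_setI_closed n)).
    - by rewrite /P setTI (L1_EFin mB fB) box0.
    - move=> _ [a' [b' ->]]; rewrite /P (L1_EFin _ (fS _ _)); [|apply: measurableI => //; exact: measurable_obox|exact: measurable_obox].
      by rewrite obox_setI box0// -obox_setI => x [_] /BO.
    - move=> S' mS' PS'; rewrite /P.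
      have mSB := measurableI _ _ mS' mB.
      have mCB := measurableI _ _ (measurableC mS') mB.
      have U : (S' `&` B) `|` (~` S' `&` B) = B by rewrite -setIUl setUv setTI.
      have fU : L1fun (leb n) ((S' `&` B) `|` (~` S' `&` B)) f by rewrite U.
      have dis : [disjoint S' `&` B & ~` S' `&` B].
        by apply/disj_setPS => x [[Sx _] [nSx _]].
      have := Rintegral_setU mSB mCB fU dis; rewrite U box0//.
      rewrite (L1_EFin mCB (fS _ (measurableC mS'))).
      have : \int[leb n]_(x in S' `&` B) f x = 0 by rewrite /Rintegral PS'.
      by move=> -> /esym; rewrite add0r => ->.
    - move=> F mF tF PF; rewrite /P setI_bigcupl integral_bigcup.
      + by rewrite eseries0// => k _ _; exact: PF.
      + exact: trivIset_setIr.
      + by move=> k; exact: measurableI.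
      + rewrite -setI_bigcupl; apply: fS; exact: bigcupT_measurable.
  have := @integral_ae_eq _ _ _ (leb n) B mB (cst 0%E) (EFin \o f) fB.
  move=> /(_ (measurable_cst _)) [E EB mE|Z [mZ Z0 sZ]].
    rewrite integral0; have := hP E mE; rewrite /P.
    by rewrite (setIidl EB).
  by exists Z; split => //; apply: subset_trans sZ => x /= + h; apply => Bx; have [] := h Bx.
have [F [OF hF]] := open_rV_boxes oO.
have Fae k : {ae leb n, forall x, F k x -> f x = 0}.
  case: (hF k) => [->|[a [b [-> abO]]]]; last exact: boxae.
  by apply: nearW => x [].
have := ae_foralln Fae; apply: filterS => x /= h.
by rewrite OF => -[k _ Fkx]; exact: h Fkx.
Qed.

End ProductTest.

Section Supported.
Context d (X : measurableType d) (R : realType) (mu : {measure set X -> \bar R}) (D : set X).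
Implicit Type f : X -> R.

Lemma L1_supp f : measurable D -> (forall x, ~ D x -> f x = 0) -> L1fun mu D f -> L1fun mu setT f.
Proof.
move=> mD f0 /(integrable_mkcond _ mD).
have -> // : (EFin \o f) \_ D = EFin \o f.
by apply/funext => x; rewrite patchE; case: ifPn => // /negP; rewrite in_setE => /f0 /= ->.
Qed.

Lemma Rint_supp f : (forall x, ~ D x -> f x = 0) ->
  \int[mu]_(x in D) f x = \int[mu]_x f x.
Proof.
move=> f0; rewrite Rintegral_mkcond; apply: Rint_ext => x _.
by rewrite patchE; case: ifPn => // /negP; rewrite in_setE => /f0 ->.
Qed.

End Supported.

Section ClosedSubspace.
Context (R : realType) (V : lmodType R).
Variables (X E : set V) (B : V -> V -> R).

Lemma semi_hilbert_closed : semi_hilbert X B -> is_subspace E -> E `<=` X ->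
  (forall s x, (forall n, E (s n)) -> X x -> quad_cvg B s x -> E x) ->
  semi_hilbert E B.
Proof.
move=> H hE EX cl; split => //.
- by move=> x y /EX Xx /EX Xy; exact: (sh_sym H).
- by move=> a x y z /EX Xx /EX Xy /EX Xz; exact: (sh_lin H).
- by move=> x /EX Xx; exact: (sh_ge0 H).
- move=> s Es cs; have [x Xx sx] := sh_complete H (fun n => EX _ (Es n)) cs.
  by exists x => //; exact: cl sx.
Qed.

End ClosedSubspace.

(** * Test functions and their integrals *)

Section TestFunctions.
Context (R : realType) (d : nat) (Om : set 'rV[R]_d).
Hypothesis oO : open Om.
Local Notation leb := (lebesgue_rV R d).
Local Notation scal := ('rV[R]_d -> R).
Hypothesis finO : (leb Om < +oo)%E.

Let mO : measurable Om. Proof. exact: open_measurable_rV. Qed.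

Lemma continuous_measurable_rV (f : scal) (D : set 'rV[R]_d) : continuous f ->
  measurable_fun D f.
Proof.
move=> /continuousP cf; apply: measurable_funTS.
have h : @measurable_fun _ _ 'rV[R]_d (measurableTypeR R) setT f.
  apply: (@measurability _ _ _ _ _ _ (@RGenOInfty.G R)).
    exact: RGenOInfty.measurableE.
  move=> _ [_ [x ->] <-]; rewrite setTI; apply: open_measurable_rV; apply: cf.
  exact: rray_open.
exact: h.
Qed.

Lemma continuous_compact_support_bounded (f : scal) (K : set 'rV[R]_d) :
  continuous f -> compact K -> (forall x, ~ K x -> f x = 0) ->
  exists M : R, forall x, `|f x| <= M.
Proof.
move=> cf cK f0.
have [M0 [_ hM]] := compact_bounded (continuous_compact (continuous_subspaceT cf) cK).
exists (`|M0| + 1) => x; have [Kx|nKx] := pselect (K x).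
  by apply: (hM (`|M0| + 1)); [rewrite (le_lt_trans (ler_norm _))// ltrDl|exists x].
by rewrite f0// normr0 addr_ge0.
Qed.

Lemma test_function_bounded (psi : scal) : test_function Om psi ->
  exists M : R, forall x, `|psi x| <= M.
Proof.
move=> [cpsi cK _]; apply: (continuous_compact_support_bounded (cpsi 0%N) cK).
move=> x nKx; apply/eqP; apply: contrapT => /negP px; apply: nKx.
exact: subset_closure.
Qed.

Lemma test_function_derive_bounded (psi : scal) i : test_function Om psi ->
  continuous ('D_(unitv R i) psi) /\
  exists M : R, forall x, `|'D_(unitv R i) psi x| <= M.
Proof.
move=> [cpsi cK _]; have [_ /(_ i)[_ cD]] := cpsi 1%N.
have {}cD : continuous ('D_(unitv R i) psi) := cD.
split => //; apply: (continuous_compact_support_bounded cD cK).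
move=> x nKx; rewrite (@near_eq_derive _ _ _ _ (cst 0)) ?derive_cst//.
have oK : open (~` closure [set x | psi x != 0]) by apply: closed_openC; exact: closed_closure.
have : nbhs x (~` closure [set x | psi x != 0]) by exact: open_nbhs_nbhs.
apply: filterS => y nKy; apply/eqP; apply: contrapT => /negP py; apply: nKy.
exact: subset_closure.
Qed.

Lemma L2_test (psi : scal) : test_function Om psi -> L2 Om psi.
Proof.
move=> tpsi; have [M hM] := test_function_bounded tpsi.
have [cpsi _ _] := tpsi.
have mp := @continuous_measurable_rV psi Om (cpsi 0%N).
exact: (@L2_bnd _ _ _ leb Om mO M psi finO mp (fun x _ => hM x)).
Qed.

Lemma L2_derive_test (psi : scal) i : test_function Om psi ->
  L2 Om (fun x => 'D_(unitv R i) psi x).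
Proof.
move=> tpsi; have [cD [M hM]] := test_function_derive_bounded i tpsi.
have mp := continuous_measurable_rV (D := Om) cD.
exact: (@L2_bnd _ _ _ leb Om mO M _ finO mp (fun x _ => hM x)).
Qed.

Lemma is_derive_line (psi : scal) (x v : 'rV[R]_d) (s : R) : derivable psi (s *: v + x) v ->
  is_derive s (1 : R) (fun r : R => psi (r *: v + x)) ('D_v psi (s *: v + x)).
Proof.
move=> dp.
have E : (fun h : R => h^-1 *: (((fun r : R => psi (r *: v + x)) \o shift s) (h *: (1 : R)) - psi (s *: v + x)))
   = (fun h : R => h^-1 *: ((psi \o shift (s *: v + x)) (h *: v) - psi (s *: v + x))).
  by apply/funext => h /=; rewrite -[h *: (1 : R)]/(h * 1) mulr1 addrA -scalerDl.
by apply: DeriveDef; rewrite /derivable /derive E.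
Qed.

Lemma test_function_lipschitz (psi : scal) i : test_function Om psi ->
  exists M : R, forall x h, `|psi (h *: unitv R i + x) - psi x| <= M * `|h|.
Proof.
move=> tpsi; have [cD [M hM]] := test_function_derive_bounded i tpsi.
have [cpsi _ _] := tpsi; have [_ /(_ i)[dp _]] := cpsi 1%N.
exists M => x h; wlog h0 : x h / 0 <= h.
  move=> W; have [/W//|h0] := leP 0 h.
  have := W (h *: unitv R i + x) (- h); rewrite addrA -scalerDl addNr scale0r add0r normrN distrC.
  by apply; rewrite oppr_ge0 ltW.
have dl s : is_derive (s : R) (1 : R) (fun r : R => psi (r *: unitv R i + x)) ('D_(unitv R i) psi (s *: unitv R i + x)).
  exact/is_derive_line/dp.
have cl : {within `[0, h], continuous (fun r : R => psi (r *: unitv R i + x))}.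
  apply: derivable_within_continuous => s _.
  exact: ex_derive.
have [s _] := MVT_segment h0 (fun s _ => dl s) cl.
rewrite scale0r add0r subr0 => ->; rewrite normrM ler_wpM2r//.
Qed.

(** Each difference quotient has zero integral by translation invariance; the Lipschitz bound and
    the finite measure of a cube let dominated convergence reach the derivative. *)
Lemma Rint_derive_test (psi : scal) i : test_function Om psi ->
  \int[leb]_(x in Om) 'D_(unitv R i) psi x = 0.
Proof.
move=> tpsi; have [M hM] := test_function_lipschitz i tpsi.
have [M' hM'] := test_function_bounded tpsi.
have [cpsi cK KO] := tpsi.
have cp : continuous psi := cpsi 0%N.
have [cD _] := test_function_derive_bounded i tpsi.
have [_ /(_ i)[dp _]] := cpsi 1%N.
have [B0 [_ hB]] := compact_bounded cK.
pose B := `|B0| + 1.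
have hB' x : psi x != 0 -> `|x| <= B.
  move=> px; apply: (hB B); first by rewrite /B (le_lt_trans (ler_norm _))// ltrDl.
  exact: subset_closure.
(* The margin one covers the shifts [h n], which are at most one: the translates of [psi] vanish
   outside [D] as well. *)
pose D := [set x : 'rV[R]_d | forall i, `|x ord0 i| <= B + 1].
have mD : measurable D.
  apply: (@measurable_coord_set _ _ (fun=> [set t : R | `|t| <= B + 1])) => j.
  have -> : [set t : R | `|t| <= B + 1] = `[- (B + 1), B + 1]%classic.
    by apply/seteqP; split => t /=; rewrite in_itv/= ler_norml.
  exact: measurable_itv.
have fD : (leb D < +oo)%E := @lebesgue_cbox_finite R d (B + 1).
have B0' : 0 <= B by rewrite /B addr_ge0.
have psiD x : ~ D x -> psi x = 0.
  move=> nD; apply/eqP; apply: contrapT => /negP px; apply: nD => j.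
  by rewrite (le_trans (ler_coord_norm _ _))// (le_trans (hB' _ px))// lerDl.
have LD (f : scal) (C : R) : measurable_fun D f -> (forall x, `|f x| <= C) -> L1fun leb D f.
  by move=> mf fC; exact: (@L1_bnd _ _ _ leb D mD C f fD mf (fun x _ => fC x)).
have psiL : L1fun leb setT psi.
  apply: (L1_supp mD psiD); apply: (LD _ M' _ hM').
  exact: continuous_measurable_rV.
pose h n : R := n.+1%:R^-1.
pose f_ n (x : 'rV[R]_d) := n.+1%:R * (psi (h n *: unitv R i + x) - psi x).
have fI n : \int[leb]_(x in D) f_ n x = 0.
  have [sL sE] := integral_shift (h n *: unitv R i) psiL.
  have sL' : L1fun leb setT (fun x => psi (h n *: unitv R i + x)).
    by apply: (L1_ext measurableT _ sL) => x _ /=; rewrite addrC.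
  have f0 x : ~ D x -> f_ n x = 0.
    move=> nD; rewrite /f_ (psiD x nD) subr0.
    suff -> : psi (h n *: unitv R i + x) = 0 by rewrite mulr0.
    apply/eqP; apply: contrapT => /negP px; apply: nD => j.
    rewrite (le_trans (ler_coord_norm _ _))//.
    have -> : x = (h n *: unitv R i + x) - h n *: unitv R i by rewrite addrC addKr.
    rewrite (le_trans (ler_normB _ _))// lerD// ?hB'//.
    apply: normr_rV_le => // k; rewrite !mxE.
    have hn : 0 <= h n by rewrite /h invr_ge0.
    rewrite normrM (ger0_norm hn) -[leRHS]mulr1 ler_pM//.
      by rewrite /h invf_le1// ler1n.
    by case: eqP => _; rewrite ?andbF ?andbT/= ?normr0 ?normr1//; case: eqP => _; rewrite ?normr0 ?normr1.
  rewrite (Rint_supp leb f0) /f_.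
  have := RintZ measurableT n.+1%:R (L1B measurableT sL' psiL); rewrite /= => ->.
  rewrite (RintB measurableT sL' psiL); apply/eqP; rewrite mulf_eq0 subr_eq0; apply/orP; right.
  apply/eqP; apply: EFin_inj; rewrite -(L1_EFin measurableT sL') -(L1_EFin measurableT psiL) -sE.
  by apply: eq_integral => x _ /=; rewrite addrC.
have D0 x : ~ D x -> 'D_(unitv R i) psi x = 0.
  move=> nD; rewrite (@near_eq_derive _ _ _ _ (cst 0)) ?derive_cst//.
  have oK : open (~` closure [set x | psi x != 0]) by apply: closed_openC; exact: closed_closure.
  have nK : (~` closure [set x | psi x != 0]) x.
    move=> Kx; apply: nD => j; rewrite (le_trans (ler_coord_norm _ _))// (@le_trans _ _ B) ?lerDl//.
    by apply: (hB B) Kx; rewrite /B (le_lt_trans (ler_norm _))// ltrDl.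
  have : nbhs x (~` closure [set x | psi x != 0]) by exact: open_nbhs_nbhs.
  apply: filterS => y nKy; apply/eqP; apply: contrapT => /negP py; apply: nKy.
  exact: subset_closure.
have O0 x : ~ Om x -> 'D_(unitv R i) psi x = 0.
  move=> nO; rewrite (@near_eq_derive _ _ _ _ (cst 0)) ?derive_cst//.
  have oK : open (~` closure [set x | psi x != 0]) by apply: closed_openC; exact: closed_closure.
  have nK : (~` closure [set x | psi x != 0]) x by move=> /KO.
  have : nbhs x (~` closure [set x | psi x != 0]) by exact: open_nbhs_nbhs.
  apply: filterS => y nKy; apply/eqP; apply: contrapT => /negP py; apply: nKy.
  exact: subset_closure.
rewrite (Rint_supp leb O0) -(Rint_supp leb D0).
have cv : \int[leb]_(x in D) f_ n x @[n --> \oo] --> \int[leb]_(x in D) 'D_(unitv R i) psi x.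
  apply: (@Rint_dominated _ _ _ leb D mD f_ _ (fun=> M)).
  - move=> n; apply: measurable_funM => //; apply: measurable_funB; last exact: continuous_measurable_rV.
    have -> : (fun x => psi (h n *: unitv R i + x)) = psi \o (fun x => 1 *: x + h n *: unitv R i).
      by apply/funext => x /=; rewrite scale1r addrC.
    apply: measurable_funTS; apply: measurableT_comp; first exact: continuous_measurable_rV.
    exact: measurable_affine_rV.
  - exact: continuous_measurable_rV.
  - apply: nearW => x Dx; have := dp x; rewrite /derivable => /cvg_ex[l hl].
    have -> : 'D_(unitv R i) psi x = l by apply: cvg_lim hl.
    have h0 : h n @[n --> \oo] --> (0 : R) by exact: cvg_harmonic.
    have hn0 n : h n != 0 by rewrite invr_eq0 pnatr_eq0.
    move/cvgr_dnbhsP : (hl) => /(_ h (conj hn0 h0)).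
    by apply: cvg_trans; apply: near_eq_cvg; apply: nearW => n /=; rewrite /f_ /h invrK.
  - exact: (@L1_cst _ _ _ leb D mD M fD).
  - move=> n x Dx; rewrite /f_ normrM ger0_norm// mulrC -ler_pdivlMr//.
    by apply: le_trans (hM x (h n)) _; rewrite ger0_norm ?invr_ge0.
have E : (fun n => \int[leb]_(x in D) f_ n x) = (fun=> 0) by apply/funext => n; exact: fI.
by rewrite E in cv; exact: (cvg_unique (@Rhausdorff R) cv (cvg_cst 0)).
Qed.

Lemma test_box_bump (a b : 'rV[R]_d) k : obox a b `<=` Om ->
  test_function Om (box_bump a b k).
Proof.
move=> abO; have [h1 h2] := box_bump_cbox a b k.
apply: test_function_prodf h1 _; first by move=> i; exact: smooth_bump.
exact: subset_trans abO.
Qed.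

Lemma L2_eq0_of_test (f : scal) : L2 Om f ->
  (forall psi, test_function Om psi -> inner Om f psi = 0) ->
  {ae leb, forall x, Om x -> f x = 0}.
Proof.
move=> fL h; apply: (du_bois_reymond oO) => [|a b k abO]; first exact: (L2_L1 mO).
by apply: h; exact: test_box_bump.
Qed.

End TestFunctions.

(** * Hilbert structure of H1 and of its mean-zero part *)

Section Sobolev1.
Context (R : realType) (d : nat) (Om : set 'rV[R]_d).
Local Notation leb := (lebesgue_rV R d).
Local Notation scal := ('rV[R]_d -> R).
Local Notation vect := ('rV[R]_d -> 'rV[R]_d).
Hypothesis oO : open Om.
Hypothesis finO : (leb Om < +oo)%E.

Let mO : measurable Om. Proof. exact: open_measurable_rV. Qed.

Local Notation aeO P := {ae leb, forall x, Om x -> P x}.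

Lemma innerC (f g : scal) : inner Om f g = inner Om g f.
Proof. exact: (@ipC _ _ R leb Om f g). Qed.

Lemma inner_ge0 (f : scal) : 0 <= inner Om f f.
Proof. exact: (@ip_ge0 _ _ R leb Om f). Qed.

Lemma inner_aeE (f g f' g' : scal) : L2 Om f -> L2 Om g -> L2 Om f' -> L2 Om g' ->
  {ae leb, forall x, Om x -> f x = f' x} -> {ae leb, forall x, Om x -> g x = g' x} -> inner Om f g = inner Om f' g'.
Proof. exact: (@ae_ip _ _ R leb Om mO f g f' g'). Qed.

Lemma inner_lin (a : R) (f g h : scal) : L2 Om f -> L2 Om g -> L2 Om h ->
  inner Om (a *: f + g) h = a * inner Om f h + inner Om g h.
Proof. by move=> fL gL hL; have := sh_lin (semi_hilbert_L2 leb mO) a fL gL hL. Qed.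

Lemma inner0l (h : scal) : inner Om (fun=> 0) h = 0.
Proof.
rewrite /inner -[RHS](@Rint0 _ _ R leb Om mO).
by apply: Rint_ext => x _; rewrite mul0r.
Qed.

Lemma innervE (F G : vect) : L2v Om F -> L2v Om G ->
  innerv Om F G = \sum_(i < d) inner Om (component F i) (component G i).
Proof. by move=> FL GL; apply: Rint_sum => // i; exact: (L2_mul mO (FL i) (GL i)). Qed.

Lemma wgrad_unique (f : scal) (G G' : vect) : L2v Om G -> L2v Om G' ->
  is_weak_grad Om f G -> is_weak_grad Om f G' ->
  forall i, {ae leb, forall x, Om x -> component G i x = component G' i x}.
Proof.
move=> GL GL' gG gG' i.
have := @L2_eq0_of_test R d Om oO finO (fun x => component G i x - component G' i x) _ _.
move=> /(_ (L2B mO (GL i) (GL' i))) h.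
suff h' : forall psi, test_function Om psi ->
    inner Om (fun x => component G i x - component G' i x) psi = 0.
  by apply: filterS (h h') => x /= + Ox => /(_ Ox)/eqP; rewrite subr_eq0 => /eqP.
move=> psi tpsi.
have pL := L2_test oO finO tpsi.
have -> : inner Om (fun x => component G i x - component G' i x) psi =
    inner Om (component G i) psi - inner Om (component G' i) psi.
  rewrite /inner -RintB//; [|exact: (L2_mul mO (GL i))|exact: (L2_mul mO (GL' i))].
  by apply: Rint_ext => x _; rewrite mulrBl.
by apply/eqP; rewrite subr_eq0 -eqr_opp -(gG i psi tpsi) -(gG' i psi tpsi).
Qed.

Lemma wgradP (f : scal) : H1 Om f -> L2v Om (wgrad Om f) /\ is_weak_grad Om f (wgrad Om f).
Proof. by move=> [_ ex]; exact: (xgetPex (fun=> 0) ex). Qed.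

Lemma H1_L2 (f : scal) : H1 Om f -> L2 Om f.
Proof. by case. Qed.

Lemma L2v_wgrad (f : scal) : H1 Om f -> L2v Om (wgrad Om f).
Proof. by move=> /wgradP[]. Qed.

Lemma wgrad_ae (f : scal) (G : vect) : H1 Om f -> L2v Om G -> is_weak_grad Om f G ->
  forall i, {ae leb, forall x, Om x -> component (wgrad Om f) i x = component G i x}.
Proof. by move=> fH GL gG; have [h1 h2] := wgradP fH; exact: wgrad_unique h1 GL h2 gG. Qed.

Lemma is_weak_grad_lin (a : R) (f g : scal) (F G : vect) : L2 Om f -> L2 Om g ->
  L2v Om F -> L2v Om G -> is_weak_grad Om f F -> is_weak_grad Om g G ->
  is_weak_grad Om (a *: f + g) (fun x => a *: F x + G x).
Proof.
move=> fL gL FL GL fF gG i psi tpsi.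
have pL := L2_test oO finO tpsi; have dL := L2_derive_test oO finO i tpsi.
have -> : inner Om (a *: f + g) (fun x => 'D_(unitv R i) psi x) =
    a * inner Om f (fun x => 'D_(unitv R i) psi x) + inner Om g (fun x => 'D_(unitv R i) psi x).
  exact: inner_lin.
have -> : inner Om (component (fun x => a *: F x + G x) i) psi =
    a * inner Om (component F i) psi + inner Om (component G i) psi.
  rewrite -(inner_lin a (FL i) (GL i) pL); congr (inner Om _ psi).
  by apply/funext => x; rewrite /component !mxE.
by rewrite (fF i psi tpsi) (gG i psi tpsi) opprD mulrN.
Qed.

Lemma L2v_lin (a : R) (F G : vect) : L2v Om F -> L2v Om G ->
  L2v Om (fun x => a *: F x + G x).
Proof.
move=> FL GL i; apply: (L2_ext mO _ (L2D mO (L2Z mO a (FL i)) (GL i))) => x _.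
by rewrite /component !mxE.
Qed.

Lemma is_subspace_L2Om : is_subspace (L2 Om).
Proof. exact: (@is_subspace_L2 _ _ R leb Om mO). Qed.

Lemma H1_zero : H1 Om 0.
Proof.
split; first exact: L20.
exists (fun=> 0); split.
  by move=> i; apply: (L2_ext mO _ (L20 leb mO)) => x _; rewrite /component mxE.
move=> i psi _.
rewrite -/(inner Om 0 _) -/(inner Om _ psi) inner0l.
have -> : component (fun=> 0 : 'rV[R]_d) i = (fun=> 0) :> scal.
  by apply/funext => x; rewrite /component mxE.
by rewrite inner0l oppr0.
Qed.

Lemma H1_lin (a : R) (f g : scal) : H1 Om f -> H1 Om g -> H1 Om (a *: f + g).
Proof.
move=> fH gH; have [FL fF] := wgradP fH; have [GL gG] := wgradP gH.
split; first by apply: is_subspace_L2Om.2; exact: H1_L2.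
exists (fun x => a *: wgrad Om f x + wgrad Om g x); split; first exact: L2v_lin.
by apply: is_weak_grad_lin => //; exact: H1_L2.
Qed.

Lemma is_subspace_H1 : is_subspace (H1 Om).
Proof. by split; [exact: H1_zero|exact: H1_lin]. Qed.

(** The gradient is a chosen representative, so linearity can hold only almost everywhere: both
    sides are weak gradients of the same function. *)
Lemma wgrad_lin (a : R) (f g : scal) : H1 Om f -> H1 Om g -> forall i,
  {ae leb, forall x, Om x -> component (wgrad Om (a *: f + g)) i x =
    a * component (wgrad Om f) i x + component (wgrad Om g) i x}.
Proof.
move=> fH gH i; have [FL fF] := wgradP fH; have [GL gG] := wgradP gH.
have := @wgrad_ae (a *: f + g) (fun x => a *: wgrad Om f x + wgrad Om g x) (H1_lin a fH gH)
  (L2v_lin a FL GL) (is_weak_grad_lin a (H1_L2 fH) (H1_L2 gH) FL GL fF gG) i.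
by apply: filterS => x /= + Ox => /(_ Ox) ->; rewrite /component !mxE.
Qed.

Lemma wgradB (f g : scal) : H1 Om f -> H1 Om g -> forall i,
  {ae leb, forall x, Om x -> component (wgrad Om (f - g)) i x =
    component (wgrad Om f) i x - component (wgrad Om g) i x}.
Proof.
move=> fH gH i; have := wgrad_lin (-1) gH fH i.
rewrite scaleN1r addrC; apply: filterS => x /= + Ox => /(_ Ox) ->.
by rewrite mulN1r addrC.
Qed.

Lemma is_weak_grad_cst (c : R) : is_weak_grad Om (fun=> c) (fun=> 0).
Proof.
move=> i psi tpsi.
have -> : component (fun=> 0 : 'rV[R]_d) i = (fun=> 0) :> scal.
  by apply/funext => x; rewrite /component mxE.
rewrite inner0l oppr0 /inner.
have dL := L2_L1 mO finO (L2_derive_test oO finO i tpsi).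
by rewrite (RintZ mO c dL) (Rint_derive_test i tpsi) mulr0.
Qed.

Definition H1ip (f g : scal) : R :=
  inner Om f g + innerv Om (wgrad Om f) (wgrad Om g).

Definition gradip (f g : scal) : R := innerv Om (wgrad Om f) (wgrad Om g).

Lemma gradipE f g : H1 Om f -> H1 Om g -> gradip f g =
  \sum_(i < d) inner Om (component (wgrad Om f) i) (component (wgrad Om g) i).
Proof. by move=> /L2v_wgrad Ff /L2v_wgrad Fg; exact: innervE. Qed.

Lemma gradipC f g : H1 Om f -> H1 Om g -> gradip f g = gradip g f.
Proof.
move=> fH gH; rewrite (gradipE fH gH) (gradipE gH fH).
by apply: eq_bigr => i _; exact: innerC.
Qed.

Lemma gradip_lin (a : R) f g h : H1 Om f -> H1 Om g -> H1 Om h ->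
  gradip (a *: f + g) h = a * gradip f h + gradip g h.
Proof.
move=> fH gH hH; have abH := H1_lin a fH gH.
rewrite (gradipE abH hH) (gradipE fH hH) (gradipE gH hH) mulr_sumr -big_split/=; apply: eq_bigr => i _.
have Lf := L2v_wgrad fH i; have Lg := L2v_wgrad gH i; have Lh := L2v_wgrad hH i.
have Lfg := L2v_wgrad (H1_lin a fH gH) i.
rewrite -(inner_lin a Lf Lg Lh).
have Ls : L2 Om (a *: component (wgrad Om f) i + component (wgrad Om g) i).
  exact: (L2D mO (L2Z mO a Lf) Lg).
apply: (inner_aeE Lfg Lh Ls Lh); first exact: wgrad_lin.
exact: nearW.
Qed.

Lemma gradip_ge0 f : H1 Om f -> 0 <= gradip f f.
Proof. by move=> fH; rewrite (gradipE fH fH); apply: sumr_ge0 => i _; exact: inner_ge0. Qed.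

Lemma inner_test_cvg (s : nat -> scal) (f psi : scal) : (forall n, L2 Om (s n)) ->
  L2 Om f -> L2 Om psi -> quad_cvg (inner Om) s f ->
  forall e : R, 0 < e -> exists N, forall n, (N <= n)%N -> `|inner Om (s n) psi - inner Om f psi| <= e.
Proof.
by move=> Ls Lf Lp; exact: (sh_quad_cvg (semi_hilbert_L2 leb mO) Ls Lf Lp).
Qed.

(** The functions and the components of their gradients converge separately in L2, and the weak
    gradient identity survives the limit against each fixed test function. *)
Lemma H1_complete (s : nat -> scal) : (forall n, H1 Om (s n)) -> quad_cauchy H1ip s ->
  exists2 f, H1 Om f & quad_cvg H1ip s f.
Proof.
move=> Hs cs.
have HB n m : H1 Om (s n - s m) by apply: (subspaceB is_subspace_H1).
have Ls n := H1_L2 (Hs n).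
have cL2 : quad_cauchy (inner Om) s.
  move=> e e0; have [N hN] := cs e e0; exists N => n k Nn Nk.
  by apply: le_trans (hN n k Nn Nk); rewrite lerDl; exact: gradip_ge0.
have [f fL sf] := L2_complete mO Ls cL2.
have cG i : quad_cauchy (inner Om) (fun n => component (wgrad Om (s n)) i).
  move=> e e0; have [N hN] := cs e e0; exists N => n k Nn Nk.
  apply: le_trans (hN n k Nn Nk).
  have -> : inner Om (component (wgrad Om (s n)) i - component (wgrad Om (s k)) i)
      (component (wgrad Om (s n)) i - component (wgrad Om (s k)) i) =
    inner Om (component (wgrad Om (s n - s k)) i) (component (wgrad Om (s n - s k)) i).
    have Lnk := L2B mO (L2v_wgrad (Hs n) i) (L2v_wgrad (Hs k) i).
    have Lnk' := L2v_wgrad (HB n k) i.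
    have h := wgradB (Hs n) (Hs k) i.
    exact/esym/(inner_aeE Lnk' Lnk' Lnk Lnk h h).
  have -> : H1ip (s n - s k) (s n - s k) = inner Om (s n - s k) (s n - s k) + gradip (s n - s k) (s n - s k) by [].
  rewrite (gradipE (HB n k) (HB n k)) (bigD1 i)//= addrCA lerDl addr_ge0//; first exact: inner_ge0.
  by apply: sumr_ge0 => j _; exact: inner_ge0.
have ex i : exists G : scal, L2 Om G /\ quad_cvg (inner Om) (fun n => component (wgrad Om (s n)) i) G.
  have [G GL sG] := L2_complete mO (fun n => L2v_wgrad (Hs n) i) (cG i).
  by exists G.
have [G hG] := choice ex.
pose F : vect := fun x => \row_i G i x.
have FE i : component F i = G i by apply/funext => x; rewrite /component mxE.
have FL : L2v Om F by move=> i; rewrite FE; exact: (hG i).1.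
have fF : is_weak_grad Om f F.
  move=> i psi tpsi; rewrite FE.
  have pL := L2_test oO finO tpsi; have dL := L2_derive_test oO finO i tpsi.
  apply: eq_of_dist_small => e e0.
  have e2 : 0 < e / 2 by rewrite divr_gt0.
  have [N hN] := inner_test_cvg Ls fL dL sf e2.
  have [M hM] := inner_test_cvg (fun n => L2v_wgrad (Hs n) i) (hG i).1 pL (hG i).2 e2.
  have := hN _ (leq_maxl N M); have := hM _ (leq_maxr N M).
  have [_ gs] := wgradP (Hs (maxn N M)).
  rewrite (gs i psi tpsi) !ler_norml.
  move: (inner Om f _) (inner Om (G i) psi) (inner Om _ psi) => x y z.
  by move=> /andP[h1 h2] /andP[h3 h4]; apply/andP; split; lra.
have fH : H1 Om f by split => //; exists F.
exists f => // e e0.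
(* One share for the function and one for each of its [d] gradient components. *)
have e' : 0 < e / d.+1%:R by rewrite divr_gt0.
have [N hN] := sf _ e'.
have exN i : exists M, forall n, (M <= n)%N -> inner Om (component (wgrad Om (s n)) i - G i)
   (component (wgrad Om (s n)) i - G i) <= e / d.+1%:R := (hG i).2 _ e'.
have [M hM] := choice exN.
exists (maxn N (\max_(i < d) M i)) => n; rewrite geq_max => /andP[Nn Mn].
have -> : H1ip (s n - f) (s n - f) = inner Om (s n - f) (s n - f) + gradip (s n - f) (s n - f) by [].
have snf : H1 Om (s n - f) by apply: (subspaceB is_subspace_H1).
rewrite (gradipE snf snf).
have -> : e = e / d.+1%:R + \sum_(i < d) (e / d.+1%:R).
  rewrite sumr_const card_ord -mulrS -(mulr_natl (e / _)) mulrC divfK// pnatr_eq0.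
apply: lerD; first exact: hN.
apply: ler_sum => i _.
have Mi : (M i <= n)%N by apply: leq_trans Mn; exact: leq_bigmax.
apply: le_trans (hM i n Mi).
rewrite le_eqVlt; apply/orP; left; apply/eqP.
have h : {ae leb, forall x, Om x -> component (wgrad Om (s n - f)) i x = component (wgrad Om (s n)) i x - G i x}.
  have h1 := wgradB (Hs n) fH i; have h2 := wgrad_ae fH FL fF i.
  by apply: filterS2 h1 h2 => x /= h1 h2 Ox; rewrite h1// h2// FE.
have La := L2v_wgrad snf i; have Lb := L2B mO (L2v_wgrad (Hs n) i) (hG i).1.
exact: (inner_aeE La La Lb Lb h h).
Qed.

Lemma semi_hilbert_H1 : semi_hilbert (H1 Om) H1ip.
Proof.
split.
- exact: is_subspace_H1.
- move=> f g fH gH; rewrite /H1ip; rewrite innerC -!/(gradip _ _) (gradipC fH gH).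
  by [].
- move=> a f g h fH gH hH; rewrite /H1ip (inner_lin a (H1_L2 fH) (H1_L2 gH) (H1_L2 hH)).
  have := gradip_lin a fH gH hH; rewrite /gradip => ->.
  by rewrite mulrDr addrACA.
- by move=> f fH; rewrite addr_ge0//; [exact: inner_ge0|exact: gradip_ge0].
- exact: H1_complete.
Qed.

Lemma normH1E f : H1 Om f -> normH1 Om f = sh_norm H1ip f.
Proof.
move=> fH; rewrite /normH1 /sh_norm /H1ip; congr Num.sqrt.
rewrite /normL2 /normL2v !sqr_sqrtr//; [exact: gradip_ge0|exact: inner_ge0].
Qed.

Lemma normL2E f : normL2 Om f = sh_norm (inner Om) f.
Proof. by []. Qed.

Lemma L2_one : L2 Om (fun=> 1).
Proof. exact: (@L2_cst _ _ R leb Om mO 1 finO). Qed.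

Lemma mean_inner f : \int[leb]_(x in Om) f x = inner Om f (fun=> 1).
Proof. by rewrite /inner; apply: Rint_ext => x _; rewrite mulr1. Qed.

Lemma is_subspace_H10 : is_subspace (H10 Om).
Proof.
split; first by split; [exact: H1_zero|exact: (@Rint0 _ _ R leb Om)].
move=> a f g [fH f0] [gH g0]; split; first exact: H1_lin.
have Lf := H1_L2 fH; have Lg := H1_L2 gH.
rewrite mean_inner (inner_lin a Lf Lg L2_one).
by rewrite -!mean_inner f0 g0 mulr0 addr0.
Qed.

Lemma semi_hilbert_H10 : semi_hilbert (H10 Om) H1ip.
Proof.
apply: (semi_hilbert_closed semi_hilbert_H1 is_subspace_H10); first by move=> f [].
move=> s f Hs fH sf; split => //.
rewrite mean_inner; apply: eq_of_dist_small => e e0; rewrite subr0.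
have sfL : quad_cvg (inner Om) s f.
  move=> r r0; have [N hN] := sf r r0; exists N => n Nn; apply: le_trans (hN n Nn).
  by rewrite lerDl; apply: gradip_ge0; apply: (subspaceB is_subspace_H1) => //; have [] := Hs n.
have Ls n : L2 Om (s n) by apply: H1_L2; have [] := Hs n.
have [N hN] := inner_test_cvg Ls (H1_L2 fH) L2_one sfL e0.
have := hN N (leqnn N); rewrite -mean_inner; have [_ ->] := Hs N.
by rewrite sub0r normrN.
Qed.

Lemma H1_cst (c : R) : H1 Om (fun=> c).
Proof.
split; first exact: (@L2_cst _ _ R leb Om mO c finO).
exists (fun=> 0); split; last exact: is_weak_grad_cst.
move=> i; have -> : component (fun=> 0 : 'rV[R]_d) i = (fun=> 0) :> scal.
  by apply/funext => x; rewrite /component mxE.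
exact: (@L20 _ _ R leb Om mO).
Qed.

Lemma wgrad_cst (c : R) i :
  {ae leb, forall x, Om x -> component (wgrad Om (fun=> c)) i x = 0}.
Proof.
have FL : L2v Om (fun=> 0 : 'rV[R]_d).
  move=> j; have -> : component (fun=> 0 : 'rV[R]_d) j = (fun=> 0) :> scal.
    by apply/funext => x; rewrite /component mxE.
  exact: (@L20 _ _ R leb Om mO).
have := wgrad_ae (H1_cst c) FL (is_weak_grad_cst c) i.
by apply: filterS => x /= + Ox => /(_ Ox) ->; rewrite /component mxE.
Qed.

Lemma gradip_cst (c : R) g : H1 Om g -> gradip (fun=> c) g = 0.
Proof.
move=> gH; rewrite (gradipE (H1_cst c) gH) big1// => i _.
have L0 : L2 Om (fun=> 0) := @L20 _ _ R leb Om mO.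
have Lg := L2v_wgrad gH i.
rewrite (inner_aeE (L2v_wgrad (H1_cst c) i) Lg L0 Lg (wgrad_cst c i)) ?inner0l//.
exact: nearW.
Qed.

Lemma H10_center f : H1 Om f -> exists c : R, H10 Om (f - (fun=> c)).
Proof.
move=> fH; have fL := H1_L2 fH; pose i1 := inner Om (fun=> 1) (fun=> 1).
have cs := sh_CS2 (semi_hilbert_L2 leb mO) fL L2_one.
exists (inner Om f (fun=> 1) / i1); split.
  by apply: (subspaceB is_subspace_H1) fH _; exact: H1_cst.
set c := _ / _; rewrite mean_inner.
have -> : f - (fun=> c) = (- c) *: (fun=> 1) + f.
  by apply/funext => x; rewrite !fctE -[(- c) *: 1]/(- c * 1) mulr1 addrC.
rewrite (inner_lin _ L2_one fL L2_one) -/i1 /c.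
(* If [Om] is a null set the quotient is zero by convention, and Cauchy-Schwarz shows that the mean
   is already zero. *)
have [i0|i0] := eqVneq i1 0; last by rewrite mulNr divfK ?addNr.
have {}cs : inner Om f (fun=> 1) ^+ 2 <= inner Om f f * i1 := cs.
move: cs; rewrite i0 !mulr0 add0r => cs; apply/eqP.
by rewrite -sqrf_eq0 eq_le sqr_ge0 andbT.
Qed.

End Sobolev1.

(** * The Sobolev inequality on Lipschitz domains *)

Section Cone.
Context (R : realType) (d : nat).
Local Notation vec := 'rV[R]_d.

Lemma mulmx_norm_le (Q : 'M[R]_d) : exists2 C : R, 0 < C & forall v : vec, `|v *m Q| <= C * `|v|.
Proof.
exists (1 + \sum_k \sum_j `|Q k j|).
  by rewrite ltr_pwDl// !sumr_ge0// => k _; rewrite sumr_ge0.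
move=> v; apply: normr_rV_le.
  by rewrite mulr_ge0// addr_ge0// !sumr_ge0// => k _; rewrite sumr_ge0.
move=> i; rewrite mxE; apply: le_trans (ler_norm_sum _ _ _) _.
rewrite mulrDl mul1r; apply: le_trans (_ : _ <= (\sum_k \sum_j `|Q k j|) * `|v|) _; last first.
  by rewrite lerDr.
rewrite mulr_suml; apply: ler_sum => k _; rewrite normrM mulrC ler_pM//.
  by rewrite (bigD1 i)//= lerDl sumr_ge0.
exact: ler_coord_norm.
Qed.

(** The uniform cone property near [p]: one ball of directions serves all points of [Om] close to
    [p]. *)
Definition cone_at (Om : set vec) (p xi0 : vec) (r dl : R) :=
  forall x xi s, Om x -> `|p - x| < r -> `|xi - xi0| < dl -> 0 <= s <= 1 -> Om (s *: xi + x).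

(** In graph coordinates, moving upwards leaves the graph faster than a Lipschitz function can
    follow, and the same holds for all nearby directions; [xi0] is a short upward vector. Around a
    point of [Om] itself every short vector serves. *)
Lemma lipschitz_cone (Om : set vec) p : open Om -> lipschitz_boundary Om -> closure Om p ->
  exists r xi0 dl, [/\ 0 < r, 0 < dl & cone_at Om p xi0 r dl].
Proof.
move=> oO lO cp; have [Op|nOp] := pselect (Om p).
  have /nbhs_normP[e /= e0 he] : nbhs p Om by exact: open_nbhs_nbhs.
  have e2 : 0 < e / 2 by rewrite divr_gt0.
  exists (e / 2), 0, (e / 2); split => // x xi s Ox xr xir /andP[s0 s1]; apply: he => /=.
  rewrite subr0 in xir.
  rewrite opprD addrCA [in ltRHS](splitr e) addrC.
  apply: le_lt_trans (ler_normD _ _) _; apply: ltrD => //.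
  rewrite normrN normrZ ger0_norm//; apply: le_lt_trans xir.
  by rewrite ler_piMl.
have [Q [i [g [QQ [L0 [_ hL0]] /nbhs_normP[e /= e0 he]]]]] :=
  lO p (conj cp (fun Op : Om° p => nOp (interior_subset Op))).
have QtQ := mulmx1C QQ.
pose L := `|L0| + 1.
have Lp : 0 < L by rewrite ltr_wpDl.
have hL y z : `|g y - g z| <= L * `|y - z|.
  by apply: (hL0 L _ (y, z)) => //; rewrite (le_lt_trans (ler_norm _))// ltrDl.
have [C C0 hC] := mulmx_norm_le Q.
pose N := `|unitv R i *m Q^T|.
(* A direction that deviates from the vertical vector of length [tau] by at most tau * ep gains at
   least tau * (1 - ep) in height, while the graph rises by at most L * tau * ep. The two are equal
   for this [ep]. *)
pose ep := (1 + L)^-1.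
have L1 : 0 < 1 + L by rewrite addr_gt0.
have ep0 : 0 < ep by rewrite invr_gt0.
have epE : L * ep = 1 - ep by rewrite /ep -[X in X - _](mulfV (lt0r_neq0 L1)); ring.
pose tau := e / 4 / (N + 1).
have N1 : 0 < N + 1 by rewrite ltr_wpDl// normr_ge0.
have tau0 : 0 < tau by rewrite !divr_gt0.
pose xi0 := tau *: (unitv R i *m Q^T).
have xi0n : `|xi0| <= e / 4.
  rewrite normrZ gtr0_norm// -/N /tau -(mulrA (e / 4)) ler_piMr ?divr_ge0 ?ltW//.
  by rewrite mulrC ltr_pdivrMr// mul1r ltrDl.
pose dl := Num.min (e / 4) (tau * ep / C).
have dl0 : 0 < dl by rewrite lt_min !divr_gt0// mulr_gt0.
exists (e / 2), xi0, dl; split => //; first by rewrite divr_gt0.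
move=> x xi s Ox xr xir /andP[s0 s1].
have xie : `|s *: xi| <= e / 2.
  rewrite normrZ ger0_norm// (@le_trans _ _ `|xi|) ?ler_piMl//.
  have -> : xi = xi0 + (xi - xi0) by rewrite addrC subrK.
  have := ler_normD xi0 (xi - xi0); have : dl <= e / 4 by rewrite ge_min lexx.
  move: xi0n xir => h1 h2 h3 h4; clear -h1 h2 h3 h4 e0; lra.
have yb : `|p - (s *: xi + x)| < e.
  rewrite opprD addrCA; have := ler_normD (- (s *: xi)) (p - x); rewrite normrN.
  move: xr xie => h1 h2 h3; clear -h1 h2 h3; lra.
have xb : `|p - x| < e by move: xr => h1; clear -h1 e0; lra.
apply/(he _ yb); have /(he _ xb) gx := Ox.
pose w := (xi - xi0) *m Q.
have wn : `|w| <= tau * ep.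
  apply: le_trans (hC _) _; rewrite mulrC -ler_pdivlMr//; apply: ltW.
  by apply: lt_le_trans xir _; rewrite ge_min lexx orbT.
have xiQ : xi *m Q = tau *: unitv R i + w.
  by rewrite /w mulmxBl /xi0 -scalemxAl -mulmxA QtQ mulmx1 addrC subrK.
have E1 : ((s *: xi + x) *m Q) ord0 i = s * (tau + w ord0 i) + (x *m Q) ord0 i.
  by rewrite mulmxDl -scalemxAl xiQ !mxE !eqxx mulr1.
have E2 : col' i ((s *: xi + x) *m Q) = s *: col' i w + col' i (x *m Q).
  apply/rowP => j; rewrite mulmxDl -scalemxAl xiQ !mxE eqxx/=.
  by rewrite eq_sym (negbTE (neq_lift i j)) mulr0 add0r.
rewrite E1 E2.
have cw : `|s *: col' i w| <= s * (tau * ep).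
  rewrite normrZ (ger0_norm s0) ler_wpM2l//; apply: le_trans _ wn.
  apply: normr_rV_le => // j; rewrite mxE; exact: ler_coord_norm.
have := hL (s *: col' i w + col' i (x *m Q)) (col' i (x *m Q)); rewrite addrK.
have wi := le_trans (ler_coord_norm w i) wn.
have h1 : L * `|s *: col' i w| <= s * tau * (1 - ep).
  rewrite -epE; apply: le_trans (_ : _ <= L * (s * (tau * ep))) _; first by rewrite ler_pM2l.
  by rewrite le_eqVlt; apply/orP; left; apply/eqP; ring.
have h2 : - (tau * ep) <= w ord0 i by move: wi; rewrite ler_norml => /andP[].
have h3 : s * (tau * (1 - ep)) <= s * (tau + w ord0 i).
  by rewrite ler_wpM2l// mulrBr mulr1 lerD2l.
move: h1; move: (L * _) => r1 h1; rewrite ler_norml => /andP[_ h4].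
move: gx h3 h1 h4; rewrite mulrA.
move: (g _) (g _) (s * tau * _) (s * (_ + _)) ((x *m Q) ord0 i) => a1 a2 a3 a4 a5 q1 q2 q3 q4.
clear -q1 q2 q3 q4; lra.
Qed.

End Cone.

(** * Fubini's theorem and averages of translates *)

Section Fubini.
Context d1 d2 (X : measurableType d1) (Y : measurableType d2) (R : realType).
Variables (m1 : {sigma_finite_measure set X -> \bar R})
  (m2 : {sigma_finite_measure set Y -> \bar R}).

Lemma L1_fine d (Z : measurableType d) (mu : {measure set Z -> \bar R}) (D : set Z)
    (f : Z -> \bar R) : measurable D -> mu.-integrable D f ->
  L1fun mu D (fun x => fine (f x)) /\
  \int[mu]_(x in D) fine (f x) = fine (\int[mu]_(x in D) f x)%E.
Proof.
move=> mD fi; have mf : measurable_fun D f by exact: measurable_int fi.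
have mfine : measurable_fun D (fun x => fine (f x)).
  by apply: (measurableT_comp _ mf); exact: fine_measurable.
split.
  apply: (le_integrable mD _ _ fi); first exact/measurable_EFinP.
  move=> x _ /=; case: (f x) => [r//||]; rewrite /= normr0 ?leey//.
rewrite /Rintegral; congr fine; apply: ae_eq_integral => //; first exact/measurable_EFinP.
have := integrable_ae mD fi; apply: filterS => x h Dx /=.
by rewrite fineK//; exact: h.
Qed.

Lemma integrable_fubiniG (f : X * Y -> \bar R) : (m1 \x m2)%E.-integrable setT f ->
  m2.-integrable setT (fubini_G m1 f).
Proof.
move=> fi; have mf : measurable_fun setT f by exact: measurable_int fi.
have mg := measurable_fubini_G fi.
apply/integrableP; split => //; apply: le_lt_trans ((integrable21ltyP m1 m2 mf).1 fi).
apply: ge0_le_integral => //.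
- exact: measurableT_comp.
- apply: (measurable_fun_fubini_tonelli_G (abse \o f)) => //=; exact: measurableT_comp.
- by move=> y _; apply: le_abse_integral => //; exact: measurableT_comp.
Qed.

Lemma Rint_fubini (F : X * Y -> R) :
  (m1 \x m2)%E.-integrable setT (EFin \o F) ->
  [/\ L1fun m1 setT (fun x => \int[m2]_y F (x, y)),
      L1fun m2 setT (fun y => \int[m1]_x F (x, y)),
      \int[m1]_x (\int[m2]_y F (x, y)) = \int[m2]_y (\int[m1]_x F (x, y)) &
      {ae m1, forall x, L1fun m2 setT (fun y => F (x, y))}].
Proof.
move=> Fi; have [L1 E1] := L1_fine measurableT (integrable_fubini_F Fi).
have [L2 E2] := L1_fine measurableT (integrable_fubiniG Fi).
split => //; last exact: (ae_integrable1 Fi).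
rewrite (_ : \int[m1]_x _ = fine (\int[m1]_x fubini_F m2 (EFin \o F) x)%E)//.
rewrite (_ : \int[m2]_y _ = fine (\int[m2]_x fubini_G m1 (EFin \o F) x)%E)//.
by congr fine; exact: (Fubini Fi).
Qed.

Lemma integrable_prod (F : X * Y -> R) (h : Y -> R) :
  measurable_fun setT F ->
  (forall y, (\int[m1]_x `|F (x, y)|%:E <= (h y)%:E)%E) -> L1fun m2 setT h ->
  (m1 \x m2)%E.-integrable setT (EFin \o F).
Proof.
move=> mF hF hL.
have mn : measurable_fun setT (fun z : X * Y => `|F z|%:E).
  by apply/measurable_EFinP; exact: measurableT_comp.
apply/integrable21ltyP; first exact/measurable_EFinP.
have [_ hlt] := (L1P (R := R) m2 setT h).1 hL.
apply: le_lt_trans hlt; apply: ge0_le_integral => //.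
- by move=> y _; apply: integral_ge0 => x _; rewrite lee_fin.
- exact: (measurable_fun_fubini_tonelli_G (fun z : X * Y => `|F z|%:E) mn).
- by apply/measurable_EFinP; apply: measurableT_comp => //; exact: L1_meas hL.
- by move=> y _; apply: le_trans (hF y) _; rewrite lee_fin ler_norm.
Qed.

End Fubini.

Section ConvolutionTransfer.
Context (R : realType) (d : nat) ds (S : measurableType ds).
Local Notation vec := 'rV[R]_d.
Local Notation leb := (lebesgue_rV R d).
Variables (kap : {sigma_finite_measure set S -> \bar R}) (th : S -> vec).
Hypothesis mth : measurable_fun setT th.
Variables (g psi : vec -> R) (a : S -> R) (M : R).
Hypothesis gL : L1fun leb setT g.
Hypothesis mpsi : measurable_fun setT psi.
Hypothesis psiM : forall x, `|psi x| <= M.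
Hypothesis aL : L1fun kap setT a.

Let mg : measurable_fun setT g. Proof. exact: L1_meas gL. Qed.
Let ma : measurable_fun setT a. Proof. exact: L1_meas aL. Qed.
Let M0 : 0 <= M. Proof. exact: le_trans (psiM 0). Qed.

Lemma measurable_addrow ds' (S' : measurableType ds') (u v : S' -> vec) :
  measurable_fun setT u -> measurable_fun setT v -> measurable_fun setT (fun z => u z + v z).
Proof.
move=> mu mv; apply: measurable_fun_rowP => i.
rewrite (_ : (fun _ => _) = (fun t => u t ord0 i + v t ord0 i)); last first.
  by apply/funext => t; rewrite mxE.
by apply: measurable_funD; apply: (measurableT_comp (measurable_coord (R := R) i)).
Qed.

Lemma measurable_opprow ds' (S' : measurableType ds') (u : S' -> vec) :
  measurable_fun setT u -> measurable_fun setT (fun z => - u z).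
Proof.
move=> mu; apply: measurable_fun_rowP => i.
rewrite (_ : (fun _ => _) = (fun t => - (u t ord0 i))); last first.
  by apply/funext => t; rewrite mxE.
apply: measurableT_comp => //; exact: (measurableT_comp (measurable_coord (R := R) i)).
Qed.

Lemma conv_integrable1 : (leb \x kap)%E.-integrable setT
  (EFin \o (fun z : vec * S => psi z.1 * (a z.2 * g (z.1 + th z.2)))).
Proof.
have ms : measurable_fun setT (fun z : vec * S => z.1 + th z.2).
  by apply: measurable_addrow; [exact: measurable_fst|exact: measurableT_comp mth measurable_snd].
apply: (@integrable_prod _ _ _ _ _ _ _ _ (fun s => M * (`|a s| * \int[leb]_x `|g x|))).
- apply: measurable_funM; first exact: measurableT_comp mpsi measurable_fst.
  apply: measurable_funM; first exact: measurableT_comp ma measurable_snd.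
  exact: measurableT_comp mg ms.
- move=> s /=; have gN := L1_normr gL.
  have [sL sE] := integral_shift (th s) gN.
  rewrite !EFinM; have -> : (\int[leb]_x `|g x|)%:E = (\int[leb]_x `|g x|%:E)%E.
    by rewrite (L1_EFin measurableT gN).
  rewrite -sE muleA -ge0_integralZl//; first last.
  - by rewrite mule_ge0 ?lee_fin.
  - by move=> x _; rewrite /= lee_fin.
  - by exact: measurable_int sL.
  apply: ge0_le_integral => //.
  + apply/measurable_EFinP; apply: measurableT_comp => //; apply: measurable_funM => //.
    apply: measurable_funM => //; apply: measurableT_comp mg _.
    apply: measurable_addrow => //; exact: measurable_id.
  + by apply: emeasurable_funM => //; exact: measurable_int sL.
  + by move=> x _ /=; rewrite -!EFinM lee_fin !normrM mulrA ler_wpM2r// ler_wpM2r.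
- by apply: (L1Z measurableT); under eq_fun do rewrite mulrC; apply: (L1Z measurableT); exact: L1_normr.
Qed.

Lemma conv_integrable2 : (leb \x kap)%E.-integrable setT
  (EFin \o (fun z : vec * S => g z.1 * (a z.2 * psi (z.1 - th z.2)))).
Proof.
have ms : measurable_fun setT (fun z : vec * S => z.1 - th z.2).
  apply: measurable_addrow; first exact: measurable_fst.
  by apply: measurable_opprow; exact: measurableT_comp mth measurable_snd.
apply: (@integrable_prod _ _ _ _ _ _ _ _ (fun s => M * (`|a s| * \int[leb]_x `|g x|))).
- apply: measurable_funM; first exact: measurableT_comp mg measurable_fst.
  apply: measurable_funM; first exact: measurableT_comp ma measurable_snd.
  exact: measurableT_comp mpsi ms.
- move=> s /=; have gN := L1_normr gL.
  rewrite !EFinM; have -> : (\int[leb]_x `|g x|)%:E = (\int[leb]_x `|g x|%:E)%E.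
    by rewrite (L1_EFin measurableT gN).
  rewrite muleA -ge0_integralZl//; first last.
  - by rewrite mule_ge0 ?lee_fin.
  - by apply/measurable_EFinP; exact: measurableT_comp.
  apply: ge0_le_integral => //.
  + apply/measurable_EFinP; apply: measurableT_comp => //; apply: measurable_funM => //.
    apply: measurable_funM => //; apply: measurableT_comp mpsi _.
    apply: measurable_addrow => //; exact: measurable_id.
  + by apply: emeasurable_funM => //; apply/measurable_EFinP; exact: measurableT_comp.
  + move=> x _ /=; rewrite -!EFinM lee_fin !normrM mulrC ler_wpM2r// mulrC ler_wpM2r//.
- by apply: (L1Z measurableT); under eq_fun do rewrite mulrC; apply: (L1Z measurableT); exact: L1_normr.
Qed.

Lemma bounded_mul_L1 (h : vec -> R) : L1fun leb setT h -> forall c : vec,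
  L1fun leb setT (fun y => h y * psi (y - c)).
Proof.
move=> hL c; apply: (L1_le measurableT (g := fun y => M * `|h y|)).
- apply: measurable_funM; first exact: L1_meas hL.
  apply: measurableT_comp mpsi _; apply: measurable_addrow => //; exact: measurable_id.
- by move=> y _; rewrite normrM mulrC ler_wpM2r.
- by apply: (L1Z measurableT); exact: L1_normr.
Qed.

End ConvolutionTransfer.

Lemma Rint_shift (R : realType) (d : nat) (c : 'rV[R]_d) (f : 'rV[R]_d -> R) :
  L1fun (lebesgue_rV R d) setT f ->
  L1fun (lebesgue_rV R d) setT (fun x => f (x + c)) /\
  \int[lebesgue_rV R d]_x f (x + c) = \int[lebesgue_rV R d]_x f x.
Proof. by move=> fL; have [h1 h2] := integral_shift c fL; split; [|congr fine]. Qed.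

Section ConvolutionTransfer2.
Context (R : realType) (d : nat) ds (S : measurableType ds).
Local Notation vec := 'rV[R]_d.
Local Notation leb := (lebesgue_rV R d).
Variables (kap : {sigma_finite_measure set S -> \bar R}) (th : S -> vec).
Hypothesis mth : measurable_fun setT th.
Variables (g psi : vec -> R) (a : S -> R) (M : R).
Hypothesis gL : L1fun leb setT g.
Hypothesis mpsi : measurable_fun setT psi.
Hypothesis psiM : forall x, `|psi x| <= M.
Hypothesis aL : L1fun kap setT a.

Let ma : measurable_fun setT a. Proof. exact: L1_meas aL. Qed.

Lemma conv_L1 : L1fun leb setT (fun x => \int[kap]_s (a s * g (x + th s))).
Proof.
have h1 (x : vec) : `|1 : R| <= 1 by rewrite normr1.
have := conv_integrable1 mth gL (measurable_cst (1 : R)) h1 aL.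
move=> /Rint_fubini[A1 _ _ _]; apply: (L1_ext measurableT _ A1) => x _ /=.
by apply: Rint_ext => s _; rewrite mul1r.
Qed.

Lemma conv_ae_L1 : {ae leb, forall x, L1fun kap setT (fun s => a s * g (x + th s))}.
Proof.
have h1 (x : vec) : `|1 : R| <= 1 by rewrite normr1.
have := conv_integrable1 mth gL (measurable_cst (1 : R)) h1 aL.
move=> /Rint_fubini[_ _ _]; apply: filterS => x A1.
by apply: (L1_ext measurableT _ A1) => s _ /=; rewrite mul1r.
Qed.

(** Fubini exchanges the two integrals and translation invariance moves the shift from [g] to [psi],
    with opposite sign. The average over s is left outside, so that the inner integral is a pairing
    of [g] with a translated test function. *)
Lemma conv_transfer1 : L1fun kap setT (fun s => a s * \int[leb]_y (g y * psi (y - th s))) /\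
  \int[leb]_x (psi x * \int[kap]_s (a s * g (x + th s))) =
  \int[kap]_s (a s * \int[leb]_y (g y * psi (y - th s))).
Proof.
have [A1 A2 A3 A4] := Rint_fubini (conv_integrable1 mth gL mpsi psiM aL).
have E1 s : \int[leb]_x (psi x * (a s * g (x + th s))) =
    a s * \int[leb]_y (g y * psi (y - th s)).
  have hL := bounded_mul_L1 mpsi psiM gL (th s).
  have [sL <-] := Rint_shift (th s) hL.
  rewrite -(RintZ measurableT _ sL); apply: Rint_ext => x _.
  by rewrite addrK; ring.
split; first by apply: (L1_ext measurableT _ A2) => s _; exact: E1.
transitivity (\int[kap]_s (\int[leb]_x (psi x * (a s * g (x + th s))))); last first.
  by apply: Rint_ext => s _; exact: E1.
rewrite -A3; apply: (ae_Rint measurableT).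
- exact: L1_meas A1.
- by apply: measurable_funM => //; exact: L1_meas conv_L1.
- apply: filterS conv_ae_L1 => x xL _.
  exact/esym/(RintZ measurableT (psi x) xL).
Qed.

(** A second use of Fubini brings the average inside, onto the translates of [psi]. Keeping it apart
    from [conv_transfer1] allows a weak gradient to be used between the two. *)
Lemma conv_transfer2 : L1fun leb setT (fun y => g y * \int[kap]_s (a s * psi (y - th s))) /\
  \int[kap]_s (a s * \int[leb]_y (g y * psi (y - th s))) =
  \int[leb]_y (g y * \int[kap]_s (a s * psi (y - th s))).
Proof.
have [B1 B2 B3 B4] := Rint_fubini (conv_integrable2 mth gL mpsi psiM aL).
have E1 s : \int[leb]_y (g y * (a s * psi (y - th s))) =
    a s * \int[leb]_y (g y * psi (y - th s)).
  have hL := bounded_mul_L1 mpsi psiM gL (th s).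
  rewrite -(RintZ measurableT _ hL); apply: Rint_ext => x _; ring.
have E2 y : \int[kap]_s (g y * (a s * psi (y - th s))) = g y * \int[kap]_s (a s * psi (y - th s)).
  rewrite RintZ//; apply: (L1_le measurableT (g := fun s => M * `|a s|)).
  - apply: measurable_funM => //; apply: measurableT_comp mpsi _.
    by apply: measurable_addrow => //; exact: measurable_opprow.
  - by move=> s _; rewrite normrM mulrC ler_wpM2r.
  - by apply: (L1Z measurableT); exact: L1_normr.
split; first by apply: (L1_ext measurableT _ B1) => y _; exact: E2.
rewrite -(Rint_ext _ (fun s _ => E1 s)) -(Rint_ext _ (fun y _ => E2 y)).
exact/esym/B3.
Qed.

End ConvolutionTransfer2.

Section RowCube.
Context (R : realType).
Local Notation leb n := (lebesgue_rV R n).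

Lemma measurable_cube n (M : R) : measurable [set x : 'rV[R]_n | forall i, `|x ord0 i| <= M].
Proof.
apply: (@measurable_coord_set _ _ (fun=> [set t : R | `|t| <= M])) => j.
have -> : [set t : R | `|t| <= M] = `[- M, M]%classic.
  by apply/seteqP; split => t /=; rewrite in_itv/= ler_norml.
exact: measurable_itv.
Qed.

Lemma lebesgue_cube_gt0 n (M : R) : 0 < M ->
  (0 < leb n [set x : 'rV[R]_n | forall i, `|x ord0 i| <= M]%R)%E.
Proof.
move=> M0; elim: n => [|n IHn].
  by rewrite /= diracE mem_set ?lte01//; case.
have mI : measurable ([set t : R | `|t| <= M] : set (measurableTypeR R)).
  rewrite (_ : [set _ | _] = `[-M, M]%classic)//.
  by apply/seteqP; split => t /=; rewrite in_itv/= ler_norml.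
rewrite /= /lebesgue_succ /pushforward.
have -> : @row_cons R n @^-1` [set x | forall i, `|x ord0 i| <= M] =
   [set t | `|t| <= M] `*` [set x : 'rV[R]_n | forall i, `|x ord0 i| <= M].
  apply/seteqP; split => -[t y] /=.
    move=> h; split.
      have := h (lshift n ord0 : 'I_(1 + n)).
      by rewrite /row_cons (row_mxEl (t%:M : 'M[R]_1) y) mxE eqxx mulr1n.
    move=> i; have := h (rshift 1 i : 'I_(1 + n)).
    by rewrite /row_cons (row_mxEr (t%:M : 'M[R]_1) y).
  move=> [ht hy] i; case: (split_ordP (i : 'I_(1 + n))) => j ->.
    by rewrite /row_cons (row_mxEl (t%:M : 'M[R]_1) y) mxE (ord1 j) eqxx mulr1n.
  by rewrite /row_cons (row_mxEr (t%:M : 'M[R]_1) y).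
rewrite (product_measure1E _ _ mI (measurable_cube M)); apply: mule_gt0 => //.
have -> : [set t : R | `|t| <= M] = `[-M, M]%classic.
  by apply/seteqP; split => t /=; rewrite in_itv/= ler_norml.
have h : (0 < (@lebesgue_measure R) (`[- M, M]%classic)%R)%E.
  have MM : - M < M by rewrite -subr_gt0 opprK addr_gt0.
  by rewrite lebesgue_measure_itv/= lte_fin MM -EFinB lte_fin subr_gt0.
exact: h.
Qed.

End RowCube.

(** * Product functions along a curve *)

Section ProductDerivative.
Context (R : realType).
Local Notation RT := (measurableTypeR R).
Local Notation time := (@lebesgue_measure R).

Lemma is_derive_congr (f g : R -> R) (t l l' : R) : is_derive t (1 : R) f l ->
  (forall x, f x = g x) -> l = l' -> is_derive t (1 : R) g l'.
Proof. by move=> fl /funext <- <-. Qed.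

Lemma is_derive_big_prod n (g : 'I_n -> R -> R) (dg : 'I_n -> R) (t : R) :
  (forall i, is_derive t (1 : R) (g i) (dg i)) ->
  is_derive t (1 : R) (fun s => \prod_(i < n) g i s)
    (\sum_(i < n) \prod_(j < n) (if j == i then dg j else g j t)).
Proof.
elim: n g dg => [|n IHn] g dg hg.
  rewrite big_ord0 (_ : (fun s => _) = cst 1); first exact: is_derive_cst.
  by apply/funext => s; rewrite big_ord0.
rewrite (_ : (fun s => _) = (fun s => g ord0 s * \prod_(i < n) g (lift ord0 i) s)); last first.
  by apply/funext => s; rewrite big_ord_recl.
have h := IHn (fun i => g (lift ord0 i)) (fun i => dg (lift ord0 i)) (fun i => hg _).
have := @is_deriveM R _ (g ord0) (fun s => \prod_(i < n) g (lift ord0 i) s) t 1 _ _ (hg ord0) h.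
move/is_derive_congr; apply => [//|]; rewrite big_ord_recl addrC; congr (_ + _).
  by rewrite big_ord_recl /= -[LHS]mulrC; congr (_ * _).
rewrite /GRing.scale/= mulr_sumr; apply: eq_bigr => i _.
by rewrite big_ord_recl/=; congr (_ * _); apply: eq_bigr => j _; rewrite (inj_eq lift_inj).
Qed.

Lemma Rint_FTC (T : R) (f df : R -> R) : 0 < T -> (forall x, is_derive x (1 : R) f (df x)) ->
  continuous df -> \int[time]_(x in `]0, T[) df x = f T - f 0.
Proof.
move=> T0 fd cf'.
have E x : derive1 f x = df x by rewrite derive1E; exact: derive_val.
have cf : continuous f.
  by move=> x; apply: differentiable_continuous; apply/derivable1_diffP; exact: ex_derive.
have h : (\int[time]_(x in `[0%R, T]) (df x)%:E = (f T)%:E - (f 0)%:E)%E.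
  apply: (@continuous_FTC2 R df f 0 T T0) => //.
    by apply: continuous_subspaceT => x; exact: cf'.
  split; first by move=> x _; exact: ex_derive.
    by apply: cvg_at_right_filter; exact: cf.
  by apply: cvg_at_left_filter; exact: cf.
rewrite /Rintegral -[RHS]/(fine ((f T)%:E - (f 0)%:E)%E) -h; congr fine.
rewrite (@integral_itv_bndoo _ 0 T (fun x => (df x)%:E) true false)//.
apply/measurable_EFinP.
exact: (cont_on_measurable (continuous_cont_on cf')).
Qed.

Lemma is_derive_pow4_affine (b : R -> R) (y c t : R) : (forall x, derivable b x 1) ->
  is_derive t (1 : R) (fun s => b (y - s ^+ 4 * c)) (- (4 * t ^+ 3 * c) * derive1 b (y - t ^+ 4 * c)).
Proof.
move=> db.
have h1 : is_derive t (1 : R) (fun s : R => y - s ^+ 4 * c) (- (4 * t ^+ 3 * c)).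
  have h : is_derive t (1 : R) (fun s : R => s ^+ 4) (4 * t ^+ 3).
    have := is_deriveX 4 (is_derive_id t (1 : R)).
    move/is_derive_congr; apply => [x|]; first by rewrite fctE.
    by rewrite /GRing.scale/= mulr1.
  have h2 := is_deriveM h (is_derive_cst c t (1 : R)).
  have := is_deriveB (is_derive_cst y t (1 : R)) h2.
  move/is_derive_congr; apply => [//|]; rewrite /GRing.scale/= mulr0 !add0r; congr (- _); rewrite /=; ring.
have h2 : is_derive (y - t ^+ 4 * c) (1 : R) b (derive1 b (y - t ^+ 4 * c)).
  by rewrite derive1E; apply: DeriveDef.
have := @is_derive1_comp R b (fun s : R => y - s ^+ 4 * c) t _ _ h2 h1.
by move/is_derive_congr; apply => //; rewrite mulrC.
Qed.

(** The fundamental theorem of calculus on [0, 1] along the curve t |-> y - t^4 xi, which runs from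
    y to y - xi. The choice of the fourth power is explained at [shift4]. *)
Lemma prodf_line_ftc d (b : 'I_d -> R -> R) (y xi : 'rV[R]_d) : (forall i, smooth (b i)) ->
  let df := fun t : R => \sum_(i < d) 4 * t ^+ 3 * xi ord0 i *
     prodf (upd b i (derive1 (b i))) (y - t ^+ 4 *: xi) in
  L1fun time `]0, 1[%classic df /\
  \int[time]_(t in `]0, 1[) df t = prodf b y - prodf b (y - xi).
Proof.
move=> sb; pose f t := \prod_(i < d) b i (y ord0 i - t ^+ 4 * xi ord0 i).
move=> df; have fE t : f t = prodf b (y - t ^+ 4 *: xi).
  by rewrite /f /prodf; apply: eq_bigr => i _; rewrite !mxE.
have fd t : is_derive t (1 : R) f (- df t).
  have := is_derive_big_prod (fun i => is_derive_pow4_affine (y ord0 i) (xi ord0 i) t (fun x => @smooth_derivable R (b i) x (sb i))).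
  move/is_derive_congr; apply => [//|]; rewrite /df -sumrN; apply: eq_bigr => i _.
  rewrite prodf_upd (bigD1 i)//= eqxx.
  rewrite (eq_bigr (fun j => b j ((y - t ^+ 4 *: xi) ord0 j))); last first.
    by move=> j /negPf ->; rewrite !mxE.
  by move: (\prod_(j < d | j != i) _) => P; rewrite !mxE; ring.
have cdf : continuous (fun t => - df t).
  have cpow k : continuous (fun t : R => t ^+ k) by move=> t; exact: exprn_continuous.
  have cfac i j : continuous (fun t : R => (if j == i then derive1 (b j) else b j) (y ord0 j - t ^+ 4 * xi ord0 j)).
    have cc : continuous (if j == i then derive1 (b j) else b j).
      by case: (j == i); [exact: smooth_continuous (smooth_derive1 (sb j))|exact: smooth_continuous].
    move=> t; apply: (@continuous_comp _ _ _ (fun t : R => y ord0 j - t ^+ 4 * xi ord0 j)); last exact: cc.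
    by apply: cvgB; [exact: cvg_cst|apply: cvgMr_tmp; exact: cpow].
  have cprod i : continuous (fun t : R => prodf (upd b i (derive1 (b i))) (y - t ^+ 4 *: xi)).
    rewrite (_ : (fun t => _) = \prod_(j < d) (fun t : R => (if j == i then derive1 (b j) else b j) (y ord0 j - t ^+ 4 * xi ord0 j))).
      apply: (@big_ind (R -> R) (fun f => continuous f)) => [|f1 f2 c1 c2|j _].
      - by rewrite (_ : 1 = cst 1)//; exact: cst_continuous.
      - by move=> t; exact: (cvgM (c1 t) (c2 t)).
      - exact: cfac.
    apply/funext => t; rewrite fct_prodE /prodf; apply: eq_bigr => j _.
    by rewrite /upd !mxE; case: eqP => [->|].
  rewrite (_ : (fun t => _) = \sum_(i < d) (fun t : R => - (4 * t ^+ 3 * xi ord0 i * prodf (upd b i (derive1 (b i))) (y - t ^+ 4 *: xi)))).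
    apply: (@big_ind (R -> R) (fun f => continuous f)) => [|f1 f2 c1 c2|j _].
    - by rewrite (_ : 0 = cst 0)//; exact: cst_continuous.
    - by move=> t; exact: (cvgD (c1 t) (c2 t)).
    - move=> t; apply: cvgN; apply: cvgM; last exact: cprod.
      by apply: cvgMr_tmp; apply: cvgMr; exact: cpow.
  by apply/funext => t; rewrite fct_sumE /df -sumrN.
have := Rint_FTC ltr01 fd cdf.
rewrite !fE expr1n scale1r expr0n/= scale0r subr0 => h.
have dfL : L1fun time `]0, 1[%classic (fun t => - df t) := cont_on_L1 ltr01 (continuous_cont_on cdf).
have dfE : (fun t => - - df t) = df by apply/funext => t; rewrite opprK.
split; first by have := L1N dfL; rewrite dfE.
rewrite -[RHS]opprB -h.
by rewrite -(RintN (measurable_itvT _) dfL) dfE.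
Qed.

End ProductDerivative.

Section LebesgueSuccFubini.
Context (R : realType) (n : nat).
Local Notation leb n := (lebesgue_rV R n).
Local Notation RT := (measurableTypeR R).
Local Notation time := (@lebesgue_measure R).

Lemma Rint_lebesgue_succ (F : 'rV[R]_n.+1 -> R) : L1fun (leb n.+1) setT F ->
  [/\ L1fun time setT (fun t : R => \int[leb n]_y F (row_cons (t, y)) : R),
      \int[leb n.+1]_x F x = \int[time]_t \int[leb n]_y F (row_cons (t, y)),
      \int[leb n.+1]_x F x = \int[leb n]_y \int[time]_t F (row_cons (t, y)) &
      {ae time, forall t : R, L1fun (leb n) setT (fun y => F (row_cons (t, y)))}].
Proof.
move=> FL; have mF := L1_meas FL.
have mc : measurable_fun setT (fun z : RT * 'rV[R]_n => F (row_cons z)).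
  exact: (measurableT_comp mF (@measurable_row_consT R n)).
have Fi : (time \x leb n)%E.-integrable setT (EFin \o (fun z : RT * 'rV[R]_n => F (row_cons z))).
  apply/integrable12ltyP; first exact/measurable_EFinP.
  have [_] := (L1P (R := R) (leb n.+1) setT F).1 FL.
  rewrite (integral_lebesgue_succ (f := fun x => `|F x|%:E))//.
  by apply/measurable_EFinP; exact: measurableT_comp.
have E : \int[leb n.+1]_x F x = \int[time]_t \int[leb n]_y F (row_cons (t, y)).
  have [A1 A2] := L1_fine measurableT (integrable_fubini_F Fi).
  transitivity (fine (\int[time]_x fubini_F (leb n) (EFin \o (fun z : RT * 'rV[R]_n => F (row_cons z))) x)%E); last by rewrite -A2.
  rewrite (integral12_prod_meas1 Fi) /Rintegral; congr fine.
  apply: (integral_image (@measurable_row_consT R n) (mu := (time \x leb n)%E)) => //.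
  exact/measurable_EFinP.
have [h1 h2 h3 h4] := Rint_fubini Fi.
by split => //; rewrite E.
Qed.

End LebesgueSuccFubini.

Lemma bump_shift (R : realType) (a b c x : R) k : bump (a + c) (b + c) k x = bump a b k (x - c).
Proof.
rewrite /bump; congr (smooth_step _ * smooth_step _); ring.
Qed.

Lemma box_bump_shift (R : realType) d (a b c : 'rV[R]_d) k x :
  box_bump (a + c) (b + c) k x = box_bump a b k (x - c).
Proof. by apply: eq_bigr => i _; rewrite !mxE bump_shift. Qed.

Lemma derive_shift (R : realType) d (psi : 'rV[R]_d -> R) (v c x : 'rV[R]_d) :
  'D_v (fun y => psi (y - c)) x = 'D_v psi (x - c).
Proof.
have E : (fun h : R => h^-1 *: (((fun y => psi (y - c)) \o shift x) (h *: v) - psi (x - c)))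
   = (fun h : R => h^-1 *: ((psi \o shift (x - c)) (h *: v) - psi (x - c))).
  by apply/funext => h /=; rewrite addrA.
by rewrite /derive E.
Qed.

(** * Sobolev's integral representation on a cone *)

Section WeakTaylor.
Context (R : realType) (d : nat) (Om : set 'rV[R]_d).
Local Notation vec := 'rV[R]_d.
Local Notation leb := (lebesgue_rV R d).
Local Notation kap := (lebesgue_rV R d.+1).
Local Notation RT := (measurableTypeR R).
Local Notation time := (@lebesgue_measure R).
Local Notation scal := ('rV[R]_d -> R).
Hypothesis oO : open Om.
Hypothesis finO : (leb Om < +oo)%E.
Variables (p xi0 : vec) (r dl : R).
Hypothesis r0 : 0 < r.
Hypothesis dl0 : 0 < dl.
Hypothesis cone : cone_at Om p xi0 r dl.

Let mO : measurable Om. Proof. exact: open_measurable_rV. Qed.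

Definition cone_dom : set vec := Om `&` [set x | `|p - x| < r].

Let A := cone_dom.

Definition cone_base : set vec := [set xi | forall i, `|(xi - xi0) ord0 i| <= dl / 2].

Let K := cone_base.

(* A point of R^(d+1) encodes the pair of a parameter t and a direction xi. *)
Definition par (s : 'rV[R]_d.+1) : R := (row_uncons s).1.
Definition dir (s : 'rV[R]_d.+1) : vec := (row_uncons s).2.
Definition wt (s : 'rV[R]_d.+1) : R := \1_K (dir s) * \1_(`]0, 1[%classic) (par s).
(** The curve t^4 xi has speed 4 t^3 xi. Two Cauchy-Schwarz steps turn this weight into t^12, which
    has to compensate the Jacobian t^(-4d) of xi |-> t^4 xi. With t^p the condition reads 4(p-1) >=
    pd, and p = 4 is the least integer that works for d = 3. *)
Definition shift4 (s : 'rV[R]_d.+1) : vec := par s ^+ 4 *: dir s.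

Lemma par_cons t xi : par (row_cons (t, xi)) = t.
Proof. by rewrite /par row_consK. Qed.

Lemma dir_cons t xi : dir (row_cons (t, xi)) = xi.
Proof. by rewrite /dir row_consK. Qed.

Lemma open_cone_dom : open A.
Proof.
apply: openI => //; have -> : [set x : vec | `|p - x| < r] = ball p r by rewrite -ball_normE.
exact: ball_open.
Qed.

Lemma measurable_cone_base : measurable K.
Proof.
have := @measurable_cube R d (dl / 2); rewrite -[X in measurable X -> _]setTI => h.
have := @measurable_affine_rV R d 1 (- xi0) measurableT _ (@measurable_cube R d (dl / 2)).
rewrite setTI; congr measurable.
by apply/seteqP; split => x /= hx i; have := hx i; rewrite scale1r.
Qed.

Lemma lebesgue_cone_base : (0 < leb K)%E /\ (leb K < +oo)%E.
Proof.
have E : leb K = leb [set x : vec | forall i, `|x ord0 i| <= dl / 2].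
  by rewrite -(lebesgue_shift (- xi0) (@measurable_cube R d (dl / 2))).
rewrite E; split; last exact: lebesgue_cbox_finite.
by apply: lebesgue_cube_gt0; rewrite divr_gt0.
Qed.

Lemma cone_base_norm xi : K xi -> `|xi - xi0| < dl.
Proof.
move=> Kxi; apply: (@le_lt_trans _ _ (dl / 2)).
  by apply: normr_rV_le => //; rewrite divr_ge0// ltW.
by rewrite ltr_pdivrMr// ltr_pMr// ltr1n.
Qed.

Lemma coneP x xi s : A x -> K xi -> 0 <= s <= 1 -> Om (s *: xi + x).
Proof. by move=> [Ox xr] /cone_base_norm Kxi s01; exact: cone. Qed.

Lemma measurable_par : measurable_fun setT par.
Proof. by apply: (measurableT_comp measurable_fst); exact: measurable_row_uncons. Qed.

Lemma measurable_dir : measurable_fun setT dir.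
Proof. by apply: (measurableT_comp measurable_snd); exact: measurable_row_uncons. Qed.

Lemma measurable_shift4 : measurable_fun setT shift4.
Proof.
apply: measurable_fun_rowP => i.
rewrite (_ : (fun _ => _) = (fun s => par s ^+ 4 * dir s ord0 i)); last first.
  by apply/funext => s; rewrite mxE.
apply: measurable_funM; first by apply: measurable_funX; exact: measurable_par.
apply: (measurableT_comp (measurable_coord (R := R) i)); exact: measurable_dir.
Qed.

Lemma measurable_wt : measurable_fun setT wt.
Proof.
apply: measurable_funM.
  apply: (@measurableT_comp _ _ _ _ _ _ (\1_K : vec -> R)); last exact: measurable_dir.
  exact: measurable_indic measurable_cone_base.
apply: (@measurableT_comp _ _ _ _ _ _ (\1_(`]0, 1[%classic) : R -> R)); last exact: measurable_par.
exact: measurable_indic.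
Qed.

Lemma wt_ge0 s : 0 <= wt s. Proof. by rewrite mulr_ge0. Qed.

Lemma wt_neq0 s : wt s != 0 -> [/\ K (dir s), 0 < par s < 1 & wt s = 1].
Proof.
rewrite /wt !indicE mulf_eq0 negb_or.
case: (boolP (dir s \in K)) => [|_]; last by rewrite eqxx.
case: (boolP (par s \in _)) => [|_]; last by rewrite eqxx andbF.
by rewrite !in_setE/= in_itv/= => h1 h2 _; rewrite mulr1.
Qed.

Lemma wt_L1 : L1fun kap setT wt.
Proof.
apply: (L1_ge0 measurable_wt) => [s _|]; first exact: wt_ge0.
rewrite (integral_lebesgue_succ (f := fun s => (wt s)%:E)); last 2 first.
- by apply/measurable_EFinP; exact: measurable_wt.
- by move=> x; rewrite lee_fin wt_ge0.
under eq_integral => t _.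
  under eq_integral => xi _ do rewrite /wt par_cons dir_cons mulrC EFinM.
  rewrite ge0_integralZl//; [|by apply/measurable_EFinP; apply: measurable_indic; exact: measurable_cone_base].
  rewrite integral_indic//; last exact: measurable_cone_base.
  rewrite setIT muleC.
over.
rewrite ge0_integralZl//=; last first.
- by apply/measurable_EFinP; exact: measurable_indic.
rewrite integral_indic// setIT lte_mul_pinfty//.
  rewrite ge0_fin_numE//; exact: lebesgue_cone_base.2.
exact: (@time_finite R 1).
Qed.

Definition cone_mass : R := \int[kap]_s wt s.

(** The weight times the i-th component of the velocity of t |-> t^4 xi. *)
Definition dwt i (s : 'rV[R]_d.+1) : R := wt s * (4 * par s ^+ 3 * dir s ord0 i).

Lemma dwt_le i s : `|dwt i s| <= 4 * (`|xi0| + dl) * (wt s * par s ^+ 3).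
Proof.
have [w0|/wt_neq0[Ks /andP[t0 t1] w1]] := eqVneq (wt s) 0.
  by rewrite /dwt w0 !mul0r normr0 mulr0.
have n4 : `|4 * par s ^+ 3| = 4 * par s ^+ 3.
  by rewrite ger0_norm// mulr_ge0// exprn_ge0// ltW.
rewrite /dwt w1 !mul1r normrM n4 mulrAC ler_wpM2r ?exprn_ge0 ?(ltW t0)// ler_wpM2l//.
have := cone_base_norm Ks; have := ler_coord_norm (dir s) i.
have := ler_normD xi0 (dir s - xi0); rewrite addrC subrK.
move: (`|dir s|) (`|xi0|) (`|dir s ord0 i|) (`|_ - _|) => x1 x2 x3 x4 h1 h2 h3.
by rewrite (le_trans h2)// (le_trans h1)// lerD2l ltW.
Qed.

Lemma measurable_dwt i : measurable_fun setT (dwt i).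
Proof.
apply: measurable_funM; first exact: measurable_wt.
apply: measurable_funM; last first.
  by apply: (measurableT_comp (measurable_coord (R := R) i)); exact: measurable_dir.
by apply: measurable_funM => //; apply: measurable_funX; exact: measurable_par.
Qed.

Lemma dwt_L1 i : L1fun kap setT (dwt i).
Proof.
apply: (L1_le measurableT (measurable_dwt i) (g := fun s => 4 * (`|xi0| + dl) * wt s)).
  move=> s _; apply: le_trans (dwt_le i s) _.
  rewrite ler_wpM2l ?mulr_ge0 ?addr_ge0 ?(ltW dl0)//.
  have [->|/wt_neq0[_ /andP[t0 t1] ->]] := eqVneq (wt s) 0; first by rewrite mul0r.
  by rewrite mul1r exprn_ile1 ?ltW.
exact: (L1Z measurableT _ wt_L1).
Qed.

Lemma ext_in (f : scal) x : Om x -> (f \_ Om) x = f x.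
Proof. by move=> Ox; rewrite patchE mem_set. Qed.

Lemma ext_out (f : scal) x : ~ Om x -> (f \_ Om) x = 0.
Proof. by move=> Ox; rewrite patchE memNset. Qed.

Lemma ext_L1 (f : scal) : L1fun leb Om f -> L1fun leb setT (f \_ Om).
Proof.
move=> fL; apply: (@L1_supp _ _ R leb Om _ mO); first by move=> x; exact: ext_out.
by apply: (L1_ext mO _ fL) => x Ox; rewrite ext_in.
Qed.

Lemma Rint_ext_out (f g : scal) : \int[leb]_x ((f \_ Om) x * g x) = \int[leb]_(x in Om) (f x * g x).
Proof.
rewrite -(@Rint_supp _ _ R leb Om); last by move=> x /ext_out ->; rewrite mul0r.
by apply: Rint_ext => x Ox; rewrite ext_in.
Qed.

Section Identity.
Variables (a b : vec) (k : nat).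
Hypothesis abA : obox a b `<=` A.

Let bb i := bump (a ord0 i) (b ord0 i) k.
Let psi := box_bump a b k.
Let dpsi i : scal := prodf (upd bb i (derive1 (bb i))).

Lemma box_bump_derive i x : 'D_(unitv R i) psi x = dpsi i x.
Proof.
have := @is_derive_prodf R d bb i x (@smooth_derivable R (bb i) _ (smooth_bump _ _ _)).
by move=> h; exact: derive_val.
Qed.

(** The cone property keeps the translated support inside [Om], so that the weak gradient of a
    function on [Om] may be tested with the translate. *)
Lemma test_translate s : wt s != 0 -> test_function Om (fun y => psi (y - shift4 s)).
Proof.
move=> /wt_neq0[Ks /andP[t0 t1] _].
rewrite (_ : (fun y => _) = box_bump (a + shift4 s) (b + shift4 s) k); last first.
  by apply/funext => y; rewrite box_bump_shift.
apply: test_box_bump => x hx.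
have : A (x - shift4 s).
  apply: abA => i; have := hx i; rewrite !mxE => /andP[h1 h2].
  by rewrite ltrBrDr h1 ltrBlDr h2.
move=> /(coneP)/(_ Ks (_ : 0 <= par s ^+ 4 <= 1)); rewrite -/(shift4 s) addrC subrK; apply.
by rewrite exprn_ge0 ?(ltW t0)//= exprn_ile1 ?(ltW t0) ?(ltW t1).
Qed.

Lemma psi_le1 x : `|psi x| <= 1.
Proof. by rewrite ger0_norm ?box_bump_ge0// box_bump_le1. Qed.

Lemma test_psi : test_function Om psi.
Proof. by apply: test_box_bump => x /abA[]. Qed.

Lemma measurable_dpsi i : measurable_fun setT (dpsi i).
Proof.
apply: measurable_prodf => j; rewrite /upd; case: (j == i).
  exact/smooth_continuous/smooth_derive1/smooth_bump.
exact/smooth_continuous/smooth_bump.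
Qed.

Lemma dpsi_bounded i : exists M : R, forall x, `|dpsi i x| <= M.
Proof.
have [_ [M hM]] := test_function_derive_bounded i test_psi.
by exists M => x; rewrite -box_bump_derive.
Qed.

Lemma Rint_unit_cst (c : R) : \int[time]_(t in `]0, 1[) c = c.
Proof.
have dc x : is_derive (x : R) (1 : R) (fun t : R => c * t) c.
  have := is_deriveM (is_derive_cst c x (1 : R)) (is_derive_id x (1 : R)).
  by move/is_derive_congr; apply => [//|]; rewrite /GRing.scale/= !mulr0 addr0 mulr1.
have cc : continuous (fun _ : R => c) by move=> ?; exact: cvg_cst.
have := Rint_FTC ltr01 dc cc.
by rewrite mulr1 mulr0 subr0.
Qed.

(** [prodf_line_ftc] integrated over all directions of the cone base: the endpoint term and the
    averaged derivatives add up to the total weight times [psi y]. *)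
Lemma bracket y : \int[kap]_s (wt s * psi (y - dir s)) +
  \sum_(i < d) \int[kap]_s (dwt i s * dpsi i (y - shift4 s)) = cone_mass * psi y.
Proof.
have mpsi : measurable_fun setT psi by exact: measurable_box_bump.
have L1a : L1fun kap setT (fun s => wt s * psi (y - dir s)).
  apply: (L1_le measurableT _ _ wt_L1).
    apply: measurable_funM; first exact: measurable_wt.
    apply: (measurableT_comp mpsi); apply: measurable_addrow => //.
    apply: measurable_opprow; exact: measurable_dir.
  by move=> s _; rewrite normrM (ger0_norm (wt_ge0 s)) ler_piMr ?wt_ge0// psi_le1.
have L1b i : L1fun kap setT (fun s => dwt i s * dpsi i (y - shift4 s)).
  have [M hM] := dpsi_bounded i.
  apply: (L1_le measurableT (g := fun s => M * `|dwt i s|)).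
  - apply: measurable_funM; first exact: measurable_dwt.
    apply: (measurableT_comp (measurable_dpsi i)); apply: measurable_addrow => //.
    apply: measurable_opprow; exact: measurable_shift4.
  - by move=> s _; rewrite normrM mulrC ler_wpM2r.
  - exact/(L1Z measurableT)/L1_normr/dwt_L1.
have L1s := L1_sum measurableT L1b.
have L1c := L1Z measurableT (psi y) wt_L1.
apply/eqP; rewrite -subr_eq0 -(Rint_sum measurableT L1b) -(RintD measurableT L1a L1s).
rewrite mulrC -(RintZ measurableT (psi y) wt_L1) -(RintB measurableT (L1D measurableT L1a L1s) L1c).
have [_ _ -> _] := Rint_lebesgue_succ (L1B measurableT (L1D measurableT L1a L1s) L1c).
apply/eqP; rewrite -[RHS](@Rint0 _ _ R leb setT measurableT); apply: Rint_ext => xi _.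
have [dL dE] := prodf_line_ftc y xi (fun i => smooth_bump (a ord0 i) (b ord0 i) k).
pose c := psi (y - xi) - psi y.
pose df (t : R) := \sum_(i < d) 4 * t ^+ 3 * xi ord0 i * dpsi i (y - t ^+ 4 *: xi).
transitivity (\int[time]_t (\1_(`]0, 1[%classic) t * (\1_K xi * (c + df t)))).
  apply: Rint_ext => t _; rewrite /df /c.
  have E1 : \sum_(i < d) dwt i (row_cons (t, xi)) * dpsi i (y - shift4 (row_cons (t, xi))) =
    \1_(`]0, 1[%classic) t * (\1_K xi * \sum_(i < d) 4 * t ^+ 3 * xi ord0 i * dpsi i (y - t ^+ 4 *: xi)).
    rewrite !mulr_sumr; apply: eq_bigr => i _; rewrite /dwt /wt /shift4 !par_cons !dir_cons.
    by move: (dpsi i _) (\1_K xi) (\1__ t) => x1 x2 x3; ring.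
  rewrite E1 /wt !par_cons !dir_cons.
  by move: (\sum_(i < d) _) (psi (y - xi)) (psi y) (\1_K xi) (\1__ t) => x1 x2 x3 x4 x5; ring.
rewrite Rint_indic setTI.
have m01 := @measurable_itvT R (Interval (BRight 0) (BLeft 1)).
have cL : L1fun time `]0, 1[%classic (fun=> c).
  by apply: L1_cst => //; exact: time_finite.
rewrite (RintZ m01 (\1_K xi) (L1D m01 cL dL)) (RintD m01 cL dL) Rint_unit_cst dE.
by rewrite /c /psi /box_bump; move: (prodf _ y) (prodf _ (y - xi)) => x1 x2; ring.
Qed.

(** Both averages are transferred to the test function. The weak gradient of [f] replaces gradient
    components by derivatives of translates of [psi], and [bracket] then makes the integrand against
    [f] vanish. *)
Lemma conv_test (f : scal) : H1 Om f ->
  \int[leb]_x (psi x * (\int[kap]_s (wt s * (f \_ Om) (x + dir s)) -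
     \sum_(i < d) \int[kap]_s (dwt i s * (component (wgrad Om f) i \_ Om) (x + shift4 s))
     - cone_mass * (f \_ Om) x)) = 0.
Proof.
move=> fH; have [GL fG] := wgradP fH.
have mpsi : measurable_fun setT psi by exact: measurable_box_bump.
have fL := ext_L1 (L2_L1 mO finO (H1_L2 fH)).
have gL i := ext_L1 (L2_L1 mO finO (GL i)).
have [M1 M2] := conv_transfer1 measurable_dir fL mpsi psi_le1 wt_L1.
have [M3 M4] := conv_transfer2 measurable_dir fL mpsi psi_le1 wt_L1.
have N0 i : L1fun leb setT (fun y => (f \_ Om) y * \int[kap]_s (dwt i s * dpsi i (y - shift4 s))) /\
  \int[leb]_x (psi x * \int[kap]_s (dwt i s * (component (wgrad Om f) i \_ Om) (x + shift4 s)))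
   = - \int[leb]_y ((f \_ Om) y * \int[kap]_s (dwt i s * dpsi i (y - shift4 s))).
  have [N1 ->] := conv_transfer1 measurable_shift4 (gL i) mpsi psi_le1 (dwt_L1 i).
  have [M hM] := dpsi_bounded i.
  have [N3 E3] := conv_transfer2 measurable_shift4 fL (measurable_dpsi i) hM (dwt_L1 i).
  split; first exact: N3.
  rewrite -E3.
  have [N5 _] := conv_transfer1 measurable_shift4 fL (measurable_dpsi i) hM (dwt_L1 i).
  rewrite -(RintN measurableT N5); apply: Rint_ext => s _.
  have [w0|w0] := eqVneq (wt s) 0; first by rewrite /dwt w0 !mul0r oppr0.
  rewrite -mulrN; congr (_ * _); rewrite !Rint_ext_out.
  have := fG i _ (test_translate w0); rewrite /inner => fGi.
  apply/eqP; rewrite -eqr_oppLR -fGi; apply/eqP; apply: Rint_ext => y _.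
  by rewrite derive_shift box_bump_derive.
have PL (h : scal) : L1fun leb setT h -> L1fun leb setT (fun x => psi x * h x).
  move=> hL; apply: (L1_le measurableT _ _ (L1_normr hL)).
    by apply: measurable_funM => //; exact: L1_meas hL.
  by move=> x _; rewrite normrM ler_piMl// psi_le1.
have ML := PL _ (conv_L1 measurable_dir fL wt_L1).
have NL i := PL _ (conv_L1 measurable_shift4 (gL i) (dwt_L1 i)).
have FL := PL _ fL.
have SL := L1_sum measurableT NL.
transitivity (\int[leb]_x (psi x * (\int[kap]_s (wt s * (f \_ Om) (x + dir s))) -
     \sum_(i < d) psi x * (\int[kap]_s (dwt i s * (component (wgrad Om f) i \_ Om) (x + shift4 s)))
     - cone_mass * (psi x * (f \_ Om) x))).
  by apply: Rint_ext => x _; rewrite !mulrBr mulr_sumr mulrCA.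
rewrite (RintB measurableT (L1B measurableT ML SL) (L1Z measurableT cone_mass FL)).
rewrite (RintB measurableT ML SL) (Rint_sum measurableT NL) (RintZ measurableT cone_mass FL) M2 M4.
rewrite (eq_bigr _ (fun i _ => (N0 i).2)) sumrN opprK.
have QL i := (N0 i).1; have QS := L1_sum measurableT QL.
rewrite -(Rint_sum measurableT QL) -(RintD measurableT M3 QS) -(RintZ measurableT cone_mass FL).
rewrite -(RintB measurableT (L1D measurableT M3 QS) (L1Z measurableT cone_mass FL)).
rewrite -[RHS](@Rint0 _ _ R leb setT measurableT); apply: Rint_ext => y _.
rewrite -mulr_sumr -mulrDr bracket; ring.
Qed.

End Identity.

(** For smooth functions this is the average over the cone of f(x + xi) - f(x), written as an
    integral of the gradient along t^4 xi. Here it is known only against bumps supported in the cone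
    domain, and [du_bois_reymond] makes it pointwise. *)
Lemma weak_taylor (f : scal) : H1 Om f -> {ae leb, forall x, A x ->
  cone_mass * (f \_ Om) x = \int[kap]_s (wt s * (f \_ Om) (x + dir s)) -
     \sum_(i < d) \int[kap]_s (dwt i s * (component (wgrad Om f) i \_ Om) (x + shift4 s))}.
Proof.
move=> fH; have [GL fG] := wgradP fH.
have fL := ext_L1 (L2_L1 mO finO (H1_L2 fH)).
have gL i := ext_L1 (L2_L1 mO finO (GL i)).
have NS := L1_sum measurableT (fun i => conv_L1 measurable_shift4 (gL i) (dwt_L1 i)).
have HL := L1B measurableT (L1B measurableT (conv_L1 measurable_dir fL wt_L1) NS)
  (L1Z measurableT cone_mass fL).
have mA : measurable A by apply: open_measurable_rV; exact: open_cone_dom.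
have HA := L1_subset measurableT mA (@subsetT _ A) HL.
have h := @du_bois_reymond R d A _ open_cone_dom HA.
suff h' : forall a b k, obox a b `<=` A -> \int[leb]_(x in A)
   ((\int[kap]_s (wt s * (f \_ Om) (x + dir s)) -
     \sum_(i < d) \int[kap]_s (dwt i s * (component (wgrad Om f) i \_ Om) (x + shift4 s))
     - cone_mass * (f \_ Om) x) * box_bump a b k x) = 0.
  by apply: filterS (h h') => x /= + Ax => /(_ Ax)/eqP; rewrite subr_eq0 => /eqP ->.
move=> a b k abA; rewrite -[RHS](conv_test k abA fH) Rint_supp; last first.
  move=> x nA; have [->|px] := eqVneq (box_bump a b k x) 0; first by rewrite mulr0.
  have [h1 h2] := box_bump_cbox a b k.
  by exfalso; apply: nA; apply: abA; apply: h2; exact: h1.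
by apply: Rint_ext => x _; rewrite mulrC.
Qed.

End WeakTaylor.

Lemma sqr_sum_le (R : realFieldType) n (a : 'I_n -> R) :
  (\sum_i a i) ^+ 2 <= n%:R * \sum_i a i ^+ 2.
Proof.
elim: n a => [|n IHn] a; first by rewrite !big_ord0 expr0n mulr0.
rewrite !big_ord_recl; have := IHn (fun i => a (lift ord0 i)).
set s := \sum_(i < n) _; set q := \sum_(i < n) _ ^+ 2 => h.
have q0 : 0 <= q by apply: sumr_ge0 => i _; rewrite sqr_ge0.
have [n0|n0] := posnP n.
  have s0 : s = 0 by rewrite /s; move: (a) => b; subst n; rewrite big_ord0.
  have q00 : q = 0 by rewrite /q; move: (a) => b; subst n; rewrite big_ord0.
  by rewrite s0 q00 !addr0 ler_peMl ?sqr_ge0// ler1n.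
have nR : 0 < n%:R :> R by rewrite ltr0n.
rewrite -natr1; move: (n%:R) (a ord0) nR h q0 => N x nR h q0.
have : 0 <= N^-1 * (N * x - s) ^+ 2 by rewrite mulr_ge0 ?sqr_ge0// invr_ge0 ltW.
have -> : N^-1 * (N * x - s) ^+ 2 = N * x ^+ 2 - 2 * (s * x) + N^-1 * s ^+ 2.
  by field; rewrite gt_eqF.
have : N^-1 * s ^+ 2 <= q by rewrite mulrC ler_pdivrMr// mulrC.
move: (N^-1 * _) => r h1 h2; nra.
Qed.

Lemma pow4_sum_le (R : realFieldType) n (a : 'I_n -> R) :
  (\sum_i a i) ^+ 4 <= n%:R ^+ 3 * \sum_i a i ^+ 4.
Proof.
have h1 := sqr_sum_le a; have h2 := sqr_sum_le (fun i => a i ^+ 2).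
have -> : (\sum_i a i) ^+ 4 = ((\sum_i a i) ^+ 2) ^+ 2 by rewrite -exprM.
apply: (@le_trans _ _ ((n%:R * \sum_i a i ^+ 2) ^+ 2)).
  by rewrite ler_sqr ?nnegrE ?sqr_ge0// mulr_ge0// sumr_ge0// => i _; rewrite sqr_ge0.
rewrite exprMn [n%:R ^+ 3]exprSr -mulrA ler_wpM2l ?sqr_ge0//.
have E : \sum_i (a i ^+ 2) ^+ 2 = \sum_i a i ^+ 4 by apply: eq_bigr => i _; rewrite -exprM.
by rewrite -E.
Qed.

Lemma unit_indic (R : realType) :
  L1fun (@lebesgue_measure R) setT (\1_(`]0, 1[%classic : set (measurableTypeR R)) : measurableTypeR R -> R) /\
  \int[@lebesgue_measure R]_t (\1_(`]0, 1[%classic) t : R) = 1.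
Proof.
have mI := @measurable_itvT R (Interval (BRight 0) (BLeft 1)).
split.
  apply: (@L1_supp _ (measurableTypeR R) R (@lebesgue_measure R) `]0, 1[%classic _ mI) => [t nt|]; first by rewrite indicE memNset.
  apply: (L1_ext mI (f := fun=> 1)) => [t It|]; first by rewrite indicE mem_set.
  by apply: L1_cst => //; exact: time_finite.
transitivity (\int[@lebesgue_measure R]_t (\1_(`]0, 1[%classic) t * (1 : R))).
  by apply: Rint_ext => t _; rewrite mulr1.
by rewrite Rint_indic setTI Rint_unit_cst.
Qed.

(** * The L4 estimate near a point *)

Section LocalSobolev.
Context (R : realType) (d : nat) (Om : set 'rV[R]_d).
Local Notation vec := 'rV[R]_d.
Local Notation leb := (lebesgue_rV R d).
Local Notation kap := (lebesgue_rV R d.+1).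
Local Notation RT := (measurableTypeR R).
Local Notation time := (@lebesgue_measure R).
Local Notation scal := ('rV[R]_d -> R).
Hypothesis d3 : (d <= 3)%N.
Hypothesis oO : open Om.
Hypothesis finO : (leb Om < +oo)%E.
Variables (p xi0 : vec) (r dl : R).
Hypothesis dl0 : 0 < dl.
Hypothesis cone : cone_at Om p xi0 r dl.

Let mO : measurable Om. Proof. exact: open_measurable_rV. Qed.
Local Notation A := (cone_dom Om p r).
Local Notation K := (cone_base xi0 dl).
Local Notation wgt := (wt xi0 dl).
Local Notation cK := (cone_mass xi0 dl).

Let wL1 := wt_L1 xi0 dl0.

Lemma wt_sqr s : wgt s ^+ 2 = wgt s.
Proof. by have [->|/wt_neq0[_ _ ->]] := eqVneq (wgt s) 0; rewrite ?expr0n ?expr1n. Qed.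

Lemma wt_cons_in t y : 0 < t < 1 -> wgt (row_cons (t, y)) = \1_K y.
Proof.
by move=> t01; rewrite /wt par_cons dir_cons [X in _ * X]indicE mem_set ?mulr1//= in_itv.
Qed.

Lemma wt_cons_out t y : ~~ (0 < t < 1) -> wgt (row_cons (t, y)) = 0.
Proof.
move=> /negP t01; rewrite /wt par_cons dir_cons [X in _ * X]indicE memNset ?mulr0//=.
Qed.

Lemma cone_mass_ge0 : 0 <= cK.
Proof. by apply: Rintegral_ge0 => s _; exact: wt_ge0. Qed.

Lemma ext_L2 (g : scal) : L2 Om g -> L2fun leb setT (g \_ Om).
Proof.
move=> [mg gL]; split; first exact: (measurable_restrictT g mO).1 mg.
rewrite (_ : (fun x => ((g \_ Om) x ^+ 2)%:E) = (fun x => (g x ^+ 2)%:E) \_ Om).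
  by rewrite -integral_mkcond.
by apply/funext => x; rewrite !patchE; case: ifP => // _; rewrite expr0n.
Qed.

Lemma ext_sqr (g : scal) : \int[leb]_x ((g \_ Om) x ^+ 2) = inner Om g g.
Proof.
rewrite /inner -Rint_ext_out; apply: Rint_ext => x _.
by rewrite patchE; case: ifP => // _; rewrite ?expr2 ?expr0n ?mul0r.
Qed.

Section Scaling.
Variable g : scal.
Hypothesis gL : L2fun leb setT g.
Let B := \int[leb]_x (g x ^+ 2).
Let mg : measurable_fun setT g. Proof. exact: L2_meas gL. Qed.
Let g2L : L1fun leb setT (fun x => g x ^+ 2). Proof. exact: L2_sqr gL. Qed.

Lemma B_ge0 : 0 <= B. Proof. by apply: Rintegral_ge0 => x _; rewrite sqr_ge0. Qed.

Let Q x := \int[kap]_s (wgt s * g (x + shift4 s) ^+ 2).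
Let W x := \int[kap]_s (wgt s * par s ^+ 6 * g (x + shift4 s) ^+ 2).

Lemma affine_sqr (t : R) (x : vec) : 0 < t ->
  (\int[leb]_xi (g (t *: xi + x) ^+ 2)%:E = (t^-1 ^+ d * B)%:E)%E.
Proof.
move=> t0; rewrite (ge0_integral_affine x (f := fun x => (g x ^+ 2)%:E) t0)//.
- by rewrite (L1_EFin measurableT g2L) EFinM.
- by apply/measurable_EFinP; exact: measurable_funX.
- by move=> y; rewrite lee_fin sqr_ge0.
Qed.

(** The change of variables costs t^(-4d), and d <= 3 together with t < 1 makes t^12 sufficient to
    cancel it. *)
Lemma slice_le (t : R) (x : vec) : 0 < t < 1 ->
  t ^+ 12 * \int[leb]_xi (\1_K xi * g (x + t ^+ 4 *: xi) ^+ 2) <= B.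
Proof.
move=> /andP[t0 t1]; have t4 : 0 < t ^+ 4 by rewrite exprn_gt0.
have mgx : measurable_fun setT (fun xi : vec => g (x + t ^+ 4 *: xi) ^+ 2).
  apply: measurable_funX; apply: (measurableT_comp mg).
  rewrite (_ : (fun xi => _) = (fun xi => t ^+ 4 *: xi + x)); first exact: measurable_affine_rV.
  by apply/funext => xi; rewrite addrC.
have aff := affine_sqr x t4.
have L : L1fun leb setT (fun xi : vec => g (x + t ^+ 4 *: xi) ^+ 2).
  apply: (L1_ge0 mgx) => [xi _|]; first by rewrite sqr_ge0.
  by under eq_integral do rewrite addrC; rewrite aff ltry.
have mK := measurable_cone_base xi0 dl.
have h1 : \int[leb]_xi (\1_K xi * g (x + t ^+ 4 *: xi) ^+ 2) <= (t ^+ 4)^-1 ^+ d * B.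
  have <- : \int[leb]_xi g (x + t ^+ 4 *: xi) ^+ 2 = (t ^+ 4)^-1 ^+ d * B.
    apply: EFin_inj; rewrite -(L1_EFin measurableT L) -aff.
    by apply: eq_integral => xi _; rewrite addrC.
  apply: (le_Rint measurableT (L1_indic measurableT mK L) L) => xi _.
  by rewrite ler_piMl ?sqr_ge0// indicE; case: (_ \in _).
apply: (@le_trans _ _ (t ^+ 12 * ((t ^+ 4)^-1 ^+ d * B))).
  by rewrite ler_wpM2l// exprn_ge0// ltW.
rewrite mulrA ler_piMl ?B_ge0// exprVn ler_pdivrMr ?exprn_gt0// mul1r -exprM.
by rewrite ler_wiXn2l ?(ltW t0) ?(ltW t1)// (leq_mul2l 4 d 3) d3.
Qed.

Lemma W_sqr_le : {ae leb, forall x, L1fun kap setT (fun s => wgt s * g (x + shift4 s) ^+ 2) /\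
  W x ^+ 2 <= B * Q x}.
Proof.
have := conv_ae_L1 (@measurable_shift4 R d) g2L wL1.
apply: filterS => x QL; split => //.
have WL : L1fun kap setT (fun s => wgt s * par s ^+ 6 * g (x + shift4 s) ^+ 2).
  apply: (L1_le measurableT _ _ QL).
    apply: measurable_funM.
      apply: measurable_funM; first exact: measurable_wt.
      by apply: measurable_funX; exact: measurable_par.
    apply: measurable_funX; apply: (measurableT_comp mg).
    by apply: measurable_addrow => //; exact: measurable_shift4.
  move=> s _; have [->|/wt_neq0[_ /andP[t0 t1] ->]] := eqVneq (wgt s) 0.
    by rewrite !mul0r normr0.
  rewrite !mul1r ger0_norm; last by rewrite mulr_ge0 ?sqr_ge0// exprn_ge0// ltW.
  by rewrite ler_piMl ?sqr_ge0// exprn_ile1 ?ltW.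
have [QL1 QE _ Qae] := Rint_lebesgue_succ QL.
have [WL1 WE _ _] := Rint_lebesgue_succ WL.
have W0 : 0 <= W x.
  apply: Rintegral_ge0 => s _; rewrite mulr_ge0 ?sqr_ge0// mulr_ge0 ?wt_ge0//.
  by rewrite (exprM _ 3 2) sqr_ge0.
have [->|Wn0] := eqVneq (W x) 0.
  rewrite expr0n mulr_ge0 ?B_ge0//; apply: Rintegral_ge0 => s _.
  by rewrite mulr_ge0 ?wt_ge0// sqr_ge0.
(* [W x] is the integral over t of t^6 times the slice [q t]. Integrating 2 W t^6 q <= W^2 + t^12
   q^2 over t in ]0, 1[ and using t^12 q <= B yields 2 W^2 <= W^2 + B Q. *)
suff : 2 * W x * W x <= W x ^+ 2 + B * Q x.
  by rewrite expr2 -mulrA mulr_natl mulr2n lerD2l.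
pose q (t : R) := \int[leb]_y (wgt (row_cons (t, y)) * g (x + shift4 (row_cons (t, y))) ^+ 2).
have [IL I1] := unit_indic R.
have E1 : W x ^+ 2 = \int[time]_t (W x ^+ 2 * \1_(`]0, 1[%classic) t).
  by rewrite (RintZ measurableT _ IL) I1 mulr1.
have E2 : 2 * W x * W x = \int[time]_t (2 * W x * \int[leb]_y
   (wgt (row_cons (t, y)) * par (row_cons (t, y)) ^+ 6 * g (x + shift4 (row_cons (t, y))) ^+ 2)).
  by rewrite (RintZ measurableT _ WL1) -WE.
have E3 : B * Q x = \int[time]_t (B * q t) by rewrite /Q QE (RintZ measurableT _ QL1).
rewrite E2 E3 {1}E1.
rewrite -(RintD measurableT (L1Z measurableT _ IL) (L1Z measurableT _ QL1)).
apply: (ae_le_Rint measurableT (L1Z measurableT _ WL1)).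
  exact: (L1D measurableT (L1Z measurableT _ IL) (L1Z measurableT _ QL1)).
apply: (ae_imply Qae) => t qL _; rewrite -/(q t).
have -> : \int[leb]_y (wgt (row_cons (t, y)) * par (row_cons (t, y)) ^+ 6 * g (x + shift4 (row_cons (t, y))) ^+ 2)
   = t ^+ 6 * q t.
  rewrite -(RintZ measurableT _ qL); apply: Rint_ext => y _.
  by rewrite par_cons mulrAC mulrC mulrA.
case: (boolP (0 < t < 1)) => t01; last first.
  have q0 : q t = 0.
    rewrite /q -[RHS](@Rint0 _ _ R leb setT measurableT); apply: Rint_ext => y _.
    by rewrite (wt_cons_out _ t01) mul0r.
  by rewrite q0 !mulr0 addr0 mulr_ge0// sqr_ge0.
rewrite indicE mem_set ?mulr1; last by rewrite /= in_itv.
have := slice_le x t01.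
have -> : \int[leb]_xi (\1_K xi * g (x + t ^+ 4 *: xi) ^+ 2) = q t.
  by apply: Rint_ext => y _; rewrite (wt_cons_in _ t01) /shift4 par_cons dir_cons.
have q0 : 0 <= q t.
  by apply: Rintegral_ge0 => y _; rewrite mulr_ge0 ?wt_ge0// sqr_ge0.
move=> h; apply: (@le_trans _ _ (W x ^+ 2 + (t ^+ 6 * q t) ^+ 2)).
  rewrite -subr_ge0; move: (W x) (t ^+ 6 * _) => u v.
  by rewrite (_ : _ - _ = (u - v) ^+ 2) ?sqr_ge0//; ring.
by rewrite lerD2l exprMn -exprM expr2 mulrA ler_wpM2r.
Qed.

Variables (a : 'rV[R]_d.+1 -> R) (c : R).
Hypothesis ma : measurable_fun setT a.
Hypothesis c0 : 0 <= c.
Hypothesis aw : forall s, `|a s| <= c * (wgt s * par s ^+ 3).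

Let aL : L1fun kap setT a.
Proof.
apply: (L1_le measurableT ma _ (L1Z measurableT c wL1)) => s _.
apply: le_trans (aw s) _; rewrite ler_wpM2l//.
have [->|/wt_neq0[_ /andP[t0 t1] ->]] := eqVneq (wgt s) 0; first by rewrite mul0r.
by rewrite mul1r exprn_ile1 ?ltW.
Qed.

(** Cauchy-Schwarz against the weight bounds the square of the average by c^2 cK W. Squaring once
    more and applying [W_sqr_le] leaves B Q, whose integral over x is cK B^2 by Fubini: two powers
    of the L2 norm of [g] have been gained pointwise. *)
Lemma conv_pow4_le : L1fun leb setT g ->
  (\int[leb]_x ((\int[kap]_s (a s * g (x + shift4 s))) ^+ 4)%:E <=
   (c ^+ 4 * cK ^+ 3 * B ^+ 2)%:E)%E.
Proof.
move=> gi; have h1 (x : vec) : `|1 : R| <= 1 by rewrite normr1.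
have m1 : measurable_fun setT (fun _ : vec => 1 : R) by exact: measurable_cst.
have [_ Qi] := conv_transfer1 (@measurable_shift4 R d) g2L m1 h1 wL1.
have QL := conv_L1 (@measurable_shift4 R d) g2L wL1.
have EQ : \int[leb]_x Q x = cK * B.
  transitivity (\int[leb]_x (1 * Q x)); first by apply: Rint_ext => x _; rewrite mul1r.
  rewrite Qi mulrC -(RintZ measurableT _ wL1); apply: Rint_ext => s _.
  by rewrite mulrC; congr (_ * _); apply: Rint_ext => y _; rewrite mulr1.
have c4 : 0 <= c ^+ 4 * cK ^+ 2 * B.
  by rewrite !mulr_ge0 ?B_ge0 ?exprn_ge0 ?cone_mass_ge0.
have -> : (c ^+ 4 * cK ^+ 3 * B ^+ 2)%:E = (\int[leb]_x (c ^+ 4 * cK ^+ 2 * B * Q x)%:E)%E.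
  rewrite (L1_EFin measurableT (L1Z measurableT _ QL)) (RintZ measurableT _ QL) EQ.
  by congr (_%:E); ring.
have NL := conv_L1 (@measurable_shift4 R d) gi aL.
apply: ae_ge0_le_integral => //.
- by move=> x _; rewrite lee_fin (exprM _ 2 2) sqr_ge0.
- by apply/measurable_EFinP; apply: measurable_funX; exact: L1_meas NL.
- move=> x _; rewrite lee_fin mulr_ge0//; apply: Rintegral_ge0 => s _.
  by rewrite mulr_ge0 ?wt_ge0// sqr_ge0.
- by apply/measurable_EFinP; exact: L1_meas (L1Z measurableT _ QL).
apply: filterS W_sqr_le => x [QLx Wx] _; rewrite lee_fin.
have mgx : measurable_fun setT (fun s => g (x + shift4 s)).
  apply: (measurableT_comp mg); apply: measurable_addrow => //; exact: measurable_shift4.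
have a2 s : (a s * g (x + shift4 s)) ^+ 2 <= c ^+ 2 * (wgt s * par s ^+ 6 * g (x + shift4 s) ^+ 2).
  rewrite exprMn mulrA ler_wpM2r ?sqr_ge0// -[a s ^+ 2]real_normK ?num_real//.
  have E : c ^+ 2 * (wgt s * par s ^+ 6) = (c * (wgt s * par s ^+ 3)) ^+ 2.
    by rewrite -[in LHS]wt_sqr; move: (wgt s) (par s) => u v; ring.
  by rewrite E ler_sqr ?nnegrE// (le_trans _ (aw s)).
have WL : L1fun kap setT (fun s => wgt s * par s ^+ 6 * g (x + shift4 s) ^+ 2).
  apply: (L1_le measurableT _ _ QLx).
    apply: measurable_funM; last exact: measurable_funX.
    apply: measurable_funM; first exact: measurable_wt.
    by apply: measurable_funX; exact: measurable_par.
  move=> s _; have [->|/wt_neq0[_ /andP[t0 t1] ->]] := eqVneq (wgt s) 0.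
    by rewrite !mul0r normr0.
  rewrite !mul1r ger0_norm; last by rewrite mulr_ge0 ?sqr_ge0// exprn_ge0// ltW.
  by rewrite ler_piMl ?sqr_ge0// exprn_ile1 ?ltW.
have uL : L2fun kap setT (fun s => a s * g (x + shift4 s)).
  apply/(L2P (R := R)); split; first exact: measurable_funM.
  apply: (L1_le measurableT _ _ (L1Z measurableT (c ^+ 2) WL)).
    by apply: measurable_funX; exact: measurable_funM.
  by move=> s _; rewrite ger0_norm ?sqr_ge0.
have wL : L2fun kap setT wgt.
  apply/(L2P (R := R)); split; first exact: measurable_wt.
  by apply: (L1_ext measurableT _ wL1) => s _; rewrite wt_sqr.
have := sh_CS2 (semi_hilbert_L2 kap measurableT) wL uL.
have -> : ip kap setT wgt wgt = cK.
  by apply: Rint_ext => s _; rewrite -expr2 wt_sqr.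
have -> : ip kap setT wgt (fun s => a s * g (x + shift4 s)) = \int[kap]_s (a s * g (x + shift4 s)).
  apply: Rint_ext => s _; have [w0|/wt_neq0[_ _ ->]] := eqVneq (wgt s) 0; last by rewrite mul1r.
  have := aw s; rewrite w0 mul0r mulr0 normr_le0 => /eqP ->.
  by rewrite !mul0r.
have h2 : ip kap setT (fun s => a s * g (x + shift4 s)) (fun s => a s * g (x + shift4 s)) <= c ^+ 2 * W x.
  rewrite -(RintZ measurableT _ WL).
  by apply: (le_Rint measurableT (L2_mul measurableT uL uL) (L1Z measurableT _ WL)) => s _; rewrite -expr2.
have W0 : 0 <= W x.
  apply: Rintegral_ge0 => s _; rewrite mulr_ge0 ?sqr_ge0// mulr_ge0 ?wt_ge0//.
  by rewrite (exprM _ 3 2) sqr_ge0.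
move=> h3; have h4 := le_trans h3 (ler_wpM2l cone_mass_ge0 h2).
rewrite (exprM _ 2 2); apply: (@le_trans _ _ ((cK * (c ^+ 2 * W x)) ^+ 2)).
  by rewrite ler_sqr ?nnegrE ?sqr_ge0// !mulr_ge0 ?cone_mass_ge0 ?exprn_ge0.
have -> : (cK * (c ^+ 2 * W x)) ^+ 2 = c ^+ 4 * cK ^+ 2 * W x ^+ 2 by ring.
have c2 : 0 <= c ^+ 4 * cK ^+ 2 by rewrite mulr_ge0 ?exprn_ge0 ?cone_mass_ge0.
by rewrite -[leRHS]mulrA ler_wpM2l.
Qed.

End Scaling.

(** The direction alone, without a shrinking factor, is a translation, so Cauchy-Schwarz bounds the
    average of [g] over the cone uniformly in x. *)
Lemma conv_sqr_le (g : scal) : L2fun leb setT g -> {ae leb, forall x,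
  (\int[kap]_s (wgt s * g (x + dir s))) ^+ 2 <= cK * \int[leb]_y (g y ^+ 2)}.
Proof.
move=> gL; have mg := L2_meas gL; have g2L := L2_sqr gL.
have := conv_ae_L1 (@measurable_dir R d) g2L wL1.
apply: filterS => x QL.
have mK := measurable_cone_base xi0 dl.
have mgx : measurable_fun setT (fun s : 'rV[R]_d.+1 => g (x + dir s)).
  by apply: (measurableT_comp mg); apply: measurable_addrow => //; exact: measurable_dir.
have gxL : L1fun leb setT (fun xi => g (x + xi) ^+ 2) /\
    \int[leb]_xi (g (x + xi) ^+ 2) = \int[leb]_y (g y ^+ 2).
  have [h1 <-] := Rint_shift x g2L.
  split; first by apply: (L1_ext measurableT _ h1) => y _; rewrite addrC.
  by apply: Rint_ext => y _; rewrite addrC.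
have [QL1 QE _ _] := Rint_lebesgue_succ QL.
have [IL I1] := unit_indic R.
have QB : \int[kap]_s (wgt s * g (x + dir s) ^+ 2) <= \int[leb]_y (g y ^+ 2).
  rewrite -[leRHS]mulr1 -I1 -(RintZ measurableT _ IL) QE.
  apply: (le_Rint measurableT QL1 (L1Z measurableT _ IL)) => t _.
  case: (boolP (0 < t < 1)) => t01; last first.
    rewrite (_ : \int[leb]_y _ = 0) ?mulr_ge0 ?Rintegral_ge0//; first by move=> y _; rewrite sqr_ge0.
    rewrite -[RHS](@Rint0 _ _ R leb setT measurableT); apply: Rint_ext => y _.
    by rewrite (wt_cons_out _ t01) mul0r.
  rewrite indicE mem_set ?mulr1; last by rewrite /= in_itv.
  rewrite -gxL.2 (_ : \int[leb]_y _ = \int[leb]_y (\1_K y * g (x + y) ^+ 2)); last first.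
    by apply: Rint_ext => y _; rewrite (wt_cons_in _ t01) dir_cons.
  apply: (le_Rint measurableT (L1_indic measurableT mK gxL.1) gxL.1) => y _.
  by rewrite ler_piMl ?sqr_ge0// indicE; case: (_ \in _).
have uL : L2fun kap setT (fun s => wgt s * g (x + dir s)).
  apply/(L2P (R := R)); split; first by apply: measurable_funM => //; exact: measurable_wt.
  by apply: (L1_ext measurableT _ QL) => s _; rewrite exprMn wt_sqr.
have wL : L2fun kap setT wgt.
  apply/(L2P (R := R)); split; first exact: measurable_wt.
  by apply: (L1_ext measurableT _ wL1) => s _; rewrite wt_sqr.
have := sh_CS2 (semi_hilbert_L2 kap measurableT) wL uL.
have -> : ip kap setT wgt wgt = cK.
  by apply: Rint_ext => s _; rewrite -expr2 wt_sqr.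
have -> : ip kap setT wgt (fun s => wgt s * g (x + dir s)) = \int[kap]_s (wgt s * g (x + dir s)).
  by apply: Rint_ext => s _; rewrite mulrA -expr2 wt_sqr.
have -> : ip kap setT (fun s => wgt s * g (x + dir s)) (fun s => wgt s * g (x + dir s)) =
    \int[kap]_s (wgt s * g (x + dir s) ^+ 2).
  by apply: Rint_ext => s _; rewrite -expr2 exprMn wt_sqr.
move=> h; apply: le_trans h _; rewrite ler_wpM2l//; exact: cone_mass_ge0.
Qed.

Lemma cone_mass_gt0 : 0 < cK.
Proof.
have [_ wE _ _] := Rint_lebesgue_succ wL1.
have mK := measurable_cone_base xi0 dl.
have [K0 Koo] := lebesgue_cone_base xi0 dl0.
have KE : \int[leb]_y \1_K y = fine (leb K).
  by rewrite /Rintegral integral_indic// setIT.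
have [IL I1] := unit_indic R.
rewrite /cone_mass wE (_ : \int[time]_t _ = \int[time]_t (fine (leb K) * \1_(`]0, 1[%classic) t)).
  by rewrite (RintZ measurableT _ IL) I1 mulr1 fine_gt0// K0 Koo.
apply: Rint_ext => t _; rewrite -KE.
case: (boolP (0 < t < 1)) => t01.
  rewrite indicE mem_set ?mulr1; last by rewrite /= in_itv.
  by apply: Rint_ext => y _; rewrite (wt_cons_in _ t01).
rewrite [X in _ * X]indicE memNset ?mulr0; last by rewrite /= in_itv; apply/negP.
rewrite -[RHS](@Rint0 _ _ R leb setT measurableT); apply: Rint_ext => y _.
by rewrite (wt_cons_out _ t01).
Qed.

Lemma inner_le_H1ip (f : scal) : H1 Om f -> inner Om f f <= H1ip Om f f /\
  forall i, inner Om (component (wgrad Om f) i) (component (wgrad Om f) i) <= H1ip Om f f.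
Proof.
move=> fH; have E : H1ip Om f f = inner Om f f + gradip Om f f by [].
rewrite E; split; first by rewrite lerDl; exact: gradip_ge0.
move=> i; rewrite (gradipE oO fH fH) (bigD1 i)//= addrCA lerDl addr_ge0//; first exact: inner_ge0.
by apply: sumr_ge0 => j _; exact: inner_ge0.
Qed.

Lemma local_sobolev : exists2 C : R, 0 <= C & forall f, H1 Om f ->
  (\int[leb]_(x in A) (f x ^+ 4)%:E <= (C * H1ip Om f f ^+ 2)%:E)%E.
Proof.
have cK0 := cone_mass_gt0.
have [c c0 hc] : exists2 c : R, 0 <= c & forall i s, `|dwt xi0 dl i s| <= c * (wgt s * par s ^+ 3).
  exists (4 * (`|xi0| + dl)); first by rewrite mulr_ge0// addr_ge0// ltW.
  by move=> i s; exact: dwt_le.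
have oA : open A by exact: open_cone_dom.
have mA : measurable A by exact: open_measurable_rV.
have AO : A `<=` Om by move=> x [].
have finA : (leb A < +oo)%E by apply: le_lt_trans finO; apply: le_measure; rewrite ?inE.
pose mu := fine (leb A); have mu0 : 0 <= mu by rewrite fine_ge0.
(* The factors 8 come from (M - U)^4 <= 8 M^4 + 8 U^4, where M is the average of [f] and U the
   gradient part; [mu] integrates the bound on M over the cone domain, and d^3 comes from the fourth
   power of a sum of [d] terms. *)
pose C := cK^-1 ^+ 4 * (8 * cK ^+ 2 * mu + 8 * d%:R ^+ 3 * (d%:R * (c ^+ 4 * cK ^+ 3))).
have C0 : 0 <= C.
  rewrite /C mulr_ge0 ?exprn_ge0 ?invr_ge0 ?(ltW cK0)// addr_ge0//.
    by rewrite !mulr_ge0 ?exprn_ge0 ?(ltW cK0).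
  by apply: mulr_ge0; [exact: (mulr_ge0 (ler0n _ _) (exprn_ge0 _ (ler0n _ _)))|exact: (mulr_ge0 (ler0n _ _) (mulr_ge0 (exprn_ge0 4 c0) (exprn_ge0 3 (ltW cK0))))].
exists C => // f fH; have [GL fG] := wgradP fH.
have [S1 S2] := inner_le_H1ip fH.
set S := H1ip Om f f in S1 S2 *.
have S0 : 0 <= S by apply: le_trans S1; exact: inner_ge0.
have gE i := ext_L2 (GL i).
have gL i := ext_L1 oO (L2_L1 mO finO (GL i)).
pose N i x := \int[kap]_s (dwt xi0 dl i s * (component (wgrad Om f) i \_ Om) (x + shift4 s)).
have N4 i : (\int[leb]_x (N i x ^+ 4)%:E <= (c ^+ 4 * cK ^+ 3 * S ^+ 2)%:E)%E.
  have h := conv_pow4_le (gE i) (measurable_dwt xi0 dl i) c0 (hc i) (gL i).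
  apply: le_trans h _.
  rewrite lee_fin ext_sqr ler_wpM2l ?mulr_ge0 ?exprn_ge0 ?(ltW cK0)//.
  by rewrite ler_sqr ?nnegrE ?inner_ge0.
have mN i : measurable_fun setT (N i).
  exact: L1_meas (conv_L1 (@measurable_shift4 R d) (gL i) (dwt_L1 xi0 dl0 i)).
have N4L i : L1fun leb setT (fun x => N i x ^+ 4).
  apply: L1_ge0; first exact: measurable_funX.
    by move=> x _; rewrite (exprM _ 2 2) sqr_ge0.
  exact: le_lt_trans (N4 i) (ltry _).
have N4A i : L1fun leb A (fun x => N i x ^+ 4) := L1_subset measurableT mA (@subsetT _ A) (N4L i).
have N4R i : \int[leb]_(x in A) (N i x ^+ 4) <= c ^+ 4 * cK ^+ 3 * S ^+ 2.
  rewrite -lee_fin -(L1_EFin mA (N4A i)); apply: le_trans (N4 i).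
  apply: ge0_subset_integral => //; first by apply/measurable_EFinP; exact: measurable_funX.
  by move=> x _; rewrite lee_fin (exprM _ 2 2) sqr_ge0.
pose rhs x := cK^-1 ^+ 4 * (8 * cK ^+ 2 * S ^+ 2 + 8 * d%:R ^+ 3 * \sum_(i < d) N i x ^+ 4).
have sL := L1_sum mA N4A.
have kL : L1fun leb A (fun=> 8 * cK ^+ 2 * S ^+ 2) := @L1_cst _ _ R leb A mA _ finA.
have rL : L1fun leb A rhs := L1Z mA _ (L1D mA kL (L1Z mA _ sL)).
have rI : \int[leb]_(x in A) rhs x <= C * S ^+ 2.
  rewrite (RintZ mA _ (L1D mA kL (L1Z mA _ sL))) (RintD mA kL (L1Z mA _ sL)) (RintZ mA _ sL) (Rint_sum mA N4A).
  rewrite /C -[leRHS]mulrA.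
  have ci : 0 <= cK^-1 ^+ 4 by rewrite exprn_ge0// invr_ge0 ltW.
  rewrite ler_wpM2l// [leRHS]mulrDl; apply: lerD.
    rewrite Rintegral_cst// -/mu mulrAC.
    by rewrite le_eqVlt; apply/orP; left; apply/eqP; ring.
  rewrite -[leRHS]mulrA ler_wpM2l ?mulr_ge0 ?exprn_ge0 ?ler0n//.
  apply: le_trans (_ : _ <= \sum_(i < d) (c ^+ 4 * cK ^+ 3 * S ^+ 2)) _; first exact: ler_sum.
  by rewrite sumr_const card_ord -[leLHS]mulr_natl !mulrA.
rewrite -lee_fin in rI; apply: le_trans rI.
rewrite -(L1_EFin mA rL); apply: ae_ge0_le_integral => //.
- by move=> x _; rewrite lee_fin (exprM _ 2 2) sqr_ge0.
- apply/measurable_EFinP; apply: measurable_funX.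
  exact: measurable_funS mO AO (L2_meas (H1_L2 fH)).
- move=> x _; rewrite lee_fin mulr_ge0 ?exprn_ge0 ?invr_ge0 ?(ltW cK0)// addr_ge0//.
    by rewrite !mulr_ge0 ?exprn_ge0 ?(ltW cK0).
  rewrite !mulr_ge0 ?exprn_ge0 ?ler0n// sumr_ge0// => i _.
  by rewrite (exprM _ 2 2) sqr_ge0.
- by apply/measurable_EFinP; exact: L1_meas rL.
have := weak_taylor oO finO dl0 cone fH; have := conv_sqr_le (ext_L2 (H1_L2 fH)).
apply: filterS2 => x hM hT Ax; rewrite lee_fin.
have := hT Ax; rewrite (ext_in _ (AO _ Ax)) -/(N _ _).
have -> : \sum_(i < d) \int[kap]_s (dwt xi0 dl i s * (component (wgrad Om f) i \_ Om) (x + shift4 s)) =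
   \sum_(i < d) N i x by [].
rewrite ext_sqr in hM; move: hM; set M := \int[kap]_s _ => hM fE.
have -> : f x = cK^-1 * (M - \sum_(i < d) N i x) by rewrite -fE mulKf ?gt_eqF.
rewrite exprMn /rhs ler_wpM2l ?exprn_ge0 ?invr_ge0 ?(ltW cK0)//.
have h1 := pow4_sum_le (fun i => N i x).
have M4 : M ^+ 4 <= cK ^+ 2 * S ^+ 2.
  rewrite (exprM _ 2 2) -exprMn ler_sqr ?nnegrE ?sqr_ge0 ?mulr_ge0 ?(ltW cK0)//.
  by apply: le_trans hM _; rewrite ler_wpM2l ?(ltW cK0).
move: (\sum_(i < d) N i x) h1 => U h1.
have h2 : (M - U) ^+ 4 <= 8 * M ^+ 4 + 8 * U ^+ 4.
  have E : 8 * M ^+ 4 + 8 * U ^+ 4 - (M - U) ^+ 4 =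
     4 * (M ^+ 2 - U ^+ 2) ^+ 2 + 2 * ((M - U) * (M + U)) ^+ 2 + (M + U) ^+ 4 + 0 by ring.
  rewrite -subr_ge0 E addr0 addr_ge0//; last by rewrite (exprM _ 2 2) sqr_ge0.
  by rewrite addr_ge0// mulr_ge0// sqr_ge0.
apply: le_trans h2 _.
have -> : 8 * cK ^+ 2 * S ^+ 2 = 8 * (cK ^+ 2 * S ^+ 2) by rewrite mulrA.
by rewrite -[8 * d%:R ^+ 3 * _]mulrA lerD// ?ler_wpM2l.
Qed.

End LocalSobolev.

Section GlobalSobolev.
Context (R : realType) (d : nat) (Om : set 'rV[R]_d).
Local Notation vec := 'rV[R]_d.
Local Notation leb := (lebesgue_rV R d).
Hypothesis d3 : (d <= 3)%N.
Hypothesis hO : bounded_lipschitz_domain Om.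

(** The closure of [Om] is compact, so finitely many of the neighbourhoods given by [lipschitz_cone]
    cover [Om], and the local estimates add up. *)
Lemma sobolev_L4 : exists2 C : R, 0 <= C & forall f, H1 Om f ->
  L4fun leb Om f /\ \int[leb]_(x in Om) (f x ^+ 4) <= C * H1ip Om f f ^+ 2.
Proof.
have [_ oO _ bO lO] := hO.
have mO : measurable Om := open_measurable_rV oO.
have finO := bounded_lebesgue_finite mO bO.
have ex (p : vec) : exists rp : R, closure Om p -> 0 < rp /\
   exists2 C : R, 0 <= C & forall f, H1 Om f ->
  (\int[leb]_(x in cone_dom Om p rp) (f x ^+ 4)%:E <= (C * H1ip Om f f ^+ 2)%:E)%E.
  have [cp|ncp] := pselect (closure Om p); last by exists 0.
  have [rp [xi0 [dl [rp0 dl0 cone]]]] := lipschitz_cone oO lO cp.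
  exists rp => _; split => //; exact: (local_sobolev d3 oO finO dl0 cone).
have [rp hrp] := choice ex.
have cO : compact (closure Om).
  apply: bounded_closed_compact; last exact: closed_closure.
  have [M0 [_ hM]] := bO.
  exists (M0 + 1); split; first exact: num_real.
  move=> M MM x cx.
  have [y [Oy]] := cx _ (nbhsx_ballx x 1 ltr01).
  rewrite -ball_normE /= => xy.
  have := ler_normD (x - y) y; rewrite subrK => h.
  have M1 : M0 < M - 1 by rewrite ltrBrDr.
  by apply: le_trans h _; rewrite -lerBrDl (le_trans (hM _ M1 y Oy))// lerB// ltW.
have oc p : open (cone_dom Om p (rp p)) by exact: open_cone_dom.
have f40 (f : vec -> R) x : (0 <= (f x ^+ 4)%:E)%E by rewrite lee_fin (exprM _ 2 2) sqr_ge0.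
have mf4 f D : H1 Om f -> D `<=` Om -> measurable_fun D (fun x => (f x ^+ 4)%:E).
  move=> fH DO; apply/measurable_EFinP; apply: measurable_funX.
  exact: measurable_funS mO DO (L2_meas (H1_L2 fH)).
have fin (s : seq vec) : (forall p, p \in s -> closure Om p) ->
   exists2 C : R, 0 <= C & forall f, H1 Om f ->
  (\int[leb]_(x in \big[setU/set0]_(p <- s) cone_dom Om p (rp p)) (f x ^+ 4)%:E <= (C * H1ip Om f f ^+ 2)%:E)%E.
  elim: s => [|p s IHs] hs.
    by exists 0 => // f fH; rewrite big_nil integral_set0 mul0r.
  have [|C1 C10 hC1] := IHs; first by move=> q qs; apply: hs; rewrite in_cons qs orbT.
  have [_ [C2 C20 hC2]] := hrp p (hs p (mem_head _ _)).
  exists (C1 + C2); first by rewrite addr_ge0.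
  move=> f fH; rewrite big_cons; set U := \big[setU/set0]_(_ <- _) _; set V := cone_dom _ _ _.
  have mU : measurable U by apply: bigsetU_measurable => q _; exact: (open_measurable_rV (oc q)).
  have mV : measurable V := open_measurable_rV (oc p).
  have UO : U `<=` Om.
    rewrite /U; elim: (s) => [|q t IHt]; first by rewrite big_nil.
    by rewrite big_cons => x [[]//|/IHt].
  have VO : V `<=` Om by move=> x [].
  have -> : V `|` U = V `|` (U `\` V) by rewrite setDE setUIr setUv setIT.
  have mD : measurable (U `\` V) by exact: measurableD.
  have DO : U `\` V `<=` Om by move=> x [/UO].
  rewrite ge0_integral_setU//; last 2 first.
  - by apply: mf4 => // x [/VO|/DO].
  - by apply/disj_setPS => x [] ? [].
  rewrite mulrDl EFinD addeC; apply: leeD; last exact: hC2.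
  apply: le_trans (hC1 f fH); apply: ge0_subset_integral => //; exact: mf4.
have := cO; rewrite compact_cover => /(_ _ (closure Om) (fun p => [set x | `|p - x| < rp p])).
case.
- move=> p _; have -> : [set x : vec | `|p - x| < rp p] = ball p (rp p) by rewrite -ball_normE.
  exact: ball_open.
- by move=> p cp; exists p => //=; rewrite subrr normr0; exact: (hrp p cp).1.
move=> D DO hD; have [|C C0 hC] := fin (finmap.enum_fset D).
  by move=> p pD; have := DO p pD; rewrite in_setE.
exists C => // f fH.
have OE : Om `<=` \big[setU/set0]_(p <- finmap.enum_fset D) cone_dom Om p (rp p).
  move=> x Ox; have [p pD px] := hD _ (subset_closure Ox).
  by rewrite -bigcup_seq; exists p.
have UO : \big[setU/set0]_(p <- finmap.enum_fset D) cone_dom Om p (rp p) `<=` Om.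
  by rewrite -bigcup_seq => x [p _ []].
have mU : measurable (\big[setU/set0]_(p <- finmap.enum_fset D) cone_dom Om p (rp p)).
  by apply: bigsetU_measurable => q _; exact: (open_measurable_rV (oc q)).
have h : (\int[leb]_(x in Om) (f x ^+ 4)%:E <= (C * H1ip Om f f ^+ 2)%:E)%E.
  by apply: le_trans (hC f fH); apply: ge0_subset_integral => //; exact: mf4.
have fL : L4fun leb Om f.
  by split; [exact: L2_meas (H1_L2 fH)|exact: le_lt_trans h (ltry _)].
split => //; rewrite -lee_fin -L1_EFin//.
by apply: (L1_ext mO _ (L2_sqr (L4_sqr fL))) => x _; rewrite -exprM.
Qed.

End GlobalSobolev.

(** * The Riesz inverse of the H1 inner product on mean-zero functions *)

Section InverseLaplacian.
Context (R : realType) (d : nat) (Om : set 'rV[R]_d).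
Local Notation leb := (lebesgue_rV R d).
Local Notation scal := ('rV[R]_d -> R).
Local Notation vect := ('rV[R]_d -> 'rV[R]_d).
Hypothesis oO : open Om.
Hypothesis finO : (leb Om < +oo)%E.

Let mO : measurable Om. Proof. exact: open_measurable_rV. Qed.
Let hL2 : semi_hilbert (L2 Om) (inner Om) := semi_hilbert_L2 leb mO.
Let hH1 : semi_hilbert (H1 Om) (H1ip Om) := semi_hilbert_H1 oO finO.
Let hH10 : semi_hilbert (H10 Om) (H1ip Om) := semi_hilbert_H10 oO finO.

Lemma H10_H1 (f : scal) : H10 Om f -> H1 Om f. Proof. by case. Qed.

Lemma H10_L2 (f : scal) : H10 Om f -> L2 Om f. Proof. by case=> /H1_L2. Qed.

Lemma H10_mean (f : scal) : H10 Om f -> inner Om f (fun=> 1) = 0.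
Proof. by case=> _; rewrite mean_inner. Qed.

(** A weak solution of the Neumann problem for the identity minus the Laplacian, tested with
    mean-zero functions. The zero-order term makes the form coercive without a Poincare
    inequality. *)
Definition Gop (e : scal) : scal :=
  xget (fun=> 0) [set g | H10 Om g /\ forall w, H10 Om w -> H1ip Om g w = inner Om e w].

Lemma inner_le_H1 (f : scal) : H1 Om f -> inner Om f f <= H1ip Om f f.
Proof. by move=> fH; rewrite lerDl; exact: gradip_ge0. Qed.

Lemma GopP (e : scal) : L2 Om e ->
  H10 Om (Gop e) /\ forall w, H10 Om w -> H1ip Om (Gop e) w = inner Om e w.
Proof.
move=> eL; suff ex : exists g, H10 Om g /\ forall w, H10 Om w -> H1ip Om g w = inner Om e w.
  exact: (xgetPex (fun=> 0) ex).
have [||g gH gE] := @riesz_representation R _ _ _ hH10 (inner Om e) (sh_norm (inner Om) e).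
- move=> a x y /H10_L2 xL /H10_L2 yL.
  by rewrite innerC (inner_lin oO a xL yL eL) !(innerC _ e).
- move=> x xH; apply: le_trans (sh_CS hL2 eL (H10_L2 xH)) _.
  by rewrite ler_wpM2l ?sh_norm_ge0// ler_wsqrtr// inner_le_H1//; exact: H10_H1.
by exists g.
Qed.

Lemma Gop_H10 e : L2 Om e -> H10 Om (Gop e). Proof. by move=> /GopP[]. Qed.

Lemma GopE e w : L2 Om e -> H10 Om w -> H1ip Om (Gop e) w = inner Om e w.
Proof. by move=> /GopP[_]; exact. Qed.

Lemma Gop_sym e f : L2 Om e -> L2 Om f -> inner Om e (Gop f) = inner Om f (Gop e).
Proof.
move=> eL fL; rewrite -(GopE eL (Gop_H10 fL)) -(GopE fL (Gop_H10 eL)).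
exact: (sh_sym hH10 (Gop_H10 eL) (Gop_H10 fL)).
Qed.

Lemma Gop_norm e : L2 Om e -> H1ip Om (Gop e) (Gop e) = inner Om e (Gop e).
Proof. by move=> eL; rewrite GopE//; exact: Gop_H10. Qed.

Lemma Gop_ge0 e : L2 Om e -> 0 <= inner Om e (Gop e).
Proof. by move=> eL; rewrite -Gop_norm//; apply: (sh_ge0 hH10); exact: Gop_H10. Qed.

Lemma GopB_le e f : L2 Om e -> L2 Om f ->
  sh_norm (H1ip Om) (Gop e - Gop f) <= sh_norm (inner Om) (e - f).
Proof.
move=> eL fL; have gH := Gop_H10 eL; have hH := Gop_H10 fL.
have dH : H10 Om (Gop e - Gop f) := subspaceB (sh_sub hH10) gH hH.
have dL : L2 Om (e - f) := subspaceB (sh_sub hL2) eL fL.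
have E : H1ip Om (Gop e - Gop f) (Gop e - Gop f) = inner Om (e - f) (Gop e - Gop f).
  rewrite (shBl hH10 gH hH dH) (GopE eL dH) (GopE fL dH).
  by rewrite (shBl hL2 eL fL (H10_L2 dH)).
have h : sh_norm (H1ip Om) (Gop e - Gop f) ^+ 2 <=
    sh_norm (inner Om) (e - f) * sh_norm (H1ip Om) (Gop e - Gop f).
  rewrite (sh_norm2 hH10 dH) E; apply: le_trans (ler_norm _) _.
  apply: le_trans (sh_CS hL2 dL (H10_L2 dH)) _.
  by rewrite ler_wpM2l ?sh_norm_ge0// ler_wsqrtr// inner_le_H1//; exact: H10_H1.
have [->|n0] := eqVneq (sh_norm (H1ip Om) (Gop e - Gop f)) 0; first exact: sh_norm_ge0.
have np : 0 < sh_norm (H1ip Om) (Gop e - Gop f) by rewrite lt_def n0 sh_norm_ge0.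
by move: h; rewrite expr2 ler_pM2r.
Qed.

Lemma H1ip_one (g : scal) : H10 Om g -> H1ip Om g (fun=> 1) = 0.
Proof.
move=> gH; have E : H1ip Om g (fun=> 1) = inner Om g (fun=> 1) + gradip Om g (fun=> 1) by [].
rewrite E (H10_mean gH) add0r (gradipC oO (H10_H1 gH) (H1_cst oO finO 1)).
exact: (gradip_cst oO finO 1 (H10_H1 gH)).
Qed.

(** Both sides vanish on constants, since [g] and [e] have zero mean, and every [w] in H1 is a
    constant plus a mean-zero function. This admits the chemical potential, whose mean is not
    prescribed, as a test function. *)
Lemma repr_H1 (g e w : scal) : H10 Om g -> L2 Om e -> inner Om e (fun=> 1) = 0 ->
  (forall v, H10 Om v -> H1ip Om g v = inner Om e v) -> H1 Om w ->
  H1ip Om g w = inner Om e w.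
Proof.
move=> gH eL e0 gE wH.
have [c wcH] := H10_center oO finO wH.
have oneH : H1 Om (fun=> 1) := H1_cst oO finO 1.
have wE : w = c *: (fun=> 1) + (w - (fun=> c)).
  by apply/funext => x; rewrite !fctE -[c *: 1]/(c * 1) mulr1 addrC subrK.
have wcH1 := H10_H1 wcH.
have cH : H1 Om (c *: (fun=> 1)) := subspaceZ c (sh_sub hH1) oneH.
have cL : L2 Om (c *: (fun=> 1)) := H1_L2 cH.
rewrite {1 2}wE (shDr hH1 cH wcH1 (H10_H1 gH)) (shZr hH1 c oneH (H10_H1 gH)).
rewrite (H1ip_one gH) mulr0 add0r (gE _ wcH).
rewrite (shDr hL2 cL (H1_L2 wcH1) eL) (shZr hL2 c (H1_L2 oneH) eL) e0.
by rewrite mulr0 add0r.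
Qed.

Lemma GopE_H1 e w : L2 Om e -> inner Om e (fun=> 1) = 0 -> H1 Om w ->
  H1ip Om (Gop e) w = inner Om e w.
Proof.
move=> eL e0; apply: repr_H1 => //; first exact: Gop_H10.
by move=> v; exact: GopE.
Qed.

End InverseLaplacian.

(** * Energy dissipation for the difference of two solutions *)

Lemma le_of_sqr (R : realFieldType) (x y : R) : 0 <= y -> x ^+ 2 <= y ^+ 2 -> x <= y.
Proof.
move=> y0 h; have [x0|x0] := leP 0 x; last by rewrite (le_trans (ltW x0)).
by rewrite -ler_sqr ?nnegrE.
Qed.

Section Holder4.
Context (R : realType) (d : nat) (Om : set 'rV[R]_d).
Local Notation leb := (lebesgue_rV R d).
Local Notation scal := ('rV[R]_d -> R).
Local Notation vect := ('rV[R]_d -> 'rV[R]_d).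
Hypothesis oO : open Om.
Hypothesis finO : (leb Om < +oo)%E.
Variable CS : R.
Hypothesis CS0 : 0 <= CS.
Hypothesis sob : forall f, H1 Om f ->
  L4fun leb Om f /\ \int[leb]_(x in Om) (f x ^+ 4) <= CS * H1ip Om f f ^+ 2.

Let mO : measurable Om. Proof. exact: open_measurable_rV. Qed.
Let hL2 : semi_hilbert (L2 Om) (inner Om) := semi_hilbert_L2 leb mO.
Let hH1 : semi_hilbert (H1 Om) (H1ip Om) := semi_hilbert_H1 oO finO.

Definition int4 (f : scal) : R := \int[leb]_(x in Om) (f x ^+ 4).

Lemma H1_L4 f : H1 Om f -> L4fun leb Om f. Proof. by move=> /sob[]. Qed.

Lemma int4E f : int4 f = inner Om (fun x => f x ^+ 2) (fun x => f x ^+ 2).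
Proof. by apply: Rint_ext => x _; rewrite -expr2 -exprM. Qed.

Lemma int4_ge0 f : 0 <= int4 f.
Proof. by rewrite int4E; exact: inner_ge0. Qed.

Lemma L2_mul4 f g : L4fun leb Om f -> L4fun leb Om g -> L2 Om (fun x => f x * g x).
Proof. by move=> fL gL; exact: (L4_mul mO fL gL). Qed.

Lemma L4_L2 f : L4fun leb Om f -> L2 Om f.
Proof.
move=> fL; apply/(L2P (R := R)); split; first exact: L4_meas fL.
exact: (L2_L1 mO finO (L4_sqr fL)).
Qed.

Lemma inner_sqr_mul f g : L4fun leb Om f -> L4fun leb Om g ->
  inner Om (fun x => f x * g x) (fun x => f x * g x) ^+ 2 <= int4 f * int4 g.
Proof.
move=> fL gL; have := sh_CS2 hL2 (L4_sqr fL) (L4_sqr gL); rewrite -!int4E.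
congr (_ ^+ 2 <= _); apply: Rint_ext => x _; ring.
Qed.

Lemma inner_mul_H1 f g : H1 Om f -> H1 Om g ->
  inner Om (fun x => f x * g x) (fun x => f x * g x) <= CS * H1ip Om f f * H1ip Om g g.
Proof.
move=> fH gH; have [fL f4] := sob fH; have [gL g4] := sob gH.
have f0 : 0 <= H1ip Om f f := sh_ge0 hH1 fH.
have g0 : 0 <= H1ip Om g g := sh_ge0 hH1 gH.
apply: le_of_sqr; first exact: (mulr_ge0 (mulr_ge0 CS0 f0) g0).
apply: le_trans (inner_sqr_mul fL gL) _.
have := ler_pM (int4_ge0 f) (int4_ge0 g) f4 g4.
move: (H1ip Om f f) (H1ip Om g g) (int4 f * int4 g) => x y z.
by congr (_ <= _); ring.
Qed.

(** The transport of [f] by one control field, as a bilinear form in [f] and [w]. *)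
Definition conv (chi : vect) (f w : scal) : R :=
  inner Om (fun x => dotv (chi x) (wgrad Om f x)) w.

(** Grouping the factors as d_j f times chi_j w exhibits a product of two L2 functions, since chi_j
    and [w] lie in L4. *)
Lemma convE chi f w : H1v Om chi -> H1 Om f -> H1 Om w ->
  (forall j, L1fun leb Om (fun x => chi x ord0 j * wgrad Om f x ord0 j * w x)) /\
  conv chi f w = \sum_(j < d) inner Om (component (wgrad Om f) j) (fun x => component chi j x * w x).
Proof.
move=> cH fH wH; have L j : L2 Om (fun x => component chi j x * w x).
  exact: L2_mul4 (H1_L4 (cH j)) (H1_L4 wH).
have L1 j : L1fun leb Om (fun x => component (wgrad Om f) j x * (component chi j x * w x)).
  exact: (L2_mul mO (L2v_wgrad fH j) (L j)).
split.
  move=> j; apply: (L1_ext mO _ (L1 j)) => x _; rewrite /component; ring.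
rewrite /inner -(Rint_sum mO L1); apply: Rint_ext => x _.
by rewrite /dotv mulr_suml; apply: eq_bigr => j _; rewrite /component; ring.
Qed.

Lemma conv_linl chi a f g w : H1v Om chi -> H1 Om f -> H1 Om g -> H1 Om w ->
  conv chi (a *: f + g) w = a * conv chi f w + conv chi g w.
Proof.
move=> cH fH gH wH; have abH := H1_lin oO finO a fH gH.
rewrite (convE cH abH wH).2 (convE cH fH wH).2 (convE cH gH wH).2 mulr_sumr -big_split/=.
apply: eq_bigr => j _.
have L : L2 Om (fun x => component chi j x * w x) := L2_mul4 (H1_L4 (cH j)) (H1_L4 wH).
have Lf := L2v_wgrad fH j; have Lg := L2v_wgrad gH j.
have Ls : L2 Om (a *: component (wgrad Om f) j + component (wgrad Om g) j).
  exact: (L2D mO (L2Z mO a Lf) Lg).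
rewrite -(inner_lin oO a Lf Lg L).
apply: (inner_aeE oO (L2v_wgrad abH j) L Ls L); first exact: wgrad_lin.
exact: nearW.
Qed.

Lemma conv_linr chi a f g w : H1v Om chi -> H1 Om f -> H1 Om g -> H1 Om w ->
  conv chi w (a *: f + g) = a * conv chi w f + conv chi w g.
Proof.
move=> cH fH gH wH; have abH := H1_lin oO finO a fH gH.
rewrite (convE cH wH abH).2 (convE cH wH fH).2 (convE cH wH gH).2 mulr_sumr -big_split/=.
apply: eq_bigr => j _; rewrite !(innerC _ (component (wgrad Om w) j)).
have Lf : L2 Om (fun x => component chi j x * f x) := L2_mul4 (H1_L4 (cH j)) (H1_L4 fH).
have Lg : L2 Om (fun x => component chi j x * g x) := L2_mul4 (H1_L4 (cH j)) (H1_L4 gH).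
rewrite -(inner_lin oO a Lf Lg (L2v_wgrad wH j)); congr (inner Om _ _).
by apply/funext => x; rewrite !fctE /= -![a *: _]/(a * _); ring.
Qed.

Lemma conv_bound chi : H1v Om chi -> exists2 C : R, 0 <= C &
  forall f w, H1 Om f -> H1 Om w ->
    `|conv chi f w| <= C * sh_norm (H1ip Om) f * sh_norm (H1ip Om) w.
Proof.
move=> cH; exists (\sum_(j < d) Num.sqrt (CS * H1ip Om (component chi j) (component chi j))).
  by apply: sumr_ge0 => j _; exact: sqrtr_ge0.
move=> f w fH wH; rewrite (convE cH fH wH).2 !mulr_suml.
apply: le_trans (ler_norm_sum _ _ _) _; apply: ler_sum => j _.
have L : L2 Om (fun x => component chi j x * w x) := L2_mul4 (H1_L4 (cH j)) (H1_L4 wH).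
have Lf := L2v_wgrad fH j.
have f0 : 0 <= H1ip Om f f := sh_ge0 hH1 fH.
have w0 : 0 <= H1ip Om w w := sh_ge0 hH1 wH.
have c0 : 0 <= H1ip Om (component chi j) (component chi j) := sh_ge0 hH1 (cH j).
apply: le_trans (sh_CS hL2 Lf L) _; rewrite mulrAC mulrC.
apply: ler_pM; [exact: sh_norm_ge0|exact: sh_norm_ge0| |].
  rewrite /sh_norm -sqrtrM; last exact: (mulr_ge0 CS0 c0).
  by apply: ler_wsqrtr; exact: (inner_mul_H1 (cH j) wH).
by have [_ h] := inner_le_H1ip oO fH; apply: ler_wsqrtr; exact: h.
Qed.

End Holder4.

Lemma derive1_double_well (R : realType) (s : R) : derive1 (@double_well R) s = s ^+ 3 - s.
Proof.
have h2 : is_derive s (1 : R) (fun x : R => 1 - x ^+ 2) (- (2 * s)).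
  have h1 := is_deriveX 2 (is_derive_id s (1 : R)).
  have := is_deriveB (is_derive_cst (1 : R) s (1 : R)) h1.
  by move/is_derive_congr; apply => [//|]; rewrite /GRing.scale/= add0r mulr1.
have h3 := is_deriveM (is_derive_cst (4^-1 : R) s (1 : R)) (is_deriveX 2 h2).
apply: derive1_eq; move/is_derive_congr : h3; apply => [//|].
rewrite scaler0 addr0 /cst -[LHS]/(4^-1 * ((2 * (1 - s ^+ 2) ^+ 1) * - (2 * s))).
have -> : 4^-1 * (2 * (1 - s ^+ 2) ^+ 1 * - (2 * s)) = 4^-1 * 4 * (s ^+ 3 - s) by ring.
by rewrite mulVf ?mul1r// pnatr_eq0.
Qed.

(** Young's inequality; the two sides differ by (a s - K t)^2 / (2a). *)
Lemma absorb (R : realFieldType) (a K s t : R) : 0 < a ->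
  2^-1 * a * s ^+ 2 - K ^+ 2 / (2 * a) * t ^+ 2 <= a * s ^+ 2 - K * (s * t).
Proof.
move=> a0; rewrite -subr_ge0.
have -> : a * s ^+ 2 - K * (s * t) - (2^-1 * a * s ^+ 2 - K ^+ 2 / (2 * a) * t ^+ 2) =
  (a * s - K * t) ^+ 2 / (2 * a) by field; rewrite gt_eqF.
by rewrite divr_ge0 ?sqr_ge0// mulr_ge0// ltW.
Qed.

(** The scalar content of [dissipation]. There s and t are the H1 norms of e and Ge, E2 and GE are
    the squared L2 norms of e and of its gradient, C4 is the integral of e^4, and A is the squared
    H1 norm of phibar. Q, I and P pair the cubic quotient with e^2, e Ge and (Ge)^2, and V is the
    integral of (e Ge)^2. Finally cT is the transport of e, F the forcing, and D the time derivative
    tested with Ge. *)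
Lemma dissipation_real (R : realFieldType) (b a k Cv CS s t E2 GE Q C4 I P V A cT D F : R) :
  0 < b -> 0 < a -> 0 < k -> 0 <= CS -> 0 <= s -> 0 <= t -> 0 <= C4 ->
  s ^+ 2 = E2 + GE ->
  D + cT + F + b * ((a * GE + k * (Q - E2)) - (a * (E2 - t ^+ 2) + k * (I - t ^+ 2))) = 0 ->
  `|cT| <= Cv * (s * t) -> E2 <= s * t -> I <= 2^-1 * Q + 2^-1 * P ->
  P <= 9 / 2 * (CS * A * t ^+ 2) + 5 / 2 * V ->
  V ^+ 2 <= C4 * (CS * (t ^+ 2) ^+ 2) -> 4^-1 * C4 <= Q ->
  2^-1 * (b * a) * s ^+ 2 + b * k * 4^-1 * Q <= - D - F +
    ((Cv + b * (2 * a + k)) ^+ 2 / (2 * (b * a)) + b * k * (9 / 4) * CS * A) * t ^+ 2 +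
    b * k * (25 / 4) * CS * (t ^+ 2) ^+ 2.
Proof.
move=> b0 a0 k0 CS0 s0 t0 C40 sE eq hcT hE hI hP hV hQ.
(* With the weights 1/20 and 5, the share of [C4] in P/2 is 5/4 * C4/20 = C4/16, hence at most Q/4.
   Added to the Q/2 already present in the bound on [I], it leaves a quarter of [Q] on the left. *)
have hV' : V <= C4 / 20 + 5 * (CS * (t ^+ 2) ^+ 2).
  have X0 : 0 <= CS * (t ^+ 2) ^+ 2 by rewrite mulr_ge0// sqr_ge0.
  move: (CS * _) hV X0 => X hV X0; apply: le_of_sqr.
    by rewrite addr_ge0// ?divr_ge0// mulr_ge0.
  apply: le_trans hV _; rewrite -subr_ge0.
  have -> : (C4 / 20 + 5 * X) ^+ 2 - C4 * X = (C4 / 20 - 5 * X) ^+ 2 + (C4 * X) * (4 * (20^-1 * 5) - 1) by field.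
  have -> : 4 * (20^-1 * 5) - 1 = 0 :> R by field.
  by rewrite mulr0 addr0 sqr_ge0.
have hab := absorb (Cv + b * (2 * a + k)) s t (mulr_gt0 b0 a0).
have bk : 0 < b * k by rewrite mulr_gt0.
have h1 : b * k * (I - Q + 4^-1 * Q) <= b * k * (9 / 4 * (CS * A * t ^+ 2) + 25 / 4 * (CS * (t ^+ 2) ^+ 2)).
  rewrite ler_pM2l//; move: (CS * A * t ^+ 2) (CS * (t ^+ 2) ^+ 2) hP hV' => X Y hP hV'.
  by clear -hI hP hV' hQ; lra.
have h2 : b * (2 * a + k) * E2 <= b * (2 * a + k) * (s * t).
  by rewrite ler_wpM2l// mulr_ge0 ?(ltW b0)// addr_ge0 ?(ltW k0)// mulr_ge0// ltW.
have h3 : - (Cv * (s * t)) <= cT by move: hcT; rewrite ler_norml => /andP[].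
have h4 : 0 <= b * (a + k) * t ^+ 2.
  by rewrite mulr_ge0 ?sqr_ge0// mulr_ge0 ?(ltW b0)// addr_ge0 ?(ltW a0)// ltW.
have E : - D - F - b * k * 4^-1 * Q = cT + b * a * s ^+ 2 - b * (2 * a + k) * E2 - b * k * (I - Q + 4^-1 * Q) + b * (a + k) * t ^+ 2.
  apply/eqP; rewrite -subr_eq0 -oppr_eq0 -[X in _ == X]eq sE; apply/eqP; ring.
rewrite -lerBrDr -!addrA [_ - b * k * 4^-1 * Q]addrC [- F + _]addrC.
suff : 2^-1 * (b * a) * s ^+ 2 <= (- D - F - b * k * 4^-1 * Q) +
    ((Cv + b * (2 * a + k)) ^+ 2 / (2 * (b * a)) + b * k * (9 / 4) * CS * A) * t ^+ 2 +
    b * k * (25 / 4) * CS * (t ^+ 2) ^+ 2.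
  by congr (_ <= _); move: (_ / _) => z; ring.
rewrite E; move: hab h1 h2 h3 h4; set K := Cv + b * (2 * a + k).
have -> : K * (s * t) = Cv * (s * t) + b * (2 * a + k) * (s * t) by rewrite /K; ring.
have -> : (K ^+ 2 / (2 * (b * a)) + b * k * (9 / 4) * CS * A) * t ^+ 2 =
   K ^+ 2 / (2 * (b * a)) * t ^+ 2 + b * k * (9 / 4 * (CS * A * t ^+ 2)).
  by move: (K ^+ 2 / _) => z; ring.
have -> : b * k * (25 / 4) * CS * (t ^+ 2) ^+ 2 = b * k * (25 / 4 * (CS * (t ^+ 2) ^+ 2)) by ring.
have -> : b * k * (9 / 4 * (CS * A * t ^+ 2) + 25 / 4 * (CS * (t ^+ 2) ^+ 2)) =
  b * k * (9 / 4 * (CS * A * t ^+ 2)) + b * k * (25 / 4 * (CS * (t ^+ 2) ^+ 2)) by ring.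
move: (b * k * (9 / 4 * _)) (b * k * (25 / 4 * _)) (K ^+ 2 / _ * _).
move: (2^-1 * _ * _) (b * a * s ^+ 2) (Cv * _) (b * (2 * a + k) * (s * t)) (b * k * (I - Q + 4^-1 * Q))
  (b * (2 * a + k) * E2) (b * (a + k) * _).
move=> x1 x2 x3 x4 x5 x6 x7 z1 z2 z3 h0 h1 h2 h3 h4.
by clear -h0 h1 h2 h3 h4; lra.
Qed.

Lemma sum_split_diff (R : nzRingType) (I : finType) (u ub x y z : I -> R) :
  (forall i, x i = y i + z i) ->
  \sum_i u i * x i - \sum_i ub i * z i = \sum_i u i * y i + \sum_i (u i - ub i) * z i.
Proof.
move=> xE; rewrite -sumrB -big_split; apply: eq_bigr => i _ /=.
by rewrite xE mulrDr mulrBl addrA.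
Qed.

Lemma combine_eq (R : comNzRingType) (l lb x y z w p q : R) : l + x + p = 0 ->
  lb + y + q = 0 -> x - y = z + w -> l - lb + z + w + (p - q) = 0.
Proof.
move=> h1 h2 h3; have -> : l - lb + z + w + (p - q) = (l + x + p) - (lb + y + q) - ((x - y) - (z + w)) by ring.
by rewrite h1 h2 h3 !subrr.
Qed.

Lemma H1ipE (R : realType) d (Om : set 'rV[R]_d) f g : H1ip Om f g = inner Om f g + gradip Om f g.
Proof. by []. Qed.

(** The scalar content of [rate_bound]. There W and Psi are the H1 norms of w and q - w, while s and
    p are those of e and phibar. T1 and T2 are the transport terms, Q is the cubic dissipation, and
    G, X, Y are the gradient, cubic and L2 pairings of e with q - w. Terms linear in s or p are
    dominated by 1 + p^2 + s^2 + Q. *)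
Lemma rate_bound_real (R : realType) (b a k CS' S W Psi s p Q T1 T2 G X Y D : R) :
  0 <= b -> 0 <= a -> 0 <= k -> 0 <= CS' -> 0 <= S -> 0 <= W -> 0 <= Psi -> 0 <= s -> 0 <= p -> 0 <= Q ->
  D + T1 + T2 + b * (a * G + k * (X - Y)) = 0 ->
  `|T1| <= S * W * s -> `|T2| <= 2 * (S * W * p) -> `|G| <= 2 * (s * Psi) ->
  `|X| <= 2^-1 * Q + 2^-1 * (9 / 2 * (CS' * p ^+ 2 * Psi ^+ 2) + 5 / 2 * (CS' * s ^+ 2 * Psi ^+ 2)) ->
  `|Y| <= s * Psi ->
  `|D| <= (3 * (S * W) + b * (2 * a * Psi + k * (2^-1 + 9 / 2 * CS' * Psi ^+ 2 + Psi))) *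
     (1 + p ^+ 2 + s ^+ 2 + Q).
Proof.
move=> b0 a0 k0 CS0' S0 W0 Psi0 s0 p0 Q0 eq hT1 hT2 hG hX hY.
set N := 1 + p ^+ 2 + s ^+ 2 + Q.
have sN : s <= N by rewrite /N; nra.
have pN : p <= N by rewrite /N; nra.
have N0 : 0 <= N := le_trans s0 sN.
have SW : 0 <= S * W by exact: mulr_ge0.
have h1 : `|T1| <= S * W * N by apply: le_trans hT1 _; rewrite ler_wpM2l.
have h2 : `|T2| <= 2 * (S * W) * N by apply: le_trans hT2 _; rewrite mulrA ler_wpM2l// mulr_ge0.
have h3 : `|G| <= 2 * Psi * N.
  by apply: le_trans hG _; rewrite -mulrA ler_wpM2l// mulrC ler_wpM2l.
have h4 : `|Y| <= Psi * N by apply: le_trans hY _; rewrite mulrC ler_wpM2l.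
have h5 : `|X| <= (2^-1 + 9 / 2 * CS' * Psi ^+ 2) * N.
  apply: le_trans hX _; set Z := CS' * Psi ^+ 2.
  have Z0 : 0 <= Z by rewrite mulr_ge0// sqr_ge0.
  have -> : CS' * p ^+ 2 * Psi ^+ 2 = Z * p ^+ 2 by rewrite /Z; ring.
  have -> : CS' * s ^+ 2 * Psi ^+ 2 = Z * s ^+ 2 by rewrite /Z; ring.
  have -> : (2^-1 + 9 / 2 * CS' * Psi ^+ 2) * N = 2^-1 * N + 9 / 2 * (Z * N) by rewrite /Z; ring.
  have z1 : Z * p ^+ 2 <= Z * N by rewrite ler_wpM2l// /N; have := sqr_ge0 s; nra.
  have z2 : Z * s ^+ 2 <= Z * N by rewrite ler_wpM2l// /N; have := sqr_ge0 p; nra.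
  have z3 : Q <= N by rewrite /N; have := sqr_ge0 p; have := sqr_ge0 s; nra.
  have z4 : 0 <= Z * N by rewrite mulr_ge0.
  move: (Z * p ^+ 2) (Z * s ^+ 2) (Z * N) z1 z2 z4 => y1 y2 y3 z1 z2 z4; lra.
have -> : D = - (T1 + T2 + b * (a * G + k * (X - Y))).
  by apply/eqP; rewrite -addr_eq0 !addrA eq.
rewrite normrN; apply: le_trans (ler_normD _ _) _.
have h6 : `|b * (a * G + k * (X - Y))| <= b * (a * (2 * Psi * N) + k * ((2^-1 + 9 / 2 * CS' * Psi ^+ 2) * N + Psi * N)).
  rewrite normrM (ger0_norm b0) ler_wpM2l//; apply: le_trans (ler_normD _ _) _.
  apply: lerD; rewrite normrM ger0_norm// ler_wpM2l//.
  by apply: le_trans (ler_normB _ _) _; rewrite lerD.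
apply: le_trans (lerD (le_trans (ler_normD _ _) (lerD h1 h2)) h6) _.
by rewrite le_eqVlt; apply/orP; left; apply/eqP; ring.
Qed.

Lemma rate_const_ge0 (R : realType) (CS' b a k S W Psi : R) : 0 <= CS' -> 0 <= b -> 0 <= a -> 0 <= k ->
  0 <= S -> 0 <= W -> 0 <= Psi ->
  0 <= 3 * (S * W) + b * (2 * a * Psi + k * (2^-1 + 9 / 2 * CS' * Psi ^+ 2 + Psi)).
Proof.
move=> CS0 b0 a0 k0 S0 W0 Psi0; have P2 := sqr_ge0 Psi.
have h1 : 0 <= S * W := mulr_ge0 S0 W0.
have h2 : 0 <= CS' * Psi ^+ 2 := mulr_ge0 CS0 P2.
have h3 : 0 <= a * Psi := mulr_ge0 a0 Psi0.
have h4 : 0 <= k * (2^-1 + 9 / 2 * CS' * Psi ^+ 2 + Psi) by rewrite mulr_ge0//; lra.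
have h5 : 0 <= b * (2 * a * Psi + k * (2^-1 + 9 / 2 * CS' * Psi ^+ 2 + Psi)) by rewrite mulr_ge0//; lra.
lra.
Qed.

Section Dissipation.
Context (R : realType) (d : nat) (Om : set 'rV[R]_d).
Local Notation leb := (lebesgue_rV R d).
Local Notation scal := ('rV[R]_d -> R).
Local Notation vect := ('rV[R]_d -> 'rV[R]_d).
Hypothesis oO : open Om.
Hypothesis finO : (leb Om < +oo)%E.
Variable CS : R.
Hypothesis CS0 : 0 <= CS.
Hypothesis sob : forall f, H1 Om f ->
  L4fun leb Om f /\ \int[leb]_(x in Om) (f x ^+ 4) <= CS * H1ip Om f f ^+ 2.

Let mO : measurable Om. Proof. exact: open_measurable_rV. Qed.
Let hL2 : semi_hilbert (L2 Om) (inner Om) := semi_hilbert_L2 leb mO.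
Let hH1 : semi_hilbert (H1 Om) (H1ip Om) := semi_hilbert_H1 oO finO.
Let L4 f (fH : H1 Om f) : L4fun leb Om f := (sob fH).1.

Lemma L1_mul4 f g h w : L4fun leb Om f -> L4fun leb Om g -> L4fun leb Om h -> L4fun leb Om w ->
  L1fun leb Om (fun x => f x * g x * (h x * w x)).
Proof. by move=> fL gL hL wL; exact: (L2_mul mO (L4_mul mO fL gL) (L4_mul mO hL wL)). Qed.

(* The divided difference of s |-> s^3. *)
Definition cubic_quot (f g : scal) : scal := fun x => f x ^+ 2 + f x * g x + g x ^+ 2.

Lemma cubic_quot_L2 f g : L4fun leb Om f -> L4fun leb Om g -> L2 Om (cubic_quot f g).
Proof.
move=> fL gL; exact: (L2D mO (L2D mO (L4_sqr fL) (L4_mul mO fL gL)) (L4_sqr gL)).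
Qed.

Lemma double_well_diff f g w : H1 Om f -> H1 Om g -> H1 Om w ->
  inner Om (fun x => derive1 (@double_well R) (f x)) w -
  inner Om (fun x => derive1 (@double_well R) (g x)) w =
  inner Om (cubic_quot f g) (fun x => (f - g) x * w x) - inner Om (f - g) w.
Proof.
move=> fH gH wH; have fL := L4 fH; have gL := L4 gH; have wL := L4 wH.
have L3 h : L4fun leb Om h -> L1fun leb Om (fun x => derive1 (@double_well R) (h x) * w x).
  move=> hL; apply: (L1_ext mO _ (L1B mO (L1_mul4 hL hL hL wL) (L2_mul mO (L4_L2 oO finO hL) (L4_L2 oO finO wL)))) => x _.
  by rewrite derive1_double_well; ring.
have eL : L4fun leb Om (fun x => (f - g) x) := L4B mO fL gL.
have qL : L1fun leb Om (fun x => cubic_quot f g x * ((f - g) x * w x)).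
  exact: (L2_mul mO (cubic_quot_L2 fL gL) (L4_mul mO eL wL)).
have ewL := L2_mul mO (L4_L2 oO finO eL) (L4_L2 oO finO wL).
rewrite /inner -(RintB mO (L3 _ fL) (L3 _ gL)) -(RintB mO qL ewL).
apply: Rint_ext => x _; rewrite !derive1_double_well /cubic_quot.
have -> : (f - g) x = f x - g x by [].
ring.
Qed.

Variables (I : finType) (chi : I -> vect).
Hypothesis chiH : forall i, H1v Om (chi i).
Variable Cc : I -> R.
Hypothesis Cc0 : forall i, 0 <= Cc i.
Hypothesis convC : forall i f w, H1 Om f -> H1 Om w ->
  `|conv Om (chi i) f w| <= Cc i * sh_norm (H1ip Om) f * sh_norm (H1ip Om) w.

Lemma mu_diff (a k : R) (phi phib mu mub w : scal) :
  H1 Om phi -> H1 Om phib -> H1 Om mu -> H1 Om mub ->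
  (forall w, H1 Om w -> a * gradip Om phi w +
     k * inner Om (fun x => derive1 (@double_well R) (phi x)) w = inner Om mu w) ->
  (forall w, H1 Om w -> a * gradip Om phib w +
     k * inner Om (fun x => derive1 (@double_well R) (phib x)) w = inner Om mub w) ->
  H1 Om w -> a * gradip Om (phi - phib) w +
    k * (inner Om (cubic_quot phi phib) (fun x => (phi - phib) x * w x) - inner Om (phi - phib) w) =
  inner Om (mu - mub) w.
Proof.
move=> phiH phibH muH mubH eq3 eq4 wH; rewrite -(double_well_diff phiH phibH wH).
rewrite (shBl hL2 (H1_L2 muH) (H1_L2 mubH) (H1_L2 wH)) -(eq3 w wH) -(eq4 w wH).
have -> : gradip Om (phi - phib) w = gradip Om phi w - gradip Om phib w.
  have -> : phi - phib = (-1) *: phib + phi by rewrite scaleN1r addrC.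
  by rewrite (gradip_lin oO finO (-1) phibH phiH wH) mulN1r addrC.
move: (gradip Om phi w) (gradip Om phib w) (inner Om _ w) (inner Om _ w) => y1 y2 y3 y4.
by ring.
Qed.

Lemma cubic_quot_ge0 f g x : 0 <= cubic_quot f g x.
Proof.
rewrite /cubic_quot; move: (f x) (g x) => y z.
have -> : y ^+ 2 + y * z + z ^+ 2 = (y + z / 2) ^+ 2 + 3 / 4 * z ^+ 2 by field.
by rewrite addr_ge0 ?sqr_ge0// mulr_ge0 ?sqr_ge0// divr_ge0.
Qed.

(** Young's inequality applied pointwise, which is legitimate because the cubic quotient is a
    nonnegative weight. *)
Lemma cubic_cross (f g e w : scal) : H1 Om f -> H1 Om g -> H1 Om e -> H1 Om w ->
  `|inner Om (cubic_quot f g) (fun x => e x * w x)| <=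
  2^-1 * inner Om (cubic_quot f g) (fun x => e x * e x) +
  2^-1 * inner Om (cubic_quot f g) (fun x => w x * w x).
Proof.
move=> /L4 fL /L4 gL /L4 eL /L4 wL; have qL := cubic_quot_L2 fL gL.
have LQ := L2_mul mO qL (L4_mul mO eL eL); have LP := L2_mul mO qL (L4_mul mO wL wL).
have LI := L2_mul mO qL (L4_mul mO eL wL).
rewrite {2 3}/inner -(RintZ mO 2^-1 LQ) -(RintZ mO 2^-1 LP) -(RintD mO (L1Z mO 2^-1 LQ) (L1Z mO 2^-1 LP)).
apply: le_trans (le_Rint_norm mO LI) _.
apply: (le_Rint mO (L1_normr LI) (L1D mO (L1Z mO 2^-1 LQ) (L1Z mO 2^-1 LP))) => x _.
have := cubic_quot_ge0 f g x; move: (cubic_quot _ _ x) (e x) (w x) => q y z q0.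
have -> : 2^-1 * (q * (y * y)) + 2^-1 * (q * (z * z)) = q * (2^-1 * (y * y + z * z)) by ring.
rewrite normrM (ger0_norm q0) ler_wpM2l// ler_norml; apply/andP; split; rewrite -subr_ge0.
  have -> : y * z - - (2^-1 * (y * y + z * z)) = 2^-1 * (y + z) ^+ 2 by field.
  by rewrite mulr_ge0 ?sqr_ge0.
have -> : 2^-1 * (y * y + z * z) - y * z = 2^-1 * (y - z) ^+ 2 by field.
by rewrite mulr_ge0 ?sqr_ge0.
Qed.

(** With e = f - g the cubic quotient equals e^2 + 3 e g + 3 g^2, and 3 e g <= 3/2 (e^2 + g^2). Only
    the reference [g] and the difference then appear, so no bound on [f] itself is required. *)
Lemma cubic_sqr (f g w : scal) : H1 Om f -> H1 Om g -> H1 Om w ->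
  inner Om (cubic_quot f g) (fun x => w x * w x) <=
  9 / 2 * inner Om (fun x => g x * w x) (fun x => g x * w x) +
  5 / 2 * inner Om (fun x => (f - g) x * w x) (fun x => (f - g) x * w x).
Proof.
move=> /L4 fL /L4 gL /L4 wL; have qL := cubic_quot_L2 fL gL.
have eL : L4fun leb Om (fun x => (f - g) x) := L4B mO fL gL.
have LP := L2_mul mO qL (L4_mul mO wL wL).
have gwL := L4_mul mO gL wL; have ewL := L4_mul mO eL wL.
have Lp := L2_mul mO gwL gwL; have LV := L2_mul mO ewL ewL.
rewrite {2 3}/inner -(RintZ mO (9 / 2) Lp) -(RintZ mO (5 / 2) LV) -(RintD mO (L1Z mO (9 / 2) Lp) (L1Z mO (5 / 2) LV)).
apply: (le_Rint mO LP (L1D mO (L1Z mO (9 / 2) Lp) (L1Z mO (5 / 2) LV))) => x _.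
have -> : (f - g) x = f x - g x by [].
rewrite /cubic_quot; move: (f x) (g x) (w x) => y p z.
rewrite -subr_ge0.
have -> : 9 / 2 * (p * z * (p * z)) + 5 / 2 * ((y - p) * z * ((y - p) * z)) - (y ^+ 2 + y * p + p ^+ 2) * (z * z) =
  3 / 2 * ((y - 2 * p) * z) ^+ 2 by field.
by rewrite mulr_ge0 ?sqr_ge0// divr_ge0.
Qed.

(** Both systems are tested with g = Ge and subtracted. The diffusion term becomes the pairing of
    the difference of the potentials with e and with Ge, and the equation for the potentials is then
    tested with both. *)
Lemma dissipation (b a k M : R) (phi phib mu mub : scal) (u ub : I -> R) (l lb : R) :
  0 < b -> 0 < a -> 0 < k -> H10 Om phi -> H10 Om phib -> H1 Om mu -> H1 Om mub ->
  (forall i, `|u i| <= M) ->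
  let e := phi - phib in let g := Gop Om e in
  l + \sum_i u i * conv Om (chi i) phi g + b * gradip Om mu g = 0 ->
  lb + \sum_i ub i * conv Om (chi i) phib g + b * gradip Om mub g = 0 ->
  (forall w, H1 Om w -> a * gradip Om phi w +
     k * inner Om (fun x => derive1 (@double_well R) (phi x)) w = inner Om mu w) ->
  (forall w, H1 Om w -> a * gradip Om phib w +
     k * inner Om (fun x => derive1 (@double_well R) (phib x)) w = inner Om mub w) ->
    2^-1 * (b * a) * H1ip Om e e +
    b * k * 4^-1 * inner Om (cubic_quot phi phib) (fun x => e x * e x) <=
   - (l - lb) - \sum_i (u i - ub i) * conv Om (chi i) phib g +
    ((\sum_i M * Cc i + b * (2 * a + k)) ^+ 2 / (2 * (b * a)) + b * k * (9 / 4) * CS * H1ip Om phib phib) * inner Om e g +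
    b * k * (25 / 4) * CS * inner Om e g ^+ 2.
Proof.
move=> b0 a0 k0 phiH0 phibH0 muH mubH uM e g eq1 eq2 eq3 eq4.
have [phiH m1] := phiH0; have [phibH m2] := phibH0.
have eH0 : H10 Om e := subspaceB (is_subspace_H10 oO finO) phiH0 phibH0.
have eH := H10_H1 eH0; have eL2 := H1_L2 eH; have eL4 := L4 eH.
have gH0 : H10 Om g := Gop_H10 oO finO eL2.
have gH := H10_H1 gH0; have gL4 := L4 gH; have gL2 := H1_L2 gH.
have emH : H1 Om (mu - mub) := subspaceB (is_subspace_H1 oO finO) muH mubH.
have e1 : inner Om e (fun=> 1) = 0 := H10_mean eH0.
have sE : sh_norm (H1ip Om) e ^+ 2 = H1ip Om e e := sh_norm2 hH1 eH.
have tE : sh_norm (H1ip Om) g ^+ 2 = inner Om e g.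
  by rewrite (sh_norm2 hH1 gH); exact: (Gop_norm oO finO eL2).
have C40 : 0 <= int4 Om e := int4_ge0 Om e.
have qL := cubic_quot_L2 (L4 phiH) (L4 phibH).
have eeL : L2 Om (fun x => e x * e x) := L4_mul mO eL4 eL4.
have egL : L2 Om (fun x => e x * g x) := L4_mul mO eL4 gL4.
have ggL : L2 Om (fun x => g x * g x) := L4_mul mO gL4 gL4.
have pL4 := L4 phibH.
have pgL : L2 Om (fun x => phib x * g x) := L4_mul mO pL4 gL4.
have phiE x : phi x = e x + phib x by rewrite /e !fctE subrK.
set Q := inner Om (cubic_quot phi phib) (fun x => e x * e x).
set II := inner Om (cubic_quot phi phib) (fun x => e x * g x).
set P := inner Om (cubic_quot phi phib) (fun x => g x * g x).
set V := inner Om (fun x => e x * g x) (fun x => e x * g x).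
have diffE w := mu_diff phiH phibH muH mubH eq3 eq4 (w := w).
(* For every f in H1 the definition of Ge gives (grad f, grad Ge) = (f, e) - (f, Ge), because e has
   zero mean. It is used for f = e here and for the difference of the potentials next. *)
have eg : gradip Om e g = inner Om e e - inner Om e g.
  have h : H1ip Om g e = inner Om e e := GopE oO finO eL2 eH0.
  have h2 : H1ip Om e g = H1ip Om g e := sh_sym hH1 eH gH.
  have h3 : H1ip Om e g = inner Om e g + gradip Om e g := H1ipE Om e g.
  by rewrite -h -h2 h3 [RHS]addrC addKr.
have emg : gradip Om mu g - gradip Om mub g = inner Om (mu - mub) e - inner Om (mu - mub) g.
  have h : H1ip Om g (mu - mub) = inner Om e (mu - mub) := GopE_H1 oO finO eL2 e1 emH.
  have h2 : H1ip Om (mu - mub) g = H1ip Om g (mu - mub) := sh_sym hH1 emH gH.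
  have h3 : H1ip Om (mu - mub) g = inner Om (mu - mub) g + gradip Om (mu - mub) g := H1ipE Om (mu - mub) g.
  have h4 : gradip Om (mu - mub) g = gradip Om mu g - gradip Om mub g.
    have -> : mu - mub = (-1) *: mub + mu by rewrite scaleN1r addrC.
    by rewrite (gradip_lin oO finO (-1) mubH muH gH) mulN1r addrC.
  by rewrite -h4 (innerC _ (mu - mub) e) -h -h2 h3 [RHS]addrC addKr.
rewrite -sE -tE.
apply: (@dissipation_real R b a k (\sum_i M * Cc i) CS (sh_norm (H1ip Om) e) (sh_norm (H1ip Om) g)
  (inner Om e e) (gradip Om e e) Q (int4 Om e) II P V (H1ip Om phib phib)
  (\sum_i u i * conv Om (chi i) e g) (l - lb) _ b0 a0 k0 CS0).
- exact: sh_norm_ge0.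
- exact: sh_norm_ge0.
- exact: C40.
- by rewrite sE H1ipE.
- have <- : inner Om (mu - mub) e = a * gradip Om e e + k * (Q - inner Om e e) := esym (diffE e eH).
  rewrite tE -eg.
  have <- : inner Om (mu - mub) g = a * gradip Om e g + k * (II - inner Om e g) := esym (diffE g gH).
  rewrite -emg mulrBr.
  have cE : \sum_i u i * conv Om (chi i) phi g - \sum_i ub i * conv Om (chi i) phib g =
     \sum_i u i * conv Om (chi i) e g + \sum_i (u i - ub i) * conv Om (chi i) phib g.
    apply: sum_split_diff => i.
    have -> : e = (-1) *: phib + phi by rewrite scaleN1r addrC.
    rewrite (conv_linl oO finO sob (-1) (chiH i) phibH phiH gH).
    by rewrite mulN1r addrC addNKr.
  exact: (combine_eq eq1 eq2 cE).
- apply: le_trans (ler_norm_sum _ _ _) _; rewrite mulr_suml; apply: ler_sum => i _.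
  rewrite normrM -mulrA; apply: ler_pM => //.
  by have := convC i eH gH; rewrite mulrA.
- have <- : H1ip Om g e = inner Om e e := GopE oO finO eL2 eH0.
  by apply: le_trans (ler_norm _) _; rewrite mulrC; exact: (sh_CS hH1 gH eH).
- by apply: le_trans (ler_norm _) _; exact: cubic_cross.
- have h : inner Om (fun x => phib x * g x) (fun x => phib x * g x) <=
     CS * H1ip Om phib phib * sh_norm (H1ip Om) g ^+ 2.
    by rewrite (sh_norm2 hH1 gH); exact: (inner_mul_H1 oO finO CS0 sob phibH gH).
  apply: le_trans (cubic_sqr phiH phibH gH) _.
  by rewrite lerD2r ler_pM2l.
- apply: le_trans (inner_sqr_mul oO eL4 gL4) _; apply: ler_wpM2l => //.
  by rewrite (sh_norm2 hH1 gH); exact: (sob gH).2.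
(* The cubic quotient dominates e^2/4: the difference e^2 + 3 e p + 3 p^2 - e^2/4 is 3 (e/2 +
   p)^2. *)
- have LQ := L2_mul mO qL eeL; have L44 := L2_mul mO eeL eeL.
  rewrite (_ : int4 Om e = inner Om (fun x => e x * e x) (fun x => e x * e x)); last first.
    by apply: Rint_ext => x _; ring.
  rewrite -(RintZ mO 4^-1 L44).
  apply: (le_Rint mO (L1Z mO 4^-1 L44) LQ) => x _.
  rewrite /cubic_quot phiE; move: (e x) (phib x) => y p.
  rewrite -subr_ge0.
  have -> : ((y + p) ^+ 2 + (y + p) * p + p ^+ 2) * (y * y) - 4^-1 * (y * y * (y * y)) =
    3 * ((y / 2 + p) * y) ^+ 2 by field.
  by rewrite mulr_ge0 ?sqr_ge0.
Qed.

(** When [w] is itself a Riesz representative of some [q] in H10, the diffusion term (grad (mu -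
    mub), grad w) equals (mu - mub, q - w), and q - w is regular enough to test the equation of the
    potentials. The rate is thus bounded by quantities that the dissipation controls, with no norm
    of the potentials involved. *)
Lemma rate_bound (b a k M : R) (w q : scal) : 0 <= b -> 0 <= a -> 0 <= k -> 0 <= M ->
  H10 Om w -> H10 Om q -> (forall v, H10 Om v -> H1ip Om w v = inner Om q v) ->
  exists2 C : R, 0 <= C & forall (phi phib mu mub : scal) (u ub : I -> R) (l lb : R),
  H10 Om phi -> H10 Om phib -> H1 Om mu -> H1 Om mub ->
  (forall i, `|u i| <= M) -> (forall i, `|ub i| <= M) ->
  l + \sum_i u i * conv Om (chi i) phi w + b * gradip Om mu w = 0 ->
  lb + \sum_i ub i * conv Om (chi i) phib w + b * gradip Om mub w = 0 ->
  (forall w, H1 Om w -> a * gradip Om phi w +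
     k * inner Om (fun x => derive1 (@double_well R) (phi x)) w = inner Om mu w) ->
  (forall w, H1 Om w -> a * gradip Om phib w +
     k * inner Om (fun x => derive1 (@double_well R) (phib x)) w = inner Om mub w) ->
  `|l - lb| <= C * (1 + H1ip Om phib phib + H1ip Om (phi - phib) (phi - phib) +
    inner Om (cubic_quot phi phib) (fun x => (phi - phib) x * (phi - phib) x)).
Proof.
move=> b0 a0 k0 M0 wH0 qH0 wE.
have wH := H10_H1 wH0; have qH := H10_H1 qH0.
have psiH : H1 Om (q - w) := subspaceB (is_subspace_H1 oO finO) qH wH.
have [W W0 WE] : exists2 W : R, 0 <= W & W = sh_norm (H1ip Om) w.
  exact: (ex_intro2 _ _ (sh_norm (H1ip Om) w) (sh_norm_ge0 _ _) (erefl _)).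
have [Psi Psi0 PsiE] : exists2 Psi : R, 0 <= Psi & Psi = sh_norm (H1ip Om) (q - w).
  exact: (ex_intro2 _ _ (sh_norm (H1ip Om) (q - w)) (sh_norm_ge0 _ _) (erefl _)).
have [S S0 SE] : exists2 S : R, 0 <= S & S = \sum_i M * Cc i.
  by exists (\sum_i M * Cc i) => //; apply: sumr_ge0 => i _; exact: mulr_ge0.
have C1 : 0 <= 3 * (S * W) + b * (2 * a * Psi + k * (2^-1 + 9 / 2 * CS * Psi ^+ 2 + Psi)).
  exact: rate_const_ge0.
exists (3 * (S * W) + b * (2 * a * Psi + k * (2^-1 + 9 / 2 * CS * Psi ^+ 2 + Psi))) => //.
move=> phi phib mu mub u ub l lb phiH0 phibH0 muH mubH uM ubM eq1 eq2 eq3 eq4.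
have phiH := H10_H1 phiH0; have phibH := H10_H1 phibH0.
set e := phi - phib.
have eH : H1 Om e := subspaceB (is_subspace_H1 oO finO) phiH phibH.
have emH : H1 Om (mu - mub) := subspaceB (is_subspace_H1 oO finO) muH mubH.
set Q := inner Om (cubic_quot phi phib) _.
have Q0 : 0 <= Q.
  by apply: Rintegral_ge0 => x _; rewrite mulr_ge0 ?cubic_quot_ge0// -expr2 sqr_ge0.
have cE : \sum_i u i * conv Om (chi i) phi w - \sum_i ub i * conv Om (chi i) phib w =
   \sum_i u i * conv Om (chi i) e w + \sum_i (u i - ub i) * conv Om (chi i) phib w.
  apply: sum_split_diff => i.
  have -> : e = (-1) *: phib + phi by rewrite scaleN1r addrC.
  rewrite (conv_linl oO finO sob (-1) (chiH i) phibH phiH wH).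
  by rewrite mulN1r addrC addNKr.
have gE : gradip Om mu w - gradip Om mub w = inner Om (mu - mub) (q - w).
  have h : H1ip Om w (mu - mub) = inner Om q (mu - mub).
    exact: (repr_H1 oO finO wH0 (H1_L2 qH) (H10_mean qH0) wE emH).
  have h2 : H1ip Om (mu - mub) w = H1ip Om w (mu - mub) := sh_sym hH1 emH wH.
  have h3 : H1ip Om (mu - mub) w = inner Om (mu - mub) w + gradip Om (mu - mub) w := H1ipE Om (mu - mub) w.
  have h4 : gradip Om (mu - mub) w = gradip Om mu w - gradip Om mub w.
    have -> : mu - mub = (-1) *: mub + mu by rewrite scaleN1r addrC.
    by rewrite (gradip_lin oO finO (-1) mubH muH wH) mulN1r addrC.
  rewrite -h4 (shBr hL2 (H1_L2 qH) (H1_L2 wH) (H1_L2 emH)) (innerC _ (mu - mub) q) -h -h2 h3.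
  by rewrite addrAC subrr add0r.
have := combine_eq eq1 eq2 cE; rewrite -mulrBr gE -(mu_diff phiH phibH muH mubH eq3 eq4 psiH) -/e.
move=> eq.
pose T1 := \sum_i u i * conv Om (chi i) e w.
pose T2 := \sum_i (u i - ub i) * conv Om (chi i) phib w.
pose G := gradip Om e (q - w).
pose X := inner Om (cubic_quot phi phib) (fun x => e x * (q - w) x).
pose Y := inner Om e (q - w).
pose s := sh_norm (H1ip Om) e; pose p := sh_norm (H1ip Om) phib.
have s0 : 0 <= s := sh_norm_ge0 _ _; have p0 : 0 <= p := sh_norm_ge0 _ _.
have sE : s ^+ 2 = H1ip Om e e := sh_norm2 hH1 eH.
have pE : p ^+ 2 = H1ip Om phib phib := sh_norm2 hH1 phibH.
rewrite -sE -pE.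
have hT1 : `|T1| <= S * W * s.
  apply: le_trans (ler_norm_sum _ _ _) _; rewrite SE !mulr_suml; apply: ler_sum => i _.
  rewrite normrM -!mulrA; apply: ler_pM => //.
  by apply: le_trans (convC i eH wH) _; rewrite -mulrA WE [X in _ <= _ * X]mulrC.
have hT2 : `|T2| <= 2 * (S * W * p).
  apply: le_trans (ler_norm_sum _ _ _) _; rewrite SE !mulr_suml mulr_sumr; apply: ler_sum => i _.
  rewrite normrM -!mulrA mulrA; apply: ler_pM => //; last first.
    by apply: le_trans (convC i phibH wH) _; rewrite -mulrA WE [X in _ <= _ * X]mulrC.
  by apply: le_trans (ler_normB _ _) _; rewrite mulr_natl mulr2n lerD.
have hY : `|Y| <= s * Psi.
  rewrite PsiE; apply: le_trans (sh_CS hL2 (H1_L2 eH) (H1_L2 psiH)) _.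
  by apply: ler_pM; [exact: sh_norm_ge0|exact: sh_norm_ge0| |]; apply: ler_wsqrtr; exact: inner_le_H1.
have hG : `|G| <= 2 * (s * Psi).
  have -> : G = H1ip Om e (q - w) - Y by rewrite H1ipE addrAC subrr add0r.
  have := sh_CS hH1 eH psiH; rewrite -PsiE => h.
  by apply: le_trans (ler_normB _ _) _; rewrite mulr_natl mulr2n lerD.
have hX : `|X| <= 2^-1 * Q + 2^-1 * (9 / 2 * (CS * p ^+ 2 * Psi ^+ 2) + 5 / 2 * (CS * s ^+ 2 * Psi ^+ 2)).
  apply: le_trans (cubic_cross phiH phibH eH psiH) _; rewrite lerD2l ler_pM2l ?invr_gt0//.
  apply: le_trans (cubic_sqr phiH phibH psiH) _.
  have Psi2 : Psi ^+ 2 = H1ip Om (q - w) (q - w) by rewrite PsiE; exact: (sh_norm2 hH1 psiH).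
  have c1 : (0 : R) <= 9 / 2 by rewrite divr_ge0.
  have c2 : (0 : R) <= 5 / 2 by rewrite divr_ge0.
  have m1 := inner_mul_H1 oO finO CS0 sob phibH psiH.
  have m2 := inner_mul_H1 oO finO CS0 sob eH psiH.
  rewrite -pE -Psi2 in m1; rewrite -sE -Psi2 in m2.
  exact: (lerD (ler_wpM2l c1 m1) (ler_wpM2l c2 m2)).
exact: (@rate_bound_real R b a k CS S W Psi s p Q T1 T2 G X Y (l - lb)).
Qed.

End Dissipation.

(** * Bochner measurability *)

Section AEMeasurable.
Import HBNNSimple.
Context d (X : measurableType d) (R : realType).
Variables (mu : {measure set X -> \bar R}) (D : set X).
Hypothesis mD : measurable D.

(** No measurability is involved: the integral of a nonnegative function is a supremum over the
    simple functions below it, hence monotone. *)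
Lemma le_integral_ge0 (f g : X -> \bar R) : (forall x, D x -> (0 <= f x)%E) ->
  (forall x, D x -> (f x <= g x)%E) ->
  (\int[mu]_(x in D) f x <= \int[mu]_(x in D) g x)%E.
Proof.
move=> f0 fg; rewrite !ge0_integralE//; last by move=> x Dx; exact: le_trans (f0 x Dx) (fg x Dx).
apply: le_ereal_sup => _ [h hf <-]; exists h => // x.
apply: le_trans (hf x) _; rewrite /patch; case: ifPn => //.
by rewrite inE => /fg.
Qed.

(** Only [g] is measurable. Simple functions below [f] lie below [g] off the null set, which gives
    one inequality; restricting [g] to the complement of that set gives the other. *)
Lemma ge0_ae_integral (f g : X -> \bar R) : (forall x, D x -> (0 <= f x)%E) ->
  (forall x, D x -> (0 <= g x)%E) -> measurable_fun D g ->
  {ae mu, forall x, D x -> f x = g x} ->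
  (\int[mu]_(x in D) f x = \int[mu]_(x in D) g x)%E.
Proof.
move=> f0 g0 mg [N [mN N0 sN]].
have mDN : measurable (D `\` N) by exact: measurableD.
have g1 : (\int[mu]_(x in D `\` N) g x = \int[mu]_(x in D) g x)%E.
  by rewrite [RHS](ge0_negligible_integral mN)//.
apply/eqP; rewrite eq_le; apply/andP; split; last first.
  rewrite -g1 !ge0_integralE//; last by move=> x [Dx _]; exact: g0.
  apply: le_ereal_sup => _ [h hf <-]; exists h => // x.
  apply: le_trans (hf x) _; rewrite /patch; case: ifPn => [|_].
    rewrite inE => -[Dx nNx]; rewrite mem_set//.
    suff -> : f x = g x by [].
    by apply: contra_notP nNx => fgx; apply: sN => /= /(_ Dx).
  by case: ifPn => //; rewrite inE => /f0.
rewrite ge0_integralE//; apply: ge_ereal_sup => _ [h hf <-].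
have := integral_nnsfun mu measurableT h; rewrite patch_setT => <-.
rewrite [X in (_ <= X)%E]integral_mkcond; apply: ae_ge0_le_integral => //.
- by move=> x _; rewrite lee_fin; exact: fun_ge0.
- exact/measurable_EFinP.
- by move=> x _; rewrite /patch; case: ifPn => //; rewrite inE => /g0.
- by apply/(measurable_restrictT g mD).
- exists N; split => // x /= h1; apply: contrapT => nNx; apply: h1 => _.
  apply: le_trans (hf x) _; rewrite /patch; case: ifPn => //.
  rewrite inE => Dx; suff -> : f x = g x by [].
  by apply: contra_notP nNx => fgx; apply: sN => /= /(_ Dx).
Qed.

Lemma ae_Rint_ext (f g : X -> R) : measurable_fun D g ->
  {ae mu, forall x, D x -> f x = g x} ->
  \int[mu]_(x in D) f x = \int[mu]_(x in D) g x.
Proof.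
move=> mg fg; rewrite /Rintegral; congr fine; rewrite integralE [RHS]integralE.
have mg' : measurable_fun D (EFin \o g) by exact/measurable_EFinP.
congr (_ - _)%E; apply: ge0_ae_integral => //.
- exact: measurable_funepos.
- by apply: filterS fg => x h Dx; rewrite !funeposE /= h.
- exact: measurable_funeneg.
- by apply: filterS fg => x h Dx; rewrite !funenegE /= h.
Qed.

(** Time functions such as the norm of a Bochner measurable map are specified only almost
    everywhere, and their values involve chosen representatives. They can only be shown to agree
    almost everywhere with a measurable function. *)
Definition ae_meas (f : X -> R) := exists2 g, measurable_fun D g &
  {ae mu, forall x, D x -> f x = g x}.

Lemma ae_meas_meas f : measurable_fun D f -> ae_meas f.
Proof. by move=> mf; exists f => //; apply: aeW. Qed.

Lemma ae_meas_ae f g : {ae mu, forall x, D x -> f x = g x} -> ae_meas g -> ae_meas f.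
Proof.
move=> fg [h mh gh]; exists h => //; apply: filterS2 fg gh => x a b Dx.
by rewrite a// b.
Qed.

Lemma ae_measD f g : ae_meas f -> ae_meas g -> ae_meas (fun x => f x + g x).
Proof.
move=> [f' mf ff] [g' mg gg]; exists (fun x => f' x + g' x); first exact: measurable_funD.
by apply: filterS2 ff gg => x a b Dx; rewrite a// b.
Qed.

Lemma ae_measM f g : ae_meas f -> ae_meas g -> ae_meas (fun x => f x * g x).
Proof.
move=> [f' mf ff] [g' mg gg]; exists (fun x => f' x * g' x); first exact: measurable_funM.
by apply: filterS2 ff gg => x a b Dx; rewrite a// b.
Qed.

Lemma ae_meas_cst c : ae_meas (fun=> c).
Proof. exact: ae_meas_meas. Qed.

Lemma ae_meas_sum (I : Type) (r : seq I) (f : I -> X -> R) :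
  (forall i, ae_meas (f i)) -> ae_meas (fun x => \sum_(i <- r) f i x).
Proof.
move=> h; elim: r => [|i r IH].
  by apply: (ae_meas_ae _ (ae_meas_cst 0)); apply: aeW => x _; rewrite big_nil.
by apply: (ae_meas_ae _ (ae_measD (h i) IH)); apply: aeW => x _; rewrite big_cons.
Qed.

(** All exceptional sets are gathered in one null set [N]; multiplying by the indicator of its
    complement makes the measurable versions converge everywhere. *)
Lemma ae_meas_lim (f_ : nat -> X -> R) f : (forall n, ae_meas (f_ n)) ->
  {ae mu, forall x, D x -> f_ n x @[n --> \oo] --> f x} -> ae_meas f.
Proof.
move=> mf_ cf.
have /choice[g gP] : forall n, exists g, measurable_fun D g /\
    {ae mu, forall x, D x -> f_ n x = g x}.
  by move=> n; have [g mg ae] := mf_ n; exists g.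
have : {ae mu, forall x, (forall n, D x -> f_ n x = g n x) /\
    (D x -> f_ n x @[n --> \oo] --> f x)}.
  have h : {ae mu, forall x, forall n, D x -> f_ n x = g n x}.
    by apply: ae_foralln => n; exact: (gP n).2.
  by apply: filterS2 h cf => x a b; split.
move=> [N [mN N0 sN]].
exists (fun x => f x * \1_(~` N) x); last first.
  exists N; split => // x /= h; apply: contrapT => nNx; apply: h => _.
  by rewrite indicE mem_set// mulr1.
have mI : measurable_fun D (\1_(~` N) : X -> R).
  by apply: measurable_indic; exact: measurableC.
apply: (@measurable_fun_cvg _ _ R D (fun n x => g n x * \1_(~` N) x)).
  by move=> n; apply: measurable_funM => //; exact: (gP n).1.
move=> x Dx; rewrite indicE; have [Nx|nNx] := pselect (N x).
  have -> : (x \in ~` N) = false by apply/negbTE; rewrite notin_setE /= => h; exact: h.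
  rewrite mulr0; under eq_fun do rewrite mulr0; exact: cvg_cst.
rewrite mem_set// mulr1; under eq_fun do rewrite mulr1.
have [a b] : (forall n, D x -> f_ n x = g n x) /\ (D x -> f_ n x @[n --> \oo] --> f x).
  by apply: contrapT => h; apply: nNx; exact: sN.
by move: (b Dx); under eq_fun do rewrite a//.
Qed.

Lemma ae_meas_if (A : set X) f g : measurable A -> ae_meas f -> ae_meas g ->
  ae_meas (fun x => if x \in A then f x else g x).
Proof.
move=> mA mf mg.
have mI : measurable_fun D (\1_A : X -> R) by exact: measurable_indic.
have mI' : measurable_fun D (\1_(~` A) : X -> R).
  by apply: measurable_indic; exact: measurableC.
apply: (ae_meas_ae _ (ae_measD (ae_measM (ae_meas_meas mI) mf) (ae_measM (ae_meas_meas mI') mg))).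
apply: aeW => x _; rewrite !indicE in_setC.
by case: (x \in A); rewrite /= ?mul1r ?mul0r ?addr0 ?add0r.
Qed.

Lemma ae_meas_L1 f : ae_meas f -> (exists2 g, L1fun mu D g &
   {ae mu, forall x, D x -> `|f x| <= g x}) ->
  exists2 g, L1fun mu D g & {ae mu, forall x, D x -> f x = g x}.
Proof.
move=> [h mh fh] [g Lg fg]; exists h => //.
by apply: (ae_L1_le mD mh Lg); apply: filterS2 fh fg => x a b Dx; rewrite -a// b.
Qed.

Lemma ae_meas_L2 f : ae_meas f -> (\int[mu]_(x in D) (f x ^+ 2)%:E < +oo)%E ->
  exists2 g, L2fun mu D g & {ae mu, forall x, D x -> f x = g x}.
Proof.
move=> [g mg fg] h; exists g => //; split => //.
have <- // : (\int[mu]_(x in D) (f x ^+ 2)%:E = \int[mu]_(x in D) (g x ^+ 2)%:E)%E.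
apply: ge0_ae_integral.
- by move=> x _; rewrite lee_fin sqr_ge0.
- by move=> x _; rewrite lee_fin sqr_ge0.
- by apply/measurable_EFinP; exact: measurable_funX.
- by apply: filterS fg => x a Dx; rewrite a.
Qed.

End AEMeasurable.

(** * Pairings and approximation of Bochner measurable maps *)

Section BochnerTime.
Context (R : realType) (T : R) (V : lmodType R).
Local Notation I := (`]0%R, T[%classic : set (measurableTypeR R)).
Local Notation time := (@lebesgue_measure R).

Let mI : measurable I. Proof. exact: (@measurable_itvT R (Interval _ _)). Qed.

(** [Phi] need not be additive in the vector, so a sum over pieces cannot be split. The induction
    instead adds the value on the last piece to the offset [x0], or leaves the offset unchanged,
    according to whether t lies in that piece. *)
Lemma simple_pairing_shift (X : set V) (Phi : R -> V -> R) : is_subspace X ->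
  (forall x, X x -> ae_meas time I (Phi ^~ x)) ->
  forall k (A : 'I_k -> set R) (x : 'I_k -> V), (forall j, measurable (A j)) ->
  (forall j, X (x j)) -> forall x0, X x0 ->
  ae_meas time I (fun t => Phi t (x0 + \sum_(j < k) \1_(A j) t *: x j)).
Proof.
move=> sX mPhi; elim=> [|k IH] A x mA Xx x0 X0.
  by apply: (ae_meas_ae _ (mPhi x0 X0)); apply: aeW => t _; rewrite big_ord0 addr0.
pose S t := \sum_(j < k) \1_(A (widen_ord (leqnSn k) j)) t *: x (widen_ord (leqnSn k) j).
have h y : X y -> ae_meas time I (fun t => Phi t (y + S t)).
  by move=> Xy; exact: (IH _ _ (fun j => mA _) (fun j => Xx _)).
have mA' : @measurable _ (measurableTypeR R) (A ord_max) by exact: mA.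
have X1 : X (x0 + x ord_max) by exact: (subspaceD sX).
apply: (ae_meas_ae _ (ae_meas_if mA' (h _ X1) (h x0 X0))).
apply: aeW => t _; rewrite big_ord_recr /= -/(S t) indicE.
by case: (t \in A ord_max); rewrite ?scale1r ?scale0r ?addr0// [S t + _]addrC addrA.
Qed.

Lemma simple_pairing (X : set V) (Phi : R -> V -> R) s : is_subspace X ->
  (forall x, X x -> ae_meas time I (Phi ^~ x)) -> simple_into X s ->
  ae_meas time I (fun t => Phi t (s t)).
Proof.
move=> sX mPhi [k [A [x [mA Xx ->]]]].
apply: (ae_meas_ae _ (@simple_pairing_shift X Phi sX mPhi k A x mA Xx 0 sX.1)).
by apply: aeW => t _; rewrite add0r.
Qed.

Lemma simple_into_in (X : set V) s t : is_subspace X -> simple_into X s -> X (s t).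
Proof.
move=> sX [k [A [x [mA Xx ->]]]]; apply: (big_ind X) => [|y z Xy Xz|j _].
- exact: sX.1.
- exact: (subspaceD sX).
- exact: (subspaceZ _ sX).
Qed.

(** A Caratheodory argument: along simple functions the pairing is measurable piece by piece, and
    the Lipschitz bound in the vector variable passes to the limit at almost every time. *)
Lemma strong_pairing (X : set V) (N : V -> R) (Phi : R -> V -> R) (K : R -> R) u :
  is_subspace X -> (forall x, X x -> ae_meas time I (Phi ^~ x)) ->
  {ae time, forall t, I t -> forall x y, X x -> X y -> `|Phi t x - Phi t y| <= K t * N (x - y)} ->
  strongly_measurable X N T u -> ae_meas time I (fun t => Phi t (u t)).
Proof.
move=> sX mPhi hK [s [ss cs]].
apply: (@ae_meas_lim _ _ _ time I (fun n (t : measurableTypeR R) => Phi t (s n t)) (fun t => Phi t (u t))).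
  by move=> n; exact: (simple_pairing sX mPhi).
apply: filterS2 hK cs => t hK cs It; have [Xu cu] := cs It.
apply/cvgrPdist_le => e e0.
have e1 : 0 < e / (`|K t| + 1) by rewrite divr_gt0// ltr_wpDl.
move/cvgrPdist_le : cu => /(_ _ e1); apply: filterS => n /=; rewrite sub0r normrN => hn.
apply: le_trans (hK It _ _ Xu (simple_into_in t sX (ss n))) _.
apply: le_trans (ler_norm _) _; rewrite normrM.
apply: le_trans (ler_wpM2l _ hn) _; first exact: normr_ge0.
by rewrite mulrCA ler_piMr ?(ltW e0)// ler_pdivrMr ?ltr_wpDl// mul1r lerDl.
Qed.

Definition seminorm_on (X : set V) (N : V -> R) :=
  is_subspace X /\ forall x y, X x -> X y -> `|N x - N y| <= N (x - y).

Lemma seminorm_ge0 X N x : seminorm_on X N -> X x -> 0 <= N x.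
Proof.
move=> [sX h] Xx; rewrite -[x]subr0; apply: le_trans (h _ _ Xx sX.1); exact: normr_ge0.
Qed.

Lemma strong_norm_meas X N u : seminorm_on X N -> strongly_measurable X N T u ->
  ae_meas time I (fun t => N (u t)).
Proof.
move=> [sX h]; apply: (@strong_pairing X N (fun _ x => N x) (fun=> 1)) => //.
  by move=> x _; exact: ae_meas_cst.
by apply: aeW => t _ x y Xx Xy; rewrite mul1r; exact: h.
Qed.

Lemma bochner_normP X N u : seminorm_on X N -> bochner_L2 X N T u ->
  exists2 g, L2fun time I g & {ae time, forall t, I t -> X (u t) /\ N (u t) = g t}.
Proof.
move=> sN [su fu]; have [g Lg gE] := ae_meas_L2 mI (strong_norm_meas sN su) fu.
exists g => //; have [s [_ cs]] := su.
by apply: filterS2 gE cs => t a b It; have [Xu _] := b It; split => //; exact: a.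
Qed.

Lemma strong_dist_meas X N u s : seminorm_on X N -> strongly_measurable X N T u ->
  simple_into X s -> ae_meas time I (fun t => N (u t - s t)).
Proof.
move=> sN su ss; have [sX h] := sN.
apply: (@strong_pairing X N (fun t x => N (x - s t)) (fun=> 1)) => //.
  move=> x Xx; apply: (@simple_pairing X (fun _ y => N (x - y))) => // y Xy.
  exact: ae_meas_cst.
apply: aeW => t _ x y Xx Xy; rewrite mul1r.
have Xs := simple_into_in t sX ss.
apply: le_trans (h _ _ (subspaceB sX Xx Xs) (subspaceB sX Xy Xs)) _.
by rewrite opprB addrA subrK.
Qed.

Lemma simple_into_restrict (X : set V) (E : set R) s : measurable E -> simple_into X s ->
  simple_into X (fun t => \1_E t *: s t).
Proof.
move=> mE [k [A [x [mA Xx ->]]]]; exists k, (fun j => E `&` A j), x; split => //.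
  by move=> j; exact: measurableI.
apply/funext => t; rewrite scaler_sumr; apply: eq_bigr => j _.
by rewrite indicI scalerA.
Qed.

(** Strong measurability gives only pointwise convergence of simple functions. Cutting them off
    where they are far from [u] makes the error dominated, so that it also tends to zero in L1 in
    time. *)
Lemma bochner_simple_approx X N u (e : R) : seminorm_on X N -> bochner_L2 X N T u -> 0 < e ->
  exists2 s, simple_into X s & exists g, [/\ L1fun time I g,
    {ae time, forall t, I t -> X (u t) /\ N (u t - s t) = g t} & \int[time]_(t in I) g t <= e].
Proof.
move=> sN bu e0; have [gu Lgu guE] := bochner_normP sN bu; have [su _] := bu.
have [s [ss cs]] := su; have sX := sN.1.
have /choice[g gP] : forall n, exists g, measurable_fun I g /\
    {ae time, forall t, I t -> N (u t - s n t) = g t}.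
  by move=> n; have [g mg ae] := strong_dist_meas sN su (ss n); exists g.
(* The set where the error is at most one: outside it the simple function is set to zero and the
   error is the norm of [u], so 1 + |u| dominates in both cases. *)
pose E n : set (measurableTypeR R) := I `&` [set t | `|g n t| <= 1].
have mE n : measurable (E n).
  have mn : measurable_fun I (fun t => `|g n t|) by apply: measurableT_comp => //; exact: (gP n).1.
  have := mn mI _ (@measurable_itv R `]-oo, 1]).
  suff -> : E n = I `&` (fun t => `|g n t|) @^-1` `]-oo, 1]%classic by [].
  by apply/seteqP; split => t [It] /=; rewrite ?in_itv.
pose h n t := if t \in E n then g n t else gu t.
have LD : L1fun time I (fun t => 1 + `|gu t|).
  apply: (L1D mI); first exact: (L1_cst mI _ (time_finite T)).
  by apply: L1_normr; exact: (L2_L1 mI (time_finite T)).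
have hD n t : I t -> `|h n t| <= 1 + `|gu t|.
  move=> It; rewrite /h; case: ifPn => [|_]; last by rewrite lerDr.
  by rewrite inE => -[_] /= h1; apply: le_trans h1 _; rewrite lerDl.
have mh n : measurable_fun I (h n).
  have -> : h n = fun t => \1_(E n) t * g n t + \1_(~` E n) t * gu t.
    apply/funext => t; rewrite /h !indicE in_setC.
    by case: (t \in E n); rewrite /= ?mul1r ?mul0r ?addr0 ?add0r.
  have m1 : measurable_fun I (\1_(E n) : measurableTypeR R -> R) by exact: measurable_indic.
  have m2 : measurable_fun I (\1_(~` E n) : measurableTypeR R -> R).
    by apply: measurable_indic; exact: measurableC.
  apply: measurable_funD; apply: measurable_funM => //; first exact: (gP n).1.
  exact: (L2_meas Lgu).
have ch : {ae time, forall t, I t -> h n t @[n --> \oo] --> (0 : R)}.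
  have hg : {ae time, forall t, forall n, I t -> N (u t - s n t) = g n t}.
    by apply: ae_foralln => n; exact: (gP n).2.
  apply: filterS2 hg cs => t hg cs It; have [Xu cu] := cs It.
  apply/cvgrPdist_le => r r0.
  have r1 : 0 < Num.min r 1 by rewrite lt_min r0 ltr01.
  move/cvgrPdist_le : cu => /(_ _ r1); apply: filterS => n /=.
  rewrite !sub0r !normrN le_min hg// => /andP[hr h1].
  by rewrite /h mem_set.
have m0 : measurable_fun I (fun=> 0 : R) by exact: measurable_cst.
have c0 := Rint_dominated mI mh m0 ch LD hD.
rewrite (Rint0 time mI) in c0.
move/cvgrPdist_le : c0 => /(_ _ e0) [n _ /(_ n (leqnn n))] /=; rewrite sub0r normrN => hn.
exists (fun t => \1_(E n) t *: s n t); first exact: (simple_into_restrict (mE n) (ss n)).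
exists (h n); split.
- exact: (L1_le mI (mh n) (hD n) LD).
- apply: filterS2 (gP n).2 guE => t a b It; have [Xu bE] := b It; split => //.
  rewrite /h indicE; case: (t \in E n); last by rewrite scale0r subr0.
  by rewrite scale1r a.
- exact: le_trans (ler_norm _) hn.
Qed.

End BochnerTime.

(** * The dual seminorm on functionals *)

Section DualNorm.
Context (R : realType) (d : nat) (Om : set 'rV[R]_d).
Hypothesis oO : open Om.
Hypothesis finO : (lebesgue_rV R d Om < +oo)%E.
Local Notation scal := ('rV[R]_d -> R).

Let hH1 : semi_hilbert (H1 Om) (H1ip Om) := semi_hilbert_H1 oO finO.
Let hH10 : semi_hilbert (H10 Om) (H1ip Om) := semi_hilbert_H10 oO finO.

Lemma seminorm_sh (V : lmodType R) (X : set V) (B : V -> V -> R) :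
  semi_hilbert X B -> seminorm_on X (sh_norm B).
Proof. by move=> h; split; [exact: sh_sub h|move=> x y; exact: sh_norm_dist]. Qed.

Lemma is_subspace_Hm1 : is_subspace (Hm1 Om : set (scal -> R)).
Proof.
split.
  split; first by move=> a f g _ _; rewrite mulr0 addr0.
  by exists 0 => f _; rewrite normr0 mul0r.
move=> a l1 l2 [lin1 [C1 h1]] [lin2 [C2 h2]]; split.
  move=> c f g fH gH; rewrite !fctE /= lin1// lin2//.
  by rewrite !scalerDr /GRing.scale /=; ring.
exists (`|a| * C1 + C2) => f fH; rewrite !fctE /=.
apply: le_trans (ler_normD _ _) _; rewrite mulrDl; apply: lerD; last exact: h2.
by rewrite normrM -mulrA ler_wpM2l// h1.
Qed.

Let dual_set (l : scal -> R) := [set `|l f| | f in [set f : scal | H10 Om f /\ normH1 Om f <= 1]].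

Lemma dual_set_sup l : Hm1 Om l -> has_sup (dual_set l).
Proof.
move=> [lin [C hC]]; split.
  have H0 : H10 Om 0 by exact: (sh_sub hH10).1.
  exists `|l 0|; exists 0 => //; split => //.
  by rewrite (normH1E oO (H10_H1 H0)) /sh_norm (sh0l hH10 H0) sqrtr0.
exists `|C| => _ [f [fH f1] <-]; apply: le_trans (hC f fH) _.
apply: le_trans (ler_norm _) _; rewrite normrM ler_piMr// ger0_norm//.
by rewrite (normH1E oO (H10_H1 fH)) sh_norm_ge0.
Qed.

Lemma normHm1_le l w : Hm1 Om l -> H10 Om w -> `|l w| <= normHm1 Om l * sh_norm (H1ip Om) w.
Proof.
move=> lH wH; have [lin [C hC]] := lH.
have [w0|wn] := eqVneq (sh_norm (H1ip Om) w) 0.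
  by have := hC w wH; rewrite (normH1E oO (H10_H1 wH)) w0 !mulr0.
have w0 : 0 < sh_norm (H1ip Om) w by rewrite lt_neqAle eq_sym wn sh_norm_ge0.
set s := sh_norm _ w in wn w0 *.
have vH : H10 Om (s^-1 *: w) := subspaceZ _ (sh_sub hH10) wH.
have H0 : H10 Om 0 := (sh_sub hH10).1.
have lZ c f : H10 Om f -> l (c *: f) = c * l f.
  move=> fH; have l0 : l 0 = 0.
    by have := lin 1 0 0 H0 H0; rewrite scale1r addr0 mul1r => /eqP; rewrite -subr_eq0 opprD addNKr oppr_eq0 => /eqP.
  by have := lin c f 0 fH H0; rewrite addr0 l0 addr0.
have : `|l (s^-1 *: w)| <= normHm1 Om l.
  apply: (sup_upper_bound (dual_set_sup lH)); exists (s^-1 *: w) => //; split => //.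
  rewrite (normH1E oO (H10_H1 vH)) (sh_normZ hH1 _ (H10_H1 wH)) ger0_norm ?invr_ge0 ?(ltW w0)//.
  by rewrite mulVf.
rewrite lZ// normrM ger0_norm ?invr_ge0 ?(ltW w0)// => h.
by rewrite -ler_pdivrMr// mulrC.
Qed.

Lemma normHm1_triangle l1 l2 : Hm1 Om l1 -> Hm1 Om l2 ->
  normHm1 Om l1 <= normHm1 Om l2 + normHm1 Om (l1 - l2).
Proof.
move=> h1 h2; have h3 := subspaceB is_subspace_Hm1 h1 h2.
apply: ge_sup; first by have [] := dual_set_sup h1.
move=> _ [f [fH f1] <-].
have -> : l1 f = l2 f + (l1 - l2) f by change (l1 f = l2 f + (l1 f - l2 f)); ring.
apply: le_trans (ler_normD _ _) _; apply: lerD.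
  by apply: (sup_upper_bound (dual_set_sup h2)); exists f.
by apply: (sup_upper_bound (dual_set_sup h3)); exists f.
Qed.

Lemma normHm1N l1 l2 : normHm1 Om (l1 - l2) = normHm1 Om (l2 - l1).
Proof.
rewrite /normHm1; congr sup; apply/seteqP; split => _ [f hf <-]; exists f => //;
by rewrite -normrN !fctE opprB.
Qed.

Lemma seminorm_Hm1 : seminorm_on (Hm1 Om : set (scal -> R)) (normHm1 Om).
Proof.
split; first exact: is_subspace_Hm1.
move=> l1 l2 h1 h2; have t1 := normHm1_triangle h1 h2; have t2 := normHm1_triangle h2 h1.
rewrite normHm1N in t2; move: (normHm1 Om l1) (normHm1 Om l2) (normHm1 _ _) t1 t2 => x y z t1 t2.
by rewrite ler_norml; apply/andP; split; lra.
Qed.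

End DualNorm.

(** * Time integrals and the Gronwall argument *)

(** Consider the infimum of the set of failures: the first hypothesis proves [P] at that point, the
    second one proves it slightly beyond, which contradicts the infimum. *)
Lemma real_induction (R : realType) (P : R -> Prop) (a b : R) :
  (forall t, a <= t <= b -> (forall s, a <= s < t -> P s) -> P t) ->
  (forall t, a <= t < b -> (forall s, a <= s <= t -> P s) ->
    exists2 dl : R, 0 < dl & forall s, t < s < t + dl -> s <= b -> P s) ->
  forall t, a <= t <= b -> P t.
Proof.
move=> hl hr t tab; apply: contrapT => nPt.
pose S := [set s : R | a <= s <= b /\ ~ P s].
have hS : has_inf S by split; [exists t|exists a => s [/andP[]]].
have mlb s : S s -> inf S <= s by move=> Ss; exact: (inf_lbound hS.2).
have am : a <= inf S by apply: lb_le_inf hS.1 _ => s [/andP[]].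
have mb : inf S <= b by apply: le_trans (mlb t _) _; [split|case/andP: tab].
have Ps s : a <= s < inf S -> P s.
  move=> /andP[as_ sm]; apply: contrapT => nPs.
  have : S s by split => //; rewrite as_/=; apply: le_trans (ltW sm) mb.
  by move=> /mlb; rewrite leNgt sm.
have Pm : P (inf S) by apply: hl => //; rewrite am mb.
have mt : inf S < b.
  rewrite lt_neqAle mb andbT; apply/eqP => mE.
  have := mlb t (conj tab nPt); case/andP: tab => _ tb; rewrite mE => bt.
  by apply: nPt; rewrite (_ : t = inf S)//; apply/le_anti; rewrite mE tb bt.
have [||dl dl0 Pd] := hr (inf S); first by rewrite am mt.
  by move=> s /andP[as_]; rewrite le_eqVlt => /predU1P[->//|sm]; apply: Ps; rewrite as_.
have [s [sab nPs] sd] := inf_adherent dl0 hS.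
apply: (nPs); have := mlb s (conj sab nPs); rewrite le_eqVlt => /predU1P[<-//|ms].
by apply: Pd; [rewrite ms sd|case/andP: sab].
Qed.

Section TimeIntegral.
Context (R : realType) (T : R).
Hypothesis T0 : 0 < T.
Local Notation RT := (measurableTypeR R).
Local Notation I := (`]0%R, T[%classic : set RT).
Local Notation time := (@lebesgue_measure R).

Definition tint (g : R -> R) (a b : R) : R := \int[time]_(t in (`]a, b[%classic : set RT)) g t.

Let mitv (a b : R) : measurable (`]a, b[%classic : set RT).
Proof. exact: (@measurable_itvT R (Interval _ _)). Qed.

Lemma itv_subT (a b : R) : 0 <= a -> b <= T -> `]a, b[%classic `<=` `]0, T[%classic.
Proof.
move=> a0 bT t; rewrite /= !in_itv /= => /andP[at_ tb].
by rewrite (le_lt_trans a0 at_) (lt_le_trans tb bT).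
Qed.

Lemma L1_itv (g : R -> R) (a b : R) : 0 <= a -> b <= T -> L1fun time I g ->
  L1fun time (`]a, b[%classic : set RT) g.
Proof. by move=> a0 bT; apply: (L1_subset (mitv 0 T) (mitv a b)); exact: itv_subT. Qed.

Lemma tint_chasles g a b c : 0 <= a -> a <= b -> b <= c -> c <= T -> L1fun time I g ->
  tint g a c = tint g a b + tint g b c.
Proof.
move=> a0 ab bc cT gL; rewrite /tint.
have [->|bn] := eqVneq b c; first by rewrite [X in _ + X](_ : _ = 0) ?addr0// set_itvoo0 Rintegral_set0.
have b1 : b < c by rewrite lt_neqAle bn.
rewrite [X in _ = X + _]Rintegral_itv_bndo_bndc; last by apply: L1_itv => //; exact: le_trans bc cT.
rewrite -(Rintegral_itvB (L1_itv a0 cT gL) (x := b)) ?bnd_simp//.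
by rewrite addrC subrK.
Qed.

Lemma tintxx g a : tint g a a = 0.
Proof. by rewrite /tint set_itvoo0 Rintegral_set0. Qed.

Lemma tintB g a b : 0 <= a -> a <= b -> b <= T -> L1fun time I g ->
  tint g 0 b - tint g 0 a = tint g a b.
Proof.
move=> a0 ab bT gL; rewrite (@tint_chasles g 0 a b)//.
by rewrite addrC addrA addNr add0r.
Qed.

Lemma ae_itv (P : R -> Prop) (a b : R) : 0 <= a -> b <= T ->
  {ae time, forall t : RT, I t -> P t} -> {ae time, forall t : RT, (`]a, b[%classic : set RT) t -> P t}.
Proof.
move=> a0 bT h; apply: (ae_imply h) => t ht /(itv_subT a0 bT).
exact: ht.
Qed.

Lemma le_tint g h a b : 0 <= a -> b <= T -> L1fun time I g -> L1fun time I h ->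
  {ae time, forall t : RT, I t -> g t <= h t} -> tint g a b <= tint h a b.
Proof.
move=> a0 bT gL hL gh; apply: (ae_le_Rint (mitv a b)).
- exact: L1_itv.
- exact: L1_itv.
- exact: (ae_itv a0 bT gh).
Qed.

Lemma eq_tint g h a b : 0 <= a -> b <= T -> L1fun time I g -> L1fun time I h ->
  {ae time, forall t : RT, I t -> g t = h t} -> tint g a b = tint h a b.
Proof.
move=> a0 bT gL hL gh; apply/le_anti/andP; split; apply: le_tint => //.
  by apply: (ae_imply gh) => t ht /ht ->.
by apply: (ae_imply gh) => t ht /ht ->.
Qed.

Lemma tintD g h a b : 0 <= a -> b <= T -> L1fun time I g -> L1fun time I h ->
  tint (fun t => g t + h t) a b = tint g a b + tint h a b.
Proof. by move=> a0 bT gL hL; apply: (RintD (mitv a b)); exact: L1_itv. Qed.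

Lemma tintZ k g a b : 0 <= a -> b <= T -> L1fun time I g ->
  tint (fun t => k * g t) a b = k * tint g a b.
Proof. by move=> a0 bT gL; apply: (RintZ (mitv a b)); exact: L1_itv. Qed.

Lemma le_tint_norm g a b : 0 <= a -> b <= T -> L1fun time I g ->
  `|tint g a b| <= tint (fun t => `|g t|) a b.
Proof. by move=> a0 bT gL; apply: (le_Rint_norm (mitv a b)); exact: L1_itv. Qed.

Lemma tint_ge0 g a b : 0 <= a -> b <= T -> L1fun time I g ->
  {ae time, forall t : RT, I t -> 0 <= g t} -> 0 <= tint g a b.
Proof.
move=> a0 bT gL g0; rewrite -[X in X <= _](Rint0 time (mitv a b)).
apply: (ae_le_Rint (mitv a b)).
- exact: L10.
- exact: L1_itv.
- exact: (ae_itv a0 bT g0).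
Qed.

Lemma tint_le g a b : 0 <= a -> a <= b -> b <= T -> L1fun time I g ->
  {ae time, forall t : RT, I t -> 0 <= g t} -> tint g a b <= tint g 0 T.
Proof.
move=> a0 ab bT gL g0.
rewrite (@tint_chasles g 0 b T)// ?(le_trans a0)// (@tint_chasles g 0 a b)//.
have bT0 : 0 <= b := le_trans a0 ab; have aT : a <= T := le_trans ab bT.
have h1 := tint_ge0 (lexx 0) aT gL g0; have h2 := tint_ge0 bT0 (lexx T) gL g0.
move: (tint g 0 a) (tint g a b) (tint g b T) h1 h2 => x y z h1 h2; lra.
Qed.

Lemma L1_mul_bnd (M : R) f g : measurable_fun I (g : RT -> R) ->
  (forall t : RT, I t -> `|g t| <= M) -> L1fun time I f -> L1fun time I (fun t => g t * f t).
Proof.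
move=> mg gM fL; apply: (L1_le (mitv 0 T) _ _ (L1Z (mitv 0 T) M (L1_normr fL))).
  by apply: measurable_funM => //; exact: L1_meas fL.
by move=> t It; rewrite normrM ler_wpM2r// gM.
Qed.

Lemma cont_mul_L1 c g : cont_on T c -> L1fun time I g -> L1fun time I (fun t => c t * g t).
Proof.
move=> cc gL; have [M M0 hM] := cont_on_bounded T0 cc.
apply: (@L1_mul_bnd M) => //; first exact: cont_on_measurable.
by move=> t; rewrite /= in_itv /= => /andP[t0 tT]; apply: hM; rewrite !ltW.
Qed.

Lemma cont_on_tint g : L1fun time I g -> cont_on T (tint g 0).
Proof.
move=> gL c /andP[c0 cT] e e0.
have gL' : L1fun time setT (fun t : RT => \1_I t * g t).
  apply: (L1_supp (mitv 0 T)).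
    by move=> x nx; rewrite indicE memNset// mul0r.
  by apply: (L1_ext (mitv 0 T) _ gL) => x Ix; rewrite indicE mem_set// mul1r.
have [dl [dl0 hd]] := integral_normr_continuous gL' e0.
exists dl => // x /andP[x0 xT] xc.
wlog: x c x0 xT c0 cT xc / c <= x => [hw|cx].
  case: (leP c x) => [|/ltW]; first exact: hw.
  by rewrite distrC; apply: hw => //; rewrite distrC.
rewrite tintB//; apply: le_trans (le_tint_norm c0 xT gL) _.
have := hd _ (mitv c x); rewrite [X in (X < _)%E -> _](@lebesgue_measure_itv R `]c, x[) /= lte_fin.
case: (ltP c x) => [cx'|xc'] h; last first.
  by rewrite (_ : x = c) ?tintxx ?ltW//; apply/le_anti; rewrite cx xc'.
rewrite -EFinB lte_fin in h.
have /ltW : \int[time]_(t in (`]c, x[%classic : set RT)) `|\1_I t * g t| < e.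
  by apply: h; apply: le_lt_trans xc; exact: ler_norm.
apply: le_trans; rewrite /tint le_eqVlt; apply/orP; left; apply/eqP; apply: Rint_ext => t /(itv_subT c0 xT) It.
by rewrite indicE mem_set// mul1r.
Qed.

(* Replaces differentiation almost everywhere of absolutely continuous functions. *)
Lemma locally_flat (Z L : R -> R) :
  (forall p e, 0 <= p <= T -> 0 < e -> exists2 dl : R, 0 < dl & forall s t, 0 <= s -> s <= t -> t <= T ->
     `|s - p| < dl -> `|t - p| < dl -> `|Z t - Z s| <= e * (L t - L s)) ->
  forall t, 0 <= t <= T -> Z t = Z 0.
Proof.
move=> h t tT; apply: eq_of_dist_small => e e0.
pose e' := e / (`|L t - L 0| + 1).
have e'0 : 0 < e' by rewrite divr_gt0// ltr_wpDl.
suff : forall s, 0 <= s <= T -> `|Z s - Z 0| <= e' * (L s - L 0).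
  move=> /(_ t tT) /le_trans; apply; apply: le_trans (ler_wpM2l (ltW e'0) (ler_norm _)) _.
  by rewrite /e' mulrAC -mulrA ler_piMr ?(ltW e0)// ler_pdivrMr ?ltr_wpDl// mul1r lerDl.
have step s r : `|Z s - Z 0| <= e' * (L s - L 0) -> `|Z r - Z s| <= e' * (L r - L s) ->
    `|Z r - Z 0| <= e' * (L r - L 0).
  move=> h1 h2; rewrite -[Z r](subrK (Z s)) -addrA; apply: le_trans (ler_normD _ _) _.
  apply: le_trans (lerD h2 h1) _; rewrite -mulrDr ler_pM2l// addrA subrK//.
apply: real_induction => s.
  move=> /andP[s0 sT] IH; have [dl dl0 hd] := h s e' (introT andP (conj s0 sT)) e'0.
  have [<-|sn] := eqVneq 0 s; first by rewrite !subrr normr0 mulr0.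
  have s1 : 0 < s by rewrite lt_neqAle sn.
  pose r := Num.max 0 (s - dl / 2).
  have r0 : 0 <= r by rewrite le_max lexx.
  have rs : r < s by rewrite gt_max s1 ltrBlDr ltrDl divr_gt0.
  apply: (step r); first by apply: IH; rewrite r0 rs.
  apply: hd => //; rewrite ?subrr ?normr0// ?(ltW rs)//.
  rewrite distrC ger0_norm ?subr_ge0 ?(ltW rs)//.
  rewrite ltrBlDr -ltrBlDl lt_max ltrD2l ltrN2 orbC; apply/orP; left.
  by rewrite ltr_pdivrMr// mulr_natr mulr2n ltrDl.
move=> /andP[s0 sT] IH; have [dl dl0 hd] := h s e' (introT andP (conj s0 (ltW sT))) e'0.
exists dl => // r /andP[sr rd] rT; apply: (step s); first by apply: IH; rewrite s0 lexx.
apply: hd => //; rewrite ?subrr ?normr0// ?(ltW sr)//.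
by rewrite ger0_norm ?subr_ge0 ?(ltW sr)// ltrBlDl.
Qed.

(** The defect [Z] of the formula is shown to have increments that are locally an arbitrarily small
    multiple of those of the integral of |a| + |k|, so [locally_flat] makes it constant. *)
Lemma tint_by_parts (a k ka : R -> R) : L1fun time I a -> L1fun time I k ->
  (forall t, 0 <= t <= T -> ka t = tint k 0 t) ->
  forall t, 0 <= t <= T ->
  tint (fun s => ka s * a s) 0 t = tint a 0 t * ka t - tint (fun s => tint a 0 s * k s) 0 t.
Proof.
move=> aL kL kaE.
have cka : cont_on T ka.
  move=> c cT e e0; have [dl dl0 hd] := cont_on_tint kL cT e0.
  by exists dl => // x xT xc; rewrite !kaE//; exact: hd.
have cal := cont_on_tint aL.
have L1a := cont_mul_L1 cka aL; have L1k := cont_mul_L1 cal kL.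
pose Z t := tint (fun s => ka s * a s) 0 t + tint (fun s => tint a 0 s * k s) 0 t - tint a 0 t * ka t.
pose L t := tint (fun s => `|a s| + `|k s|) 0 t.
have LL : L1fun time I (fun s => `|a s| + `|k s|) by apply: (L1D (mitv 0 T)); exact: L1_normr.
suff hZ : forall t, 0 <= t <= T -> Z t = Z 0.
  move=> t tT; have := hZ t tT; rewrite /Z !tintxx mul0r subr0 addr0 => /eqP.
  by rewrite subr_eq0 => /eqP <-; rewrite addrK.
apply: (@locally_flat _ L) => p e pT e0.
have e2 : 0 < e / 2 by rewrite divr_gt0.
have [d1 d10 hd1] := cka p pT _ e2; have [d2 d20 hd2] := cal p pT _ e2.
exists (Num.min d1 d2); first by rewrite lt_min d10.
move=> s t s0 st tT; rewrite !lt_min => /andP[sp1 sp2] /andP[tp1 tp2].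
have sT : s <= T := le_trans st tT; have t0 : 0 <= t := le_trans s0 st.
(* The increment pairs [a] and [k] with oscillations of the two primitives over [s, t]; these are
   small by continuity. *)
have -> : Z t - Z s = tint (fun r => (ka r - ka t) * a r) s t + tint (fun r => (tint a 0 r - tint a 0 s) * k r) s t.
  have E1 : tint (fun r => (ka r - ka t) * a r) s t = tint (fun r => ka r * a r) s t - ka t * tint a s t.
    rewrite -mulNr -tintZ// -tintD//; last exact: (L1Z (mitv 0 T)).
    by apply: Rint_ext => r _; rewrite -mulrDl.
  have E2 : tint (fun r => (tint a 0 r - tint a 0 s) * k r) s t = tint (fun r => tint a 0 r * k r) s t - tint a 0 s * tint k s t.
    rewrite -mulNr -tintZ// -tintD//; last exact: (L1Z (mitv 0 T)).
    by apply: Rint_ext => r _; rewrite -mulrDl.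
  rewrite E1 E2 -!(@tintB _ s t)// -!kaE ?s0 ?t0//.
  by rewrite /Z; ring.
have in_st r : (`]s, t[%classic : set RT) r -> 0 <= r <= T /\ forall d, `|s - p| < d -> `|t - p| < d -> `|r - p| < d.
  rewrite /= in_itv /= => /andP[sr rt]; split; first by rewrite (le_trans s0 (ltW sr)) (le_trans (ltW rt) tT).
  move=> d; rewrite !ltr_norml => /andP[h1 h2] /andP[h3 h4]; apply/andP; split; lra.
have LE : L t - L s = tint (fun r => `|a r|) s t + tint (fun r => `|k r|) s t.
  by rewrite /L tintB// tintD//; exact: L1_normr.
rewrite LE mulrDr; apply: le_trans (ler_normD _ _) _; apply: lerD.
  rewrite -tintZ//; last exact: L1_normr.
  have L1' : L1fun time (`]s, t[%classic : set RT) (fun r => (ka r - ka t) * a r).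
    apply: L1_itv => //; have := L1B (mitv 0 T) L1a (L1Z (mitv 0 T) (ka t) aL).
    by apply: (L1_ext (mitv 0 T)) => r _; rewrite -mulrBl.
  apply: le_trans (le_Rint_norm (mitv s t) L1') _.
  apply: (le_Rint (mitv s t)); first exact: L1_normr.
    by apply: (L1Z (mitv s t)); apply: L1_normr; exact: L1_itv.
  move=> r /in_st [rT hr]; rewrite normrM ler_wpM2r//.
  have h1 := hd1 r rT (hr _ sp1 tp1).
  have h2 := hd1 t (introT andP (conj t0 tT)) tp1.
  by rewrite -(subrKA (ka p)); apply: le_trans (ler_normD _ _) _; rewrite -opprB in h2; rewrite normrN in h2; lra.
rewrite -tintZ//; last exact: L1_normr.
have L1' : L1fun time (`]s, t[%classic : set RT) (fun r => (tint a 0 r - tint a 0 s) * k r).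
  apply: L1_itv => //; have := L1B (mitv 0 T) L1k (L1Z (mitv 0 T) (tint a 0 s) kL).
  by apply: (L1_ext (mitv 0 T)) => r _; rewrite -mulrBl.
apply: le_trans (le_Rint_norm (mitv s t) L1') _.
apply: (le_Rint (mitv s t)); first exact: L1_normr.
  by apply: (L1Z (mitv s t)); apply: L1_normr; exact: L1_itv.
move=> r /in_st [rT hr]; rewrite normrM ler_wpM2r//.
have h1 := hd2 r rT (hr _ sp2 tp2).
have h2 := hd2 s (introT andP (conj s0 sT)) sp2.
by rewrite -(subrKA (tint a 0 p)); apply: le_trans (ler_normD _ _) _; rewrite -opprB in h2; rewrite normrN in h2; lra.
Qed.

(** (1 - D)(1 + 2D) >= 1 for 0 <= D <= 1/2, and 1 + 2D <= exp(2D). *)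
Lemma gronwall_step (x y D : R) : 0 <= y -> 0 <= D -> D <= 2^-1 -> y * (1 - D) <= x ->
  y <= x * expR (2 * D).
Proof.
move=> y0 D0 D1 h; have e1 := expR_ge1Dx (2 * D).
have h1 : y <= y * ((1 - D) * (1 + 2 * D)) by rewrite ler_peMr//; nra.
apply: le_trans h1 _; rewrite mulrA.
apply: le_trans (ler_wpM2l _ e1) _; first by rewrite mulr_ge0//; lra.
by rewrite ler_wpM2r// expR_ge0.
Qed.

(** On an interval over which [B] has integral D <= 1/2, the majorant [p] grows by at most D times
    its final value, which is absorbed on the left; the resulting exponentials multiply from one
    interval to the next. Absorbing instead of differentiating costs the factor 2 in the
    exponent. *)
Lemma gronwall (y B : R -> R) (q tau : R) : 0 <= q -> tau <= T -> cont_on T y ->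
  L1fun time I B -> (forall t : RT, I t -> 0 <= B t) -> (forall t, 0 <= t <= T -> 0 <= y t) ->
  (forall t, 0 <= t <= tau -> y t <= q + tint (fun s => y s * B s) 0 t) ->
  forall t, 0 <= t <= tau -> y t <= q * expR (2 * tint B 0 t).
Proof.
move=> q0 tauT cy BL B0 y0 hy.
have yBL := cont_mul_L1 cy BL.
have I_in (t : RT) : I t -> 0 <= t <= T by rewrite /= in_itv /= => /andP[a b]; rewrite !ltW.
have yB0 : {ae time, forall t : RT, I t -> 0 <= y t * B t}.
  by apply: aeW => t It; rewrite mulr_ge0 ?B0// y0// I_in.
pose p t := q + tint (fun s => y s * B s) 0 t.
have p_incr s t : 0 <= s -> s <= t -> t <= T -> p s <= p t.
  by move=> s0 st tT; rewrite /p lerD2l -subr_ge0 tintB// tint_ge0.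
have p0 t : 0 <= t -> t <= T -> 0 <= p t.
  by move=> t0 tT; rewrite addr_ge0// tint_ge0.
have pstep s t : 0 <= s -> s <= t -> t <= tau -> tint B s t <= 2^-1 -> p t <= p s * expR (2 * tint B s t).
  move=> s0 st tt hB; have tT := le_trans tt tauT.
  have B0' : {ae time, forall t : RT, I t -> 0 <= B t} by apply: aeW.
  apply: gronwall_step => //; [exact: p0 (le_trans s0 st) tT|exact: tint_ge0|].
  rewrite mulrBr mulr1 lerBlDr -lerBlDl /p opprD addrACA subrr add0r tintB// -/(p t).
  rewrite -tintZ//; apply: (le_Rint (mitv s t)).
  - exact: L1_itv.
  - by apply: (L1Z (mitv s t)); exact: L1_itv.
  move=> r rst; have Ir := itv_subT s0 tT rst; rewrite ler_wpM2r ?B0//.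
  move: rst; rewrite /= in_itv /= => /andP[sr rt].
  apply: le_trans (p_incr r t _ _ _) => //; rewrite ?(ltW rt)// ?(le_trans s0 (ltW sr))//.
  by apply: hy; rewrite (le_trans s0 (ltW sr)) (le_trans (ltW rt) tt).
have pE s t : 0 <= s -> s <= t -> t <= tau -> tint B s t <= 2^-1 ->
    p s <= q * expR (2 * tint B 0 s) -> p t <= q * expR (2 * tint B 0 t).
  move=> s0 st tt hB ps; apply: le_trans (pstep s t s0 st tt hB) _.
  apply: le_trans (ler_wpM2r (expR_ge0 _) ps) _.
  by rewrite (tint_chasles (lexx 0) s0 st (le_trans tt tauT) BL) mulrDr expRD mulrA lexx.
suff hp : forall t, 0 <= t <= tau -> p t <= q * expR (2 * tint B 0 t).
  by move=> t tt; apply: le_trans (hy t tt) _; exact: hp.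
have cB := cont_on_tint BL; have h2 : (0 : R) < 2^-1 by rewrite invr_gt0.
apply: real_induction => t.
  move=> /andP[t0 tt] IH; have tT := le_trans tt tauT.
  have [<-|tn] := eqVneq 0 t; first by rewrite /p !tintxx mulr0 expR0 mulr1 addr0.
  have t1 : 0 < t by rewrite lt_neqAle tn.
  have [dl dl0 hd] := cB t (introT andP (conj t0 tT)) _ h2.
  pose r := Num.max 0 (t - dl / 2).
  have r0 : 0 <= r by rewrite le_max lexx.
  have rs : r < t by rewrite gt_max t1 ltrBlDr ltrDl divr_gt0.
  apply: (pE r t) => //; rewrite ?(ltW rs)//; last by apply: IH; rewrite r0 rs.
  rewrite -tintB ?(ltW rs)//; apply: le_trans (ler_norm _) _; rewrite distrC; apply: hd.
    by rewrite r0 (le_trans (ltW rs) tT).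
  rewrite distrC ger0_norm ?subr_ge0 ?(ltW rs)//.
  rewrite ltrBlDr -ltrBlDl lt_max ltrD2l ltrN2 orbC; apply/orP; left.
  by rewrite ltr_pdivrMr// mulr_natr mulr2n ltrDl.
move=> /andP[t0 tt] IH; have tT := le_trans (ltW tt) tauT.
have [dl dl0 hd] := cB t (introT andP (conj t0 tT)) _ h2.
exists dl => // r /andP[tr rd] rt; have rT := le_trans rt tauT.
apply: (pE t r) => //; rewrite ?(ltW tr)//; last by apply: IH; rewrite t0 lexx.
rewrite -tintB ?(ltW tr)//; apply: le_trans (ler_norm _) _; apply: hd.
  by rewrite (le_trans t0 (ltW tr)).
by rewrite ger0_norm ?subr_ge0 ?(ltW tr)// ltrBlDl.
Qed.

(* The bound on the forcing is only available as long as [y <= 1]; it is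
   propagated together with the smallness of [y]. *)
Lemma stability (y h F B : R -> R) (q : R) : cont_on T y -> (forall t, 0 <= t <= T -> 0 <= y t) ->
  (forall t, 0 <= t <= T -> y t = 2 * tint h 0 t) ->
  L1fun time I h -> L1fun time I F -> L1fun time I B -> (forall t : RT, I t -> 0 <= B t) ->
  {ae time, forall t : RT, I t -> y t <= 1 -> h t + F t <= y t * B t} ->
  (forall tau, 0 <= tau <= T -> (forall s, 0 <= s <= tau -> y s <= 1) -> `|tint F 0 tau| <= q) ->
  2 * q * expR (4 * tint B 0 T) < 1 ->
  forall t, 0 <= t <= T -> y t <= 2 * q * expR (4 * tint B 0 T).
Proof.
move=> cy y0 yE hL FL BL B0 hdis hF hq.
have q0 : 0 <= q.
  apply: le_trans (normr_ge0 _) (hF 0 _ _); first by rewrite lexx ltW.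
  move=> s s0; have -> : s = 0 by apply/le_anti; rewrite andbC.
  by rewrite yE ?lexx ?ltW// tintxx mulr0.

set K := 2 * q * _ in hq *.
have yBL := cont_mul_L1 cy BL.
have B0' : {ae time, forall t : RT, I t -> 0 <= B t} by apply: aeW.
have B2L : L1fun time I (fun t => 2 * B t) by exact: (L1Z (mitv 0 T)).
have key tau : 0 <= tau <= T -> (forall s, 0 <= s <= tau -> y s <= 1) -> y tau <= K.
  move=> /andP[tau0 tauT] y1.
  (* Since y is twice the integral of [h], both [q] and [B] are doubled before Gronwall; its own
     factor 2 then gives the 4 in the exponent. *)
  have : forall t, 0 <= t <= tau -> y t <= 2 * q * expR (2 * tint (fun s => 2 * B s) 0 t).
    apply: gronwall => //; first by rewrite mulr_ge0.
      by move=> t It; rewrite mulr_ge0 ?B0.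
    move=> t /andP[t0 tt]; have tT := le_trans tt tauT.
    have hFt : `|tint F 0 t| <= q.
      apply: hF; first by rewrite t0.
      by move=> s /andP[s0 st]; apply: y1; rewrite s0 (le_trans st).
    have hFL : L1fun time I (fun s => y s * B s - F s) by apply: (L1B (mitv 0 T)).
    have hle : tint h 0 t <= tint (fun s => y s * B s - F s) 0 t.
      apply: (ae_le_Rint (mitv 0 t)); [exact: L1_itv|exact: L1_itv|].
      apply: (ae_imply hdis) => s hs st.
      rewrite lerBrDr; apply: hs; first exact: (itv_subT (lexx 0) tT).
      by move: st; rewrite /= in_itv /= => /andP[s0 st]; apply: y1; rewrite (ltW s0) (le_trans (ltW st)).
    have E1 : tint (fun s => y s * B s - F s) 0 t = tint (fun s => y s * B s) 0 t - tint F 0 t.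
      by apply: (RintB (mitv 0 t)); exact: L1_itv.
    have E2 : tint (fun s => y s * (2 * B s)) 0 t = 2 * tint (fun s => y s * B s) 0 t.
      by rewrite -tintZ//; apply: Rint_ext => s _; rewrite mulrCA.
    rewrite yE ?t0// E2; move: hFt; rewrite ler_norml => /andP[hF1 _].
    rewrite E1 in hle; lra.
  move=> /(_ tau); rewrite tau0 lexx => /(_ isT) /le_trans; apply.
  rewrite /K ler_wpM2l ?mulr_ge0// ler_expR tintZ// mulrA -natrM ler_wpM2l//.
  exact: tint_le.
apply: real_induction => t.
  move=> /andP[t0 tT] IH; have [<-|tn] := eqVneq 0 t.
    have -> : y 0 = 0 by rewrite yE ?lexx ?ltW// tintxx mulr0.
    exact: (mulr_ge0 (mulr_ge0 (ler0n _ 2) q0) (expR_ge0 _)).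
  have t1 : 0 < t by rewrite lt_neqAle tn.
  (* The bound holds just before [t] and reaches [t] by continuity. *)
  apply/ler_addgt0Pr => e e0; have [dl dl0 hd] := cy t (introT andP (conj t0 tT)) _ e0.
  pose r := Num.max 0 (t - dl / 2).
  have r0 : 0 <= r by rewrite le_max lexx.
  have rs : r < t by rewrite gt_max t1 ltrBlDr ltrDl divr_gt0.
  have yr : y r <= K by apply: IH; rewrite r0 rs.
  have : `|y r - y t| <= e.
    apply: hd; first by rewrite r0 (le_trans (ltW rs) tT).
    rewrite distrC ger0_norm ?subr_ge0 ?(ltW rs)//.
    rewrite ltrBlDr -ltrBlDl lt_max ltrD2l ltrN2 orbC; apply/orP; left.
    by rewrite ltr_pdivrMr// mulr_natr mulr2n ltrDl.
  by rewrite ler_norml => /andP[h1 h2]; lra.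
(* As K < 1, continuity keeps [y] at most one slightly beyond [t]; the bound on the forcing is then
   available there and [key] restores the sharper bound K. *)
move=> /andP[t0 tT] IH; have e0 : 0 < 1 - K by rewrite subr_gt0.
have [dl dl0 hd] := cy t (introT andP (conj t0 (ltW tT))) _ e0.
exists dl => // r /andP[tr rd] rT; apply: key; first by rewrite (le_trans t0 (ltW tr)).
move=> s /andP[s0 sr]; case: (leP s t) => st; first by apply: le_trans (ltW hq); apply: IH; rewrite s0.
have yt : y t <= K by apply: IH; rewrite t0 lexx.
have : `|y s - y t| <= 1 - K.
  apply: hd; first by rewrite s0 (le_trans sr).
  by rewrite ger0_norm ?subr_ge0 ?(ltW st)// ltrBlDl (le_lt_trans sr).
by rewrite ler_norml => /andP[h1 h2]; lra.
Qed.

End TimeIntegral.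

(** * Evolutions in the dual of the mean-zero Sobolev space *)

Section Evolution.
Context (R : realType) (d : nat) (Om : set 'rV[R]_d) (T : R).
Local Notation scal := ('rV[R]_d -> R).
Local Notation leb := (lebesgue_rV R d).
Hypothesis oO : open Om.
Hypothesis finO : (leb Om < +oo)%E.
Hypothesis T0 : 0 < T.
Local Notation RT := (measurableTypeR R).
Local Notation I := (`]0%R, T[%classic : set RT).
Local Notation time := (@lebesgue_measure R).

Let mO : measurable Om. Proof. exact: open_measurable_rV. Qed.
Let mI : measurable I. Proof. exact: (@measurable_itvT R (Interval _ _)). Qed.
Let hL2 : semi_hilbert (L2 Om) (inner Om) := semi_hilbert_L2 leb mO.
Let hH1 : semi_hilbert (H1 Om) (H1ip Om) := semi_hilbert_H1 oO finO.
Let hH10 : semi_hilbert (H10 Om) (H1ip Om) := semi_hilbert_H10 oO finO.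

Definition continuous_in (V : lmodType R) (X : set V) (N : V -> R) (c : R -> V) :=
  (forall t, 0 <= t <= T -> X (c t)) /\
  forall t e, 0 <= t <= T -> 0 < e -> exists2 dl : R, 0 < dl &
    forall s, 0 <= s <= T -> `|s - t| < dl -> N (c t - c s) <= e.

(** Step functions that sample [c] at the left endpoints of cells of length T/(n+1) converge at each
    time, by continuity at that time. *)
Lemma continuous_in_strong (V : lmodType R) (X : set V) (N : V -> R) (c : R -> V) :
  seminorm_on X N -> continuous_in X N c -> strongly_measurable X N T c.
Proof.
move=> sN [Xc cc]; have [sX hN] := sN.
pose w n : R := T / n.+1%:R.
have w0 n : 0 < w n by rewrite divr_gt0.
have wn n : n.+1%:R * w n = T by rewrite /w mulrC divfK// gt_eqF.
pose A n (j : 'I_n.+1) : set R := `[j%:R * w n, j.+1%:R * w n[%classic.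
exists (fun n t => \sum_(j < n.+1) \1_(A n j) t *: c (j%:R * w n)); split.
  move=> n; exists n.+1, (A n), (fun j => c (j%:R * w n)); split => //.
    by move=> j; exact: (@measurable_itvT R (Interval _ _)).
  move=> j; apply: Xc; rewrite mulr_ge0 ?(ltW (w0 n))//=.
  by rewrite -[X in _ <= X](wn n) ler_wpM2r ?(ltW (w0 n))// ler_nat ltnW.
apply: aeW => t; rewrite in_itv /= => /andP[t0 tT].
have tI : 0 <= t <= T by rewrite !ltW.
split; first exact: Xc.
apply/cvgrPdist_le => e e0; have [dl dl0 hd] := cc t e tI e0.
have [n _ hn] := near_natr_ge ((T + 1) / dl).
exists n => // k nk; have {hn} := hn k nk; rewrite /= ler_pdivrMr// => hk.
pose j := Num.truncn (t / w k).
have tw0 : 0 <= t / w k by rewrite divr_ge0 ?(ltW t0) ?(ltW (w0 k)).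
have /andP[j1 j2] : j%:R <= t / w k < j.+1%:R by exact: truncn_itv.
rewrite ler_pdivlMr// in j1; rewrite ltr_pdivrMr// in j2.
have jk : (j < k.+1)%N.
  rewrite -(ltr_nat R) -(ltr_pM2r (w0 k)) wn; exact: le_lt_trans j1 tT.
have -> : \sum_(i < k.+1) \1_(A k i) t *: c (i%:R * w k) = c (j%:R * w k).
  rewrite (bigD1 (Ordinal jk))//= indicE mem_set ?scale1r; last by rewrite /A /= in_itv /= j1 j2.
  rewrite big1 ?addr0// => i ij; rewrite indicE memNset ?scale0r//.
  rewrite /A /= in_itv /= => /andP[i1 i2]; move/eqP: ij; apply; apply: val_inj => /=.
  have h1 : (i < j.+1)%N by rewrite -(ltr_nat R) -(ltr_pM2r (w0 k)); exact: le_lt_trans i1 j2.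
  have h2 : (j < i.+1)%N by rewrite -(ltr_nat R) -(ltr_pM2r (w0 k)); exact: le_lt_trans j1 i2.
  by apply/eqP; rewrite eqn_leq; apply/andP; split; [exact: h1|exact: h2].
have jT : 0 <= j%:R * w k <= T.
  rewrite mulr_ge0 ?(ltW (w0 k))//=; exact: le_trans j1 (ltW tT).
have jd : `|j%:R * w k - t| < dl.
  rewrite distrC ger0_norm ?subr_ge0// ltrBlDl; apply: lt_trans j2 _.
  rewrite -natr1 mulrDl mul1r ltrD2l /w ltr_pdivrMr// mulrC.
  by apply: lt_le_trans hk; rewrite ltrDl.
rewrite sub0r normrN ger0_norm; last by apply: (seminorm_ge0 sN); exact: (subspaceB sX (Xc _ tI) (Xc _ jT)).
exact: hd _ jT jd.
Qed.

Lemma L2_continuousP (phi : R -> scal) : L2_continuous Om T phi ->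
  continuous_in (L2 Om) (sh_norm (inner Om)) phi.
Proof.
move=> h; have hL t : 0 <= t <= T -> L2 Om (phi t) by move=> tT; have [] := h t; rewrite ?in_itv.
split => // t e tT e0; have [_ /cvgrPdist_le /(_ _ e0)] : L2 Om (phi t) /\ _ := h t tT.
rewrite near_withinE => /nbhs_ballP[dl /= dl0 hd]; exists dl => // s sT st.
have := hd s; rewrite /ball /= distrC => /(_ st).
rewrite in_itv /= sT => /(_ isT); rewrite sub0r normrN normL2E ger0_norm ?sh_norm_ge0//.
by rewrite (sh_normC hL2)//; exact: hL.
Qed.

(** What the argument uses of a curve in C([0, T]; L2) with time derivative [l] in the dual of H10:
    an integrable bound in time and, against each fixed test function, the integrated form of the
    derivative. The notion is stable under differences ([evolutionB]), unlike the chosen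
    representative [time_deriv]. *)
Record evolution (e : R -> scal) (l : R -> scal -> R) : Prop := Evolution {
  ev_cont : continuous_in (L2 Om) (sh_norm (inner Om)) e ;
  ev_bound : exists2 lam : R -> R, L1fun time I lam &
    {ae time, forall t : RT, I t -> Hm1 Om (l t) /\
      forall w, H10 Om w -> `|l t w| <= lam t * sh_norm (H1ip Om) w} ;
  ev_rate : forall v, H10 Om v -> exists2 k : R -> R, L1fun time I k &
    {ae time, forall t : RT, I t -> l t v = k t} /\
    forall s t, 0 <= s -> s <= t -> t <= T ->
      inner Om (e t) v - inner Om (e s) v = tint k s t }.

Lemma Hm1_sub (l : scal -> R) v w : Hm1 Om l -> H10 Om v -> H10 Om w -> l (v - w) = l v - l w.
Proof.
move=> [lin _] vH wH; rewrite [v - w]addrC -scaleN1r lin// mulN1r addrC//.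
Qed.

Lemma continuous_inB (V : lmodType R) (X : set V) (B : V -> V -> R) (c1 c2 : R -> V) :
  semi_hilbert X B -> continuous_in X (sh_norm B) c1 -> continuous_in X (sh_norm B) c2 ->
  continuous_in X (sh_norm B) (fun t => c1 t - c2 t).
Proof.
move=> hB [X1 h1] [X2 h2]; have sX := sh_sub hB.
split; first by move=> t tT; apply: (subspaceB sX); [exact: X1|exact: X2].
move=> t e tT e0; have e2 : 0 < e / 2 by rewrite divr_gt0.
have [d1 d10 hd1] := h1 t _ tT e2; have [d2 d20 hd2] := h2 t _ tT e2.
exists (Num.min d1 d2); first by rewrite lt_min d10.
move=> s sT; rewrite lt_min => /andP[s1 s2].
have -> : c1 t - c2 t - (c1 s - c2 s) = (c1 t - c1 s) - (c2 t - c2 s).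
  by rewrite !opprB [X in _ + X = _]addrC addrACA; congr (_ + _); rewrite addrC.
apply: le_trans (sh_normB hB _ _) _.
- exact: (subspaceB sX (X1 _ tT) (X1 _ sT)).
- exact: (subspaceB sX (X2 _ tT) (X2 _ sT)).
by rewrite [X in _ <= X](splitr e); apply: lerD; [exact: hd1|exact: hd2].
Qed.

Lemma evolutionB e1 l1 e2 l2 : evolution e1 l1 -> evolution e2 l2 ->
  evolution (fun t => e1 t - e2 t) (fun t => l1 t - l2 t).
Proof.
move=> [c1 [lam1 L1 h1] r1] [c2 [lam2 L2' h2] r2]; split.
- exact: continuous_inB.
- exists (fun t => lam1 t + lam2 t); first exact: (L1D mI).
  apply: (ae_imply2 h1 h2) => t a b It.
  have [m1 b1] := a It; have [m2 b2] := b It; split.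
    exact: (subspaceB (is_subspace_Hm1 _) m1 m2).
  move=> w wH; rewrite mulrDl; apply: le_trans (ler_normB _ _) _.
  by apply: lerD; [exact: b1|exact: b2].
move=> v vH; have [k1 K1 [a1 f1]] := r1 v vH; have [k2 K2 [a2 f2]] := r2 v vH.
exists (fun t => k1 t - k2 t); first exact: (L1B mI).
split.
  apply: (ae_imply2 a1 a2) => t a b It.
  by rewrite -a// -b.
move=> s t s0 st tT.
have s1 : 0 <= s <= T by rewrite s0 (le_trans st).
have t1 : 0 <= t <= T by rewrite (le_trans s0).
have vL := H10_L2 vH.
have -> : tint (fun r => k1 r - k2 r) s t = tint k1 s t - tint k2 s t.
  by apply: RintB; [exact: (@measurable_itvT R (Interval _ _))|exact: (@L1_itv R T)|exact: (@L1_itv R T)].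
rewrite -f1// -f2// !(shBl hL2)//; try exact: (c1.1); try exact: (c2.1).
by move: (inner Om (e1 t) v) (inner Om (e1 s) v) (inner Om (e2 t) v) (inner Om (e2 s) v) => x y z w; ring.
Qed.

(** The scalar function t |-> (phi t, v) is continuous with integrable weak derivative, so
    [weak_derivative_ftc] gives its increments; the integrable bound is the dual norm of [l]. *)
Lemma W0T_evolution (phi : R -> scal) (l : R -> scal -> R) : L2_continuous Om T phi ->
  bochner_L2 (Hm1 Om : set (scal -> R)) (normHm1 Om) T l -> is_time_deriv Om T phi l ->
  evolution phi l.
Proof.
move=> cphi bl dl; have cP := L2_continuousP cphi.
have [lam Llam hlam] := bochner_normP (seminorm_Hm1 oO finO) bl.
have lamL : L1fun time I lam := L2_L1 mI (time_finite T) Llam.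
have hb : {ae time, forall t : RT, I t -> Hm1 Om (l t) /\
      forall w, H10 Om w -> `|l t w| <= lam t * sh_norm (H1ip Om) w}.
  apply: (ae_imply hlam) => t h It.
  have [lH <-] := h It; split => // w wH; exact: (normHm1_le oO finO).
split => //; first by exists lam.
move=> v vH; have vL := H10_L2 vH.
have ml : ae_meas time I (fun t => l t v).
  apply: (@strong_pairing R T _ (Hm1 Om : set (scal -> R)) (normHm1 Om) (fun _ L => L v)
    (fun=> sh_norm (H1ip Om) v)); last exact: bl.1.
  - exact: is_subspace_Hm1.
  - by move=> L _; exact: ae_meas_cst.
  - apply: aeW => t _ L L' LH LH'; rewrite mulrC.
    exact: (normHm1_le oO finO (subspaceB (is_subspace_Hm1 _) LH LH') vH).
have [k kL kE] : exists2 g, L1fun time I g & {ae time, forall t : RT, I t -> l t v = g t}.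
  apply: (ae_meas_L1 mI ml); exists (fun t => sh_norm (H1ip Om) v * lam t); first exact: (L1Z mI).
  by apply: (ae_imply hb) => t h It; rewrite mulrC; exact: (h It).2.
exists k => //; split => //.
have cin : cont_on T (fun t => inner Om (phi t) v).
  move=> c cT e e0; have e1 : 0 < e / (sh_norm (inner Om) v + 1) by rewrite divr_gt0// ltr_wpDl ?sh_norm_ge0.
  have [dl' dl0 hd] := cP.2 c _ cT e1; exists dl' => // x xT xc.
  rewrite distrC -(shBl hL2) //; try exact: (cP.1).
  apply: le_trans (sh_CS hL2 _ vL) _; first by apply: (subspaceB (sh_sub hL2)); exact: (cP.1).
  apply: le_trans (ler_wpM2r (sh_norm_ge0 _ _) (hd x xT xc)) _.
  by rewrite mulrAC ler_pdivrMr ?ltr_wpDl ?sh_norm_ge0// ler_pM2l// lerDl.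
move=> s t s0; rewrite le_eqVlt => /predU1P[<- _|st tT]; first by rewrite subrr tintxx.
apply: (weak_derivative_ftc T0 cin kL) => // z zt.
rewrite (dl v vH z zt); congr (- _).
have [dz _ _] := zt.
have cz : continuous z by apply: derivable_continuous => x; exact: (dz 0%N x).
apply: (ae_Rint_ext mI).
  apply: measurable_funM; first exact: L1_meas kL.
  by apply: cont_on_measurable; exact: continuous_cont_on.
by apply: (ae_imply kE) => r h Ir; rewrite h.
Qed.

Lemma Gop_continuous e : continuous_in (L2 Om) (sh_norm (inner Om)) e ->
  continuous_in (H10 Om) (sh_norm (H1ip Om)) (fun t => Gop Om (e t)).
Proof.
move=> [Le ce]; split; first by move=> t tT; apply: (Gop_H10 oO finO); exact: Le.
move=> t r tT r0; have [dl dl0 hd] := ce t r tT r0; exists dl => // s sT st.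
apply: le_trans (hd s sT st); exact: (GopB_le oO finO (Le _ tT) (Le _ sT)).
Qed.

Lemma continuous_in_bounded (V : lmodType R) (X : set V) (N : V -> R) (c : R -> V) :
  seminorm_on X N -> (forall x y, X x -> X y -> N (x - y) = N (y - x)) -> continuous_in X N c ->
  cont_on T (fun t => N (c t)) /\ exists2 M : R, 0 <= M & forall t, 0 <= t <= T -> N (c t) <= M.
Proof.
move=> sN NC [Xc cc].
have cN : cont_on T (fun t => N (c t)).
  move=> t tT e e0; have [dl dl0 hd] := cc t e tT e0; exists dl => // s sT st.
  rewrite distrC; apply: le_trans (sN.2 _ _ (Xc _ tT) (Xc _ sT)) _; exact: hd.
split => //; have [M M0 hM] := cont_on_bounded T0 cN; exists M => // t tT.
exact: le_trans (ler_norm _) (hM t tT).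
Qed.

(** With c = Ge, the symmetry of [Gop] gives (e_t, c_t) - (e_s, c_s) = (e_t - e_s, c_t + c_s), the
    integral over [s, t] of l u (c_t + c_s). It differs from the integral of 2 l u (c_u) only
    through increments of c, small in H1 by continuity, and [locally_flat] concludes. *)
Lemma evolution_energy e l : evolution e l ->
  cont_on T (fun t => inner Om (e t) (Gop Om (e t))) /\
  exists2 h : R -> R, L1fun time I h &
   {ae time, forall t : RT, I t -> l t (Gop Om (e t)) = h t} /\
   forall t, 0 <= t <= T ->
     inner Om (e t) (Gop Om (e t)) - inner Om (e 0) (Gop Om (e 0)) = 2 * tint h 0 t.
Proof.
move=> [ce [lam lamL hb] hr]; have cc := Gop_continuous ce.
pose c t := Gop Om (e t); pose y t := inner Om (e t) (c t).
have sH := seminorm_sh hH10.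
have sC x z : H10 Om x -> H10 Om z -> sh_norm (H1ip Om) (x - z) = sh_norm (H1ip Om) (z - x).
  exact: (sh_normC hH10).
have [cN [M M0 hM]] := continuous_in_bounded sH sC cc.
have eL t : 0 <= t <= T -> L2 Om (e t) := ce.1 t.
have cH t : 0 <= t <= T -> H10 Om (c t) := cc.1 t.
have yE x : 0 <= x <= T -> y x = sh_norm (H1ip Om) (c x) * sh_norm (H1ip Om) (c x).
  by move=> xT; rewrite -expr2 (sh_norm2 hH10 (cH x xT)) (Gop_norm oO finO (eL x xT)).
have cy : cont_on T y.
  move=> t tT r r0.
  have [dl dl0 hd] := cont_onM T0 cN cN tT r0; exists dl => // s sT st.
  rewrite (yE s sT) (yE t tT); exact: hd.
split=> //.
have ml : ae_meas time I (fun t => l t (c t)).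
  apply: (@strong_pairing R T _ (H10 Om) (sh_norm (H1ip Om)) (fun t x => l t x) lam).
  - exact: (sh_sub hH10).
  - by move=> x xH; have [k kL [kE _]] := hr x xH; exists k => //; exact: L1_meas kL.
  - apply: (ae_imply hb) => t h It x z xH zH.
    have [lH hl] := h It; rewrite -(Hm1_sub lH xH zH); apply: hl.
    exact: (subspaceB (sh_sub hH10)).
  - exact: continuous_in_strong.
have It_in (t : RT) : I t -> 0 <= t <= T by rewrite /= in_itv /= => /andP[a b]; rewrite !ltW.
have [h hL hE] : exists2 g, L1fun time I g & {ae time, forall t : RT, I t -> l t (c t) = g t}.
  apply: (ae_meas_L1 mI ml); exists (fun t => M * `|lam t|); first by apply: (L1Z mI); exact: L1_normr.
  apply: (ae_imply hb) => t ht It.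
  have tT := It_in t It.
  apply: le_trans ((ht It).2 _ (cH t tT)) _.
  apply: le_trans (ler_norm _) _; rewrite normrM mulrC ler_wpM2r//.
  by rewrite ger0_norm ?sh_norm_ge0//; exact: hM.
exists h => //; split => //.
suff flat : forall t, 0 <= t <= T -> y t - 2 * tint h 0 t = y 0 - 2 * tint h 0 0.
  move=> t tT; change (y t - y 0 = 2 * tint h 0 t).
  have := flat t tT; rewrite (tintxx h 0).
  move: (y t) (y 0) (tint h 0 t) => x1 x2 x3 x4; lra.
apply: (@locally_flat _ T _ (tint (fun t => `|lam t|) 0)) => p r pT r0.
(* The error consists of l u (c t - c u) and l u (c s - c u), and each difference is compared
   through the value at [p]: four contributions of r/4. *)
have r4 : 0 < r / 4 by rewrite divr_gt0.
have [dl dl0 hd] := cc.2 p _ pT r4; exists dl => // s t s0 st tT sp tp.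
have sT : 0 <= s <= T by rewrite s0 (le_trans st).
have tT' : 0 <= t <= T by rewrite (le_trans s0).
have vH : H10 Om (c t + c s) by apply: (subspaceD (sh_sub hH10)); exact: cH.
have [k kL [kE kF]] := hr _ vH.
have lamN : L1fun time I (fun u => `|lam u|) := L1_normr lamL.
rewrite (tintB s0 st tT lamN).
have -> : y t - 2 * tint h 0 t - (y s - 2 * tint h 0 s) = tint (fun u => k u - 2 * h u) s t.
  have -> : tint (fun u => k u - 2 * h u) s t = tint k s t - 2 * tint h s t.
    rewrite -mulNr -(tintZ _ s0 tT hL) -(tintD s0 tT kL (L1Z mI _ hL)).
    by apply: Rint_ext => u _; rewrite mulNr.
  rewrite -kF// -(tintB s0 st tT hL).
  have E1 := shDr hL2 (H10_L2 (cH _ tT')) (H10_L2 (cH _ sT)) (eL _ tT').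
  have E2 := shDr hL2 (H10_L2 (cH _ tT')) (H10_L2 (cH _ sT)) (eL _ sT).
  have E3 : inner Om (e s) (c t) = inner Om (e t) (c s) := Gop_sym oO finO (eL _ sT) (eL _ tT').
  have E4 : y t = inner Om (e t) (c t) := erefl.
  have E5 : y s = inner Om (e s) (c s) := erefl.
  move: (inner Om (e t) (c t + c s)) (inner Om (e s) (c t + c s)) (inner Om (e t) (c t)) (inner Om (e s) (c s))
    (inner Om (e t) (c s)) (inner Om (e s) (c t)) (y t) (y s) (tint h 0 t) (tint h 0 s) E1 E2 E3 E4 E5.
  move=> x1 x2 x3 x4 x5 x6 x7 x8 x9 x10 -> -> -> -> ->; ring.
have kh : L1fun time I (fun u => k u - 2 * h u) by apply: (L1B mI) => //; exact: (L1Z mI).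
have mst : measurable (`]s, t[%classic : set RT) by exact: (@measurable_itvT R (Interval _ _)).
apply: le_trans (le_tint_norm s0 tT kh) _; rewrite -(tintZ _ s0 tT lamN).
apply: (ae_le_Rint mst).
- by apply: L1_normr; exact: (L1_itv s0 tT kh).
- by apply: (L1Z mst); exact: (L1_itv s0 tT lamN).
have h3 := ae_conj kE hE.
have h4 := ae_conj h3 hb.
apply: (ae_imply h4) => u hu ust.
have Iu := itv_subT s0 tT ust; have [[ku hu'] [lH hl]] := hu Iu.
have uT := It_in u Iu.
rewrite -ku -hu'.
have -> : l u (c t + c s) - 2 * l u (c u) = l u (c t - c u) + l u (c s - c u).
  rewrite (Hm1_sub lH (cH _ tT') (cH _ uT)) (Hm1_sub lH (cH _ sT) (cH _ uT)).
  have -> : l u (c t + c s) = l u (c t) + l u (c s).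
    by have := lH.1 1 (c t) (c s) (cH _ tT') (cH _ sT); rewrite scale1r mul1r.
  by move: (l u (c t)) (l u (c s)) (l u (c u)) => x1 x2 x3; ring.
have dH a : 0 <= a <= T -> `|a - p| < dl -> sh_norm (H1ip Om) (c p - c a) <= r / 4 := hd a.
have up : `|u - p| < dl.
  move: ust; rewrite /= in_itv /= => /andP[su ut]; move: sp tp; rewrite !ltr_norml => /andP[q1 q2] /andP[q3 q4].
  apply/andP; split; lra.
have dd a : 0 <= a <= T -> `|a - p| < dl -> sh_norm (H1ip Om) (c a - c u) <= r / 2.
  move=> aT ap; have -> : c a - c u = (c p - c u) - (c p - c a).
    by rewrite opprB [RHS]addrC addrA subrK.
  apply: le_trans (sh_normB hH10 _ _) _; try by apply: (subspaceB (sh_sub hH10)); exact: cH.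
  apply: le_trans (lerD (dH u uT up) (dH a aT ap)) _; lra.
have bb a : 0 <= a <= T -> `|a - p| < dl -> `|l u (c a - c u)| <= `|lam u| * (r / 2).
  move=> aT ap; have aH : H10 Om (c a - c u) by apply: (subspaceB (sh_sub hH10)); exact: cH.
  apply: le_trans (hl _ aH) _; apply: le_trans (ler_wpM2r (sh_norm_ge0 _ _) (ler_norm _)) _.
  by rewrite ler_wpM2l//; exact: dd.
apply: le_trans (ler_normD _ _) _; apply: le_trans (lerD (bb t tT' tp) (bb s sT sp)) _.
move: (`|lam u|) => x; lra.
Qed.

End Evolution.

(** * Weak convergence of controls implies strong convergence of states *)

Lemma linear_on_sum (R : realType) (V : lmodType R) (X : set V) (L : V -> R) : is_subspace X ->
  (forall (a : R) f g, X f -> X g -> L (a *: f + g) = a * L f + L g) ->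
  forall n (c : 'I_n -> R) (x : 'I_n -> V), (forall j, X (x j)) ->
  X (\sum_j c j *: x j) /\ L (\sum_j c j *: x j) = \sum_j c j * L (x j).
Proof.
move=> sX lin; elim=> [|n IH] c x Xx.
  rewrite !big_ord0; split; first exact: sX.1.
  have := lin 1 0 0 sX.1 sX.1; rewrite scale1r addr0 mul1r => /eqP.
  by rewrite -subr_eq0 opprD addNKr oppr_eq0 => /eqP.
rewrite !big_ord_recl; have [h1 h2] := IH (fun j => c (lift ord0 j)) (fun j => x (lift ord0 j)) (fun j => Xx _).
split; last by rewrite lin// h2.
exact: sX.2.
Qed.

Lemma filter_leq (U : set_system nat) (P : nat -> nat -> Prop) (N : nat) : Filter U ->
  (forall k, \forall n \near U, P k n) -> \forall n \near U, forall k, (k <= N)%N -> P k n.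
Proof.
move=> FU h; elim: N => [|N IH].
  by apply: filterS (h 0%N) => n hn k; rewrite leqn0 => /eqP ->.
apply: filterS2 IH (h N.+1) => n h1 h2 k; rewrite leq_eqVlt => /predU1P[->//|].
by rewrite ltnS; exact: h1.
Qed.

Lemma filter_forall_fin (X : Type) (U : set_system X) (J : finType) (P : J -> X -> Prop) : Filter U ->
  (forall j, \forall n \near U, P j n) -> \forall n \near U, forall j, P j n.
Proof.
move=> FU h.
suff : forall s : seq J, \forall n \near U, forall j, j \in s -> P j n.
  by move=> /(_ (enum J)); apply: filterS => n hn j; apply: hn; rewrite mem_enum.
elim=> [|j s IH]; first by apply: nearW => n j; rewrite in_nil.
apply: filterS2 IH (h j) => n h1 h2 i; rewrite inE => /predU1P[->//|]; exact: h1.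
Qed.

Lemma sum_share_le (R : realType) n (q : R) : 0 <= q -> \sum_(i < n) q / n.+1%:R <= q.
Proof.
move=> q0; rewrite sumr_const card_ord -[X in X <= _]mulr_natr mulrAC ler_pdivrMr//.
by rewrite ler_wpM2l// ler_nat.
Qed.

Section PrimitiveSmall.
Context (R : realType) (T : R).
Hypothesis T0 : 0 < T.
Local Notation RT := (measurableTypeR R).
Local Notation I := (`]0%R, T[%classic : set RT).
Local Notation time := (@lebesgue_measure R).

Let mI : measurable I. Proof. exact: (@measurable_itvT R (Interval _ _)). Qed.

Lemma tint_cst (c s t : R) : s <= t -> tint (fun=> c) s t = c * (t - s).
Proof.
move=> st; rewrite /tint Rintegral_cst; last exact: (@measurable_itvT R (Interval _ _)).
congr (_ * _); rewrite [X in fine X](@lebesgue_measure_itv R `]s, t[) /= lte_fin.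
by case: (ltgtP s t) st => [_ _|//|-> _]; rewrite ?subrr// -EFinB.
Qed.

(** The primitives are M-Lipschitz, so it is enough to control them on a finite grid whose cells
    change them by at most e/2. On the grid this is weak convergence tested with indicators of
    initial intervals. *)
Lemma primitive_small (U : set_system nat) (f_ : nat -> R -> R) (M : R) : Filter U -> 0 <= M ->
  (forall n, L1fun time I (f_ n)) -> (forall n, {ae time, forall t : RT, I t -> `|f_ n t| <= M}) ->
  (forall B : set R, measurable B -> forall e : R, 0 < e ->
    \forall n \near U, `|\int[time]_(t in I) (f_ n t * \1_B t)| <= e) ->
  forall e : R, 0 < e -> \forall n \near U, forall t, 0 <= t <= T -> `|tint (f_ n) 0 t| <= e.
Proof.
move=> FU M0 fL fM wc e e0; have e2 : 0 < e / 2 by rewrite divr_gt0.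
have [N _ hN] := near_natr_ge (M * T / (e / 2)).
have {hN} := hN N (leqnn N); rewrite /= ler_pdivrMr// => hN.
pose w : R := T / N.+1%:R.
have w0 : 0 < w by rewrite divr_gt0.
have wn : N.+1%:R * w = T by rewrite /w mulrC divfK// gt_eqF.
have Mw : M * w <= e / 2 by rewrite /w mulrA ler_pdivrMr// [X in _ <= X]mulrC.
have near_k k : \forall n \near U, `|\int[time]_(t in I) (f_ n t * \1_(`]0, k%:R * w[%classic) t)| <= e / 2.
  by apply: wc => //; exact: (@measurable_itvT R (Interval _ _)).
apply: filterS (filter_leq N.+1 FU near_k) => n hn t /andP[t0 tT].
pose j := Num.truncn (t / w).
have tw0 : 0 <= t / w by rewrite divr_ge0 ?(ltW w0).
have /andP[j1 j2] : j%:R <= t / w < j.+1%:R by exact: truncn_itv.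
rewrite ler_pdivlMr// in j1; rewrite ltr_pdivrMr// in j2.
have jN : (j <= N.+1)%N.
  rewrite -(ler_nat R) -(ler_pM2r w0) wn; exact: le_trans j1 tT.
have jw0 : 0 <= j%:R * w by rewrite mulr_ge0// ltW.
have h1 : `|tint (f_ n) 0 (j%:R * w)| <= e / 2.
  have := hn j jN; congr (`|_| <= _).
  under Rint_ext do rewrite mulrC.
  rewrite (Rint_indic time) /tint; congr (Rintegral _ _ _).
  by rewrite setIidr//; exact: (@itv_subT R T _ _ (lexx 0) (le_trans j1 tT)).
have ML : L1fun time I (fun=> M) := L1_cst mI M (time_finite T).
have h2 : `|tint (f_ n) (j%:R * w) t| <= e / 2.
  apply: le_trans (le_tint_norm jw0 tT (fL n)) _.
  apply: le_trans (le_tint jw0 tT (L1_normr (fL n)) ML (fM n)) _.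
  rewrite tint_cst//; apply: le_trans Mw; rewrite ler_wpM2l// lerBlDl.
  by move: (ltW j2); rewrite -natr1 mulrDl mul1r.
rewrite (tint_chasles (lexx 0) jw0 j1 tT (fL n)); apply: le_trans (ler_normD _ _) _.
by rewrite [X in _ <= X](splitr e) lerD.
Qed.

End PrimitiveSmall.

(** * Stability estimate relative to a reference solution *)

Section WeakToStrong.
Context (R : realType) (d : nat) (Om : set 'rV[R]_d) (T : R).
Local Notation scal := ('rV[R]_d -> R).
Local Notation vect := ('rV[R]_d -> 'rV[R]_d).
Local Notation leb := (lebesgue_rV R d).
Hypothesis oO : open Om.
Hypothesis finO : (leb Om < +oo)%E.
Hypothesis T0 : 0 < T.
Local Notation RT := (measurableTypeR R).
Local Notation I := (`]0%R, T[%classic : set RT).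
Local Notation time := (@lebesgue_measure R).
Local Notation nrm := (sh_norm (H1ip Om)).

Let mO : measurable Om. Proof. exact: open_measurable_rV. Qed.
Let mI : measurable I. Proof. exact: (@measurable_itvT R (Interval _ _)). Qed.
Let hL2 : semi_hilbert (L2 Om) (inner Om) := semi_hilbert_L2 leb mO.
Let hH1 : semi_hilbert (H1 Om) (H1ip Om) := semi_hilbert_H1 oO finO.
Let hH10 : semi_hilbert (H10 Om) (H1ip Om) := semi_hilbert_H10 oO finO.

(** If [z] is null in L2, then zero is one of its weak gradients, and weak gradients are unique up
    to null sets. *)
Lemma H1ip_eq0 (z : scal) : H1 Om z -> inner Om z z = 0 -> H1ip Om z z = 0.
Proof.
move=> zH z0; have zL := H1_L2 zH.
have L20v : L2v Om (fun=> 0).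
  move=> i; have := (sh_sub hL2).1; congr (L2 Om _).
  by apply/funext => x; rewrite /component mxE.
have wg : is_weak_grad Om z (fun=> 0).
  move=> i psi tpsi.
  have -> : inner Om (component (fun=> 0) i) psi = 0.
    rewrite (_ : component _ i = (fun=> 0)) ?inner0l//.
    by apply/funext => x; rewrite /component mxE.
  have := sh_CS hL2 zL (L2_derive_test oO finO i tpsi).
  rewrite {1}/sh_norm z0 sqrtr0 mul0r normr_le0 => /eqP ->; by rewrite oppr0.
rewrite H1ipE z0 add0r (gradipE oO zH zH) big1// => i _.
have h := wgrad_ae oO finO zH L20v wg i.
have Li := L2v_wgrad zH i.
rewrite (inner_aeE oO Li Li (L20v i) (L20v i) h h).
rewrite (_ : component _ i = (fun=> 0)) ?inner0l//.
by apply/funext => x; rewrite /component mxE.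
Qed.

(* The set of Riesz representatives is dense because only [0] is orthogonal to it. *)
Lemma represented_dense (z : scal) (e : R) : H10 Om z -> 0 < e ->
  exists w q, [/\ H10 Om w, H10 Om q, forall v, H10 Om v -> H1ip Om w v = inner Om q v &
    nrm (z - w) <= e].
Proof.
move=> zH e0.
pose E : set scal := [set w | H10 Om w /\ exists2 q, H10 Om q &
  forall v, H10 Om v -> H1ip Om w v = inner Om q v].
have sE : is_subspace E.
  split.
    split; first exact: (sh_sub hH10).1.
    exists 0; first exact: (sh_sub hH10).1.
    by move=> v vH; rewrite (sh0l hH10 vH) (sh0l hL2 (H10_L2 vH)).
  move=> a x y [xH [q qH qE]] [yH [r rH rE]]; split; first exact: (sh_sub hH10).2.
  exists (a *: q + r); first exact: (sh_sub hH10).2.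
  move=> v vH; rewrite (sh_lin hH10)// (sh_lin hL2) ?qE ?rE//; exact: H10_L2.
have EH : E `<=` H10 Om by move=> w [].
have orth x : H10 Om x -> (forall w, E w -> H1ip Om x w = 0) -> H1ip Om x x = 0.
  move=> xH h; apply: H1ip_eq0; first exact: H10_H1.
  have xL := H10_L2 xH.
  rewrite -(GopE oO finO xL xH) (sh_sym hH10 (Gop_H10 oO finO xL) xH).
  apply: h; split; first exact: Gop_H10.
  by exists x => // v vH; exact: GopE.
have [w [wH [q qH qE]] hw] := dense_of_orthogonal hH10 sE EH orth zH (exprn_gt0 2 e0).
exists w, q; split => //.
apply: le_of_sqr; first exact: ltW.
by rewrite (sh_norm2 hH10)//; exact: (subspaceB (sh_sub hH10)).
Qed.

Lemma seminorm_H10 : seminorm_on (H10 Om) (normH1 Om).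
Proof.
have sX := sh_sub hH10; split => // x y xH yH.
rewrite !(normH1E oO)//; try exact: H10_H1.
  exact: (sh_norm_dist hH10).
exact/H10_H1/(subspaceB sX).
Qed.

Variables (m : nat) (chi : 'I_m -> vect).
Hypothesis chiH : forall i, H1v Om (chi i).
Variable CS : R.
Hypothesis CS0 : 0 <= CS.
Hypothesis sob : forall f, H1 Om f ->
  L4fun leb Om f /\ \int[leb]_(x in Om) (f x ^+ 4) <= CS * H1ip Om f f ^+ 2.
Variable Cc : 'I_m -> R.
Hypothesis Cc0 : forall i, 0 <= Cc i.
Hypothesis convC : forall i f w, H1 Om f -> H1 Om w ->
  `|conv Om (chi i) f w| <= Cc i * nrm f * nrm w.
Variables (b a k M : R).
Hypotheses (b0 : 0 < b) (a0 : 0 < a) (k0 : 0 < k) (M0 : 0 <= M).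
Variable phi0 : scal.

Lemma conv_lin_l i w : H1 Om w -> forall (r : R) f g, H10 Om f -> H10 Om g ->
  conv Om (chi i) (r *: f + g) w = r * conv Om (chi i) f w + conv Om (chi i) g w.
Proof.
by move=> wH r f g fH gH; apply: (conv_linl oO finO sob) => //; exact: H10_H1.
Qed.

Lemma conv_lin_r i f : H1 Om f -> forall (r : R) v w, H10 Om v -> H10 Om w ->
  conv Om (chi i) f (r *: v + w) = r * conv Om (chi i) f v + conv Om (chi i) f w.
Proof.
by move=> fH r v w vH wH; apply: (conv_linr oO finO sob) => //; exact: H10_H1.
Qed.

Lemma convB_l i f g w : H10 Om f -> H10 Om g -> H1 Om w ->
  conv Om (chi i) f w - conv Om (chi i) g w = conv Om (chi i) (f - g) w.
Proof.
move=> fH gH wH; have := conv_lin_l i wH (-1) gH fH.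
by rewrite scaleN1r [- g + f]addrC mulN1r => ->; rewrite addrC.
Qed.

Lemma convB_r i f v w : H1 Om f -> H10 Om v -> H10 Om w ->
  conv Om (chi i) f v - conv Om (chi i) f w = conv Om (chi i) f (v - w).
Proof.
move=> fH vH wH; have := conv_lin_r i fH (-1) wH vH.
by rewrite scaleN1r [- w + v]addrC mulN1r => ->; rewrite addrC.
Qed.

(** Three approximations are combined: [phi] by a simple function of time with values x_j, the
    functional given by each x_j by its Riesz representative z_j, and z_j by some w_j with a
    smoother preimage q_j, to which [rate_bound] applies. *)
Lemma conv_simple_approx (phi : R -> scal) i (e : R) :
  bochner_L2 (H10 Om) (normH1 Om) T phi -> 0 < e ->
  exists n (A : 'I_n -> set R) (w q : 'I_n -> scal) (g : R -> R),
  [/\ forall j, measurable (A j),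
      forall j, [/\ H10 Om (w j), H10 Om (q j) &
        forall v, H10 Om v -> H1ip Om (w j) v = inner Om (q j) v],
      L1fun time I g /\ forall t, 0 <= g t,
      {ae time, forall t : RT, I t -> forall x, H10 Om x ->
        `|conv Om (chi i) (phi t) x - \sum_j \1_(A j) t * H1ip Om (w j) x| <= g t * nrm x} &
      \int[time]_(t in I) g t <= e].
Proof.
move=> bphi e0.
have e1 : 0 < e / 2 / (Cc i + 1) by rewrite !divr_gt0// ltr_wpDl.
have [s [n [A [x [mA xH ->]]]] [g0 [gL0 gE0 gI0]]] := bochner_simple_approx seminorm_H10 bphi e1.
pose g t := `|g0 t|; have gL : L1fun time I g := L1_normr gL0.
have sH t : H10 Om (\sum_j \1_(A j) t *: x j).
  apply: (big_ind (H10 Om)) => [|y z yH zH|j _]; first exact: (sh_sub hH10).1.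
    exact: (subspaceD (sh_sub hH10)).
  exact: (subspaceZ _ (sh_sub hH10)).
have gE : {ae time, forall t : RT, I t -> H10 Om (phi t) /\
    normH1 Om (phi t - \sum_j \1_(A j) t *: x j) = g t}.
  apply: (ae_imply gE0) => t h It; have [pH gt] := h It.
  split => //; rewrite /g -gt ger0_norm// (seminorm_ge0 seminorm_H10)//.
  exact: (subspaceB (sh_sub hH10)).
have gI : \int[time]_(t in I) g t <= e / 2 / (Cc i + 1).
  rewrite (@ae_Rint_ext _ _ _ time I mI g g0)//; first exact: L1_meas gL0.
  apply: (ae_imply2 gE gE0) => t q1 q2 It.
  by rewrite -(q1 It).2 -(q2 It).2.
(* The [n] pieces each contribute at most [dl] over a time [T], in total at most e/2; n+1 and T+1
   keep the denominator positive with room to spare. *)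
pose dl := e / 2 / (n.+1%:R * (T + 1)).
have dl0 : 0 < dl by rewrite !divr_gt0// mulr_gt0// ltr_wpDl// ltW.
have /choice[z zP] : forall j, exists z, H10 Om z /\ forall v, H10 Om v ->
    H1ip Om z v = conv Om (chi i) (x j) v.
  move=> j; have xj := H10_H1 (xH j).
  have [z zH zE] := riesz_representation hH10 (conv_lin_r i xj)
    (fun v vH => convC i xj (H10_H1 vH)).
  by exists z.
have /choice[w /choice[q wqP]] : forall j, exists w, exists q, [/\ H10 Om w, H10 Om q,
    forall v, H10 Om v -> H1ip Om w v = inner Om q v & nrm (z j - w) <= dl].
  by move=> j; exact: (represented_dense (zP j).1 dl0).
have Lc : L1fun time I (fun=> n%:R * dl) by exact: (L1_cst mI _ (time_finite T)).
have Lg := L1Z mI (Cc i) gL.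
exists n, A, w, q, (fun t => Cc i * g t + n%:R * dl); split => //.
- by move=> j; have [] := wqP j.
- split; first exact: (L1D mI Lg Lc).
  by move=> t; exact: (addr_ge0 (mulr_ge0 (Cc0 i) (normr_ge0 _)) (mulr_ge0 (ler0n _ _) (ltW dl0))).
- apply: (ae_imply gE) => t h It v vH.
  have [phiH gt] := h It; have vH1 := H10_H1 vH.
  pose S := \sum_j \1_(A j) t *: x j.
  have [SH SE] := linear_on_sum (sh_sub hH10) (conv_lin_l i vH1) (fun j => \1_(A j) t) xH.
  have -> : conv Om (chi i) (phi t) v - \sum_j \1_(A j) t * H1ip Om (w j) v =
    conv Om (chi i) (phi t - S) v + \sum_j \1_(A j) t * H1ip Om (z j - w j) v.
    rewrite -(convB_l i phiH SH vH1) SE -addrA; congr (_ + _).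
    rewrite -sumrN -[RHS]addrC -sumrN -big_split /=; apply: eq_bigr => j _.
    have [wH _ _ _] := wqP j; rewrite (shBl hH10 (zP j).1 wH vH) (zP j).2//.
    by rewrite mulrBr addrAC subrr add0r.
  apply: le_trans (ler_normD _ _) _; rewrite mulrDl; apply: lerD.
    have dH := subspaceB (sh_sub hH10) phiH SH.
    apply: le_trans (convC i (H10_H1 dH) vH1) _.
    by rewrite -(normH1E oO (H10_H1 dH)) gt.
  apply: le_trans (ler_norm_sum _ _ _) _.
  rewrite [n%:R * dl](_ : _ = \sum_(j < n) dl) ?mulr_suml; last first.
    by rewrite sumr_const card_ord mulr_natl.
  apply: ler_sum => j _; have [wH _ _ hw] := wqP j.
  have zwH := subspaceB (sh_sub hH10) (zP j).1 wH.
  rewrite normrM; apply: le_trans (_ : _ <= 1 * `|H1ip Om (z j - w j) v|) _.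
    by rewrite ler_wpM2r// indicE ger0_norm// lern1 leq_b1.
  rewrite mul1r; apply: le_trans (sh_CS hH10 zwH vH) _.
  by rewrite ler_wpM2r// sh_norm_ge0.
- rewrite (RintD mI Lg Lc) (RintZ mI _ gL) [X in _ <= X](splitr e); apply: lerD.
    apply: le_trans (ler_wpM2l (Cc0 i) gI) _.
    by rewrite mulrCA ler_piMr ?divr_ge0 ?(ltW e0)// ler_pdivrMr ?ltr_wpDl// mul1r lerDl.
  have -> : \int[time]_(t in I) (n%:R * dl) = n%:R * dl * T.
    rewrite Rintegral_cst//; congr (_ * _).
    rewrite [X in fine X](@lebesgue_measure_itv R `]0, T[) /= lte_fin T0.
    by rewrite -EFinB /= subr0.
  have X0 : 0 < n.+1%:R * (T + 1) by rewrite mulr_gt0// ltr_wpDl// ltW.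
  have h : n%:R * T <= n.+1%:R * (T + 1).
    by apply: ler_pM => //; rewrite ?(ltW T0)// ?ler_nat// lerDl.
  rewrite /dl; move: (n.+1%:R * (T + 1)) X0 h => X X0 h.
  rewrite (_ : _ * T = (n%:R * T) * (e / 2) / X); last by ring.
  by rewrite ler_pdivrMr// mulrC ler_wpM2l// divr_ge0// ltW.
Qed.

(** [strong_pairing] is used twice: in the transported field for a fixed test function, and then in
    the test function. *)
Lemma conv_time_meas (phi c : R -> scal) i : bochner_L2 (H10 Om) (normH1 Om) T phi ->
  strongly_measurable (H10 Om) nrm T c ->
  ae_meas time I (fun t => conv Om (chi i) (phi t) (c t)).
Proof.
move=> bphi sc; have [g Lg gE] := bochner_normP seminorm_H10 bphi.
apply: (@strong_pairing R T _ (H10 Om) nrm (fun t x => conv Om (chi i) (phi t) x)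
  (fun t => Cc i * nrm (phi t))) => //; first exact: (sh_sub hH10).
- move=> x xH; apply: (@strong_pairing R T _ (H10 Om) (normH1 Om) (fun _ f => conv Om (chi i) f x)
    (fun=> Cc i * nrm x)); last exact: bphi.1.
  + exact: (sh_sub hH10).
  + by move=> f _; exact: ae_meas_cst.
  + apply: aeW => t _ f f' fH fH'.
    have fB := subspaceB (sh_sub hH10) fH fH'.
    rewrite (convB_l i fH fH' (H10_H1 xH)) (normH1E oO (H10_H1 fB)) mulrAC.
    exact: (convC i (H10_H1 fB) (H10_H1 xH)).
- apply: (ae_imply gE) => t h It x x' xH xH'.
  have [pH _] := h It; rewrite (convB_r i (H10_H1 pH) xH xH').
  exact: (convC i (H10_H1 pH) (H10_H1 (subspaceB (sh_sub hH10) xH xH'))).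
Qed.

(** The form of a solution on which the estimates run: all equations hold at a common set of times,
    the transport is split into the individual fields, and the controls are bounded by the fixed
    [M]. *)
Record weak_sol (u : 'I_m -> R -> R) (phi mu : R -> scal) (l : R -> scal -> R) : Prop := WeakSol {
  ws_ev : evolution Om T phi l ;
  ws_bochner : bochner_L2 (H10 Om) (normH1 Om) T phi ;
  ws_init : ae_eq_on Om (phi 0) phi0 ;
  ws_meas : forall i, measurable_fun I (u i : RT -> R) ;
  ws_eq : {ae time, forall t : RT, I t -> [/\ H10 Om (phi t), H1 Om (mu t), forall i, `|u i t| <= M,
    forall w, H10 Om w -> l t w + \sum_i u i t * conv Om (chi i) (phi t) w + b * gradip Om (mu t) w = 0 &
    forall w, H1 Om w -> a * gradip Om (phi t) w +
      k * inner Om (fun x => derive1 (@double_well R) (phi t x)) w = inner Om (mu t) w]} }.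

Variables (ub : 'I_m -> R -> R) (phib mub : R -> scal) (lb : R -> scal -> R).
Hypothesis ref : weak_sol ub phib mub lb.
Variable g : R -> R.
Hypothesis gL : L2fun time I g.
Hypothesis gE : {ae time, forall t : RT, I t -> H10 Om (phib t) /\ normH1 Om (phib t) = g t}.

Definition rho (phi : R -> scal) t := phi t - phib t.
Definition rhoG (phi : R -> scal) t := Gop Om (rho phi t).
Definition dist2 (phi : R -> scal) t := inner Om (rho phi t) (rhoG phi t).
Definition quart (phi : R -> scal) t := inner Om (cubic_quot (phi t) (phib t)) (fun x => rho phi t x * rho phi t x).

(** The coefficient of y in the differential inequality, including the coefficient of y^2, since y^2
    <= y while y <= 1. Its time dependence comes only from [g], the H1 norm of the reference
    state. *)
Definition Dcoef t := (\sum_i M * Cc i + b * (2 * a + k)) ^+ 2 / (2 * (b * a)) + b * k * (25 / 4) * CS +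
  b * k * (9 / 4) * CS * g t ^+ 2.
Definition Fbound := \sum_i (2 * M) * Cc i.

Lemma Dcoef_ge0 t : 0 <= Dcoef t.
Proof.
have ba := mulr_gt0 b0 a0; have bk := ltW (mulr_gt0 b0 k0).
have c1 : (0 : R) <= 9 / 4 by rewrite divr_ge0.
have c2 : (0 : R) <= 25 / 4 by rewrite divr_ge0.
rewrite /Dcoef; apply: addr_ge0.
  apply: addr_ge0; last exact: (mulr_ge0 (mulr_ge0 bk c2) CS0).
  by rewrite divr_ge0 ?sqr_ge0// mulr_ge0// ltW.
exact: (mulr_ge0 (mulr_ge0 (mulr_ge0 bk c1) CS0) (sqr_ge0 _)).
Qed.

Lemma Dcoef_L1 : L1fun time I Dcoef.
Proof.
apply: (L1D mI); first exact: (L1_cst mI _ (time_finite T)).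
by apply: (L1Z mI); exact: L2_sqr gL.
Qed.

Lemma Fbound_ge0 : 0 <= Fbound.
Proof. by apply: sumr_ge0 => i _; rewrite !mulr_ge0. Qed.

(** [dissipation] at almost every time, with integrable versions [h] and [F] of the tested time
    derivative and of the forcing. The initial value of [dist2] is zero because both states start
    from [phi0]. *)
Lemma energy_structure u phi mu l : weak_sol u phi mu l ->
  cont_on T (dist2 phi) /\
  exists h F : R -> R, [/\ L1fun time I h, L1fun time I F,
    forall t, 0 <= t <= T -> dist2 phi t = 2 * tint h 0 t &
   {ae time, forall t : RT, I t -> [/\ F t = \sum_i (u i t - ub i t) * conv Om (chi i) (phib t) (rhoG phi t),
     `|F t| <= Fbound * `|g t| * nrm (rhoG phi t), H10 Om (rho phi t) & dist2 phi t <= 1 ->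
       2^-1 * (b * a) * H1ip Om (rho phi t) (rho phi t) + b * k * 4^-1 * quart phi t <=
         - h t - F t + dist2 phi t * Dcoef t]}].
Proof.
move=> sol; have ev := evolutionB oO (ws_ev sol) (ws_ev ref).
have [cy [h hL [hE yE]]] := evolution_energy oO finO T0 ev.
have y0 : dist2 phi 0 = 0.
  have z0 : 0 <= (0 : R) <= T by rewrite lexx ltW.
  have L1' := (ev_cont ev).1 0 z0.
  have LG := H10_L2 (Gop_H10 oO finO L1').
  have Z : L2 Om (fun=> 0) := (sh_sub hL2).1.
  rewrite /dist2 (inner_aeE oO L1' LG Z LG _ (aeW _ _)) ?inner0l//.
  apply: filterS2 (ws_init sol) (ws_init ref) => x h1 h2 Ox.
  by change (phi 0 x - phib 0 x = 0); rewrite h1// h2// subrr.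
have ce := (ev_cont ev).
have cc := Gop_continuous oO finO ce.
have sc := continuous_in_strong T0 (seminorm_sh hH10) cc.
have [F0 mF0 F0E] : ae_meas time I (fun t => \sum_i (u i t - ub i t) * conv Om (chi i) (phib t) (rhoG phi t)).
  apply: ae_meas_sum => i; apply: ae_measM; last exact: (conv_time_meas i (ws_bochner ref) sc).
  by apply: ae_meas_meas; apply: measurable_funB; [exact: ws_meas sol i|exact: ws_meas ref i].
split => //.
have sC x z : H10 Om x -> H10 Om z -> nrm (x - z) = nrm (z - x) by exact: (sh_normC hH10).
have [cN [Mc Mc0 hMc]] := continuous_in_bounded T0 (seminorm_sh hH10) sC cc.
have It_in (t : RT) : I t -> 0 <= t <= T by rewrite /= in_itv /= => /andP[q r]; rewrite !ltW.
have Fb : {ae time, forall t : RT, I t -> `|\sum_i (u i t - ub i t) * conv Om (chi i) (phib t) (rhoG phi t)| <=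
     Fbound * `|g t| * nrm (rhoG phi t)}.
  have h2 := ae_conj (ws_eq sol) (ws_eq ref).
  apply: (ae_imply2 gE h2) => t q1 q2 It.
  have [pH pg] := q1 It; have [[_ _ uM _ _] [_ _ ubM _ _]] := q2 It.
  have cH := cc.1 t (It_in t It).
  apply: le_trans (ler_norm_sum _ _ _) _; rewrite /Fbound !mulr_suml; apply: ler_sum => i _.
  rewrite normrM -!mulrA mulrA; apply: ler_pM => //.
    by apply: le_trans (ler_normB _ _) _; rewrite mulr_natl mulr2n lerD.
  apply: le_trans (convC i (H10_H1 pH) (H10_H1 cH)) _.
  rewrite -(normH1E oO (H10_H1 pH)) pg mulrA ler_wpM2r ?sh_norm_ge0//.
  by rewrite ler_wpM2l// ler_norm.
exists h, F0; split => //.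
- have Lg1 : L1fun time I (fun t => Fbound * Mc * `|g t|).
    by apply: (L1Z mI); apply: L1_normr; exact: (L2_L1 mI (time_finite T)).
  apply: (ae_L1_le mI mF0 Lg1).
  apply: (ae_imply2 F0E Fb) => t q1 q2 It.
  rewrite -(q1 It); apply: le_trans (q2 It) _; rewrite mulrAC ler_wpM2r//.
  by rewrite ler_wpM2l ?Fbound_ge0//; exact: hMc _ (It_in t It).
- by move=> t tT; have := yE t tT; rewrite -/(rhoG phi 0) -/(dist2 phi 0) y0 subr0.
have h2 := ae_conj (ws_eq sol) (ws_eq ref).
have h3 := ae_conj F0E hE.
have h4 := ae_conj gE Fb.
have h5 := ae_conj h2 h3.
apply: (ae_imply2 h4 h5) => t q1 q2 It.
have [[pH pg] fb] := q1 It.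
have [[[sH smu uM seq1 seq2] [_ rmu _ req1 req2]] [FE hE']] := q2 It.
split; rewrite -?FE//; first exact: (subspaceB (sh_sub hH10)).
move=> y1.
have gH := cc.1 t (It_in t It).
have := dissipation oO finO CS0 sob chiH convC b0 a0 k0 sH pH smu rmu uM (seq1 _ gH) (req1 _ gH) seq2 req2.
rewrite -(sh_norm2 hH1 (H10_H1 pH)) -(normH1E oO (H10_H1 pH)) pg.
have -> : l t (Gop Om (phi t - phib t)) - lb t (Gop Om (phi t - phib t)) = h t := hE'.
rewrite -/(rho phi t) -/(rhoG phi t) -/(dist2 phi t) -/(quart phi t) => /le_trans; apply.
have y00 : 0 <= dist2 phi t by exact: (Gop_ge0 oO finO (ce.1 t (It_in t It))).
rewrite -addrA lerD2l /Dcoef.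
have c2 : (0 : R) <= 25 / 4 by rewrite divr_ge0.
have w0 : 0 <= b * k * (25 / 4) * CS := mulr_ge0 (mulr_ge0 (ltW (mulr_gt0 b0 k0)) c2) CS0.
move: (dist2 phi t) ((\sum_i M * Cc i + b * (2 * a + k)) ^+ 2 / (2 * (b * a))) (b * k * (25 / 4) * CS) (b * k * (9 / 4) * CS * g t ^+ 2) y00 y1 w0.
move=> y p q r y00 y1 w0.
have yy : y ^+ 2 <= y by rewrite expr2 ler_piMr.
have := ler_wpM2l w0 yy; rewrite (_ : (p + r) * y = y * p + y * r); last by ring.
rewrite (_ : y * (p + q + r) = y * p + y * r + q * y); last by ring.
by rewrite lerD2l.
Qed.

Lemma rho_init u phi mu l v : weak_sol u phi mu l -> L2 Om v -> inner Om (rho phi 0) v = 0.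
Proof.
move=> sol vL; have z0 : 0 <= (0 : R) <= T by rewrite lexx ltW.
have L1' := (ev_cont (evolutionB oO (ws_ev sol) (ws_ev ref))).1 0 z0.
have Z : L2 Om (fun=> 0) := (sh_sub hL2).1.
rewrite (inner_aeE oO L1' vL Z vL _ (aeW _ _)) ?inner0l//.
apply: filterS2 (ws_init sol) (ws_init ref) => x h1 h2 Ox.
by change (phi 0 x - phib 0 x = 0); rewrite h1// h2// subrr.
Qed.

(** The constant [C] is chosen before the solution, so that the bound is uniform along a sequence of
    states. *)
Lemma rate_structure w q : H10 Om w -> H10 Om q -> (forall v, H10 Om v -> H1ip Om w v = inner Om q v) ->
  exists2 C : R, 0 <= C & forall u phi mu l, weak_sol u phi mu l ->
  exists kap : R -> R, [/\ L1fun time I kap,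
    forall t, 0 <= t <= T -> inner Om (rho phi t) w = tint kap 0 t &
    {ae time, forall t : RT, I t -> `|kap t| <=
      C * (1 + g t ^+ 2 + H1ip Om (rho phi t) (rho phi t) + quart phi t)}].
Proof.
move=> wH qH wE.
have [C C0 hC] := rate_bound oO finO CS0 sob chiH Cc0 convC (ltW b0) (ltW a0) (ltW k0) M0 wH qH wE.
exists C => // u phi mu l sol.
have ev := evolutionB oO (ws_ev sol) (ws_ev ref).
have [kap kL [kE kF]] := ev_rate ev wH.
exists kap; split => //.
  move=> t /andP[t0 tT]; rewrite -(kF 0 t)// -/(rho phi 0) (rho_init sol (H10_L2 wH)) subr0//.
have h2 := ae_conj (ws_eq sol) (ws_eq ref).
have h3 := ae_conj gE kE.
apply: (ae_imply2 h2 h3) => t q1 q2 It.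
have [[sH smu uM seq1 seq2] [pH rmu ubM req1 req2]] := q1 It.
have [[_ pg] ke] := q2 It; rewrite -ke.
have := hC _ _ _ _ _ _ _ _ sH pH smu rmu uM ubM (seq1 _ wH) (req1 _ wH) seq2 req2.
by rewrite -(sh_norm2 hH1 (H10_H1 pH)) -(normH1E oO (H10_H1 pH)) pg.
Qed.

Lemma weighted_sum_le (c0 c1 X Y D : R) : 0 < c0 -> 0 < c1 -> 0 <= X -> 0 <= Y ->
  c0 * X + c1 * Y <= D -> X + Y <= (c0^-1 + c1^-1) * D.
Proof.
move=> c00 c10 X0 Y0 h.
have hX : X <= c0^-1 * D.
  rewrite mulrC ler_pdivlMr// mulrC; apply: le_trans h; rewrite lerDl mulr_ge0// ltW//.
have hY : Y <= c1^-1 * D.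
  rewrite mulrC ler_pdivlMr// mulrC; apply: le_trans h; rewrite lerDr mulr_ge0// ltW//.
by rewrite mulrDl lerD.
Qed.

Lemma quart_ge0 phi t : 0 <= quart phi t.
Proof.
by apply: Rintegral_ge0 => x _; rewrite mulr_ge0 ?cubic_quot_ge0// -expr2 sqr_ge0.
Qed.

Lemma nrm_rhoG u phi mu l t : weak_sol u phi mu l -> 0 <= t <= T ->
  H10 Om (rhoG phi t) /\ nrm (rhoG phi t) ^+ 2 = dist2 phi t.
Proof.
move=> sol tT; have ev := evolutionB oO (ws_ev sol) (ws_ev ref).
have L := (ev_cont ev).1 t tT; have GH := Gop_H10 oO finO L.
split; first exact: GH.
by rewrite (sh_norm2 hH10 GH) (Gop_norm oO finO L).
Qed.

Lemma nrm_rhoG_le1 u phi mu l t : weak_sol u phi mu l -> 0 <= t <= T -> dist2 phi t <= 1 ->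
  nrm (rhoG phi t) <= 1.
Proof.
move=> sol tT d1; have [_ h] := nrm_rhoG sol tT.
by apply: le_of_sqr => //; rewrite h expr1n.
Qed.

(** While [dist2] stays at most one, the H1 norm and the cubic term in [rate_structure] are bounded
    through the dissipation inequality by -h plus terms depending only on the reference. Integration
    turns -h into minus half of [dist2], which has the good sign, so the constant is independent of
    the solution. *)
Lemma rate_integral w q : H10 Om w -> H10 Om q -> (forall v, H10 Om v -> H1ip Om w v = inner Om q v) ->
  exists2 C : R, 0 <= C & forall u phi mu l, weak_sol u phi mu l ->
  exists kap : R -> R, [/\ L1fun time I kap,
    forall t, 0 <= t <= T -> inner Om (rho phi t) w = tint kap 0 t &
    forall tau, 0 <= tau <= T -> (forall s, 0 <= s <= tau -> dist2 phi s <= 1) ->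
      tint (fun t => `|kap t|) 0 tau <= C].
Proof.
move=> wH qH wE; have [C C0 hC] := rate_structure wH qH wE.
pose c0 := 2^-1 * (b * a); pose c1 := b * k * 4^-1.
have c00 : 0 < c0 by rewrite !mulr_gt0// invr_gt0.
have c10 : 0 < c1 by rewrite !mulr_gt0// invr_gt0.
pose K := C * (c0^-1 + c1^-1).
have K0 : 0 <= K by rewrite mulr_ge0// addr_ge0// invr_ge0 ltW.
pose P t := C * (1 + g t ^+ 2) + K * (Fbound * `|g t| + Dcoef t).
have gL1 : L1fun time I (fun t => `|g t|) by apply: L1_normr; exact: (L2_L1 mI (time_finite T)).
have PL : L1fun time I P.
  apply: (L1D mI); apply: (L1Z mI); apply: (L1D mI).
  - exact: (L1_cst mI _ (time_finite T)).
  - exact: L2_sqr gL.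
  - exact: (L1Z mI).
  - exact: Dcoef_L1.
have P0 t : 0 <= P t.
  apply: addr_ge0; apply: mulr_ge0 => //; apply: addr_ge0 => //; first exact: sqr_ge0.
    by rewrite mulr_ge0// Fbound_ge0.
  exact: Dcoef_ge0.
have P0' : {ae time, forall t : RT, I t -> 0 <= P t} by apply: aeW.
exists (tint P 0 T); first exact: (tint_ge0 (lexx 0) (lexx T) PL P0').
move=> u phi mu l sol; have [kap [kL kE kB]] := hC u phi mu l sol.
exists kap; split => // tau /andP[tau0 tauT] y1.
have [cy [h [F [hL FL yE hae]]]] := energy_structure sol.
have PhL : L1fun time I (fun t => P t - K * h t) by apply: (L1B mI) => //; exact: (L1Z mI).
have mtau : measurable (`]0, tau[%classic : set RT) by exact: (@measurable_itvT R (Interval _ _)).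
have key : tint (fun t => `|kap t|) 0 tau <= tint (fun t => P t - K * h t) 0 tau.
  apply: (ae_le_Rint mtau).
  - by apply: L1_normr; exact: (L1_itv (lexx 0) tauT kL).
  - exact: (L1_itv (lexx 0) tauT PhL).
  apply: (ae_imply2 kB hae) => t q1 q2 tt.
  have It := itv_subT (lexx 0) tauT tt; have [FE Fb rH hd] := q2 It.
  have t1 : 0 <= t <= tau by move: tt; rewrite /= in_itv /= => /andP[x y]; rewrite !ltW.
  have tT : 0 <= t <= T by case/andP: t1 => -> /le_trans; apply.
  have dt1 := y1 t t1; have n1 := nrm_rhoG_le1 sol tT dt1.
  have E0 := sh_ge0 hH1 (H10_H1 rH).
  have := weighted_sum_le c00 c10 E0 (quart_ge0 phi t) (hd dt1) => hs.
  apply: le_trans (q1 It) _.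
  have d0 : 0 <= dist2 phi t by rewrite -(nrm_rhoG sol tT).2 sqr_ge0.
  have hF : - F t <= Fbound * `|g t|.
    apply: le_trans (ler_norm _) _; rewrite normrN; apply: le_trans Fb _.
    by rewrite ler_piMr// mulr_ge0// Fbound_ge0.
  have hD : dist2 phi t * Dcoef t <= Dcoef t by rewrite ler_piMl// Dcoef_ge0.
  have cK : 0 <= c0^-1 + c1^-1 by rewrite addr_ge0// invr_ge0 ltW.
  have h2 : (c0^-1 + c1^-1) * (- h t - F t + dist2 phi t * Dcoef t) <=
      (c0^-1 + c1^-1) * (- h t + Fbound * `|g t| + Dcoef t).
    by rewrite ler_wpM2l// lerD// lerD2l.
  have h3 := le_trans hs h2.
  rewrite -addrA; apply: le_trans (ler_wpM2l C0 (lerD (lexx _) h3)) _.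
  rewrite /P /K le_eqVlt; apply/orP; left; apply/eqP.
  move: (c0^-1 + c1^-1) (Fbound * `|g t|) (Dcoef t) (h t) (g t ^+ 2) => x1 x2 x3 x4 x5; ring.
apply: le_trans key _.
have -> : tint (fun t => P t - K * h t) 0 tau = tint P 0 tau - K * tint h 0 tau.
  rewrite -(tintZ K (lexx 0) tauT hL).
  by apply: (RintB mtau); [exact: (L1_itv (lexx 0) tauT PL)|apply: (L1Z mtau); exact: (L1_itv (lexx 0) tauT hL)].
have h0 : 0 <= tint h 0 tau.
  have tT : 0 <= tau <= T by rewrite tau0.
  have := yE tau tT; rewrite -(nrm_rhoG sol tT).2 => /(congr1 (fun x => 2^-1 * x)).
  by rewrite mulKf// => <-; rewrite mulr_ge0 ?invr_ge0// sqr_ge0.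
apply: le_trans (tint_le (lexx 0) tau0 tauT PL P0'); rewrite lerBlDr lerDl mulr_ge0//.
Qed.

(** * Convergence of the states along a filter of controls *)

Section Sequence.
Variables (U : set_system nat) (FU : Filter U).
Variables (u_ : nat -> 'I_m -> R -> R) (phi_ mu_ : nat -> R -> scal) (l_ : nat -> R -> scal -> R).
Hypothesis sol_ : forall n, weak_sol (u_ n) (phi_ n) (mu_ n) (l_ n).
Hypothesis wc : forall i (A : set R), measurable A -> forall e : R, 0 < e ->
  \forall n \near U, `|\int[time]_(t in I) ((u_ n i t - ub i t) * \1_A t)| <= e.

Let v_ n i t := u_ n i t - ub i t.

Let v_bound n i : {ae time, forall t : RT, I t -> `|v_ n i t| <= 2 * M}.
Proof.
apply: (ae_imply2 (ws_eq (sol_ n)) (ws_eq ref)) => t q1 q2 It.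
have [_ _ h1 _ _] := q1 It; have [_ _ h2 _ _] := q2 It.
by apply: le_trans (ler_normB _ _) _; rewrite mulr_natl mulr2n lerD.
Qed.

Let v_meas n i : measurable_fun I (v_ n i : RT -> R).
Proof. by apply: measurable_funB; [exact: ws_meas (sol_ n) i|exact: ws_meas ref i]. Qed.

Let v_cut_L1 n i (A : set R) : measurable A -> L1fun time I (fun t => v_ n i t * \1_A t).
Proof.
move=> mA; have mA' : @measurable _ RT A by exact: mA.
apply: (ae_L1_le mI _ (L1_cst mI (2 * M) (time_finite T))).
  by apply: measurable_funM => //; exact: (@measurable_indic _ RT R _ _ mA').
apply: (ae_imply (v_bound n i)) => t h It.
rewrite normrM; apply: le_trans (h It); rewrite ler_piMr// indicE ger0_norm//.
by rewrite lern1 leq_b1.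
Qed.

Lemma cut_primitive_small i (A : set R) (e : R) : measurable A -> 0 < e ->
  \forall n \near U, forall t, 0 <= t <= T -> `|tint (fun s => v_ n i s * \1_A s) 0 t| <= e.
Proof.
move=> mA e0; apply: (@primitive_small R T T0 U _ (2 * M)) => //.
- by rewrite mulr_ge0.
- by move=> n; exact: v_cut_L1.
- move=> n; apply: (ae_imply (v_bound n i)) => t h It.
  rewrite normrM; apply: le_trans (h It); rewrite ler_piMr// indicE ger0_norm//.
  by rewrite lern1 leq_b1.
- move=> B mB r r0; apply: filterS (wc i (measurableI _ _ mA mB) r0) => n.
  congr (`|_| <= _); apply: Rint_ext => t _.
  by rewrite indicI /= mulrA.
Qed.

(** Up to an error small in L1, the transport term is a sum over j of the indicator of A_j times the
    scalar (rho, w_j), whose rate is bounded in L1 by [rate_integral]. Integration by parts in time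
    moves the derivative onto this scalar and leaves primitives of v_n times the indicator, which
    are uniformly small. The set of good n depends neither on [tau] nor on the version [f]. *)
Lemma forcing_small1 i (q : R) : 0 < q -> \forall n \near U, forall tau, 0 <= tau <= T ->
  (forall s, 0 <= s <= tau -> dist2 (phi_ n) s <= 1) ->
  forall f, L1fun time I f ->
  {ae time, forall t : RT, I t -> f t = v_ n i t * conv Om (chi i) (phib t) (rhoG (phi_ n) t)} ->
  `|tint f 0 tau| <= q.
Proof.
move=> q0.
have e0 : 0 < q / 2 / (2 * M + 1) by rewrite !divr_gt0// ltr_wpDl// mulr_ge0.
have [n [A [w [r [kap [mA wr [kL kap0] hk ik]]]]]] := conv_simple_approx i (ws_bochner ref) e0.
have /choice[C hC] : forall j, exists C : R, 0 <= C /\ forall u phi mu l, weak_sol u phi mu l ->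
  exists kap : R -> R, [/\ L1fun time I kap,
    forall t, 0 <= t <= T -> inner Om (rho phi t) (w j) = tint kap 0 t &
    forall tau, 0 <= tau <= T -> (forall s, 0 <= s <= tau -> dist2 phi s <= 1) ->
      tint (fun t => `|kap t|) 0 tau <= C].
  by move=> j; have [wH rH wE] := wr j; have [C C0 h] := rate_integral wH rH wE; exists C.
(* After integration by parts, [nrm (w j)] bounds the boundary factor and [C j] the L1 norm of the
   rate; the added one keeps the divisor positive. *)
pose D j := nrm (w j) + C j + 1.
have D0 j : 0 < D j by rewrite ltr_wpDl// addr_ge0 ?sh_norm_ge0// (hC j).1.
pose dl j := q / 2 / n.+1%:R / D j.
have dl0 j : 0 < dl j by rewrite !divr_gt0.
have near_j := filter_forall_fin FU (fun j => cut_primitive_small i (mA j) (dl0 j)).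
apply: filterS near_j => N hN tau tauT y1 f fL fE.
have sol := sol_ N; case/andP: (tauT) => tau0 tauT'.
have mtau : measurable (`]0, tau[%classic : set RT) by exact: (@measurable_itvT R (Interval _ _)).
have /choice[kj hkj] : forall j, exists kj : R -> R, [/\ L1fun time I kj,
    forall t, 0 <= t <= T -> inner Om (rho (phi_ N) t) (w j) = tint kj 0 t &
    tint (fun t => `|kj t|) 0 tau <= C j].
  by move=> j; have [kj [h1 h2 h3]] := (hC j).2 _ _ _ _ sol; exists kj; split => //; exact: h3.
pose ka j t := tint (kj j) 0 t.
pose al j t := v_ N i t * \1_(A j) t.
have alL j : L1fun time I (al j) by exact: v_cut_L1.
have kjL j : L1fun time I (kj j) by have [] := hkj j.
have termL j : L1fun time I (fun t => ka j t * al j t).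
  by apply: (cont_mul_L1 T0) => //; exact: cont_on_tint.
have term_small j : `|tint (fun t => ka j t * al j t) 0 tau| <= q / 2 / n.+1%:R.
  have [_ kjE kjC] := hkj j; have [wH _ _] := wr j.
  rewrite (tint_by_parts T0 (alL j) (kjL j) (fun _ _ => erefl) tauT).
  have aj t : 0 <= t <= T -> `|tint (al j) 0 t| <= dl j := hN j t.
  have [GH _] := nrm_rhoG sol tauT.
  have ktau : `|ka j tau| <= nrm (w j).
    rewrite /ka -(kjE tau tauT) -(GopE oO finO _ wH); last first.
      exact: (ev_cont (evolutionB oO (ws_ev sol) (ws_ev ref))).1 tau tauT.
    apply: le_trans (sh_CS hH10 GH wH) _.
    rewrite ler_piMl ?sh_norm_ge0//; apply: (nrm_rhoG_le1 sol tauT); apply: y1.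
    by rewrite tau0 lexx.
  have h1 : `|tint (al j) 0 tau * ka j tau| <= dl j * nrm (w j).
    by rewrite normrM ler_pM// aj.
  have alk : L1fun time I (fun s => tint (al j) 0 s * kj j s).
    by apply: (cont_mul_L1 T0) => //; exact: cont_on_tint.
  have h2 : `|tint (fun s => tint (al j) 0 s * kj j s) 0 tau| <= dl j * C j.
    apply: le_trans (le_tint_norm (lexx 0) tauT' alk) _.
    apply: le_trans (ler_wpM2l (ltW (dl0 j)) kjC).
    rewrite -(tintZ _ (lexx 0) tauT' (L1_normr (kjL j))).
    apply: (le_tint (lexx 0) tauT' (L1_normr alk) (L1Z mI (dl j) (L1_normr (kjL j)))).
    apply: aeW => s Is; rewrite normrM ler_wpM2r//; apply: aj.
    by move: Is; rewrite /= in_itv /= => /andP[x y]; rewrite !ltW.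
  apply: le_trans (ler_normB _ _) _; apply: le_trans (lerD h1 h2) _.
  rewrite -mulrDr /dl mulrAC -mulrA ler_piMr//; last by rewrite ler_pdivrMr// mul1r lerDl.
  by rewrite !divr_ge0// ltW.
pose S t := \sum_(j < n) ka j t * al j t.
have SL : L1fun time I S by exact: (L1_sum mI).
have fSL : L1fun time I (fun t => f t - S t) by exact: (L1B mI).
have -> : tint f 0 tau = tint (fun t => f t - S t) 0 tau + \sum_(j < n) tint (fun t => ka j t * al j t) 0 tau.
  rewrite -(Rint_sum mtau); last by move=> j; exact: (L1_itv (lexx 0) tauT' (termL j)).
  rewrite -(tintD (lexx 0) tauT' fSL SL); apply: Rint_ext => t _.
  by rewrite subrK.
apply: le_trans (ler_normD _ _) _; rewrite [X in _ <= X](splitr q); apply: lerD; last first.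
  apply: le_trans (ler_norm_sum _ _ _) _.
  apply: le_trans (ler_sum _ (fun j _ => term_small j)) _.
  by apply: sum_share_le; rewrite divr_ge0// ltW.
apply: le_trans (le_tint_norm (lexx 0) tauT' fSL) _.
have kML : L1fun time I (fun t => 2 * M * kap t) by exact: (L1Z mI).
apply: (@le_trans _ _ (tint (fun t => 2 * M * kap t) 0 tau)).
  apply: (ae_le_Rint mtau).
  - by apply: L1_normr; exact: (L1_itv (lexx 0) tauT' fSL).
  - exact: (L1_itv (lexx 0) tauT' kML).
  have h2 := ae_conj fE (v_bound N i).
  apply: (ae_imply2 hk h2) => t q1 q2 tt.
  have It := itv_subT (lexx 0) tauT' tt; have [fe vb] := q2 It.
  have t1 : 0 <= t <= tau by move: tt; rewrite /= in_itv /= => /andP[x y]; rewrite !ltW.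
  have tT : 0 <= t <= T by case/andP: t1 => -> /le_trans; apply.
  have [GH _] := nrm_rhoG sol tT.
  have -> : f t - S t = v_ N i t * (conv Om (chi i) (phib t) (rhoG (phi_ N) t) -
      \sum_j \1_(A j) t * H1ip Om (w j) (rhoG (phi_ N) t)).
    rewrite fe mulrBr; congr (_ - _); rewrite /S mulr_sumr; apply: eq_bigr => j _.
    have [_ kjE _] := hkj j; have [wH _ _] := wr j.
    rewrite /ka -(kjE t tT) -(GopE oO finO _ wH); last first.
      exact: (ev_cont (evolutionB oO (ws_ev sol) (ws_ev ref))).1 t tT.
    rewrite (sh_sym hH10 wH GH) /al mulrCA; congr (_ * _).
    by rewrite mulrC.
  rewrite normrM; apply: ler_pM => //; apply: le_trans (q1 It _ GH) _.
  by rewrite ler_piMr//; apply: (nrm_rhoG_le1 sol tT); exact: y1.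
have kML0 : {ae time, forall t : RT, I t -> 0 <= 2 * M * kap t}.
  by apply: aeW => t _; rewrite mulr_ge0// mulr_ge0.
apply: le_trans (tint_le (lexx 0) tau0 tauT' kML kML0) _.
rewrite (tintZ _ (lexx 0) (lexx T) kL).
apply: le_trans (ler_wpM2l _ ik) _; first by rewrite mulr_ge0.
by rewrite mulrCA ler_piMr ?divr_ge0 ?(ltW q0)// ler_pdivrMr ?ltr_wpDl ?mulr_ge0// mul1r lerDl.
Qed.

Let piece_L1 n i : exists2 f : R -> R, L1fun time I f &
  {ae time, forall t : RT, I t -> f t = v_ n i t * conv Om (chi i) (phib t) (rhoG (phi_ n) t)}.
Proof.
have ev := evolutionB oO (ws_ev (sol_ n)) (ws_ev ref).
have cc := Gop_continuous oO finO (ev_cont ev).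
have sc := continuous_in_strong T0 (seminorm_sh hH10) cc.
have sC x z : H10 Om x -> H10 Om z -> nrm (x - z) = nrm (z - x) by exact: (sh_normC hH10).
have [_ [Mc Mc0 hMc]] := continuous_in_bounded T0 (seminorm_sh hH10) sC cc.
have me := ae_measM (ae_meas_meas time (v_meas n i)) (conv_time_meas i (ws_bochner ref) sc).
have [f fL fE] : exists2 f, L1fun time I f &
    {ae time, forall t : RT, I t -> v_ n i t * conv Om (chi i) (phib t) (rhoG (phi_ n) t) = f t}.
  apply: (ae_meas_L1 mI me); exists (fun t => 2 * M * (Cc i * Mc) * `|g t|).
    by apply: (L1Z mI); apply: L1_normr; exact: (L2_L1 mI (time_finite T)).
  apply: (ae_imply2 gE (v_bound n i)) => t q1 q2 It.
  have [pH pg] := q1 It.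
  have tT : 0 <= t <= T by move: It; rewrite /= in_itv /= => /andP[x y]; rewrite !ltW.
  have cH := cc.1 t tT.
  rewrite normrM -mulrA; apply: ler_pM => //; first exact: q2.
  apply: le_trans (convC i (H10_H1 pH) (H10_H1 cH)) _.
  rewrite -(normH1E oO (H10_H1 pH)) pg mulrAC.
  have g0 : 0 <= g t by rewrite -pg (normH1E oO (H10_H1 pH)) sh_norm_ge0.
  apply: (ler_pM (mulr_ge0 (Cc0 i) (sh_norm_ge0 _ _)) g0 _ (ler_norm _)).
  by rewrite ler_wpM2l//; exact: hMc.
exists f => //.
by apply: (ae_imply fE) => t h It; rewrite h.
Qed.

Lemma forcing_small (q : R) : 0 < q -> \forall n \near U, forall tau, 0 <= tau <= T ->
  (forall s, 0 <= s <= tau -> dist2 (phi_ n) s <= 1) ->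
  forall F, L1fun time I F ->
  {ae time, forall t : RT, I t -> F t = \sum_i (u_ n i t - ub i t) * conv Om (chi i) (phib t) (rhoG (phi_ n) t)} ->
  `|tint F 0 tau| <= q.
Proof.
move=> q0; have e0 : 0 < q / m.+1%:R by rewrite divr_gt0.
apply: filterS (filter_forall_fin FU (fun i => forcing_small1 i e0)) => n hn tau tauT y1 F FL FE.
case/andP: (tauT) => tau0 tauT'.
have /choice[f fP] : forall i, exists f : R -> R, L1fun time I f /\
  {ae time, forall t : RT, I t -> f t = v_ n i t * conv Om (chi i) (phib t) (rhoG (phi_ n) t)}.
  by move=> i; have [f fL fE] := piece_L1 n i; exists f.
have fS : L1fun time I (fun t => \sum_i f i t) by apply: (L1_sum mI) => i; exact: (fP i).1.
have -> : tint F 0 tau = tint (fun t => \sum_i f i t) 0 tau.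
  apply: (eq_tint (lexx 0) tauT' FL fS).
  have h := filter_forall_fin (ae_filter_ringOfSetsType time) (fun i => (fP i).2).
  apply: (ae_imply2 h FE) => t q1 q2 It.
  by rewrite q2//; apply: eq_bigr => i _; rewrite q1.
have mtau : measurable (`]0, tau[%classic : set RT) by exact: (@measurable_itvT R (Interval _ _)).
rewrite /tint (Rint_sum mtau); last by move=> i; exact: (L1_itv (lexx 0) tauT' (fP i).1).
apply: le_trans (ler_norm_sum _ _ _) _.
apply: le_trans (ler_sum _ (fun i _ => hn i tau tauT y1 _ (fP i).1 (fP i).2)) _.
exact: (sum_share_le m (ltW q0)).
Qed.

(** [stability] makes [dist2] small on all of [0, T]. The dissipation inequality then holds at
    almost every time, and integrating it bounds the space-time L2 norm of the difference. *)
Lemma weak_to_strong (eta : R) : 0 < eta -> \forall n \near U,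
  (forall t, 0 <= t <= T -> dist2 (phi_ n) t <= eta) /\
  \int[time]_(t in I) (normL2 Om (phi_ n t - phib t) ^+ 2) <= eta.
Proof.
move=> eta0.
have DL := Dcoef_L1.
have D0' : {ae time, forall t : RT, I t -> 0 <= Dcoef t} by apply: aeW => t _; exact: Dcoef_ge0.
have [bt bt0 btE] : exists2 bt : R, 0 <= bt & bt = tint Dcoef 0 T.
  by exists (tint Dcoef 0 T) => //; exact: (tint_ge0 (lexx 0) (lexx T) DL D0').
have [E E0 EE] : exists2 E : R, 0 < E & E = expR (4 * bt) by exists (expR (4 * bt)); rewrite ?expR_gt0.
pose c0 := 2^-1 * (b * a).
have c00 : 0 < c0 by rewrite !mulr_gt0// invr_gt0.
(* The three conditions serve the closing condition of [stability], the pointwise bound on [dist2],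
   and the integrated dissipation inequality. *)
have [q q0 [q1 q2 q3]] : exists2 q : R, 0 < q & [/\ 2 * q * E < 1, 2 * q * E <= eta & c0^-1 * (q + 2 * q * E * bt) <= eta].
  pose q := Num.min (1 / (4 * E)) (Num.min (eta / (2 * E)) (eta * c0 / (1 + 2 * E * bt))).
  have X0 : 0 < 1 + 2 * E * bt by rewrite ltr_pwDl// !mulr_ge0// ltW.
  have q1 : q <= 1 / (4 * E) by rewrite /q ge_min lexx.
  have q2 : q <= eta / (2 * E) by rewrite /q ge_min; apply/orP; right; rewrite ge_min lexx.
  have q3 : q <= eta * c0 / (1 + 2 * E * bt) by rewrite /q ge_min; apply/orP; right; rewrite ge_min lexx orbT.
  have q0 : 0 < q by rewrite /q !lt_min !divr_gt0 ?mulr_gt0.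
  exists q => //; split.
  - move: q1; rewrite ler_pdivlMr ?mulr_gt0// => h; lra.
  - by move: q2; rewrite ler_pdivlMr ?mulr_gt0// mulrCA mulrA.
  - move: q3; rewrite ler_pdivlMr// => h.
    rewrite mulrC ler_pdivrMr//; apply: le_trans h; rewrite le_eqVlt; apply/orP; left; apply/eqP; ring.
apply: filterS (forcing_small q0) => n hn; have sol := sol_ n.
have [cy [h [F [hL FL yE hae]]]] := energy_structure sol.
have y0 t : 0 <= t <= T -> 0 <= dist2 (phi_ n) t by move=> tT; rewrite -(nrm_rhoG sol tT).2 sqr_ge0.
have FE : {ae time, forall t : RT, I t -> F t = \sum_i (u_ n i t - ub i t) * conv Om (chi i) (phib t) (rhoG (phi_ n) t)}.
  by apply: (ae_imply hae) => t ht It; have [] := ht It.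
have hF tau : 0 <= tau <= T -> (forall s, 0 <= s <= tau -> dist2 (phi_ n) s <= 1) -> `|tint F 0 tau| <= q.
  by move=> tT y1; exact: hn.
have hdis : {ae time, forall t : RT, I t -> dist2 (phi_ n) t <= 1 ->
    c0 * inner Om (rho (phi_ n) t) (rho (phi_ n) t) <= - h t - F t + dist2 (phi_ n) t * Dcoef t}.
  apply: (ae_imply hae) => t ht It y1; have [_ _ rH hd] := ht It.
  apply: le_trans (hd y1); rewrite -[X in X <= _]addr0; apply: lerD.
    apply: ler_wpM2l; first exact: ltW.
    by apply: inner_le_H1 => //; exact: H10_H1.
  apply: mulr_ge0; last exact: quart_ge0.
  by rewrite !mulr_ge0 ?invr_ge0// ltW.
have hst : {ae time, forall t : RT, I t -> dist2 (phi_ n) t <= 1 -> h t + F t <= dist2 (phi_ n) t * Dcoef t}.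
  apply: (ae_imply hdis) => t ht It y1.
  have i0 : 0 <= c0 * inner Om (rho (phi_ n) t) (rho (phi_ n) t) by apply: mulr_ge0; [exact: ltW|exact: inner_ge0].
  move: (ht It y1) i0; move: (inner Om _ _) (dist2 _ _ * _) (h t) (F t) => x1 x2 x3 x4 q4 q5; lra.
have small : forall t, 0 <= t <= T -> dist2 (phi_ n) t <= 2 * q * E.
  move=> t tT; rewrite EE btE; apply: (stability T0 cy y0 yE hL FL DL _ hst hF) => //.
    by move=> s _; exact: Dcoef_ge0.
  by rewrite -btE -EE.
split; first by move=> t tT; exact: le_trans (small t tT) q2.
have yDL := cont_mul_L1 T0 cy DL.
have ev := evolutionB oO (ws_ev sol) (ws_ev ref).
have [cN _] := continuous_in_bounded T0 (seminorm_sh hL2) (fun x z xL zL => sh_normC hL2 xL zL) (ev_cont ev).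
have iL : L1fun time I (fun t => normL2 Om (phi_ n t - phib t) ^+ 2).
  apply: (L1_ext mI _ (cont_on_L1 T0 (cont_onM T0 cN cN))) => t _.
  by rewrite -expr2 normL2E.
have RL : L1fun time I (fun t => - h t - F t + dist2 (phi_ n) t * Dcoef t).
  by apply: (L1D mI) => //; apply: (L1B mI) => //; exact: L1N.
have T1 : 0 <= T <= T by rewrite lexx ltW.
apply: le_trans (_ : _ <= c0^-1 * tint (fun t => - h t - F t + dist2 (phi_ n) t * Dcoef t) 0 T) _.
  rewrite -(tintZ _ (lexx 0) (lexx T) RL); apply: (ae_le_Rint mI iL); first exact: (L1Z mI).
  apply: (ae_imply hdis) => t ht It.
  have tT : 0 <= t <= T by move: It; rewrite /= in_itv /= => /andP[x y]; rewrite !ltW.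
  have y1 : dist2 (phi_ n) t <= 1 by apply: le_trans (small t tT) (ltW q1).
  have hh := ht It y1.
  have -> : normL2 Om (phi_ n t - phib t) ^+ 2 = inner Om (rho (phi_ n) t) (rho (phi_ n) t).
    by rewrite normL2E; exact: (sh_norm2 hL2 ((ev_cont ev).1 t tT)).
  by rewrite [c0^-1 * _]mulrC ler_pdivlMr// [X in X <= _]mulrC.
apply: le_trans q3; rewrite ler_pM2l ?invr_gt0//.
have -> : tint (fun t => - h t - F t + dist2 (phi_ n) t * Dcoef t) 0 T =
    - tint h 0 T - tint F 0 T + tint (fun t => dist2 (phi_ n) t * Dcoef t) 0 T.
  rewrite (tintD (lexx 0) (lexx T) _ yDL); last by apply: (L1B mI) => //; exact: L1N.
  congr (_ + _); rewrite /tint (RintB mI _ FL); last exact: L1N.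
  by rewrite (RintN mI).
have h0 : 0 <= tint h 0 T by have := y0 T T1; rewrite (yE T T1) pmulr_rge0.
have hFT : - tint F 0 T <= q.
  apply: le_trans (ler_norm _) _; rewrite normrN; apply: hF => // s /andP[s0 sT].
  by apply: le_trans (small s _) (ltW q1); rewrite s0.
have hD : tint (fun t => dist2 (phi_ n) t * Dcoef t) 0 T <= 2 * q * E * bt.
  rewrite btE -(tintZ _ (lexx 0) (lexx T) DL); apply: (le_tint (lexx 0) (lexx T) yDL (L1Z mI _ DL)).
  apply: aeW => t It; rewrite ler_wpM2r ?Dcoef_ge0//; apply: small.
  by move: It; rewrite /= in_itv /= => /andP[x y]; rewrite !ltW.
move: (tint h 0 T) (tint F 0 T) (tint (fun t => dist2 (phi_ n) t * Dcoef t) 0 T) (2 * q * E * bt) h0 hFT hD => x1 x2 x3 x4 h0 hFT hD; lra.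
Qed.

End Sequence.

End WeakToStrong.

(** * Weak limits of controls *)

Section UltraLimit.
Variables (U : set_system nat) (UU : UltraFilter U).

(** The limit is the supremum of the reals lying below [x_ n] for n in a set of [U]; the bound from
    above uses that an ultrafilter contains each set or its complement. *)
Lemma ultra_limit (R : realType) (x_ : nat -> R) (K : R) : (forall n, `|x_ n| <= K) ->
  exists l : R, forall e : R, 0 < e -> \forall n \near U, `|x_ n - l| <= e.
Proof.
move=> xK; pose S := [set r : R | \forall n \near U, r <= x_ n].
have xb n : - K <= x_ n <= K by rewrite -ler_norml.
have hS : has_sup S.
  split; first by exists (- K); apply: nearW => n; have /andP[] := xb n.
  exists K => r Sr; have [n rn] := filter_ex Sr; apply: le_trans rn _.
  by have /andP[] := xb n.
exists (sup S) => e e0.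
have h1 : \forall n \near U, sup S - e <= x_ n.
  have [r Sr hr] := sup_adherent e0 hS.
  by apply: filterS Sr => n; apply: le_trans; exact: ltW.
have h2 : \forall n \near U, x_ n <= sup S + e.
  have [h|h] := in_ultra_setVsetC [set n | sup S + e <= x_ n] UU.
    have : sup S + e <= sup S by apply: sup_upper_bound.
    by rewrite gerDl leNgt e0.
  by apply: filterS h => n /= /negP; rewrite -ltNge => /ltW.
by apply: filterS2 h1 h2 => n q1 q2; rewrite ler_distl q1.
Qed.

Section WeakLimit.
Context d (X : measurableType d) (R : realType).
Variables (mu : {measure set X -> \bar R}) (D : set X).
Hypothesis mD : measurable D.
Local Notation L2D := (L2fun mu D).
Local Notation ipD := (ip mu D).

Let hL := semi_hilbert_L2 mu mD.

(** The limits along [U] of the scalar sequences, one for each [z], form a bounded linear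
    functional, which the Riesz theorem represents; the same filter serves every [z]. *)
Lemma ultra_weak_limit (v_ : nat -> X -> R) (B : R) : (forall n, L2D (v_ n)) ->
  (forall n, sh_norm ipD (v_ n) <= B) ->
  exists2 v, L2D v & forall z, L2D z -> forall e : R, 0 < e ->
    \forall n \near U, `|ipD (v_ n) z - ipD v z| <= e.
Proof.
move=> vL vB.
have hb z : L2D z -> forall n, `|ipD (v_ n) z| <= B * sh_norm ipD z.
  move=> zL n; apply: le_trans (sh_CS hL (vL n) zL) _.
  by rewrite ler_wpM2r ?sh_norm_ge0.
have /choice[l lP] : forall z, exists l : R, L2D z -> forall e : R, 0 < e ->
    \forall n \near U, `|ipD (v_ n) z - l| <= e.
  move=> z; have [zL|nz] := pselect (L2D z); last by exists 0.
  by have [l hl] := ultra_limit (hb z zL); exists l.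
have sX := sh_sub hL.
have lin (a : R) x y : L2D x -> L2D y -> l (a *: x + y) = a * l x + l y.
  move=> xL yL; apply: eq_of_dist_small => e e0.
  have e1 : 0 < e / (`|a| + 2) by rewrite divr_gt0// ltr_wpDl.
  have [n [[h1 h2] h3]] := filter_ex (filterI (filterI (lP _ xL _ e1) (lP _ yL _ e1))
    (lP _ (sX.2 a _ _ xL yL) _ e1)).
  have E : ipD (v_ n) (a *: x + y) = a * ipD (v_ n) x + ipD (v_ n) y.
    rewrite (shDr hL)//; last exact: (subspaceZ _ sX).
    by rewrite (shZr hL).
  rewrite E in h3.
  set p := ipD (v_ n) x in h1 h3; set q := ipD (v_ n) y in h2 h3.
  have -> : l (a *: x + y) - (a * l x + l y) =
    - (a * p + q - l (a *: x + y)) + (a * (p - l x) + (q - l y)) by ring.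
  apply: le_trans (ler_normD _ _) _; rewrite normrN.
  apply: le_trans (lerD h3 (ler_normD _ _)) _; rewrite normrM.
  apply: le_trans (lerD (lexx _) (lerD (ler_wpM2l (normr_ge0 a) h1) h2)) _.
  have -> : e / (`|a| + 2) + (`|a| * (e / (`|a| + 2)) + e / (`|a| + 2)) = e * ((`|a| + 2) / (`|a| + 2)) by ring.
  by rewrite divff ?mulr1// gt_eqF// ltr_wpDl.
have bnd x : L2D x -> `|l x| <= B * sh_norm ipD x.
  move=> xL; apply/ler_addgt0Pr => e e0.
  have [n hn] := filter_ex (lP _ xL _ e0).
  rewrite -[l x](subrK (ipD (v_ n) x)) addrC; apply: le_trans (ler_normD _ _) _.
  by apply: lerD; [exact: hb|rewrite distrC].
have [v vL' vE] := riesz_representation hL lin bnd.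
by exists v => // z zL e e0; rewrite vE//; exact: lP.
Qed.

(** Weak convergence is tested with the indicator of the set where al - v >= 0: there v_n - v is at
    least al - v, so the integral of al - v over that set is zero. *)
Lemma weak_limit_ge (v_ : nat -> X -> R) (v al : X -> R) : (mu D < +oo)%E ->
  (forall n, L2D (v_ n)) -> L2D v -> L2D al ->
  (forall z, L2D z -> forall e : R, 0 < e -> \forall n \near U, `|ipD (v_ n) z - ipD v z| <= e) ->
  (forall n, {ae mu, forall x, D x -> al x <= v_ n x}) ->
  {ae mu, forall x, D x -> al x <= v x}.
Proof.
move=> finD vL_ vL aL wc hge.
pose w x := al x - v x; have wL : L2D w by exact: (L2B mD).
have mw := L2_meas wL.
pose E := D `&` [set x | 0 <= w x].
have mE : measurable E.
  have := mw mD _ (@measurable_itv R `[0, +oo[).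
  suff -> : E = D `&` w @^-1` `[0, +oo[%classic by [].
  by apply/seteqP; split => x [Dx] /=; rewrite in_itv /= ?andbT.
have mz : measurable_fun D (\1_E : X -> R) by exact: measurable_indic.
have zL : L2D (\1_E : X -> R).
  by apply: (@L2_bnd _ _ R mu D mD 1) => // x _; rewrite indicE ger0_norm// lern1 leq_b1.
have JL : L1fun mu D (fun x => w x * \1_E x) := L2_mul mD wL zL.
have J0 x : D x -> 0 <= w x * \1_E x.
  move=> Dx; rewrite indicE; case: (boolP (x \in E)); last by rewrite mulr0.
  by rewrite inE => -[_ /=]; rewrite mulr1.
have Jz : \int[mu]_(x in D) (w x * \1_E x) = 0.
  apply/le_anti/andP; split; last exact: Rintegral_ge0.
  apply/ler_addgt0Pr => e e0; rewrite add0r.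
  have [n hn] := filter_ex (wc _ zL e e0).
  apply: le_trans (ler_norm _) _; rewrite ger0_norm; last exact: Rintegral_ge0.
  apply: le_trans hn; apply: le_trans (ler_norm _).
  rewrite -(shBl hL (vL_ n) vL zL).
  apply: (ae_le_Rint mD JL); first exact: (L2_mul mD (subspaceB (sh_sub hL) (vL_ n) vL) zL).
  apply: filterS (hge n) => x h Dx; rewrite ler_wpM2r//.
  by change (al x - v x <= v_ n x - v x); rewrite lerD2r; exact: h.
apply: filterS (Rint_eq0_ae mD JL J0 Jz) => x h Dx.
case: (leP (al x) (v x)) => // lt_; have w0 : 0 < w x by rewrite subr_gt0.
have := h Dx; rewrite indicE mem_set ?mulr1; last by split => //; exact: ltW.
by move=> w00; rewrite w00 ltxx in w0.
Qed.

End WeakLimit.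
End UltraLimit.

(** * Density of H1 in L2 *)

Section H1Dense.
Context (R : realType) (d : nat) (Om : set 'rV[R]_d).
Local Notation scal := ('rV[R]_d -> R).
Local Notation leb := (lebesgue_rV R d).
Hypothesis oO : open Om.
Hypothesis finO : (leb Om < +oo)%E.

Let mO : measurable Om. Proof. exact: open_measurable_rV. Qed.
Let hL2 : semi_hilbert (L2 Om) (inner Om) := semi_hilbert_L2 leb mO.

Lemma CkS k (f : scal) : Ck k.+1 f -> Ck k f.
Proof.
elim: k f => [|k IH] f [cf h]; first exact: cf.
split => // i; have [df hf] := h i; split => //; exact: IH.
Qed.

Lemma CkD k (f g : scal) : Ck k f -> Ck k g -> Ck k (f + g).
Proof.
elim: k f g => [|k IH] f g.
  by move=> cf cg x; apply: continuousD; [exact: cf|exact: cg].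
move=> [cf hf] [cg hg]; split.
  by move=> x; apply: continuousD; [exact: cf|exact: cg].
move=> i; have [df f1] := hf i; have [dg g1] := hg i; split.
  by move=> x; exact: derivableD.
have -> : (fun x => 'D_(unitv R i) (f + g) x) =
    (fun x => 'D_(unitv R i) f x) + (fun x => 'D_(unitv R i) g x).
  by apply/funext => x; rewrite deriveD.
exact: IH.
Qed.

Lemma CkM k (f g : scal) : Ck k f -> Ck k g -> Ck k (f * g).
Proof.
elim: k f g => [|k IH] f g.
  by move=> cf cg x; apply: continuousM; [exact: cf|exact: cg].
move=> hf0 hg0; have f0 := CkS hf0; have g0 := CkS hg0.
move: hf0 hg0 => [cf hf] [cg hg]; split.
  by move=> x; apply: continuousM; [exact: cf|exact: cg].
move=> i; have [df f1] := hf i; have [dg g1] := hg i; split.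
  by move=> x; exact: derivableM.
have -> : (fun x => 'D_(unitv R i) (f * g) x) =
    f * (fun x => 'D_(unitv R i) g x) + g * (fun x => 'D_(unitv R i) f x).
  by apply/funext => x; rewrite deriveM.
by apply: CkD; exact: IH.
Qed.

Lemma test_functionM (f g : scal) : (forall k, Ck k f) -> test_function Om g ->
  test_function Om (f * g).
Proof.
move=> Cf [Cg cg sg]; have sub : closure [set x | (f * g) x != 0] `<=` closure [set x | g x != 0].
  apply: closureS => x /=; apply: contra_neq => g0.
  by change (f x * g x = 0); rewrite g0 mulr0.
split; first by move=> k; exact: CkM.
- apply: subclosed_compact cg sub; exact: closed_closure.
- exact: subset_trans sub sg.
Qed.

(** The product of two test functions is a test function, and the integral of its derivative is
    zero; hence classical derivatives are weak ones. *)
Lemma H1_test (psi : scal) : test_function Om psi -> H1 Om psi.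
Proof.
move=> tpsi; have [Cpsi _ _] := tpsi.
have dpsi i x : derivable psi x (unitv R i) by have [_ /(_ i)[]] := Cpsi 1%N.
split; first exact: L2_test.
exists (fun x => \row_i 'D_(unitv R i) psi x).
have cE i : component (fun x => \row_i 'D_(unitv R i) psi x) i = (fun x => 'D_(unitv R i) psi x).
  by apply/funext => x; rewrite /component mxE.
split; first by move=> i; rewrite cE; exact: L2_derive_test.
move=> i eta teta; rewrite cE; have [Ceta _ _] := teta.
have deta x : derivable eta x (unitv R i) by have [_ /(_ i)[]] := Ceta 1%N.
have := Rint_derive_test i (test_functionM Cpsi teta).
have -> : (fun x => 'D_(unitv R i) (psi * eta) x) =
    (fun x => psi x * 'D_(unitv R i) eta x + 'D_(unitv R i) psi x * eta x).
  by apply/funext => x; rewrite deriveM// [eta x *: _]mulrC.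
have L1' := L2_mul mO (L2_test oO finO tpsi) (L2_derive_test oO finO i teta).
have L2' := L2_mul mO (L2_derive_test oO finO i tpsi) (L2_test oO finO teta).
by rewrite (RintD mO L1' L2') => /eqP; rewrite addr_eq0 => /eqP.
Qed.

(** A function orthogonal to H1 is orthogonal to every test function, hence null. *)
Lemma H1_dense (p : scal) (e : R) : L2 Om p -> 0 < e ->
  exists2 psi, H1 Om psi & sh_norm (inner Om) (p - psi) <= e.
Proof.
move=> pL e0.
have [|psi psiH h] := dense_of_orthogonal hL2 (is_subspace_H1 oO finO) (@H1_L2 _ _ _) _ pL (exprn_gt0 2 e0).
  move=> z zL hz; have z0 := L2_eq0_of_test oO finO zL (fun psi tpsi => hz psi (H1_test tpsi)).
  have Z : L2 Om (fun=> 0) := (sh_sub hL2).1.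
  by rewrite (inner_aeE oO zL zL Z Z z0 z0) inner0l.
exists psi => //; apply: le_of_sqr; first exact: ltW.
by rewrite (sh_norm2 hL2)//; apply: (subspaceB (sh_sub hL2)) => //; exact: H1_L2.
Qed.

End H1Dense.

(** * Velocity fields generated by controls *)

Section SimpleInto.
Context (R : realType) (V : lmodType R) (X : set V).

Lemma simple_into0 : simple_into X (fun=> 0).
Proof.
exists 0%N, (fun=> set0), (fun=> 0); split; try by case.
by apply/funext => t; rewrite big_ord0.
Qed.

Lemma simple_into_indic (A : set R) x : measurable A -> X x ->
  simple_into X (fun t => \1_A t *: x).
Proof.
move=> mA Xx; exists 1%N, (fun=> A), (fun=> x); split => //.
by apply/funext => t; rewrite big_ord1.
Qed.

Lemma simple_intoD s1 s2 : simple_into X s1 -> simple_into X s2 ->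
  simple_into X (fun t => s1 t + s2 t).
Proof.
move=> [k1 [A1 [x1 [mA1 X1 ->]]]] [k2 [A2 [x2 [mA2 X2 ->]]]].
exists (k1 + k2)%N, (fun j => match fintype.split j with inl i => A1 i | inr i => A2 i end),
  (fun j => match fintype.split j with inl i => x1 i | inr i => x2 i end); split.
- by move=> j; case: (fintype.split j).
- by move=> j; case: (fintype.split j).
apply/funext => t; rewrite big_split_ord /=; congr (_ + _); apply: eq_bigr => j _.
  by rewrite (unsplitK (inl j)).
by rewrite (unsplitK (inr j)).
Qed.

Lemma simple_into_sum (J : Type) (r : seq J) (s : J -> R -> V) : (forall j, simple_into X (s j)) ->
  simple_into X (fun t => \sum_(j <- r) s j t).
Proof.
move=> h; elim: r => [|j r IH].
  by have := simple_into0; congr simple_into; apply/funext => t; rewrite big_nil.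
have := simple_intoD (h j) IH; congr simple_into.
by apply/funext => t; rewrite big_cons.
Qed.

End SimpleInto.

Section ControlVelocity.
Context (R : realType) (T : R).
Hypothesis T0 : 0 < T.
Local Notation RT := (measurableTypeR R).
Local Notation I := (`]0%R, T[%classic : set RT).
Local Notation time := (@lebesgue_measure R).

Let mI : measurable I. Proof. exact: (@measurable_itvT R (Interval _ _)). Qed.

(** [f] is rounded down to the grid of mesh 1/(n+1) that starts at - M, with enough cells to cover
    the range [- M, M]. *)
Lemma scalar_simple_approx (V : lmodType R) (X : set V) (x : V) (f : R -> R) (M : R) n :
  is_subspace X -> X x -> 0 <= M -> measurable_fun I (f : RT -> R) ->
  exists g : R -> R, simple_into X (fun t => g t *: x) /\
    forall t, I t -> `|f t| <= M -> `|f t - g t| <= n.+1%:R^-1.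
Proof.
move=> sX Xx M0 mf; pose h : R := n.+1%:R^-1.
have h0 : 0 < h by rewrite invr_gt0.
have [K _ hK] := near_natr_ge ((2 * M) / h).
have {hK} := hK K (leqnn K); rewrite /= ler_pdivrMr// => hK.
pose A (j : nat) : set RT := I `&` f @^-1` `[j%:R * h - M, j.+1%:R * h - M[%classic.
have mA j : measurable (A j) by apply: mf => //; exact: measurable_itv.
pose c (j : nat) : R := j%:R * h - M.
exists (fun t => \sum_(j < K.+2) \1_(A j) t * c j); split.
  have := simple_into_sum (enum 'I_K.+2) (fun j : 'I_K.+2 => @simple_into_indic R V X (A j) (c j *: x) (mA j) (subspaceZ _ sX Xx)).
  congr simple_into; apply/funext => t; rewrite scaler_suml big_enum.
  by apply: eq_bigr => j _; rewrite scalerA.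
move=> t It ft; have := ft; rewrite ler_norml => /andP[f1 f2].
pose j := Num.truncn ((f t + M) / h).
have y0 : 0 <= (f t + M) / h by apply: divr_ge0; [lra|exact: ltW].
have /andP[j1 j2] : j%:R <= (f t + M) / h < j.+1%:R by exact: truncn_itv.
rewrite ler_pdivlMr// in j1; rewrite ltr_pdivrMr// in j2.
have jK : (j < K.+2)%N.
  rewrite ltnS -(ler_nat R) -(ler_pM2r h0); apply: le_trans j1 _; apply: le_trans hK; lra.
have -> : \sum_(i < K.+2) \1_(A i) t * c i = c j.
  rewrite (bigD1 (Ordinal jK))//= indicE mem_set ?mul1r; last first.
    by split => //=; rewrite in_itv /= lerBlDr j1 ltrBrDr j2.
  rewrite big1 ?addr0// => i ij; rewrite indicE memNset ?mul0r//.
  move=> -[_]; rewrite /= in_itv /= lerBlDr ltrBrDr => /andP[i1 i2].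
  have h1 : (i < j.+1)%N by rewrite -(ltr_nat R) -(ltr_pM2r h0); exact: le_lt_trans i1 j2.
  have h2 : (j < i.+1)%N by rewrite -(ltr_nat R) -(ltr_pM2r h0); exact: le_lt_trans j1 i2.
  move/eqP: ij; apply; apply: val_inj => /=.
  by apply/eqP; rewrite eqn_leq; apply/andP; split; [exact: h1|exact: h2].
rewrite /c opprB addrA ger0_norm ?subr_ge0// lerBlDr.
have e1 : j.+1%:R * h = h + j%:R * h by rewrite -[j.+1%:R]natr1 mulrDl mul1r addrC.
by rewrite -/h -e1 ltW.
Qed.

(** Each coefficient is approximated uniformly by step functions, and the hypothesis on [N] says
    that combinations with small coefficients have small norm. This one statement covers both norms
    of the velocity class. *)
Lemma control_strong (V : lmodType R) (X : set V) (N : V -> R) m (chi : 'I_m -> V) (K M : R)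
    (f : 'I_m -> R -> R) : is_subspace X -> (forall i, X (chi i)) -> 0 <= M ->
  (forall (c : 'I_m -> R) (h : R), 0 <= h -> (forall i, `|c i| <= h) ->
     0 <= N (\sum_i c i *: chi i) <= h * K) ->
  (forall i, measurable_fun I (f i : RT -> R)) ->
  {ae time, forall t : RT, I t -> forall i, `|f i t| <= M} ->
  strongly_measurable X N T (fun t => \sum_i f i t *: chi i).
Proof.
move=> sX Xc M0 hN mf fM.
have /choice[g gP] : forall n, exists g : 'I_m -> R -> R, forall i,
   simple_into X (fun t => g i t *: chi i) /\
    forall t, I t -> `|f i t| <= M -> `|f i t - g i t| <= n.+1%:R^-1.
  move=> n; have /choice[g gP] : forall i, exists g : R -> R, simple_into X (fun t => g t *: chi i) /\
      forall t, I t -> `|f i t| <= M -> `|f i t - g t| <= n.+1%:R^-1.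
    by move=> i; exact: scalar_simple_approx.
  by exists g.
exists (fun n t => \sum_i g n i t *: chi i); split.
  move=> n; have := simple_into_sum (enum 'I_m) (fun i => (gP n i).1).
  by congr simple_into; apply/funext => t; rewrite big_enum.
apply: (ae_imply fM) => t h It.
split.
  by apply: (big_ind X) => [|y z Xy Xz|i _]; [exact: sX.1|exact: subspaceD|exact: subspaceZ].
apply/cvgrPdist_le => e e0; have [n _ hn] := near_natr_ge ((`|K| + 1) / e).
exists n => // k nk; have {hn} := hn k nk; rewrite /= ler_pdivrMr// => hk.
have -> : \sum_i f i t *: chi i - \sum_i g k i t *: chi i = \sum_i (f i t - g k i t) *: chi i.
  by rewrite -sumrB; apply: eq_bigr => i _; rewrite scalerBl.
have k0 : 0 <= k.+1%:R^-1 :> R by rewrite invr_ge0.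
have /andP[n0 n1] := hN (fun i => f i t - g k i t) _ k0 (fun i => (gP k i).2 t It (h It i)).
rewrite sub0r normrN ger0_norm//; apply: le_trans n1 _.
rewrite mulrC ler_pdivrMr//; apply: le_trans (ler_norm _) _.
by rewrite mulrC; apply: le_trans hk; rewrite lerDl.
Qed.

(** [f] is not assumed measurable: it lies below a function that equals a constant almost
    everywhere, and the integral of nonnegative functions is monotone without measurability. *)
Lemma ae_bounded_integral (f : RT -> R) (C : R) : (forall t, 0 <= f t) ->
  {ae time, forall t : RT, I t -> f t <= C} -> (\int[time]_(t in I) (f t)%:E < +oo)%E.
Proof.
move=> f0 fC.
have C0 : 0 <= Num.max C 0 by rewrite le_max lexx orbT.
apply: (@le_lt_trans _ _ (\int[time]_(t in I) (Num.max (f t) (Num.max C 0))%:E)%E).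
  apply: le_integral_ge0 => t _; first by rewrite lee_fin.
  by rewrite lee_fin le_max lexx.
rewrite (@ge0_ae_integral _ _ _ time I mI _ (fun=> (Num.max C 0)%:E)).
- rewrite integral_cst//; apply: lte_mul_pinfty => //; exact: (time_finite T).
- by move=> t _; rewrite lee_fin le_max f0.
- by move=> t _; rewrite lee_fin.
- exact: measurable_cst.
apply: (ae_imply fC) => t h It.
by rewrite max_r// le_max h.
Qed.

End ControlVelocity.

Section VelocityClass.
Context (R : realType) (d : nat) (Om : set 'rV[R]_d) (T : R).
Local Notation scal := ('rV[R]_d -> R).
Local Notation vect := ('rV[R]_d -> 'rV[R]_d).
Local Notation leb := (lebesgue_rV R d).
Hypothesis oO : open Om.
Hypothesis finO : (leb Om < +oo)%E.
Hypothesis T0 : 0 < T.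
Local Notation RT := (measurableTypeR R).
Local Notation I := (`]0%R, T[%classic : set RT).
Local Notation time := (@lebesgue_measure R).

Let mO : measurable Om. Proof. exact: open_measurable_rV. Qed.
Let mI : measurable I. Proof. exact: (@measurable_itvT R (Interval _ _)). Qed.
Let hL2 : semi_hilbert (L2 Om) (inner Om) := semi_hilbert_L2 leb mO.
Let hH1 : semi_hilbert (H1 Om) (H1ip Om) := semi_hilbert_H1 oO finO.

Lemma component_lin (c : R) (F G : vect) i : component (c *: F + G) i = c *: component F i + component G i.
Proof. by apply/funext => x; rewrite /component !fctE !mxE. Qed.

Lemma component_sum m (c : 'I_m -> R) (chi : 'I_m -> vect) i :
  component (\sum_j c j *: chi j) i = \sum_j c j *: component (chi j) i.
Proof.
apply/funext => x; rewrite /component !fct_sumE summxE; apply: eq_bigr => j _.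
by rewrite !fctE mxE.
Qed.

Lemma is_subspace_H1v : is_subspace (H1v Om : set vect).
Proof.
split.
  move=> i; have := (sh_sub hH1).1; congr (H1 Om _).
  by apply/funext => x; rewrite /component mxE.
move=> a F G FH GH i; rewrite component_lin; exact: (sh_sub hH1).2.
Qed.

Lemma innerv_lin (a : R) (F G W : vect) : L2v Om F -> L2v Om G -> L2v Om W ->
  innerv Om (a *: F + G) W = a * innerv Om F W + innerv Om G W.
Proof.
move=> FL GL WL; have SL : L2v Om (a *: F + G).
  by move=> i; rewrite component_lin; exact: (sh_sub hL2).2.
rewrite !innervE// mulr_sumr -big_split /=; apply: eq_bigr => i _.
by rewrite component_lin (sh_lin hL2).
Qed.

Lemma is_subspace_L2sigma : is_subspace (L2sigma Om : set vect).
Proof.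
have Z0 : L2v Om (0 : vect).
  move=> i; have := (sh_sub hL2).1; congr (L2 Om _).
  by apply/funext => x; rewrite /component mxE.
have innerv0 (W : vect) : L2v Om W -> innerv Om 0 W = 0.
  move=> WL; rewrite innervE// big1// => i _.
  rewrite (_ : component _ i = (fun=> 0)) ?inner0l//.
  by apply/funext => x; rewrite /component mxE.
have tL (psi : scal) : test_function Om psi -> L2v Om (fun x => \row_i 'D_(unitv R i) psi x).
  move=> tpsi i; rewrite (_ : component _ i = (fun x => 'D_(unitv R i) psi x)); first exact: L2_derive_test.
  by apply/funext => x; rewrite /component mxE.
split.
  split => //.
    by move=> psi tpsi; rewrite innerv0 ?inner0l ?oppr0//; exact: tL.
  by move=> w wH; rewrite innerv0 ?inner0l ?addr0//; exact: L2v_wgrad.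
move=> a F G [FL Fd Ft] [GL Gd Gt]; split.
- by move=> i; rewrite component_lin; exact: (sh_sub hL2).2.
- move=> psi tpsi; rewrite innerv_lin//; last exact: tL.
  by rewrite (Fd psi tpsi) (Gd psi tpsi) inner0l//; ring.
- move=> w wH; rewrite innerv_lin//; last exact: L2v_wgrad.
  have i0 : inner Om (fun=> 0) w = 0 by rewrite inner0l.
  have f1 := Ft w wH; have g1 := Gt w wH; rewrite i0 addr0 in f1; rewrite i0 addr0 in g1.
  by rewrite f1 g1 i0 mulr0 !addr0.
Qed.

Lemma comb_norm_le (X : set scal) (B : scal -> scal -> R) m (chi : 'I_m -> vect) : semi_hilbert X B ->
  (forall i j, X (component (chi i) j)) -> exists K : R, forall (c : 'I_m -> R) (h : R), 0 <= h ->
  (forall i, `|c i| <= h) ->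
    Num.sqrt (\sum_(j < d) sh_norm B (component (\sum_i c i *: chi i) j) ^+ 2) <= h * K.
Proof.
move=> hB Xc; pose S j := \sum_i sh_norm B (component (chi i) j).
exists (Num.sqrt (\sum_j S j ^+ 2)) => c h h0 ch.
rewrite -[X in X * _](ger0_norm h0) -sqrtr_sqr -sqrtrM ?sqr_ge0//.
apply: ler_wsqrtr; rewrite mulr_sumr; apply: ler_sum => j _.
rewrite -exprMn; apply: lerXn2r; rewrite ?nnegrE ?sh_norm_ge0 ?mulr_ge0 ?sumr_ge0//.
  by move=> i _; exact: sh_norm_ge0.
rewrite component_sum /S mulr_sumr.
have : X (\sum_i c i *: component (chi i) j) /\
    sh_norm B (\sum_i c i *: component (chi i) j) <= \sum_i h * sh_norm B (component (chi i) j).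
  apply: (big_ind2 (fun x y => X x /\ sh_norm B x <= y)).
  - split; first exact: (sh_sub hB).1.
    by rewrite /sh_norm (sh0l hB (sh_sub hB).1) sqrtr0.
  - move=> x1 x2 y1 y2 [X1 h1] [X2 h2]; split; first exact: (subspaceD (sh_sub hB)).
    by apply: le_trans (sh_normD hB X1 X2) _; exact: lerD.
  - move=> i _; split; first exact: (subspaceZ _ (sh_sub hB)).
    by rewrite (sh_normZ hB)// ler_wpM2r// sh_norm_ge0.
by case.
Qed.

Variables (m : nat) (chi : 'I_m -> vect).
Hypothesis chiP : forall i, L2sigma Om (chi i) /\ H1v Om (chi i).

Lemma velocity_class_control (u : R -> 'rV[R]_m) (M : R) : 0 <= M ->
  (forall i, measurable_fun I (fun t : RT => u t ord0 i)) ->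
  {ae time, forall t : RT, I t -> forall i, `|u t ord0 i| <= M} ->
  velocity_class Om T (control_op chi u).
Proof.
move=> M0 mu uM.
have vE : control_op chi u = (fun t => \sum_i u t ord0 i *: chi i).
  apply/funext => t; apply/funext => x; rewrite /control_op fct_sumE.
  by apply: eq_bigr => i _; rewrite !fctE.
rewrite vE.
have Xs i : L2sigma Om (chi i) := (chiP i).1.
have Xh i : H1v Om (chi i) := (chiP i).2.
have [K1 hK1] := comb_norm_le hL2 (fun i j => let: conj (And3 L _ _) _ := chiP i in L j).
have [K2 hK2] := comb_norm_le hH1 (fun i j => Xh i j).
have N1 (c : 'I_m -> R) (h : R) : 0 <= h -> (forall i, `|c i| <= h) ->
     0 <= normL2v Om (\sum_i c i *: chi i) <= h * K1.
  move=> h0 ch; rewrite /normL2v sqrtr_ge0 /=.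
  have [SL _ _] : L2sigma Om (\sum_i c i *: chi i).
    apply: (big_ind (L2sigma Om)) => [|y z Xy Xz|i _]; first exact: is_subspace_L2sigma.1.
      exact: (subspaceD is_subspace_L2sigma).
    exact: (subspaceZ _ is_subspace_L2sigma).
  rewrite innervE//; apply: le_trans (hK1 c h h0 ch); rewrite le_eqVlt; apply/orP; left; apply/eqP.
  by congr Num.sqrt; apply: eq_bigr => j _; rewrite (sh_norm2 hL2).
have N2 (c : 'I_m -> R) (h : R) : 0 <= h -> (forall i, `|c i| <= h) ->
     0 <= normH1v Om (\sum_i c i *: chi i) <= h * K2.
  move=> h0 ch; rewrite /normH1v sqrtr_ge0 /=.
  have SL : H1v Om (\sum_i c i *: chi i).
    apply: (big_ind (H1v Om)) => [|y z Xy Xz|i _]; first exact: is_subspace_H1v.1.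
      exact: (subspaceD is_subspace_H1v).
    exact: (subspaceZ _ is_subspace_H1v).
  apply: le_trans (hK2 c h h0 ch); rewrite le_eqVlt; apply/orP; left; apply/eqP.
  by congr Num.sqrt; apply: eq_bigr => j _; rewrite (normH1E oO).
split; split.
- exact: (@control_strong _ _ _ _ _ _ chi K1 M (fun i t => u t ord0 i) is_subspace_L2sigma Xs M0 N1 mu uM).
- exists (M * K1); apply: (ae_imply uM) => t h It.
  by have /andP[] := N1 (fun i => u t ord0 i) M M0 (h It).
- exact: (@control_strong _ _ _ _ _ _ chi K2 M (fun i t => u t ord0 i) is_subspace_H1v Xh M0 N2 mu uM).
- apply: (@ae_bounded_integral R T _ ((M * K2) ^+ 2)); first by move=> t; exact: sqr_ge0.
  apply: (ae_imply uM) => t h It.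
  have /andP[n0 n1] := N2 (fun i => u t ord0 i) M M0 (h It).
  by apply: lerXn2r; rewrite ?nnegrE// (le_trans n0).
Qed.

Variable CS : R.
Hypothesis sob : forall f, H1 Om f ->
  L4fun leb Om f /\ \int[leb]_(x in Om) (f x ^+ 4) <= CS * H1ip Om f f ^+ 2.

Lemma conv_comb (c : 'I_m -> R) f w : H1 Om f -> H1 Om w ->
  inner Om (fun x => dotv (\sum_i c i *: chi i x) (wgrad Om f x)) w =
  \sum_i c i * conv Om (chi i) f w.
Proof.
move=> fH wH.
have L i : L1fun leb Om (fun x => dotv (chi i x) (wgrad Om f x) * w x).
  have [h _] := convE oO sob (chiP i).2 fH wH.
  apply: (L1_ext mO _ (L1_sum mO h)) => x _.
  by rewrite /dotv mulr_suml.
rewrite /conv /inner.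
under [RHS]eq_bigr do rewrite -(RintZ mO _ (L _)).
rewrite -(Rint_sum mO); last by move=> i; exact: (L1Z mO).
apply: Rint_ext => x _; rewrite /dotv mulr_suml.
under eq_bigr do rewrite summxE mulr_suml mulr_suml.
rewrite exchange_big /=; apply: eq_bigr => i _.
rewrite mulr_suml mulr_sumr; apply: eq_bigr => j _.
by rewrite mxE !mulrA.
Qed.

(** The chosen [time_deriv] is a genuine derivative because [W0T] provides one, and [conv_comb]
    distributes the transport over the control fields. *)
Lemma CH_solution_weak (b sigma eps M : R) (phi0 : scal) (u : R -> 'rV[R]_m) (phi mu : R -> scal) :
  (forall i, measurable_fun I (fun t : RT => u t ord0 i)) ->
  {ae time, forall t : RT, I t -> forall i, `|u t ord0 i| <= M} ->
  CH_solution Om T b sigma eps phi0 (control_op chi u) phi mu ->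
  weak_sol Om T chi b (sigma * eps) (sigma / eps) M phi0 (fun i t => u t ord0 i) phi mu (time_deriv Om T phi).
Proof.
move=> mu_ uM [[W _ bmu] cphi init eq1 eq2].
have [bphi exl] := W.
have [bl dl] : bochner_L2 (Hm1 Om) (normHm1 Om) T (time_deriv Om T phi) /\
    is_time_deriv Om T phi (time_deriv Om T phi).
  exact: (xgetPex (fun=> 0) exl).
split => //.
- exact: W0T_evolution.
have [gphi _ hphi] := bochner_normP (seminorm_H10 oO finO) bphi.
have sN1 : seminorm_on (H1 Om) (normH1 Om).
  have sX := sh_sub hH1; split => // x y xH yH.
  rewrite !(normH1E oO)//; first exact: (sh_norm_dist hH1).
  exact: (subspaceB sX).
have [gmu _ hmu] := bochner_normP sN1 bmu.
have h2 := ae_conj hphi hmu.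
have h3 := ae_conj eq1 eq2.
have h4 := ae_conj h2 uM.
apply: (ae_imply2 h4 h3) => t q1 q2 It.
have [[[pH _] [mH _]] um] := q1 It; have [e1 e2] := q2 It.
split => // w wH; have := e1 w wH.
by rewrite (conv_comb (fun i => u t ord0 i) (H10_H1 pH) (H10_H1 wH)).
Qed.

End VelocityClass.

(** * Semicontinuity of the cost *)

Section CostTerms.
Context (R : realType) (d : nat) (Om : set 'rV[R]_d) (T : R).
Local Notation scal := ('rV[R]_d -> R).
Local Notation leb := (lebesgue_rV R d).
Hypothesis oO : open Om.
Hypothesis finO : (leb Om < +oo)%E.
Hypothesis T0 : 0 < T.
Local Notation RT := (measurableTypeR R).
Local Notation I := (`]0%R, T[%classic : set RT).
Local Notation time := (@lebesgue_measure R).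

Let mO : measurable Om. Proof. exact: open_measurable_rV. Qed.
Let mI : measurable I. Proof. exact: (@measurable_itvT R (Interval _ _)). Qed.
Let hL2 : semi_hilbert (L2 Om) (inner Om) := semi_hilbert_L2 leb mO.
Let hH1 : semi_hilbert (H1 Om) (H1ip Om) := semi_hilbert_H1 oO finO.
Let hH10 : semi_hilbert (H10 Om) (H1ip Om) := semi_hilbert_H10 oO finO.

Lemma young_sqr (s x y : R) : 0 < s -> 2 * (x * y) <= s^-1 * x ^+ 2 + s * y ^+ 2.
Proof.
move=> s0; rewrite -subr_ge0.
have -> : s^-1 * x ^+ 2 + s * y ^+ 2 - 2 * (x * y) = s^-1 * (x - s * y) ^+ 2.
  by field; rewrite gt_eqF.
by rewrite mulr_ge0 ?sqr_ge0// invr_ge0 ltW.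
Qed.

Lemma sqr_norm_diff (p q : scal) : L2 Om p -> L2 Om q ->
  normL2 Om p ^+ 2 = normL2 Om q ^+ 2 - 2 * inner Om (q - p) p - normL2 Om (q - p) ^+ 2.
Proof.
move=> pL qL; have eL := subspaceB (sh_sub hL2) qL pL.
rewrite !normL2E (sh_norm2 hL2 pL) (sh_norm2 hL2 qL) (sh_norm2 hL2 eL).
have E := sh_sqrD hL2 eL pL.
rewrite subrK in E; rewrite E.
by move: (inner Om (q - p) (q - p)) (inner Om (q - p) p) (inner Om p p) => x y z; ring.
Qed.

(** |q|^2 is expanded around [p] and the cross term split by Young's inequality; its share s |p|^2
    involves only the fixed limit. *)
Lemma tracking_pointwise (p q : scal) (s : R) : L2 Om p -> L2 Om q -> 0 < s ->
  normL2 Om p ^+ 2 <= normL2 Om q ^+ 2 + s^-1 * normL2 Om (q - p) ^+ 2 + s * normL2 Om p ^+ 2.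
Proof.
move=> pL qL s0; have eL := subspaceB (sh_sub hL2) qL pL.
rewrite {1}(sqr_norm_diff pL qL).
have h1 := sh_CS hL2 eL pL; rewrite -!normL2E in h1.
have h2 := young_sqr (normL2 Om (q - p)) (normL2 Om p) s0.
have h3 := sqr_ge0 (normL2 Om (q - p)).
move: h1; rewrite ler_norml => /andP[h1 _].
move: (inner Om (q - p) p) (normL2 Om (q - p) * normL2 Om p) (normL2 Om (q - p) ^+ 2)
  (normL2 Om q ^+ 2) (s^-1 * _) (s * _) h1 h2 h3 => x1 x2 x3 x4 x5 x6 h1 h2 h3; lra.
Qed.

(** Only weak convergence is available at the final time. The cross term is evaluated on a more
    regular [psi] near [p], and the error 2 s |q - p| is absorbed by |q - p|^2 at the cost of
    s^2. *)
Lemma terminal_pointwise (p q psi : scal) (s : R) : L2 Om p -> L2 Om q -> L2 Om psi ->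
  sh_norm (inner Om) (p - psi) <= s ->
  normL2 Om p ^+ 2 <= normL2 Om q ^+ 2 + 2 * `|inner Om (q - p) psi| + s ^+ 2.
Proof.
move=> pL qL psiL hs; have eL := subspaceB (sh_sub hL2) qL pL.
have fL := subspaceB (sh_sub hL2) pL psiL.
rewrite (sqr_norm_diff pL qL).
have h1 := le_trans (sh_CS hL2 eL fL) (ler_wpM2l (sh_norm_ge0 _ _) hs).
rewrite -normL2E (shBr hL2 pL psiL eL) in h1.
move: h1; rewrite ler_norml => /andP[h1 _].
have h2 := ler_norm (- inner Om (q - p) psi); rewrite normrN in h2.
have h3 := sqr_ge0 (normL2 Om (q - p) - s).
move: (inner Om (q - p) p) (inner Om (q - p) psi) (`|inner Om (q - p) psi|) (normL2 Om (q - p)) (normL2 Om q ^+ 2)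
  h1 h2 h3 => x1 x2 x3 x4 x5 h1 h2 h3.
rewrite -subr_ge0; rewrite sqrrB in h3.
have -> : x5 + 2 * x3 + s ^+ 2 - (x5 - 2 * x1 - x4 ^+ 2) =
  (x4 ^+ 2 - x4 * s *+ 2 + s ^+ 2) + 2 * (x1 - x2 + x4 * s) + 2 * (x3 + x2) by ring.
lra.
Qed.

Lemma tracking_meas (phi phid : R -> scal) : continuous_in T (L2 Om) (sh_norm (inner Om)) phi ->
  bochner_L2 (L2 Om) (normL2 Om) T phid ->
  exists2 f : R -> R, L2fun time I f &
    {ae time, forall t : RT, I t -> L2 Om (phid t) /\ normL2 Om (phi t - phid t) = f t}.
Proof.
move=> cphi bphid; have sN := seminorm_sh hL2.
have NC x z : L2 Om x -> L2 Om z -> sh_norm (inner Om) (x - z) = sh_norm (inner Om) (z - x) := @sh_normC _ _ _ _ hL2 x z.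
have [cN [M M0 hM]] := continuous_in_bounded T0 sN NC cphi.
have bd : bochner_L2 (L2 Om) (sh_norm (inner Om)) T phid := bphid.
have [g Lg gE] := bochner_normP sN bd.
have It_in (t : RT) : I t -> 0 <= t <= T by rewrite /= in_itv /= => /andP[x y]; rewrite !ltW.
have me : ae_meas time I (fun t => sh_norm (inner Om) (phi t - phid t)).
  apply: (@strong_pairing R T _ (L2 Om) (sh_norm (inner Om)) (fun t x => sh_norm (inner Om) (phi t - x)) (fun=> 1)); last exact: bd.1.
  - exact: (sh_sub hL2).
  - move=> x xL; apply: ae_meas_meas; apply: cont_on_measurable => t tT e e0.
    have [dl dl0 hd] := cphi.2 t e tT e0; exists dl => // s sT st.
    rewrite distrC; apply: le_trans (hd s sT st).
    have h := sh_norm_dist hL2 (subspaceB (sh_sub hL2) (cphi.1 t tT) xL) (subspaceB (sh_sub hL2) (cphi.1 s sT) xL).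
    by apply: le_trans h _; rewrite opprB addrA subrK.
  - apply: aeW => t It x y xL yL; rewrite mul1r.
    have pL := cphi.1 t (It_in t It).
    have h := sh_norm_dist hL2 (subspaceB (sh_sub hL2) pL xL) (subspaceB (sh_sub hL2) pL yL).
    apply: le_trans h _; rewrite opprB addrC addrA subrK (NC y x)//.
have [f mf fE] := me.
exists f; last first.
  by apply: (ae_imply2 gE fE) => t q1 q2 It; split; [exact: (q1 It).1|exact: q2].
have Lb : L2fun time I (fun t => M + `|g t|).
  apply: (L2D mI); first exact: (L2_cst mI M (time_finite T)).
  apply: (L2_le mI _ _ Lg); first by apply: measurableT_comp => //; exact: L2_meas Lg.
  by move=> t _; rewrite normr_id.
split => //.
apply: le_lt_trans Lb.2; apply: ae_ge0_le_integral => //.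
- by move=> t _; rewrite lee_fin sqr_ge0.
- by apply/measurable_EFinP; exact: measurable_funX.
- by move=> t _; rewrite lee_fin sqr_ge0.
- by apply/measurable_EFinP; apply: measurable_funX; exact: L2_meas Lb.
apply: (ae_imply2 gE fE) => t q1 q2 It.
have [dL dN] := q1 It; rewrite lee_fin -(q2 It).
have pL := cphi.1 t (It_in t It).
apply: lerXn2r; rewrite ?nnegrE ?sh_norm_ge0 ?addr_ge0//.
apply: le_trans (sh_normB hL2 pL dL) _; apply: lerD; first exact: hM _ (It_in t It).
by rewrite dN ler_norm.
Qed.

Lemma tracking_lsc (phi phib phid : R -> scal) (s : R) :
  continuous_in T (L2 Om) (sh_norm (inner Om)) phi ->
  continuous_in T (L2 Om) (sh_norm (inner Om)) phib ->
  bochner_L2 (L2 Om) (normL2 Om) T phid -> 0 < s ->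
  \int[time]_(t in I) (normL2 Om (phib t - phid t) ^+ 2) <=
  \int[time]_(t in I) (normL2 Om (phi t - phid t) ^+ 2) +
  s^-1 * \int[time]_(t in I) (normL2 Om (phi t - phib t) ^+ 2) +
  s * \int[time]_(t in I) (normL2 Om (phib t - phid t) ^+ 2).
Proof.
move=> cphi cphib bphid s0.
have [f fL fE] := tracking_meas cphi bphid; have [fb fbL fbE] := tracking_meas cphib bphid.
have cd := continuous_inB hL2 cphi cphib.
have NC x z : L2 Om x -> L2 Om z -> sh_norm (inner Om) (x - z) = sh_norm (inner Om) (z - x) := @sh_normC _ _ _ _ hL2 x z.
have [cN _] := continuous_in_bounded T0 (seminorm_sh hL2) NC cd.
have dL : L1fun time I (fun t => normL2 Om (phi t - phib t) ^+ 2).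
  apply: (L1_ext mI _ (cont_on_L1 T0 (cont_onM T0 cN cN))) => t _.
  by rewrite -expr2 normL2E.
have It_in (t : RT) : I t -> 0 <= t <= T by rewrite /= in_itv /= => /andP[x y]; rewrite !ltW.
have sq (g : R -> R) : L2fun time I g -> measurable_fun I (fun t : RT => g t ^+ 2).
  by move=> gL; apply: measurable_funX; exact: L2_meas gL.
rewrite (@ae_Rint_ext _ _ _ time I mI (fun t => normL2 Om (phib t - phid t) ^+ 2) (fun t => fb t ^+ 2)); first last.
- by apply: (ae_imply fbE) => t h It; rewrite (h It).2.
- exact: sq.
rewrite (@ae_Rint_ext _ _ _ time I mI (fun t => normL2 Om (phi t - phid t) ^+ 2) (fun t => f t ^+ 2)); first last.
- by apply: (ae_imply fE) => t h It; rewrite (h It).2.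
- exact: sq.
have fL1 := L2_sqr fL; have fbL1 := L2_sqr fbL.
rewrite -(RintZ mI _ dL) -(RintZ mI _ fbL1) -(RintD mI fL1 (L1Z mI _ dL)) -(RintD mI (L1D mI fL1 (L1Z mI _ dL)) (L1Z mI _ fbL1)).
apply: (ae_le_Rint mI fbL1 (L1D mI (L1D mI fL1 (L1Z mI _ dL)) (L1Z mI _ fbL1))).
apply: (ae_imply2 fE fbE) => t q1 q2 It.
have [pdL e1] := q1 It; have [_ e2] := q2 It.
have pL := cphi.1 t (It_in t It); have pbL := cphib.1 t (It_in t It).
have := tracking_pointwise (subspaceB (sh_sub hL2) pbL pdL) (subspaceB (sh_sub hL2) pL pdL) s0.
by rewrite e1 e2 opprB addrA subrK.
Qed.

(** A nonzero value at [T] would persist, by continuity, on an interval []r, T[] of positive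
    length. *)
Lemma cont_ae0 (f : R -> R) : cont_on T f -> {ae time, forall t : RT, I t -> f t = 0} -> f T = 0.
Proof.
move=> cf [N [mN N0 sN]]; apply/eqP; apply: contrapT => /negP fT.
have c0 : 0 < `|f T| / 2 by rewrite divr_gt0// normr_gt0.
have TT : 0 <= T <= T by rewrite lexx ltW.
have [dl dl0 hd] := cf T TT _ c0.
pose r := Num.max 0 (T - dl).
have r0 : 0 <= r by rewrite le_max lexx.
have rT : r < T by rewrite gt_max T0 ltrBlDr ltrDl.
have sub : `]r, T[%classic `<=` N.
  move=> t; rewrite /= in_itv /= => /andP[rt tT]; apply: sN => /= h.
  have t0 : 0 < t := le_lt_trans r0 rt.
  have tI : I t by rewrite /= in_itv /= t0.
  have tI' : 0 <= t <= T by rewrite !ltW.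
  have := hd t tI'; rewrite (h tI) sub0r normrN => /(_ _) h1.
  have : `|f T| <= `|f T| / 2.
    apply: h1; rewrite distrC ger0_norm ?subr_ge0 ?(ltW tT)// ltrBlDl -ltrBlDr.
    by apply: le_lt_trans rt; rewrite le_max lexx orbT.
  rewrite leNgt => /negP; apply; rewrite ltr_pdivrMr// ltr_pMr ?normr_gt0//.
  by rewrite ltr1n.
have mr : measurable (`]r, T[%classic : set RT) by exact: (@measurable_itvT R (Interval _ _)).
have : (time (`]r, T[%classic : set RT) <= time N)%E by apply: le_measure; rewrite ?inE.
rewrite N0 [X in (X <= _)%E](@lebesgue_measure_itv R `]r, T[) /= lte_fin rT -EFinB lee_fin.
by rewrite leNgt subr_gt0 rT.
Qed.

(** The state has zero mean at almost every time, and the mean is continuous in time up to [T]. At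
    [T] this makes [GopE_H1] applicable to the difference of two states. *)
Lemma weak_sol_mean m (chi : 'I_m -> 'rV[R]_d -> 'rV[R]_d) (b a k M : R) phi0 u phi mu l :
  weak_sol Om T chi b a k M phi0 u phi mu l -> inner Om (phi T) (fun=> 1) = 0.
Proof.
move=> sol; have cP := ev_cont (ws_ev sol).
have oneL : L2 Om (fun=> 1) := L2_one oO finO.
have cin : cont_on T (fun t => inner Om (phi t) (fun=> 1)).
  move=> c cT e e0; have n1 : 0 < sh_norm (inner Om) (fun=> 1) + 1 by rewrite ltr_wpDl ?sh_norm_ge0.
  have e1 : 0 < e / (sh_norm (inner Om) (fun=> 1) + 1) by rewrite divr_gt0.
  have [dl dl0 hd] := cP.2 c _ cT e1; exists dl => // x xT xc.
  rewrite distrC -(shBl hL2 (cP.1 c cT) (cP.1 x xT) oneL).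
  apply: le_trans (sh_CS hL2 (subspaceB (sh_sub hL2) (cP.1 c cT) (cP.1 x xT)) oneL) _.
  apply: le_trans (ler_wpM2r (sh_norm_ge0 _ _) (hd x xT xc)) _.
  by rewrite mulrAC ler_pdivrMr// ler_pM2l// lerDl.
apply: (cont_ae0 cin).
apply: (ae_imply (ws_eq sol)) => t h It.
by have [pH _ _ _ _] := h It; exact: H10_mean.
Qed.

Lemma ae_close_itv (P : R -> Prop) : {ae time, forall t : RT, I t -> P t} ->
  {ae time, forall t : RT, t \in `[0, T] -> P t}.
Proof.
have ne (c : R) : {ae time, forall t : RT, t <> c :> R}.
  exists [set c]; split => //; first exact: lebesgue_measure_set1.
  by move=> t /= /contrapT.
move=> h; apply: (ae_imply3 (ne 0) (ne T) h) => t t0 tT ht.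
rewrite in_itv /= => /andP[h1 h2]; apply: ht; rewrite /= in_itv /= !lt_neqAle h1 h2 !andbT.
by apply/andP; split; apply/eqP => // /esym.
Qed.

End CostTerms.

Section Controls.
Context (R : realType) (T : R) (m : nat).
Hypothesis T0 : 0 < T.
Local Notation RT := (measurableTypeR R).
Local Notation I := (`]0%R, T[%classic : set RT).
Local Notation time := (@lebesgue_measure R).

Let mI : measurable I. Proof. exact: (@measurable_itvT R (Interval _ _)). Qed.

Lemma control_coord_meas (u : R -> 'rV[R]_m) (i : 'I_m) :
  measurable_fun (`]0, T[%classic : set R) u -> measurable_fun I (fun t : RT => u t ord0 i).
Proof.
move=> mu; apply: (measurableT_comp (f := fun x : 'rV[R]_m => x ord0 i)); first exact: measurable_coord.
exact: mu.
Qed.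

Lemma row_bound (ua ub : R -> 'rV[R]_m) : control_Linfty T ua -> control_Linfty T ub ->
  exists2 M : R, 0 <= M & forall u : R -> 'rV[R]_m,
    {ae time, forall t : RT, t \in `[0, T] -> row_le (ua t) (u t) /\ row_le (u t) (ub t)} ->
    {ae time, forall t : RT, I t -> forall i, `|u t ord0 i| <= M}.
Proof.
move=> [_ [Ma ha]] [_ [Mb hb]]; exists (`|Ma| + `|Mb|); first exact: addr_ge0.
move=> u hu; apply: (ae_imply3 ha hb hu) => t h1 h2 h3 It i.
have tT : t \in `[0, T] by move: It; rewrite /= !in_itv /= => /andP[x y]; rewrite !ltW.
have [r1 r2] := h3 tT.
have a1 := le_trans (ler_coord_norm (ua t) i) (le_trans (h1 It) (ler_norm Ma)).
have b1 := le_trans (ler_coord_norm (ub t) i) (le_trans (h2 It) (ler_norm Mb)).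
move: (r1 i) (r2 i) a1 b1 (normr_ge0 Ma) (normr_ge0 Mb); rewrite !ler_norml.
move: (ua t ord0 i) (u t ord0 i) (ub t ord0 i) (`|Ma|) (`|Mb|) => x y z A B r1' r2' /andP[a1 a2] /andP[b1 b2] A0 B0.
apply/andP; split; lra.
Qed.

Lemma bounded_L2 (f : RT -> R) (M : R) : measurable_fun I f ->
  {ae time, forall t : RT, I t -> `|f t| <= M} -> L2fun time I f.
Proof.
move=> mf fM; split => //; apply: (@ae_bounded_integral R T _ (M ^+ 2)); first by move=> t; exact: sqr_ge0.
apply: (ae_imply fM) => t h It.
by rewrite -real_normK ?num_real//; apply: lerXn2r; rewrite ?nnegrE// ?h// (le_trans _ (h It)).
Qed.

Lemma bounded_L2_norm (f : RT -> R) (M : R) : 0 <= M -> measurable_fun I f ->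
  {ae time, forall t : RT, I t -> `|f t| <= M} ->
  sh_norm (ip time I : (RT -> R) -> (RT -> R) -> R) f <= Num.sqrt (\int[time]_(t in I) (M * M)).
Proof.
move=> M0 mf fM; apply: ler_wsqrtr; have fL := bounded_L2 mf fM.
apply: (ae_le_Rint mI (L2_mul mI fL fL) (L1_cst mI _ (time_finite T))).
apply: (ae_imply fM) => t h It.
by rewrite -expr2 -real_normK ?num_real// expr2; apply: ler_pM => //; exact: h.
Qed.

(** Weak limits are taken coordinate by coordinate; both bounds survive by [weak_limit_ge], the
    upper one after a change of sign. *)
Lemma admissible_limit (U : set_system nat) (ua ub : R -> 'rV[R]_m) (u_ : nat -> R -> 'rV[R]_m) :
  UltraFilter U -> control_Linfty T ua -> control_Linfty T ub -> (forall n, admissible T ua ub (u_ n)) ->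
  exists2 ubar : R -> 'rV[R]_m, admissible T ua ub ubar &
    forall i (z : RT -> R), L2fun time I z -> forall e : R, 0 < e -> \forall n \near U,
      `|ip time I (fun t => u_ n t ord0 i) z - ip time I (fun t => ubar t ord0 i) z| <= e.
Proof.
move=> UU hua hub adm; have [M M0 hM] := row_bound hua hub.
have cm n i : measurable_fun I (fun t : RT => u_ n t ord0 i) by apply: control_coord_meas; exact: (adm n).1.1.
have cM n i : {ae time, forall t : RT, I t -> `|u_ n t ord0 i| <= M}.
  by apply: (ae_imply (hM _ (adm n).2)) => t h It; exact: h.
have cL n i : L2fun time I (fun t : RT => u_ n t ord0 i) := bounded_L2 (cm n i) (cM n i).
have /choice[v vP] : forall i, exists v : RT -> R, L2fun time I v /\ forall z, L2fun time I z ->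
    forall e : R, 0 < e -> \forall n \near U, `|ip time I (fun t => u_ n t ord0 i) z - ip time I v z| <= e.
  move=> i; have [v vL vE] := ultra_weak_limit UU mI (fun n => cL n i)
    (fun n => bounded_L2_norm M0 (cm n i) (cM n i)).
  by exists v.
(* Extension by zero outside the time interval makes each coordinate measurable on the whole
   line. *)
pose ubar (t : R) : 'rV[R]_m := \row_i (\1_I t * v i t).
have ubarE i t : I t -> ubar t ord0 i = v i t by move=> It; rewrite mxE indicE mem_set// mul1r.
have hL := semi_hilbert_L2 time mI.
have bL (w : R -> 'rV[R]_m) i : control_Linfty T w -> L2fun time I (fun t : RT => w t ord0 i).
  move=> [mw [K hK]]; apply: (@bounded_L2 _ K); first exact: control_coord_meas.
  apply: (ae_imply hK) => t h It.
  exact: le_trans (ler_coord_norm _ _) (h It).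
have It_cl t : I t -> t \in `[0, T] by rewrite /= !in_itv /= => /andP[x y]; rewrite !ltW.
have lo i : {ae time, forall t : RT, I t -> ua t ord0 i <= v i t}.
  apply: (weak_limit_ge UU mI (time_finite T) (fun n => cL n i) (vP i).1 (bL ua i hua) (vP i).2) => n.
  apply: (ae_imply (adm n).2) => t h It.
  exact: (h (It_cl t It)).1.
have hi i : {ae time, forall t : RT, I t -> v i t <= ub t ord0 i}.
  have NL f : L2fun time I f -> L2fun time I ((-1) *: f) := @L2Z _ _ _ _ _ mI (-1) f.
  have wc z : L2fun time I z -> forall e : R, 0 < e -> \forall n \near U,
      `|ip time I ((-1) *: (fun t : RT => u_ n t ord0 i)) z - ip time I ((-1) *: v i) z| <= e.
    move=> zL e e0; apply: filterS ((vP i).2 z zL e e0) => n.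
    rewrite !(shZl hL)//; last exact: (vP i).1.
    by rewrite !mulN1r -opprD normrN.
  have := weak_limit_ge UU mI (time_finite T) (fun n => NL _ (cL n i)) (NL _ (vP i).1) (NL _ (bL ub i hub)) wc.
  have hh n : {ae time, forall x : RT, I x -> ((-1) *: (fun t : RT => ub t ord0 i)) x <= ((-1) *: (fun t : RT => u_ n t ord0 i)) x}.
    apply: (ae_imply (adm n).2) => t h It.
    change (-1 * ub t ord0 i <= -1 * u_ n t ord0 i); rewrite !mulN1r lerN2.
    exact: (h (It_cl t It)).2.
  move=> /(_ hh) h; apply: (ae_imply h) => t ht It.
  have := ht It; change (-1 * ub t ord0 i <= -1 * v i t -> v i t <= ub t ord0 i).
  by rewrite !mulN1r lerN2.
have bounds : {ae time, forall t : RT, t \in `[0, T] -> row_le (ua t) (ubar t) /\ row_le (ubar t) (ub t)}.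
  apply: ae_close_itv.
  have h1 := filter_forall_fin (ae_filter_ringOfSetsType time) lo.
  have h2 := filter_forall_fin (ae_filter_ringOfSetsType time) hi.
  apply: (ae_imply2 h1 h2) => t q1 q2 It.
  by split => i; rewrite ubarE//; [exact: q1|exact: q2].
have mubar : measurable_fun (`]0, T[%classic : set RT) (ubar : RT -> 'rV[R]_m).
  apply: (@measurable_funS _ _ _ _ setT) => //.
  apply: measurable_fun_rowP => i.
  rewrite (_ : (fun _ => _) = (v i) \_ I).
    by apply/(measurable_restrictT _ mI); exact: L2_meas (vP i).1.
  by apply/funext => t; rewrite mxE patchE indicE; case: (t \in I); rewrite ?mul1r ?mul0r.
exists ubar; last first.
  move=> i z zL e e0; apply: filterS ((vP i).2 z zL e e0) => n; congr (`|_ - _| <= _).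
  by apply: ip_ext => // t It; rewrite ubarE.
split => //; split; first exact: mubar.
apply: (@ae_bounded_integral R T (fun t => dotv (ubar t) (ubar t)) (\sum_(i < m) M ^+ 2)).
  by move=> t; apply: sumr_ge0 => i _; rewrite -expr2 sqr_ge0.
apply: (ae_imply (hM _ bounds)) => t h It.
apply: ler_sum => i _; rewrite -expr2 -real_normK ?num_real//.
by apply: lerXn2r; rewrite ?nnegrE//; exact: h.
Qed.

Lemma control_energy (u : R -> 'rV[R]_m) : (forall i, L2fun time I (fun t : RT => u t ord0 i)) ->
  \int[time]_(t in I) dotv (u t) (u t) =
  \sum_i ip time I (fun t => u t ord0 i) (fun t => u t ord0 i).
Proof.
move=> uL; rewrite -(Rint_sum mI)//.
by move=> i; exact: (L2_mul mI (uL i) (uL i)).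
Qed.

End Controls.

(** The x_i are the three cost terms of the limit and the y_i those of a member of the minimizing
    sequence; s is the infimum and t the excess of that member. *)
Lemma cost_combine (R : realFieldType) (b1 b2 b3 x1 x2 x3 y1 y2 y3 s t e : R) :
  0 <= b1 -> 0 <= b2 -> 0 <= b3 -> 0 <= e ->
  x1 <= y1 + e / 2 / (b1 + b2 + b3 + 1) -> x2 <= y2 + e / 2 / (b1 + b2 + b3 + 1) ->
  x3 <= y3 + e / 2 / (b1 + b2 + b3 + 1) ->
  b1 / 2 * y1 + b2 / 2 * y2 + b3 / 2 * y3 <= s + t -> t <= e / 2 ->
  b1 / 2 * x1 + b2 / 2 * x2 + b3 / 2 * x3 <= s + e.
Proof.
move=> b10 b20 b30 e0; set r := e / 2 / _ => h1 h2 h3 hy ht.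
have B0 : 0 < b1 + b2 + b3 + 1 by rewrite ltr_wpDl// !addr_ge0.
have hr : (b1 / 2 + b2 / 2 + b3 / 2) * r <= e / 2.
  by rewrite /r mulrA ler_pdivrMr// mulrC ler_wpM2l ?divr_ge0//; lra.
have q1 : b1 / 2 * x1 <= b1 / 2 * y1 + b1 / 2 * r by rewrite -mulrDr ler_wpM2l// divr_ge0.
have q2 : b2 / 2 * x2 <= b2 / 2 * y2 + b2 / 2 * r by rewrite -mulrDr ler_wpM2l// divr_ge0.
have q3 : b3 / 2 * x3 <= b3 / 2 * y3 + b3 / 2 * r by rewrite -mulrDr ler_wpM2l// divr_ge0.
rewrite !mulrDl in hr; lra.
Qed.

Lemma sub_zeros (V : zmodType) (x y z : V) : x = y - z -> y = 0 -> z = 0 -> x = 0.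
Proof. by move=> -> -> ->; rewrite subrr. Qed.

(** Weak lower semicontinuity of the norm, with x = |ubar|^2, y = (u_n, ubar) and z = |u_n|^2 for
    one coordinate. *)
Lemma square_excess (R : realFieldType) (x y z e : R) : - (e / 2) <= y - x -> 0 <= z - 2 * y + x -> x <= z + e.
Proof. by move=> h1 h2; lra. Qed.

Lemma add_quarters (R : realFieldType) (x y z e : R) : y <= e / 4 -> z <= e / 2 -> x + 2 * y + z <= x + e.
Proof. by move=> h1 h2; lra. Qed.

(** * Existence of an optimal control *)

Theorem theorem1 (R : realType) (d : nat) (hd : d = 2%N \/ d = 3%N)
    (Om : set 'rV[R]_d) (hOm : bounded_lipschitz_domain Om)
    (T : R) (hT : 0 < T)
    (b sigma eps : R) (hb : 0 < b) (hsigma : 0 < sigma) (heps : 0 < eps)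
    (phi0 : 'rV[R]_d -> R) (hphi0 : H10 Om phi0)
    (hE : finite_energy Om sigma eps phi0)
    (hwp : CH_well_posed Om T b sigma eps phi0)
    (m : nat) (chi : 'I_m -> 'rV[R]_d -> 'rV[R]_d)
    (hchi : forall i, L2sigma Om (chi i) /\ H1v Om (chi i))
    (ua ub : R -> 'rV[R]_m)
    (hua : control_Linfty T ua) (hub : control_Linfty T ub)
    (huab : {ae @lebesgue_measure R, forall t, t \in `[0, T] ->
               row_le (ua t) (ub t)})
    (beta1 beta2 gamma : R)
    (hbeta1 : 0 <= beta1) (hbeta2 : 0 <= beta2) (hgamma : 0 < gamma)
    (phid : R -> 'rV[R]_d -> R) (hphid : bochner_L2 (L2 Om) (normL2 Om) T phid)
    (phiT : 'rV[R]_d -> R) (hphiT : L2 Om phiT) :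
  exists2 ubar : R -> 'rV[R]_m,
    admissible T ua ub ubar &
    reduced_cost Om T b sigma eps phi0 chi beta1 beta2 gamma phid phiT ubar =
    inf [set reduced_cost Om T b sigma eps phi0 chi
               beta1 beta2 gamma phid phiT u | u in admissible T ua ub].
Proof.
pose RT := measurableTypeR R; pose I : set RT := `]0%R, T[%classic.
pose time := @lebesgue_measure R.
have mI : measurable I by exact: (@measurable_itvT R (Interval _ _)).
have [_ oO _ bO _] := hOm.
have finO : (lebesgue_rV R d Om < +oo)%E := bounded_lebesgue_finite (open_measurable_rV oO) bO.
have d3 : (d <= 3)%N by case: hd => ->.
have [CS CS0 sob] := sobolev_L4 d3 hOm.
have chiH i : H1v Om (chi i) := (hchi i).2.
have /choice[Cc CcP] : forall i, exists C : R, 0 <= C /\ forall f w, H1 Om f -> H1 Om w ->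
    `|conv Om (chi i) f w| <= C * sh_norm (H1ip Om) f * sh_norm (H1ip Om) w.
  by move=> i; have [C C0 h] := conv_bound oO finO CS0 sob (chiH i); exists C.
have a0 : 0 < sigma * eps by exact: mulr_gt0.
have k0 : 0 < sigma / eps by exact: divr_gt0.
have [M M0 hM] := row_bound hua hub.
have cM u : admissible T ua ub u -> {ae time, forall t : RT, I t -> forall i, `|u t ord0 i| <= M}.
  by move=> [_ h]; exact: hM.
have cm u i : admissible T ua ub u -> measurable_fun I (fun t : RT => u t ord0 i).
  by move=> [[mu _] _]; exact: control_coord_meas.
have cL u i : admissible T ua ub u -> L2fun time I (fun t : RT => u t ord0 i).
  move=> au; apply: (@bounded_L2 R T _ M); first exact: cm.
  by apply: (ae_imply (cM u au)) => t h It; exact: h.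
pose phi u := phase_field Om T b sigma eps phi0 (control_op chi u).
(* [phase_field] is a choice among solutions, so the existence half of well-posedness makes it
   one. *)
have exsol u : admissible T ua ub u -> exists mu, CH_solution Om T b sigma eps phi0 (control_op chi u) (phi u) mu.
  move=> au; have vc := velocity_class_control oO finO hchi M0 (fun i => cm u i au) (cM u au).
  exact: (xgetPex (fun=> 0) (hwp _ vc).1).
have wsol u : admissible T ua ub u -> exists mu, weak_sol Om T chi b (sigma * eps) (sigma / eps) M phi0
    (fun i t => u t ord0 i) (phi u) mu (time_deriv Om T (phi u)).
  move=> au; have [mu h] := exsol u au; exists mu.
  exact: (CH_solution_weak oO finO hT hchi sob (fun i => cm u i au) (cM u au) h).
pose J u := reduced_cost Om T b sigma eps phi0 chi beta1 beta2 gamma phid phiT u.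
pose J1 u := \int[time]_(t in I) (normL2 Om (phi u t - phid t) ^+ 2).
pose J2 u := normL2 Om (phi u T - phiT) ^+ 2.
pose J3 (u : R -> 'rV[R]_m) := \int[time]_(t in I) dotv (u t) (u t).
have JE u : J u = beta1 / 2 * J1 u + beta2 / 2 * J2 u + gamma / 2 * J3 u by [].
have J0 u : 0 <= J u.
  rewrite JE !addr_ge0// mulr_ge0 ?divr_ge0 ?(ltW hgamma)//.
  - by apply: Rintegral_ge0 => t _; exact: sqr_ge0.
  - exact: sqr_ge0.
  - by apply: Rintegral_ge0 => t _; apply: sumr_ge0 => i _; rewrite -expr2 sqr_ge0.
(* The lower bound is itself an admissible control, so the infimum is taken over a nonempty set. *)
have au : admissible T ua ub ua.
  have bd : {ae time, forall t : RT, t \in `[0, T] -> row_le (ua t) (ua t) /\ row_le (ua t) (ub t)}.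
    by apply: (ae_imply huab) => t h tT; split => //; exact: h.
  split => //; split; first exact: hua.1.
  apply: (@ae_bounded_integral R T (fun t => dotv (ua t) (ua t)) (\sum_(i < m) M ^+ 2)).
    by move=> t; apply: sumr_ge0 => i _; rewrite -expr2 sqr_ge0.
  apply: (ae_imply (hM _ bd)) => t h It.
  apply: ler_sum => i _; rewrite -expr2 -real_normK ?num_real//.
  by apply: lerXn2r; rewrite ?nnegrE//; exact: h.
pose S := [set J u | u in admissible T ua ub].
have hS : has_inf S.
  by split; [exists (J ua); exists ua|exists 0 => _ [u _ <-]; exact: J0].
have /choice[u_ uP] : forall n : nat, exists u, admissible T ua ub u /\ J u <= inf S + n.+1%:R^-1.
  move=> n; have n0 : 0 < n.+1%:R^-1 :> R by rewrite invr_gt0.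
  by have [_ [u adm <-] /ltW h] := inf_adherent n0 hS; exists u.
have adm n : admissible T ua ub (u_ n) := (uP n).1.
(* An ultrafilter containing all tails: every property that holds eventually holds along [U], and
   bounded sequences converge along it. *)
have [U [UU sU]] := ultraFilterLemma (@eventually_filter).
have [ubar aubar wc] := admissible_limit UU hua hub adm.
have [mub ref] := wsol ubar aubar.
have /choice[mu_ sol_] : forall n, exists mu, weak_sol Om T chi b (sigma * eps) (sigma / eps) M phi0
    (fun i t => u_ n t ord0 i) (phi (u_ n)) mu (time_deriv Om T (phi (u_ n))).
  by move=> n; exact: wsol.
have [g gL gE] := bochner_normP (seminorm_H10 oO finO) (ws_bochner ref).
have hL := semi_hilbert_L2 time mI.
have wc' i (A : set R) : measurable A -> forall e : R, 0 < e -> \forall n \near U,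
    `|\int[time]_(t in I) ((u_ n t ord0 i - ubar t ord0 i) * \1_A t)| <= e.
  move=> mA e e0; have mA' : @measurable _ RT A by exact: mA.
  have zL : L2fun time I (\1_A : RT -> R).
    apply: (@L2_bnd _ _ R time I mI 1); first exact: (time_finite T).
      exact: (@measurable_indic _ RT R _ _ mA').
    by move=> t _; rewrite indicE ger0_norm// lern1 leq_b1.
  apply: filterS (wc i _ zL e e0) => n.
  by rewrite -(shBl hL (cL _ i (adm n)) (cL _ i aubar) zL).
have w2s eta : 0 < eta -> \forall n \near U,
    (forall t, 0 <= t <= T -> dist2 Om (phi ubar) (phi (u_ n)) t <= eta) /\
    \int[time]_(t in I) (normL2 Om (phi (u_ n) t - phi ubar t) ^+ 2) <= eta.
  exact: (weak_to_strong oO finO hT chiH CS0 sob (fun i => (CcP i).1) (fun i => (CcP i).2)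
    hb a0 k0 M0 ref gL gE _ sol_ wc').
have hL2 : semi_hilbert (L2 Om) (inner Om) := semi_hilbert_L2 (lebesgue_rV R d) (open_measurable_rV oO).
have hH1 : semi_hilbert (H1 Om) (H1ip Om) := semi_hilbert_H1 oO finO.
have TT : 0 <= T <= T by rewrite lexx ltW.
have cphi n := ev_cont (ws_ev (sol_ n)); have cphib := ev_cont (ws_ev ref).
have near1 e : 0 < e -> \forall n \near U, J1 ubar <= J1 (u_ n) + e.
  move=> e0; have K0 : 0 <= J1 ubar by apply: Rintegral_ge0 => t _; exact: sqr_ge0.
  (* The weight for [tracking_lsc] is fixed first, so that its multiple of [J1 ubar] is at most e/2;
     the squared distance of the states is then asked to be below s * e/2. *)
  pose s := e / 2 / (J1 ubar + 1).
  have s0 : 0 < s by rewrite !divr_gt0// ltr_wpDl.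
  have sK : s * J1 ubar <= e / 2.
    by rewrite /s mulrAC ler_pdivrMr ?ltr_wpDl// ler_wpM2l ?lerDl// divr_ge0// ltW.
  have eta0 : 0 < s * (e / 2) by rewrite mulr_gt0// divr_gt0.
  apply: filterS (w2s _ eta0) => n [_ hn].
  have h := tracking_lsc oO hT (cphi n) cphib hphid s0.
  have h2 : s^-1 * \int[time]_(t in I) (normL2 Om (phi (u_ n) t - phi ubar t) ^+ 2) <= e / 2.
    by rewrite mulrC ler_pdivrMr// mulrC.
  apply: le_trans h _; rewrite -addrA lerD2l; apply: le_trans (lerD h2 sK) _.
  by rewrite -splitr.
have near2 e : 0 < e -> \forall n \near U, J2 ubar <= J2 (u_ n) + e.
  move=> e0; pose s := Num.min 1 (e / 2).
  have s0 : 0 < s by rewrite lt_min ltr01 divr_gt0.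
  have s2 : s ^+ 2 <= e / 2.
    have s1 : s <= 1 by rewrite /s ge_min lexx.
    apply: (@le_trans _ _ s); last by rewrite /s ge_min lexx orbT.
    by rewrite expr2 ler_piMr// ltW.
  have pL := subspaceB (sh_sub hL2) (cphib.1 T TT) hphiT.
  have [psi psiH hpsi] := H1_dense oO finO pL s0.
  (* For psi in H1 the pairing of the difference of the states with psi equals (Ge, psi)_{H1}, at
     most |Ge| |psi|, and |Ge|^2 is [dist2] at time [T]; hence the request [dist2] <= r^2. *)
  pose r := e / 4 / (sh_norm (H1ip Om) psi + 1).
  have P0 := sh_norm_ge0 (H1ip Om) psi.
  have r0 : 0 < r by rewrite !divr_gt0// ltr_wpDl.
  apply: filterS (w2s _ (exprn_gt0 2 r0)) => n [hn _].
  have qL := subspaceB (sh_sub hL2) ((cphi n).1 T TT) hphiT.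
  have eL := subspaceB (sh_sub hL2) ((cphi n).1 T TT) (cphib.1 T TT).
  have mean : inner Om (phi (u_ n) T - phi ubar T) (fun=> 1) = 0.
    have m1 := weak_sol_mean oO finO hT (sol_ n); have m2 := weak_sol_mean oO finO hT ref.
    have m3 := shBl hL2 ((cphi n).1 T TT) (cphib.1 T TT) (L2_one oO finO).
    exact: (sub_zeros m3 m1 m2).
  have [GH GN] := nrm_rhoG oO finO (u := fun i t => u_ n t ord0 i) ref (sol_ n) TT.
  have GR : sh_norm (H1ip Om) (rhoG Om (phi ubar) (phi (u_ n)) T) <= r.
    by apply: le_of_sqr; [exact: ltW|rewrite GN; exact: hn].
  have bound : `|inner Om (phi (u_ n) T - phi ubar T) psi| <= e / 4.
    rewrite -(GopE_H1 oO finO eL mean psiH).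
    apply: le_trans (sh_CS hH1 (H10_H1 GH) psiH) _.
    apply: le_trans (ler_wpM2r P0 GR) _.
    by rewrite /r mulrAC ler_pdivrMr ?ltr_wpDl// ler_wpM2l ?lerDl// divr_ge0// ltW.
  have := terminal_pointwise oO pL qL (H1_L2 psiH) hpsi.
  rewrite opprB addrA subrK => h; exact: (le_trans h (add_quarters _ bound s2)).
have near3 e : 0 < e -> \forall n \near U, J3 ubar <= J3 (u_ n) + e.
  move=> e0; have e1 : 0 < e / m.+1%:R / 2 by rewrite !divr_gt0.
  (* Weak convergence is tested with the limit control itself, because |u|^2 >= 2 (u, ubar) -
     |ubar|^2. *)
  apply: filterS (filter_forall_fin _ (fun i => wc i _ (cL ubar i aubar) _ e1)) => n hn.
  rewrite /J3 (control_energy (fun i => cL _ i aubar)) (control_energy (fun i => cL _ i (adm n))).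
  apply: le_trans (_ : _ <= \sum_i ip time I (fun t => u_ n t ord0 i) (fun t => u_ n t ord0 i) +
     \sum_(i < m) e / m.+1%:R) _; last by rewrite lerD2l; apply: sum_share_le; exact: ltW.
  rewrite -big_split /=; apply: ler_sum => i _.
  have := sh_ge0 hL (subspaceB (sh_sub hL) (cL _ i (adm n)) (cL _ i aubar)).
  rewrite (sh_sqrB hL (cL _ i (adm n)) (cL _ i aubar)).
  move: (hn i); rewrite ler_norml => /andP[h1 _] h2.
  exact: (square_excess h1 h2).
exists ubar => //; apply/le_anti/andP; split; last first.
  by apply: (inf_lbound hS.2); exists ubar.
rewrite -/(J ubar); change (J ubar <= inf S).
apply/ler_addgt0Pr => e e0.
pose e' := e / 2 / (beta1 + beta2 + gamma + 1).
have B0 : 0 < beta1 + beta2 + gamma + 1 by rewrite ltr_wpDl// !addr_ge0// ltW.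
have e'0 : 0 < e' by rewrite !divr_gt0.
have nearN : \forall n \near U, n.+1%:R^-1 <= e / 2.
  apply: sU; apply: filterS (near_natr_ge (e / 2)^-1) => n hn.
  by rewrite -[X in _ <= X]invrK lef_pV2 ?posrE ?invr_gt0 ?divr_gt0.
have [n [[[h1 h2] h3] h4]] := filter_ex (filterI (filterI (filterI (near1 _ e'0) (near2 _ e'0)) (near3 _ e'0)) nearN).
have hu := (uP n).2; rewrite JE in hu; rewrite JE.
exact: (cost_combine hbeta1 hbeta2 (ltW hgamma) (ltW e0) h1 h2 h3 hu h4).
Qed.
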